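(* Let $\Omega\subset\mathbb{R}^2$ be a bounded simply connected domain with $C^2$ boundary and let $\delta_\Omega:=\frac{|\partial\Omega|}{\sqrt{4\pi|\Omega|}}-1$ denote its isoperimetric deficit. Then, for all $a>0$, $$|\Omega|\,\mu^{\mathrm{Rob}}_\Omega\Big(\frac{a}{\sqrt{|\Omega|}}\Big)-\pi\,\mu^{\mathrm{Rob}}_{\mathbb{D}}\Big(\frac{a}{\sqrt{\pi}}\Big)\leq F\left(\sqrt{\mu^{\mathrm{Rob}}_{\mathbb{D}}\big(\tfrac{a}{\sqrt{\pi}}\big)}\right)\delta_\Omega(\delta_\Omega+2)+G\left(\sqrt{\mu^{\mathrm{Rob}}_{\mathbb{D}}\big(\tfrac{a}{\sqrt{\pi}}\big)}\right)\delta_\Omega,$$ where $F,G:[0,j_{0,1}]\to\mathbb{R}$ are defined by $$F(x):=\pi x^2\left(\frac{1}{J_0^2(x)+J_1^2(x)}-1\right),\qquad G(x):=\pi x\,\frac{2J_0(x)J_1(x)}{J_0^2(x)+J_1^2(x)}.$$ In particular, for all $a>0$, $$|\Omega|\,\mu^{\mathrm{Rob}}_\Omega\Big(\frac{a}{\sqrt{|\Omega|}}\Big)-\pi\,\mu^{\mathrm{Rob}}_{\mathbb{D}}\Big(\frac{a}{\sqrt{\pi}}\Big)\leq C_{\mathrm{PW}}\,\delta_\Omega(\delta_\Omega+2)+\pi j_{0,1}\,\delta_\Omega,$$ and equality holds in this last inequality if and only if $\Omega$ is a disk.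
   Context: $|\Omega|$ is the area of $\Omega$, $|\partial\Omega|$ is its perimeter, and $\mathbb{D}\subset\mathbb{R}^2$ is the open disk of unit radius centered at the origin. $J_0,J_1$ are the Bessel functions of the first kind of order $0$ and $1$, $j_{0,1}$ is the first positive zero of $J_0$, and $$C_{\mathrm{PW}}:=\pi j_{0,1}^2\left(\frac{1}{J_1^2(j_{0,1})}-1\right).$$ For a bounded domain $\Omega\subset\mathbb{R}^2$ with $C^2$ boundary and $a>0$, $\mu^{\mathrm{Rob}}_\Omega(a)$ denotes the first (smallest) eigenvalue of the Robin Laplacian, i.e. of the problem $-\Delta u=\mu u$ in $\Omega$, $\nu\cdot\nabla u+au=0$ on $\partial\Omega$ ($\nu$ the outward unit normal); it is characterized by $$\mu^{\mathrm{Rob}}_\Omega(a)=\inf_{u\in H^1(\Omega;\mathbb{R})\setminus\{0\}}\frac{\int_\Omega|\nabla u|^2+a\int_{\partial\Omega}|u|^2}{\int_\Omega|u|^2}.$$ It is known that $0<\mu^{\mathrm{Rob}}_{\mathbb{D}}(a)<j_{0,1}^2$ for every $a>0$, so that $F$ and $G$ are evaluated inside their domain. *)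

(* Defs.v *)
From HB Require Import structures.
From mathcomp Require Import all_boot all_order all_algebra.
From mathcomp Require Import all_classical all_reals all_analysis.

Set Implicit Arguments.
Unset Strict Implicit.
Unset Printing Implicit Defensive.

Import Order.TTheory GRing.Theory Num.Theory.
Import numFieldNormedType.Exports.

Local Open Scope classical_set_scope.
Local Open Scope ring_scope.

Section euclidean_plane.
Context {R : realType}.
Implicit Types (A Omega : set (R * R)) (x y : R * R) (r : R).

(* The plane is [R * R]. Its norm in the library is the sup norm, which gives
   the same topology and the same bounded sets as the Euclidean distance, but
   different disks and diameters. *)
Definition edist x y : R :=
  Num.sqrt ((x.1 - y.1) ^+ 2 + (x.2 - y.2) ^+ 2).

Definition disk x r : set (R * R) := [set y | edist x y < r].

Definition unit_disk : set (R * R) := disk (0, 0) 1.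

Definition is_disk Omega := exists c r, 0 < r /\ Omega = disk c r.

Definition boundary A : set (R * R) := closure A `\` A°.

Definition plane_measure := (@lebesgue_measure R \x @lebesgue_measure R)%E.

Definition area A : R := fine (plane_measure A).

End euclidean_plane.

Section hausdorff_measure.
Context {R : realType}.
Implicit Types (A : set (R * R)) (d : R).
Local Open Scope ereal_scope.

(* 0 is included so that the empty set has diameter 0. *)
Definition diam A : \bar R :=
  ereal_sup [set e | e = 0 \/
    exists x y, [/\ A x, A y & e = (edist x y)%:E]].

Definition hausdorff_gauge d A : \bar R :=
  if diam A <= d%:E then diam A else +oo.

(* [mu_ext] takes covers by Borel sets; a set and its closure have the same
   diameter, so arbitrary covers would give the same value. *)
Definition hausdorff_content d A : \bar R := mu_ext (hausdorff_gauge d) A.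

Definition hausdorff1 A : \bar R :=
  ereal_sup [set hausdorff_content d A | d in [set d : R | (0 < d)%R]].

Lemma diam_ge0 A : 0 <= diam A.
Proof. by apply: ereal_sup_ubound; left. Qed.

Lemma diam0 : diam set0 = 0.
Proof.
apply/eqP; rewrite eq_le diam_ge0 andbT.
by apply: ge_ereal_sup => e [->//|[x [y []]]].
Qed.

Lemma hausdorff_gauge_ge0 d A : 0 <= hausdorff_gauge d A.
Proof.
by rewrite /hausdorff_gauge; case: ifP => _; [exact: diam_ge0 | exact: leey].
Qed.

Lemma hausdorff_gauge0 d : (0 < d)%R -> hausdorff_gauge d set0 = 0.
Proof. by move=> d0; rewrite /hausdorff_gauge diam0 lee_fin ltW. Qed.

Lemma hausdorff_content_le d A : (0 < d)%R ->
  hausdorff_content d A <= hausdorff1 A.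
Proof. by move=> d0; apply: ereal_sup_ubound; exists d. Qed.

Lemma hausdorff10 : hausdorff1 set0 = 0.
Proof.
rewrite /hausdorff1 (_ : [set _ | _ in _] = [set 0]) ?ereal_sup1//.
have E d : (0 < d)%R -> hausdorff_content d set0 = 0.
  move=> d0; apply: mu_ext0; first exact: hausdorff_gauge0.
  exact: hausdorff_gauge_ge0.
apply/seteqP; split => [_ [d d0 <-]|_ ->]; first exact: E.
by exists 1%R; [exact: ltr01 | apply/E/ltr01].
Qed.

Lemma hausdorff1_ge0 A : 0 <= hausdorff1 A.
Proof.
apply: le_trans (hausdorff_content_le A ltr01).
exact: (mu_ext_ge0 (hausdorff_gauge_ge0 1)).
Qed.

Lemma le_hausdorff1 : {homo hausdorff1 : A B / A `<=` B >-> A <= B}.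
Proof.
move=> A B AB; apply: ge_ereal_sup => _ [d d0 <-].
by apply: le_trans (hausdorff_content_le B d0); exact: le_mu_ext.
Qed.

Lemma hausdorff1_sigma_subadditive : sigma_subadditive hausdorff1.
Proof.
move=> F; apply: ge_ereal_sup => _ [d d0 <-].
apply: le_trans (mu_ext_sigma_subadditive (hausdorff_gauge_ge0 d) F) _.
apply: lee_nneseries => n _.
  by move=> _; exact: (mu_ext_ge0 (hausdorff_gauge_ge0 d)).
exact: (hausdorff_content_le (F n) d0).
Qed.

HB.instance Definition _ := isOuterMeasure.Build R (R * R)%type hausdorff1
  hausdorff10 hausdorff1_ge0 le_hausdorff1 hausdorff1_sigma_subadditive.

Definition hausdorff1_outer : {outer_measure set (R * R) -> \bar R} := hausdorff1.

Definition length_measure :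
    {measure set (caratheodory_type hausdorff1_outer) -> \bar R} :=
  (hausdorff1_outer : set (caratheodory_type hausdorff1_outer) -> \bar R).

End hausdorff_measure.

Section planar_domains.
Context {R : realType}.
Implicit Types (Omega : set (R * R)).

Definition perimeter Omega : R := fine (hausdorff1 (boundary Omega)).

Definition isoperimetric_deficit Omega : R :=
  perimeter Omega / Num.sqrt (4 * pi * area Omega) - 1.

Definition domain Omega :=
  [/\ open Omega, connected Omega & Omega !=set0].

(* Every loop is homotopic to a constant with fixed base point; for open sets
   connected and path-connected are the same. *)
Definition simply_connected Omega :=
  connected Omega /\
  forall gamma : R -> R * R,
    {within `[0, 1], continuous gamma} ->
    (forall t, 0 <= t <= 1 -> Omega (gamma t)) ->
    gamma 0 = gamma 1 ->
    exists H : R * R -> R * R,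
      [/\ {within `[0, 1] `*` `[0, 1], continuous H},
          forall s t, 0 <= s <= 1 -> 0 <= t <= 1 -> Omega (H (s, t)),
          forall t, 0 <= t <= 1 -> H (0, t) = gamma t,
          forall t, 0 <= t <= 1 -> H (1, t) = gamma 0 &
          forall s, 0 <= s <= 1 -> H (s, 0) = gamma 0 /\ H (s, 1) = gamma 0].

Definition C2_real (h : R -> R) :=
  [/\ forall x, derivable h x 1,
      forall x, derivable (h^`())%classic x 1 &
      continuous (h^`(2))%classic].

(* Near each boundary point, in coordinates rotated by the unit vector e,
   Omega is the strict epigraph of a C^2 function. *)
Definition C2_boundary Omega :=
  forall p, boundary Omega p ->
  exists (e : R * R) (r : R) (h : R -> R),
    [/\ e.1 ^+ 2 + e.2 ^+ 2 = 1, 0 < r, C2_real h &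
        forall x, disk p r x ->
          (Omega x <-> h (e.1 * x.1 + e.2 * x.2) < e.1 * x.2 - e.2 * x.1)].

End planar_domains.

Section sobolev.
Context {R : realType}.
Implicit Types (Omega : set (R * R)) (u ux uy g f : R * R -> R).

Definition d1 f : R * R -> R := fun x => 'D_((1, 0) : R * R) f x.
Definition d2 f : R * R -> R := fun x => 'D_((0, 1) : R * R) f x.

Fixpoint Ck (k : nat) f : Prop :=
  if k is k'.+1 then
    [/\ continuous f,
        forall x, derivable f x ((1, 0) : R * R)
               /\ derivable f x ((0, 1) : R * R),
        Ck k' (d1 f) & Ck k' (d2 f)]
  else continuous f.

Definition smooth f := forall k, Ck k f.

Definition test_function Omega f :=
  [/\ smooth f, compact (closure [set x | f x != 0]) &
      closure [set x | f x != 0] `<=` Omega].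

Definition L2 Omega f :=
  measurable_fun Omega f /\
  plane_measure.-integrable Omega (fun x => (f x ^+ 2)%:E).

Definition weak_gradient Omega u ux uy :=
  forall phi, test_function Omega phi ->
    \int[plane_measure]_(x in Omega) (u x * d1 phi x)
      = - (\int[plane_measure]_(x in Omega) (ux x * phi x))
    /\
    \int[plane_measure]_(x in Omega) (u x * d2 phi x)
      = - (\int[plane_measure]_(x in Omega) (uy x * phi x)).

(* u is in H^1(Omega), with weak gradient (ux, uy). *)
Definition H1 Omega u ux uy :=
  [/\ L2 Omega u, L2 Omega ux, L2 Omega uy & weak_gradient Omega u ux uy].

(* The domain of g carries the Caratheodory sigma-algebra of [hausdorff1]. *)
Definition L2_boundary Omega g :=
  @measurable_fun _ _ (caratheodory_type (@hausdorff1_outer R)) R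
    (boundary Omega) g /\
  length_measure.-integrable (boundary Omega) (fun x => (g x ^+ 2)%:E).

(* The trace operator is the continuous extension to H^1(Omega) of
   w |-> w restricted to the boundary, for w smooth up to the boundary. *)
Definition trace Omega u ux uy g :=
  L2_boundary Omega g /\
  exists w : nat -> R * R -> R,
    [/\ forall n, smooth (w n),
        (\int[plane_measure]_(x in Omega)
           ((w n x - u x) ^+ 2 + (d1 (w n) x - ux x) ^+ 2
            + (d2 (w n) x - uy x) ^+ 2)%:E @[n --> \oo] --> 0)%E &
        (\int[length_measure]_(x in boundary Omega)
           ((w n x - g x) ^+ 2)%:E @[n --> \oo] --> 0)%E].

Definition robin_rayleigh Omega (a : R) u ux uy g : R :=
  (\int[plane_measure]_(x in Omega) (ux x ^+ 2 + uy x ^+ 2)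
   + a * \int[length_measure]_(x in boundary Omega) (g x ^+ 2))
  / \int[plane_measure]_(x in Omega) (u x ^+ 2).

Definition robin_eigenvalue Omega (a : R) : R :=
  inf [set q | exists u ux uy g,
    [/\ H1 Omega u ux uy, trace Omega u ux uy g,
        \int[plane_measure]_(x in Omega) (u x ^+ 2) != 0 &
        q = robin_rayleigh Omega a u ux uy g]].

End sobolev.

Section bessel.
Context {R : realType}.

Definition bessel_coeff (n : nat) (x : R) : R ^nat :=
  [sequence (-1) ^+ m / (m`! * (m + n)`!)%:R * (x / 2) ^+ (m.*2 + n)]_m.

Definition bessel_J (n : nat) (x : R) : R := limn (series (bessel_coeff n x)).

(* The least positive zero: the infimum is attained, since J_0 is continuous
   and J_0(0) = 1. *)
Definition j01 : R := inf [set x | 0 < x /\ bessel_J 0 x = 0].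

Definition C_PW : R := pi * j01 ^+ 2 * (1 / bessel_J 1 j01 ^+ 2 - 1).

Definition F (x : R) : R :=
  pi * x ^+ 2 * (1 / (bessel_J 0 x ^+ 2 + bessel_J 1 x ^+ 2) - 1).

Definition G (x : R) : R :=
  pi * x * (2 * bessel_J 0 x * bessel_J 1 x
            / (bessel_J 0 x ^+ 2 + bessel_J 1 x ^+ 2)).

End bessel.

Arguments j01 R : clear implicits.
Arguments C_PW R : clear implicits.
Arguments unit_disk R : clear implicits.

(* Main.v *)
(* Payne and Weinberger's method of interior parallels. Let A and L be the area
   and the perimeter of Omega, d the distance to the boundary and V(t) the area
   of {d > t}. As Omega has no hole,
     V(s) - V(t) <= L (t - s) - pi (t^2 - s^2),
   that is, V - pi t^2 is convex with slope at least - L at 0. The slope is the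
   measure of thin tubes. Convexity is a lower bound for the second differences
   of V; inscribed regular polygons replace disks, and erosion by a polygon is
   iterated erosion by segments, so that it remains to see that for segments u
   and v, |X| - |X - u| - |X - v| + |X - (u + v)| >= |u x v|. This is an average
   over translated lattices of the Euler characteristic of the complex of the
   lattice cells contained in X, which is positive since X has no hole.

   With b = a / sqrt pi and k J_1(k) = b J_0(k), 0 < k < j_{0,1}, the test
   function J_0(k sqrt(q(d))), q(t) = (A - L t + pi t^2) / A, gives the first
   inequality with k^2 in place of the eigenvalue of the unit disk: the integrals
   of functions of d are bounded by means of V and computed exactly by Bessel
   identities. It is approximated by smooth functions, with d replaced by a soft
   minimum of the distances to a finite net of the boundary. On the unit disk
   this yields mu <= k^2, and Picone's inequality with the radial eigenfunction
   yields mu >= k^2. Finally F < C_PW and G < pi j_{0,1} at k, so that equality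
   forces delta = 0; then Omega contains a disk of radius L / (2 pi), which has
   the same area. *)
Require Import Defs.
From mathcomp Require Import all_boot all_order all_algebra.
From mathcomp Require Import all_classical all_reals all_analysis.
From mathcomp Require Import measurable_realfun.
From mathcomp Require finmap.
From mathcomp Require Import ring lra zify.

Set Implicit Arguments.
Unset Strict Implicit.
Unset Printing Implicit Defensive.

Import Order.TTheory GRing.Theory Num.Theory.
Import numFieldNormedType.Exports.
Import Defs.

Local Open Scope classical_set_scope.
Local Open Scope ring_scope.

(** The inner parallel sets may split and have corners, and d is not differentiable, so no parallel
    curve is ever measured: everything follows from the inequality for the areas V(t). It bounds the
    integral of h(d), for h >= 0, by that of h(t) (L - 2 pi t). Such upper bounds suffice, because
    the integral of the squared test function psi is A minus that of 1 - psi^2 >= 0.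

    On a disk of radius r about c, q(d) is |x - c|^2 / r^2 and psi is the eigenfunction. In general
    q falls from 1 to 0 at the smaller root T of A - L t + pi t^2, and A^2 q'^2 = D + 4 pi A q with
    D = L^2 - 4 pi A = 4 pi A delta (delta + 2). The term D gives F, the boundary term, linear in L,
    gives G, and their denominators come from the integral of psi^2, which is at least A (J_0(k)^2 +
    J_1(k)^2).

    Erosion may disconnect a set, so the absence of holes is expressed by branches of the argument,
    which erosion preserves. Of the smoothness of the boundary, the tubes need only outer cones that
    are nearly half-planes. *)

Lemma lebesgue_measure_shift (R : realType) (a : R) (B : set R) :
  measurable B ->
  lebesgue_measure ((fun y => y + a) @^-1` B) = lebesgue_measure B.
Proof.
move=> mB.
have mf : measurable_fun [set: measurableTypeR R] (fun y : measurableTypeR R => (y + a : measurableTypeR R)).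
  by apply: measurable_funD => //; exact: measurable_cst.
pose f : measurableTypeR R -> measurableTypeR R := fun y => y + a.
rewrite -[LHS]/(pushforward lebesgue_measure f B); apply/esym.
have := @lebesgue_measure_unique R (measure_function_pushforward__canonical__measure_function_Measure lebesgue_measure (f := f) mf).
move=> H; apply: H => // X.
case=> -[u v] /= _ <-; apply/esym.
have -> : pushforward (@lebesgue_measure R) f `]u, v]%classic =
  lebesgue_measure (`]u - a, v - a]%classic : set R).
  rewrite /pushforward; congr (lebesgue_measure _).
  by apply/seteqP; split => y /=; rewrite !in_itv/= ltrBlDr lerBrDr.
rewrite !lebesgue_measure_itv /= !lte_fin ltrD2r; case: ifP => // _.
by rewrite -!EFinD; congr EFin; ring.
Qed.

(** * Measurable sets and shears of the plane *)

Section plane.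
Context {R : realType}.
Implicit Types (A B : set (R * R)) (f : R * R -> R).

(** An open set is the union of the countably many rational squares that it contains; squares, the
    balls of the sup norm, are products of intervals and so lie in the product sigma-algebra. *)
Lemma open_plane_measurable A : open A -> measurable A.
Proof.
move=> oA.
pose F (i : rat * rat * nat) : set (R * R) :=
  let B := ball ((ratr i.1.1, ratr i.1.2) : R * R) (i.2.+1%:R^-1) in
  if `[< B `<=` A >] then B else set0.
have -> : A = \bigcup_i F i.
  apply/seteqP; split => [x Ax|x [i _]]; last first.
    by rewrite /F; case: asboolP => // BA /BA.
  have := oA; rewrite openE => /(_ x Ax); rewrite /interior -nbhs_ballE.
  move=> [e /= e0 eA].
  have [n ne] : exists n : nat, n.+1%:R^-1 < e / 2.
    have e20 : 0 < e / 2 by rewrite divr_gt0.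
    have [n _ /(_ n (leqnn n))] := near_infty_natSinv_lt (PosNum e20).
    by exists n.
  have n0 : 0 < (n.+1%:R^-1 : R) by rewrite invr_gt0.
  move: ne n0; set t := _^-1 => ne n0.
  have [q1 q1P] : exists q, ratr q \in `]x.1 - t, x.1 + t[.
    by apply: rat_in_itvoo; lra.
  have [q2 q2P] : exists q, ratr q \in `]x.2 - t, x.2 + t[.
    by apply: rat_in_itvoo; lra.
  move: q1P q2P; rewrite !in_itv /= => /andP[a1 a2] /andP[b1 b2].
  have Bx : ball ((ratr q1, ratr q2) : R * R) t x.
    by split; rewrite /ball /= ltr_norml; apply/andP; split; lra.
  exists (q1, q2, n) => //; rewrite /F /=; case: asboolP => // -[] y [y1 y2].
  apply: eA; move: y1 y2; rewrite /ball /= /ball /= !ltr_norml -/t => /andP[? ?] /andP[? ?].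
  by split; rewrite /ball /= ltr_norml; apply/andP; split; lra.
apply: countable_bigcupT_measurable => // i; rewrite /F.
case: asboolP => // _; rewrite (_ : ball _ _ =
  ball (ratr i.1.1 : R) i.2.+1%:R^-1 `*` ball (ratr i.1.2 : R) i.2.+1%:R^-1)//.
by apply: measurableX; apply: open_measurable; exact: ball_open.
Qed.

Lemma closed_plane_measurable A : closed A -> measurable A.
Proof. by move/closed_openC/open_plane_measurable/measurableC; rewrite setCK. Qed.

Lemma continuous_plane_measurable f : continuous f -> measurable_fun setT f.
Proof.
move=> /continuousP cf; apply: (measurability _ (RGenOpens.measurableE R)).
move=> _ [_ [a [b ->] <-]]; rewrite setTI; apply: open_plane_measurable.
exact/cf/interval_open.
Qed.

(** By Fubini a shear only translates the sections. Translations, rotations and the areas of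
    parallelograms are all reduced to shears. *)
Lemma plane_measure_shear (c : R -> R) A : continuous c -> measurable A ->
  plane_measure ((fun x => (x.1, x.2 + c x.1)) @^-1` A) = plane_measure A.
Proof.
move=> cc mA; rewrite /plane_measure /product_measure1.
apply: eq_integral => x _ /=.
rewrite -[RHS](lebesgue_measure_shift (c x)); last exact: measurable_xsection.
by congr (lebesgue_measure _); apply/seteqP; split => y /=;
  rewrite /xsection /= ?inE.
Qed.

Lemma plane_measureE2 A : measurable A -> plane_measure A =
  (\int[@lebesgue_measure R]_y lebesgue_measure (ysection A y))%E.
Proof.
move=> mA; have := @product_measure_unique _ _ _ _ R
  (@lebesgue_measure R) (@lebesgue_measure R)
  (lebesgue_measure \x^ lebesgue_measure)%E.
by apply => // U V mU mV; exact: product_measure2E.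
Qed.

Lemma plane_measure_shear2 (c : R -> R) A : continuous c -> measurable A ->
  plane_measure ((fun x => (x.1 + c x.2, x.2)) @^-1` A) = plane_measure A.
Proof.
move=> cc mA; rewrite !plane_measureE2//; last first.
  rewrite -[X in measurable X]setTI.
  have mf : measurable_fun [set: R * R] (fun x : R * R => (x.1 + c x.2, x.2)).
    apply: measurable_fun_pair; last exact: measurable_snd.
    apply: measurable_funD; first exact: measurable_fst.
    apply: (measurableT_comp (f := c)); last exact: measurable_snd.
    exact: continuous_measurable_fun.
  exact: mf.
apply: eq_integral => x _ /=.
rewrite -[RHS](lebesgue_measure_shift (c x)); last exact: measurable_ysection.
by congr (lebesgue_measure _); apply/seteqP; split => y /=;
  rewrite /ysection /= ?inE.
Qed.

Lemma plane_measure_shift (v : R * R) A : measurable A ->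
  plane_measure ((fun x => (x.1 + v.1, x.2 + v.2)) @^-1` A) = plane_measure A.
Proof.
move=> mA.
have c1 : continuous (fun _ : R => v.1) by move=> ?; exact: cvg_cst.
have c2 : continuous (fun _ : R => v.2) by move=> ?; exact: cvg_cst.
rewrite -[RHS](plane_measure_shear c2)// -[RHS](plane_measure_shear2 c1)//.
rewrite -[X in measurable X]setTI.
have mf : measurable_fun [set: R * R] (fun x : R * R => (x.1, x.2 + v.2)).
  apply: measurable_fun_pair; first exact: measurable_fst.
  by apply: measurable_funD; [exact: measurable_snd|exact: measurable_cst].
exact: mf.
Qed.

End plane.

(** * The Euler characteristic of grids *)

Section chain_complex.
Context {R : fieldType} {vT eT fT : finType}.
Variables (V : {set vT}) (E : {set eT}) (C : {set fT}).
Variables (d : eT -> vT -> R) (g : fT -> eT -> R).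

(* [d] and [g] are the two boundary maps: [d] has rank less than [#|V|], its
   columns being dependent, and its kernel lies in the image of [g]. *)
Lemma card_exact_complex : (0 < #|V|)%N ->
  (forall e, e \in E -> \sum_(v in V) d e v = 0) ->
  (forall z : eT -> R, (forall v, v \in V -> \sum_(e in E) z e * d e v = 0) ->
     exists b : fT -> R,
       forall e, e \in E -> z e = \sum_(f in C) b f * g f e) ->
  (#|E|.+1 <= #|V| + #|C|)%N.
Proof.
move=> V0 dV ex.
pose D1 := \matrix_(i < #|E|, j < #|V|) d (enum_val i) (enum_val j).
pose D2 := \matrix_(i < #|C|, j < #|E|) g (enum_val i) (enum_val j).
have r1 : (\rank D1 < #|V|)%N.
  rewrite ltn_neqAle rank_leq_col andbT; apply/negP => /eqP rV.
  have : row_free D1^T by rewrite /row_free mxrank_tr rV.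
  move/row_free_inj => /(_ 1%N (const_mx 1) 0).
  have -> : const_mx 1 *m D1^T = (0 : 'rV_#|V|) *m D1^T.
    rewrite mul0mx; apply/matrixP => i j; rewrite !mxE.
    rewrite -[RHS](dV _ (enum_valP j)) [RHS]big_enum_val.
    by apply: eq_bigr => k _; rewrite !mxE mul1r.
  move=> /(_ erefl) /matrixP /(_ ord0 (Ordinal V0)); rewrite !mxE => /eqP.
  by rewrite oner_eq0.
have r2 : (\rank (kermx D1) <= #|C|)%N.
  suff K : (kermx D1 <= D2)%MS by apply: leq_trans (mxrankS K) (rank_leq_row _).
  apply/row_subP => i; set z0 := row i _.
  have z0P : z0 *m D1 = 0 by rewrite /z0 -row_mul mulmx_ker row0.
  pose z e := if @idP (e \in E) is ReflectT He then z0 ord0 (enum_rank_in He e) else 0.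
  have zE k : z (enum_val k) = z0 ord0 k.
    rewrite /z; case: {-}_ / idP => [He|/(_ (enum_valP k))//].
    by rewrite enum_valK_in.
  have [|b bP] := ex z.
    move=> v vV; have /matrixP/(_ ord0 (enum_rank_in vV v)) := z0P.
    rewrite mxE [in RHS]mxE => H; rewrite -[RHS]H [LHS]big_enum_val.
    by apply: eq_bigr => k _; rewrite zE [D1 _ _]mxE enum_rankK_in.
  apply/submxP; exists (\row_k b (enum_val k)); apply/rowP => k.
  rewrite -zE bP ?enum_valP// !mxE big_enum_val; apply: eq_bigr => l _.
  by rewrite !mxE.
have := mxrank_ker D1; move: r1 r2 (rank_leq_row D1) => /=; lia.
Qed.

End chain_complex.

Section grid.
Context {R : realFieldType}.

(** Shift by one index, with 0 before the first: nothing enters the grid from outside. *)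
Definition prev (h : nat -> R) (i : nat) : R := if i is i'.+1 then h i' else 0.

(** Summation by parts; by hypothesis the boundary term at the last index n - 1 vanishes. *)
Lemma sum_prev (n : nat) (g f : nat -> R) : (forall i, (n <= i.+1)%N -> g i = 0) ->
  \sum_(i < n) prev g i * f i = \sum_(i < n) g i * f i.+1.
Proof.
case: n => [|n] gn; first by rewrite !big_ord0.
rewrite big_ord_recl/= mul0r add0r big_ord_recr/= gn// mul0r addr0.
by apply: eq_bigr => i _; rewrite /= /bump.
Qed.

Variables (n : nat) (V Eh Ev C : nat -> nat -> bool).
Hypothesis V_lt : forall i j, V i j -> (i < n)%N && (j < n)%N.
Hypothesis EhV : forall i j, Eh i j -> V i j && V i.+1 j.
Hypothesis EvV : forall i j, Ev i j -> V i j && V i j.+1.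

Let circ (ah av : nat -> nat -> R) i j :=
  ah i j + av i.+1 j - ah i j.+1 - av i j.

(* The cell [i, i + 1] x [j, j + 1] is missing because of the point (x, y) of
   that cell. The edge weights ah, av (angles under which the edges are seen
   from the missing point) derive from a potential on the complex; their
   circulation around a cell is positive if the cell contains the point, and
   vanishes otherwise. *)
Hypothesis top : forall i j, (i < n)%N -> (j < n)%N -> ~~ C i j ->
  exists (x y : R) (ah av A : nat -> nat -> R),
  [/\ forall i j, Eh i j -> ah i j = A i.+1 j - A i j,
      forall i j, Ev i j -> av i j = A i j.+1 - A i j,
      (forall i j, Eh i j -> ~~ ((i%:R <= x <= i.+1%:R) && (y == j%:R))) /\
      (forall i j, Ev i j -> ~~ ((j%:R <= y <= j.+1%:R) && (x == i%:R))),
      forall i j, 0 <= circ ah av i j /\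
        (0 < circ ah av i j -> (i%:R <= x <= i.+1%:R) && (j%:R <= y <= j.+1%:R)) &
      0 < circ ah av i j].

Section cycle.
Variables zh zv : nat -> nat -> R.
Hypothesis zhE : forall i j, ~~ Eh i j -> zh i j = 0.
Hypothesis zvE : forall i j, ~~ Ev i j -> zv i j = 0.
(** Conservation at the vertex (i, j): what enters from the left and from below leaves to the right
    and upwards. *)
Hypothesis cycle : forall i j,
  prev (zh^~ j) i - zh i j + (prev (zv i) j - zv i j) = 0.

Let zh0 i j : (n <= i.+1)%N || (n <= j)%N -> zh i j = 0.
Proof.
move=> nij; apply: zhE; apply/negP => /EhV /andP[/V_lt ? /V_lt ?]; lia.
Qed.
Let zv0 i j : (n <= i)%N || (n <= j.+1)%N -> zv i j = 0.
Proof.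
move=> nij; apply: zvE; apply/negP => /EvV /andP[/V_lt ? /V_lt ?]; lia.
Qed.

(** Total flow across the ray that leaves the cell (i, j) to the right, that is, the winding number
    of the cycle around the cell. By [filling_h] and [filling_v] the boundary of this chain is the
    cycle. *)
Definition filling i j : R := \sum_(i.+1 <= k < n) zv k j.
Local Notation b := filling.

Lemma filling_recl i j : b i j = zv i.+1 j + b i.+1 j.
Proof.
rewrite /b; have [ni|ni] := leqP n i.+1.
  by rewrite !big_geq// ?zv0 ?ni ?addr0//; lia.
by rewrite big_ltn.
Qed.

Lemma filling_out i j : (n <= i.+1)%N || (n <= j.+1)%N -> b i j = 0.
Proof.
case/orP => h; first by rewrite /b big_geq.
by rewrite /b big1// => k _; rewrite zv0 ?h ?orbT.
Qed.

(** Summing the conservation law along a line of vertices shows that successive rows of vertical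
    edges carry the same flow; below the grid it is 0. *)
Lemma row_flux j : \sum_(0 <= k < n) zv k j = 0.
Proof.
have step j' : \sum_(0 <= k < n) prev (zv k) j' = \sum_(0 <= k < n) zv k j'.
  apply/eqP; rewrite -subr_eq0 -sumrB; apply/eqP.
  transitivity (\sum_(0 <= k < n) (zh k j' - prev (zh^~ j') k)).
    by apply: eq_bigr => k _; have := cycle k j'; lra.
  rewrite sumrB !big_mkord; apply/eqP; rewrite subr_eq0; apply/eqP.
  have := @sum_prev n (zh^~ j') (fun=> 1).
  under eq_bigr do rewrite mulr1.
  under [in RHS]eq_bigr do rewrite mulr1.
  by move=> ->// i ni; rewrite zh0// ni.
elim: j => [|j IH]; rewrite -step //=.
by rewrite big1.
Qed.

Lemma filling_v i j : zv i j = prev (b^~ j) i - b i j.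
Proof.
case: i => [|i] /=; last by rewrite (filling_recl i) addrK.
have := row_flux j; rewrite /b; case: (posnP n) => [n0|n0].
  by rewrite !big_geq ?n0// => _; rewrite zv0 ?n0// subr0.
by rewrite big_ltn// => /eqP; rewrite addr_eq0 => /eqP ->; rewrite sub0r.
Qed.

Lemma filling_h i j : zh i j = b i j - prev (b i) j.
Proof.
have [m] := ubnP (n - i); elim: m i => // m IH i mi.
have [ni|ni] := leqP n i.+1.
  have b0 k : b i k = 0 by rewrite /b big_geq.
  by rewrite zh0 ?ni// b0; case: (j) => [|j'] /=; rewrite ?b0 subr0.
have := cycle i.+1 j; rewrite /= => cij.
have h := IH i.+1.
have -> : zh i j = zh i.+1 j + zv i.+1 j - prev (zv i.+1) j by lra.
rewrite h; last lia.
have -> : prev (b i) j = prev (zv i.+1) j + prev (b i.+1) j.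
  by case: (j) => [|j'] /=; rewrite ?addr0// filling_recl.
by rewrite (filling_recl i j); ring.
Qed.

(** A gradient is orthogonal to cycles, by summation by parts. *)
Lemma cycle_potential (A : nat -> nat -> R) :
  \sum_(i < n) \sum_(j < n)
    (zh i j * (A i.+1 j - A i j) + zv i j * (A i j.+1 - A i j)) = 0.
Proof.
have -> : \sum_(i < n) \sum_(j < n)
    (zh i j * (A i.+1 j - A i j) + zv i j * (A i j.+1 - A i j)) =
  \sum_(i < n) \sum_(j < n) zh i j * A i.+1 j
  - \sum_(i < n) \sum_(j < n) zh i j * A i j
  + (\sum_(i < n) \sum_(j < n) zv i j * A i j.+1
  - \sum_(i < n) \sum_(j < n) zv i j * A i j).
  rewrite -!sumrB -big_split/=; apply: eq_bigr => i _.
  by rewrite -!sumrB -big_split/=; apply: eq_bigr => j _; ring.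
have -> : \sum_(i < n) \sum_(j < n) zh i j * A i.+1 j =
  \sum_(i < n) \sum_(j < n) prev (zh^~ j) i * A i j.
  rewrite exchange_big [RHS]exchange_big/=; apply: eq_bigr => j _.
  rewrite (@sum_prev n (zh^~ (j : nat)) (A^~ (j : nat)))// => i ni.
  by rewrite zh0 ?ni.
have -> : \sum_(i < n) \sum_(j < n) zv i j * A i j.+1 =
  \sum_(i < n) \sum_(j < n) prev (zv i) j * A i j.
  apply: eq_bigr => i _.
  by rewrite (@sum_prev n (zv i) (A i))// => j nj; rewrite zv0// nj orbT.
rewrite -!sumrB -big_split big1//= => i _.
rewrite -!sumrB -big_split big1//= => j _.
by rewrite -!mulrBl -mulrDl cycle mul0r.
Qed.

(** Discrete Green formula for the chain [filling] and the edge weights. *)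
Lemma cycle_circ (ah av : nat -> nat -> R) :
  \sum_(i < n) \sum_(j < n) (zh i j * ah i j + zv i j * av i j) =
  \sum_(i < n) \sum_(j < n) b i j * circ ah av i j.
Proof.
have E1 : \sum_(i < n) \sum_(j < n) zh i j * ah i j =
    \sum_(i < n) \sum_(j < n) b i j * (ah i j - ah i j.+1).
  apply: eq_bigr => i _; under eq_bigr do rewrite filling_h mulrBl.
  rewrite sumrB sum_prev; last by move=> j nj; rewrite filling_out// nj orbT.
  by rewrite -sumrB; apply: eq_bigr => j _; rewrite mulrBr.
have E2 : \sum_(i < n) \sum_(j < n) zv i j * av i j =
    \sum_(i < n) \sum_(j < n) b i j * (av i.+1 j - av i j).
  rewrite exchange_big [RHS]exchange_big/=.
  apply: eq_bigr => j _; under eq_bigr do rewrite filling_v mulrBl.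
  rewrite sumrB (@sum_prev n (b^~ (j : nat)) (av^~ (j : nat))); last first.
    by move=> i ni; rewrite filling_out// ni.
  by rewrite -sumrB; apply: eq_bigr => i _; rewrite mulrBr.
under eq_bigr do rewrite big_split/=.
rewrite big_split/= E1 E2 -big_split/=; apply: eq_bigr => i _.
by rewrite -big_split/=; apply: eq_bigr => j _; rewrite /circ; ring.
Qed.

(** Pair the cycle with the angles seen from the missing point. The result is 0 because they derive
    from a potential; by [cycle_circ] it is also the sum of [filling] times the circulations, and
    these vanish except on cells containing the point. Two such cells that are neighbours share an
    edge through the point, which is not in the complex, so that [filling] takes one value on all of
    them; this value times a positive number is 0. *)
Lemma filling_missing i j : (i < n)%N -> (j < n)%N -> ~~ C i j -> b i j = 0.
Proof.
move=> ni nj /(top ni nj)[x [y [ah [av [A [hE vE [xyh xyv] cP c0]]]]]].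
have /andP[xi yj] : (i%:R <= x <= i.+1%:R) && (j%:R <= y <= j.+1%:R).
  by have [_] := cP i j; apply.
have bx i' j' : i%:R <= x <= i.+1%:R -> i'%:R <= x <= i'.+1%:R ->
    j'%:R <= y <= j'.+1%:R -> (i' <= i)%N -> b i j' = b i' j'.
  move=> /andP[x1 x2] /andP[x3 x4] yj' ii'.
  have : i%:R <= i'.+1%:R :> R by exact: le_trans x1 x4.
  rewrite ler_nat => i'i.
  have [->//|ne] := eqVneq i i'.
  have ei : i = i'.+1 by lia.
  have xe : x = i%:R by apply/eqP; rewrite eq_le x1 ei x4.
  have := filling_v i j'; rewrite zvE ?ei /=; first by move/eqP; rewrite eq_sym subr_eq0 => /eqP.
  apply/negP => /xyv/negP; apply; rewrite yj'/=; apply/eqP; rewrite -ei; exact: xe.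
have bx2 i' j' : i%:R <= x <= i.+1%:R -> i'%:R <= x <= i'.+1%:R ->
    j'%:R <= y <= j'.+1%:R -> (i <= i')%N -> b i j' = b i' j'.
  move=> /andP[x1 x2] /andP[x3 x4] yj' ii'.
  have : i'%:R <= i.+1%:R :> R by exact: le_trans x3 x2.
  rewrite ler_nat => i'i.
  have [->//|ne] := eqVneq i i'.
  have ei : i' = i.+1 by lia.
  have xe : x = i'%:R by apply/eqP; rewrite eq_le x3 ei x2.
  have := filling_v i' j'; rewrite zvE ?ei /=; first by move/eqP; rewrite eq_sym subr_eq0 => /eqP.
  apply/negP => /xyv/negP; apply; rewrite yj'/=; apply/eqP; rewrite -ei; exact: xe.
have by1 j' : j'%:R <= y <= j'.+1%:R -> b i j' = b i j.
  move: yj => /andP[y1 y2] /andP[y3 y4].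
  have h1 : (j <= j'.+1)%N by rewrite -(ler_nat R); exact: le_trans y1 y4.
  have h2 : (j' <= j.+1)%N by rewrite -(ler_nat R); exact: le_trans y3 y2.
  have [->//|ne] := eqVneq j j'.
  have [ej|ej] : j' = j.+1 \/ j = j'.+1 by lia.
    have ye : y = j'%:R by apply/eqP; rewrite eq_le y3 ej y2.
    have := filling_h i j'; rewrite zhE ?ej /=; first by move/eqP; rewrite eq_sym subr_eq0 => /eqP.
    by apply/negP => /xyh/negP; apply; rewrite xi -ej; apply/eqP.
  have ye : y = j%:R by apply/eqP; rewrite eq_le y1 ej y4.
  have := filling_h i j; rewrite zhE ?ej /=; first by move/eqP; rewrite eq_sym subr_eq0 => /eqP.
  by apply/negP => /xyh/negP; apply; rewrite xi -ej; apply/eqP.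
have link i' j' : 0 < circ ah av i' j' -> b i' j' = b i j.
  move=> /(cP i' j').2 /andP[xi' yj'].
  rewrite -(by1 _ yj'); have [ii'|ii'] := leqP i' i; first by rewrite -bx.
  by rewrite -bx2// ltnW.
have S0 : \sum_(i < n) \sum_(j < n) b i j * circ ah av i j = 0.
  rewrite -cycle_circ -[RHS](cycle_potential A); apply: eq_bigr => i' _.
  apply: eq_bigr => j' _; congr (_ + _).
    by have [/hE ->//|/zhE ->] := boolP (Eh i' j'); rewrite !mul0r.
  by have [/vE ->//|/zvE ->] := boolP (Ev i' j'); rewrite !mul0r.
have S1 : \sum_(i < n) \sum_(j < n) b i j * circ ah av i j =
    b i j * \sum_(i < n) \sum_(j < n) circ ah av i j.
  rewrite mulr_sumr; apply: eq_bigr => i' _; rewrite mulr_sumr.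
  apply: eq_bigr => j' _; have [] := cP i' j'; rewrite le_eqVlt => /orP[/eqP <-|/link ->//].
  by rewrite !mulr0.
move: S0; rewrite S1 => /eqP; rewrite mulf_eq0 => /orP[/eqP//|].
rewrite psumr_eq0; last first.
  by move=> k _; apply: sumr_ge0 => l _; have [] := cP k l.
move/allP => /(_ (Ordinal ni)); rewrite mem_index_enum => /(_ isT) /=.
rewrite psumr_eq0; last by move=> l _; have [] := cP i l.
move/allP => /(_ (Ordinal nj)); rewrite mem_index_enum => /(_ isT) /=.
by rewrite (gt_eqF c0).
Qed.

End cycle.

(** The Euler characteristic of the complex is at least 1. Exactness, as [card_exact_complex] wants
    it: a cycle bounds its [filling], and this is carried by the cells of C according to
    [filling_missing]. *)
Lemma grid_euler : (exists i j, V i j) ->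
  (\sum_(i < n) \sum_(j < n) (Eh i j + Ev i j) + 1 <=
   \sum_(i < n) \sum_(j < n) (V i j + C i j))%N.
Proof.
move=> [i0 [j0 V0]].
pose Vs := [set v : 'I_n * 'I_n | V v.1 v.2]%SET.
pose Cs := [set v : 'I_n * 'I_n | C v.1 v.2]%SET.
pose Es := [set e : bool * ('I_n * 'I_n) |
  if e.1 then Eh e.2.1 e.2.2 else Ev e.2.1 e.2.2]%SET.
have sumE (P : nat -> nat -> bool) :
    (\sum_(i < n) \sum_(j < n) P i j)%N = #|[set v : 'I_n * 'I_n | P v.1 v.2]%SET|.
  rewrite pair_big/= -sum1_card big_mkcond [RHS]big_mkcond; apply: eq_bigr => v _.
  by rewrite inE; case: (P _ _).
have cE : (\sum_(i < n) \sum_(j < n) (Eh i j + Ev i j))%N = #|Es|.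
  transitivity (\sum_(a : bool) \sum_(v : 'I_n * 'I_n)
      nat_of_bool (if a then Eh v.1 v.2 else Ev v.1 v.2))%N.
    rewrite big_bool/= pair_big/= -big_split/=.
    by apply: eq_bigr.
  rewrite pair_big/= -sum1_card [RHS]big_mkcond/=; apply: eq_bigr => -[a v] _.
  by rewrite inE /=; case: a => /=; [case: (Eh _ _)|case: (Ev _ _)].
have cV : (\sum_(i < n) \sum_(j < n) (V i j + C i j))%N = (#|Vs| + #|Cs|)%N.
  under eq_bigr do rewrite big_split/=.
  by rewrite big_split/= !sumE.
rewrite cE cV addn1.
pose ends (e : bool * ('I_n * 'I_n)) : nat * nat :=
  if e.1 then (e.2.1.+1, e.2.2 : nat) else (e.2.1 : nat, e.2.2.+1).
pose ind (p q : nat * nat) : R := (p == q)%:R.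
pose nv (v : 'I_n * 'I_n) : nat * nat := (v.1 : nat, v.2 : nat).
pose d (e : bool * ('I_n * 'I_n)) v : R := ind (ends e) (nv v) - ind (nv e.2) (nv v).
pose g (f : 'I_n * 'I_n) (e : bool * ('I_n * 'I_n)) : R :=
  if e.1 then ind (nv f) (nv e.2) - ind (f.1 : nat, f.2.+1) (nv e.2)
  else ind (f.1.+1, f.2 : nat) (nv e.2) - ind (nv f) (nv e.2).
have /andP[li lj] := V_lt V0.
have sum_ind (p : nat * nat) (h : nat -> nat -> R) :
    \sum_(v : 'I_n * 'I_n) h v.1 v.2 * ind p (nv v) =
    if (p.1 < n)%N && (p.2 < n)%N then h p.1 p.2 else 0.
  case: p => q1 q2 /=; case: ifPn => [/andP[p1 p2]|pn].
    rewrite (bigD1 (Ordinal p1, Ordinal p2))//= /ind /nv /= eqxx mulr1.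
    rewrite big1 ?addr0// => v vp; case: eqP => [pv|]; last by rewrite mulr0.
    by case/eqP: vp; case: v pv => a b /= [e1 e2]; congr (_, _); apply: val_inj.
  rewrite big1// => v _; rewrite /ind; case: eqP => [[pv1 pv2]|]; last by rewrite mulr0.
  by move: pn; rewrite pv1 pv2 !ltn_ord.
apply: (@card_exact_complex R _ _ _ Vs Es Cs d g).
- by apply/card_gt0P; exists (Ordinal li, Ordinal lj); rewrite inE.
- move=> e eE.
  have sV p : V p.1 p.2 -> \sum_(v in Vs) ind p (nv v) = 1.
    move=> Vp; rewrite big_mkcond/=.
    transitivity (\sum_(v : 'I_n * 'I_n) (V v.1 v.2)%:R * ind p (nv v)).
      by apply: eq_bigr => v _; rewrite inE; case: (V _ _); rewrite (mul1r, mul0r).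
    by rewrite (sum_ind p (fun i j => (V i j)%:R)) (V_lt Vp) Vp.
  rewrite sumrB !sV ?subrr//.
    by move: eE; rewrite inE /=; case: ifP => _ => [/EhV|/EvV] /andP[].
  by move: eE; rewrite inE /ends /=; case: ifP => _ => [/EhV|/EvV] /andP[].
move=> z zc.
(* The chain z, split into horizontal and vertical edges and extended by 0 to all pairs of
   naturals. *)
pose zz (a : bool) (P : nat -> nat -> bool) i j : R :=
  if P i j then if (insub i : option 'I_n) is Some i' then
    if (insub j : option 'I_n) is Some j' then
    z (a, (i', j')) else 0 else 0 else 0.
pose zh := zz true Eh; pose zv := zz false Ev.
have zzE (a : bool) (P : nat -> nat -> bool) (e : 'I_n * 'I_n) : P e.1 e.2 -> zz a P e.1 e.2 = z (a, e).
  by case: e => i j /= Pij; rewrite /zz Pij !valK.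
have zz0 a P i j : ~~ P i j -> zz a P i j = 0 by rewrite /zz => /negbTE ->.
have zhE i j : ~~ Eh i j -> zh i j = 0 by exact: zz0.
have zvE i j : ~~ Ev i j -> zv i j = 0 by exact: zz0.
have sumz (h : bool * ('I_n * 'I_n) -> R) : \sum_(e in Es) z e * h e =
    \sum_(v : 'I_n * 'I_n) zh v.1 v.2 * h (true, v) +
    \sum_(v : 'I_n * 'I_n) zv v.1 v.2 * h (false, v).
  rewrite big_mkcond/=.
  transitivity (\sum_(a : bool) \sum_(v : 'I_n * 'I_n)
      if (a, v) \in Es then z (a, v) * h (a, v) else 0).
    by rewrite pair_big/=; apply: eq_bigr => -[a v].
  rewrite big_bool/=.
  congr (_ + _); apply: eq_bigr => v _; rewrite inE /=; case: ifPn => h1.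
  - by rewrite /zh zzE.
  - by rewrite zhE// mul0r.
  - by rewrite /zv zzE.
  - by rewrite zvE// mul0r.
have cyc i j : prev (zh^~ j) i - zh i j + (prev (zv i) j - zv i j) = 0.
  have [Vij|nVij] := boolP (V i j); last first.
    rewrite zhE; last by apply: contraNN nVij => /EhV /andP[].
    rewrite zvE; last by apply: contraNN nVij => /EvV /andP[].
    have -> : prev (zh^~ j) i = 0.
      by case: i nVij => //= i nVij; apply: zhE; apply: contraNN nVij => /EhV /andP[].
    have -> : prev (zv i) j = 0.
      by case: j nVij => //= j nVij; apply: zvE; apply: contraNN nVij => /EvV /andP[].
    by rewrite !subr0 addr0.
  have /andP[ni nj] := V_lt Vij.
  have := zc (Ordinal ni, Ordinal nj); rewrite inE => /(_ Vij).
  rewrite sumz /d /ends /nv /=.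
  have E1 : \sum_(v : 'I_n * 'I_n) zh v.1 v.2 *
      (ind (v.1.+1, v.2 : nat) (i, j) - ind (v.1 : nat, v.2 : nat) (i, j)) =
      prev (zh^~ j) i - zh i j.
    under eq_bigr do rewrite mulrBr.
    rewrite sumrB; congr (_ - _); last first.
      transitivity (\sum_(v : 'I_n * 'I_n) zh v.1 v.2 * ind (i, j) (nv v)).
        by apply: eq_bigr => v _; rewrite /ind eq_sym.
      by rewrite sum_ind /= ni nj.
    case: i ni {Vij} => [|i] ni /=.
      by rewrite big1// => v _; rewrite /ind mulr0.
    transitivity (\sum_(v : 'I_n * 'I_n) zh v.1 v.2 * ind (i, j) (nv v)).
      by apply: eq_bigr => v _; rewrite /ind eq_sym.
    by rewrite sum_ind /= nj (ltnW ni).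
  have E2 : \sum_(v : 'I_n * 'I_n) zv v.1 v.2 *
      (ind (v.1 : nat, v.2.+1) (i, j) - ind (v.1 : nat, v.2 : nat) (i, j)) =
      prev (zv i) j - zv i j.
    under eq_bigr do rewrite mulrBr.
    rewrite sumrB; congr (_ - _); last first.
      transitivity (\sum_(v : 'I_n * 'I_n) zv v.1 v.2 * ind (i, j) (nv v)).
        by apply: eq_bigr => v _; rewrite /ind eq_sym.
      by rewrite sum_ind /= ni nj.
    case: j nj {Vij E1} => [|j] nj /=.
      rewrite big1// => v _; rewrite /ind (_ : (_ == _) = false) ?mulr0//.
      by apply/eqP => -[].
    transitivity (\sum_(v : 'I_n * 'I_n) zv v.1 v.2 * ind (i, j) (nv v)).
      by apply: eq_bigr => v _; rewrite /ind eq_sym.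
    by rewrite sum_ind /= ni (ltnW nj).
  by rewrite E1 E2.
exists (fun f : 'I_n * 'I_n => filling zv f.1 f.2) => -[a v]; rewrite inE /= => ev.
have cmk (h : 'I_n * 'I_n -> R) : \sum_(f : 'I_n * 'I_n | f \in Cs) filling zv f.1 f.2 * h f =
    \sum_(f : 'I_n * 'I_n) filling zv f.1 f.2 * h f.
  rewrite big_mkcond/=; apply: eq_bigr => f _; rewrite inE; case: ifPn => // nC.
  by rewrite (filling_missing zhE zvE cyc) ?mul0r.
rewrite cmk /g /=; case: a ev => /= ev.
- rewrite -(zzE _ _ _ ev) -/zh (filling_h zhE zvE cyc).
  under eq_bigr do rewrite mulrBr.
  rewrite sumrB; congr (_ - _).
    transitivity (\sum_(f : 'I_n * 'I_n) filling zv f.1 f.2 * ind (nv v) (nv f)).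
      by rewrite sum_ind /= !ltn_ord.
    by apply: eq_bigr => f _; rewrite /ind eq_sym.
  case: v {ev} => v1 [[|v2] v2n] /=.
    by rewrite big1// => f _; rewrite /ind (_ : (_ == _) = false) ?mulr0//; apply/eqP => -[].
  transitivity (\sum_(f : 'I_n * 'I_n) filling zv f.1 f.2 * ind (v1 : nat, v2) (nv f)).
    by rewrite sum_ind /= ltn_ord (ltnW v2n).
  by apply: eq_bigr => f _; rewrite /ind eq_sym.
- rewrite -(zzE _ _ _ ev) -/zv (filling_v zhE zvE cyc).
  under eq_bigr do rewrite mulrBr.
  rewrite sumrB; congr (_ - _); last first.
    transitivity (\sum_(f : 'I_n * 'I_n) filling zv f.1 f.2 * ind (nv v) (nv f)).
      by rewrite sum_ind /= !ltn_ord.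
    by apply: eq_bigr => f _; rewrite /ind eq_sym.
  case: v {ev} => [[[|v1] v1n] v2] /=.
    by rewrite big1// => f _; rewrite /ind (_ : (_ == _) = false) ?mulr0//; apply/eqP => -[].
  transitivity (\sum_(f : 'I_n * 'I_n) filling zv f.1 f.2 * ind (v1, v2 : nat) (nv f)).
    by rewrite sum_ind /= ltn_ord (ltnW v1n).
  by apply: eq_bigr => f _; rewrite /ind eq_sym.
Qed.

End grid.

(** * Angles and holes *)

Section angle.
Context {R : realType}.
Implicit Types (u v w x y p n : R * R).

Definition dot u v : R := u.1 * v.1 + u.2 * v.2.
Definition cross u v : R := u.1 * v.2 - u.2 * v.1.
Definition enorm u : R := Num.sqrt (dot u u).
Arguments dot : simpl never.
Arguments cross : simpl never.

Lemma dot_ge0 u : 0 <= dot u u.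
Proof. by rewrite /dot -!expr2 addr_ge0 ?sqr_ge0. Qed.

Lemma enorm_ge0 u : 0 <= enorm u. Proof. exact: sqrtr_ge0. Qed.

Lemma sqr_enorm u : enorm u ^+ 2 = dot u u.
Proof. by rewrite sqr_sqrtr ?dot_ge0. Qed.

Lemma dot_cross u v : dot u u * dot v v = dot u v ^+ 2 + cross u v ^+ 2.
Proof. by rewrite /dot /cross; ring. Qed.

Lemma ler_dot u v : `|dot u v| <= enorm u * enorm v.
Proof.
rewrite -(@ler_pXn2r _ 2) ?nnegrE ?normr_ge0 ?mulr_ge0 ?enorm_ge0//.
by rewrite exprMn !sqr_enorm real_normK ?num_real// dot_cross lerDl sqr_ge0.
Qed.

Lemma enorm_dist (x y : R * R) : edist x y = enorm (x - y).
Proof. by rewrite /edist /enorm /dot /= !expr2. Qed.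

Lemma enormN u : enorm (- u) = enorm u.
Proof. by rewrite /enorm /dot /= !mulrNN. Qed.

Lemma enormD u v : enorm (u + v) <= enorm u + enorm v.
Proof.
rewrite -(@ler_pXn2r _ 2) ?nnegrE ?addr_ge0 ?enorm_ge0//.
have := le_trans (ler_norm _) (ler_dot u v); rewrite sqrrD !sqr_enorm.
by rewrite /dot /=; lra.
Qed.

Lemma enormZ (a : R) u : enorm (a *: u) = `|a| * enorm u.
Proof.
rewrite /enorm -sqrtr_sqr -sqrtrM ?sqr_ge0//; congr Num.sqrt.
by rewrite /dot /= /GRing.scale /=; ring.
Qed.

Lemma norm1_le_enorm u : `|u.1| <= enorm u.
Proof. by rewrite -sqrtr_sqr ler_sqrt ?dot_ge0// /dot -!expr2 lerDl sqr_ge0. Qed.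

Lemma norm2_le_enorm u : `|u.2| <= enorm u.
Proof. by rewrite -sqrtr_sqr ler_sqrt ?dot_ge0// /dot -!expr2 lerDr sqr_ge0. Qed.

Lemma enorm_le_norm u : enorm u <= `|u.1| + `|u.2|.
Proof.
rewrite -(@ler_pXn2r _ 2) ?nnegrE ?addr_ge0 ?enorm_ge0//.
rewrite sqr_enorm sqrrD !real_normK ?num_real// /dot -!expr2.
by rewrite -addrA [X in _ <= _ + X]addrC addrA lerDl mulrn_wge0// mulr_ge0.
Qed.

Lemma enorm_eq0 u : (enorm u == 0) = (u == 0).
Proof.
apply/eqP/eqP => [u0|->]; last by rewrite /enorm /dot /= mul0r addr0 sqrtr0.
have := norm1_le_enorm u; have := norm2_le_enorm u; rewrite u0 !normr_le0.
by case: u {u0} => a b /= /eqP -> /eqP ->.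
Qed.

Lemma enorm_gt0 u : (0 < enorm u) = (u != 0).
Proof. by rewrite lt_neqAle enorm_ge0 andbT eq_sym enorm_eq0. Qed.

(* The signed angle from u to v, by tan (theta / 2) = sin theta / (1 + cos
   theta); it is 0 if u and v are opposite or if one of them is 0, since then
   the denominator vanishes. *)
Definition ang u v : R := 2 * atan (cross u v / (enorm u * enorm v + dot u v)).

Lemma ang_refl u : ang u u = 0.
Proof. by rewrite /ang /cross [u.2 * _]mulrC subrr mul0r atan0 mulr0. Qed.

Lemma ang_sym u v : ang v u = - ang u v.
Proof.
rewrite /ang -mulrN -atanN -mulNr [enorm u * _]mulrC.
by congr (2 * atan (_ / (_ + _))); rewrite /cross /dot; ring.
Qed.

Lemma ang_den_ge0 u v : 0 <= enorm u * enorm v + dot u v.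
Proof. by have := ler_dot u v; rewrite ler_norml => /andP[]; lra. Qed.

Lemma ang_ge0 u v : 0 <= cross u v -> 0 <= ang u v.
Proof.
move=> c0; rewrite /ang mulr_ge0//.
by rewrite -[leLHS]atan0 le_atan// divr_ge0// ang_den_ge0.
Qed.

Lemma ang_gt0 u v : 0 < cross u v -> 0 < ang u v.
Proof.
move=> c0; rewrite /ang mulr_gt0//.
rewrite -[ltLHS]atan0 lt_atan// divr_gt0// lt_neqAle ang_den_ge0 andbT eq_sym.
apply/eqP => d0.
have : dot u u * dot v v = dot u v ^+ 2.
  by rewrite -!sqr_enorm -exprMn (_ : dot u v = - (enorm u * enorm v)) ?sqrrN//; lra.
by rewrite dot_cross => /eqP; rewrite -subr_eq0 addrC addKr expf_eq0/= gt_eqF.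
Qed.

Lemma atan_half (a b : R) : - (pi / 2) < a < pi / 2 -> - (pi / 2) < b < pi / 2 ->
  2 * atan (sin (b - a) / (1 + cos (b - a))) = b - a.
Proof.
move=> /andP[a1 a2] /andP[b1 b2]; set t := (b - a) / 2.
have -> : b - a = t *+ 2 by rewrite /t -mulr_natr; field.
have tI : - (pi / 2) < t < pi / 2 by apply/andP; split; rewrite /t; lra.
have ct : 0 < cos t by rewrite cos_gt0_pihalf.
rewrite sin_mulr2n cos_mulr2n.
have -> : cos t * sin t *+ 2 / (1 + (cos t ^+ 2 *+ 2 - 1)) = tan t.
  rewrite /tan; move: (cos t) (sin t) ct => c s c0.
  have c1 : c != 0 by rewrite gt_eqF.
  by rewrite addrC subrK -(mulr_natr (c * s)) -(mulr_natr (c ^+ 2)); field.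
by rewrite tanK ?in_itv//= mulr_natl.
Qed.

Definition polar n w : R := atan (cross n w / dot n w).

(** On the open half-plane [0 < dot n w] the argument measured from n is single valued; this is the
    source of every additivity of [ang]. *)
Lemma ang_polar n u v : 0 < dot n u -> 0 < dot n v ->
  ang u v = polar n v - polar n u.
Proof.
move=> nu nv; rewrite -(@atan_half (polar n u)) ?atan_gtNpi2 ?atan_ltpi2//.
rewrite /ang; congr (2 * atan _).
have n0 : 0 < dot n n.
  rewrite lt_neqAle dot_ge0 andbT eq_sym; apply/eqP => n0.
  have := dot_cross n u; rewrite n0 mul0r => /esym/eqP.
  by rewrite paddr_eq0 ?sqr_ge0// expf_eq0/= gt_eqF.
have en w : 0 < dot n w -> 0 < enorm w.
  move=> nw; rewrite lt_neqAle enorm_ge0 andbT eq_sym enorm_eq0.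
  by apply/eqP => w0; move: nw; rewrite w0 /dot /= !mulr0 addr0 ltxx.
have cp w : 0 < dot n w -> cos (polar n w) = dot n w / (enorm n * enorm w).
  move=> nw; rewrite /polar cos_atan.
  have -> : 1 + (cross n w / dot n w) ^+ 2 = (enorm n * enorm w / dot n w) ^+ 2.
    rewrite [in RHS]expr_div_n [in RHS]exprMn !sqr_enorm dot_cross.
    by rewrite expr_div_n; field; rewrite gt_eqF.
  rewrite sqrtr_sqr ger0_norm ?invf_div//.
  by rewrite divr_ge0// ?mulr_ge0 ?enorm_ge0// ltW.
have sp w : 0 < dot n w -> sin (polar n w) = cross n w / (enorm n * enorm w).
  move=> nw; have c0 : cos (polar n w) != 0.
    by rewrite gt_eqF// cos_gt0_pihalf// atan_gtNpi2 atan_ltpi2.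
  rewrite -[LHS](mulfVK c0) -/(tan _) [X in X * _]atanK cp//.
  field; rewrite !gt_eqF//= ?en//.
have en0 : 0 < enorm n.
  by rewrite enorm_gt0; apply/eqP => n1; move: n0; rewrite n1 /dot /= mulr0 addr0 ltxx.
have := en _ nu; have := en _ nv => ev eu.
rewrite sinB cosB !cp// !sp//.
have E1 : cross n v * dot n u - dot n v * cross n u = cross u v * dot n n.
  by rewrite /cross /dot; ring.
have E2 : dot n v * dot n u + cross n v * cross n u = dot u v * dot n n.
  by rewrite /cross /dot; ring.
have -> : cross n v / (enorm n * enorm v) * (dot n u / (enorm n * enorm u)) -
   dot n v / (enorm n * enorm v) * (cross n u / (enorm n * enorm u)) =
   cross u v / (enorm u * enorm v).
  have -> : cross u v = (cross n v * dot n u - dot n v * cross n u) / enorm n ^+ 2.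
    by rewrite E1 sqr_enorm mulfK// gt_eqF.
  by field; rewrite !gt_eqF.
have -> : dot n v / (enorm n * enorm v) * (dot n u / (enorm n * enorm u)) +
   cross n v / (enorm n * enorm v) * (cross n u / (enorm n * enorm u)) =
   dot u v / (enorm u * enorm v).
  have -> : dot u v = (dot n v * dot n u + cross n v * cross n u) / enorm n ^+ 2.
    by rewrite E2 sqr_enorm mulfK// gt_eqF.
  by field; rewrite !gt_eqF.
have -> : 1 + dot u v / (enorm u * enorm v) =
    (enorm u * enorm v + dot u v) / (enorm u * enorm v).
  by field; rewrite !gt_eqF.
by rewrite invf_div mulrA mulfVK// gt_eqF// mulr_gt0.
Qed.


Definition seg_in (X : set (R * R)) x y :=
  forall s, 0 <= s <= 1 -> X (x + s *: (y - x)).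

(* Every function x |-> arg (x - p) with p outside X has a branch on X; for
   open X this says that X has no hole. *)
Definition hole_free (X : set (R * R)) := forall p, ~ X p ->
  exists A : R * R -> R,
    forall x y, seg_in X x y -> ang (x - p) (y - p) = A y - A x.

Lemma dot_seg n x y p s : dot n (x + s *: (y - x) - p) =
  (1 - s) * dot n (x - p) + s * dot n (y - p).
Proof. by rewrite /dot /= /GRing.scale /=; ring. Qed.

(** The segment is seen from p under an angle less than pi, so that the bisector of this angle can
    serve as n. If the denominator of [ang] vanished, the vectors to the end points would be
    opposite and p would divide the segment in the ratio of their lengths. *)
Lemma seg_halfplane x y p : (forall s, 0 <= s <= 1 -> x + s *: (y - x) != p) ->
  exists n, forall s, 0 <= s <= 1 -> 0 < dot n (x + s *: (y - x) - p).
Proof.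
move=> xyp; set u := x - p; set v := y - p.
have u0 : 0 < enorm u.
  rewrite enorm_gt0 subr_eq0; have := xyp 0; rewrite scale0r addr0; apply.
  by rewrite lexx ler01.
have v0 : 0 < enorm v.
  rewrite enorm_gt0 subr_eq0; have := xyp 1; rewrite scale1r addrC subrK; apply.
  by rewrite lexx ler01.
have := ang_den_ge0 u v; rewrite le_eqVlt => /orP[/eqP d0|d0].
  have uv0 : enorm u + enorm v != 0 by rewrite gt_eqF// addr_gt0.
  set t := enorm u / (enorm u + enorm v).
  have t01 : 0 <= t <= 1.
    rewrite /t divr_ge0 ?addr_ge0 ?enorm_ge0//= ler_pdivrMr ?addr_gt0//.
    by rewrite mul1r lerDl enorm_ge0.
  case/eqP: (xyp t t01); apply/eqP; rewrite -subr_eq0 -enorm_eq0 -sqrf_eq0 sqr_enorm.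
  have -> : dot (x + t *: (y - x) - p) (x + t *: (y - x) - p) =
     (1 - t) ^+ 2 * dot u u + t ^+ 2 * dot v v + 2 * (t * (1 - t)) * dot u v.
    by rewrite /u /v /dot /= /GRing.scale /=; ring.
  rewrite -!sqr_enorm (_ : dot u v = - (enorm u * enorm v)); last by move: d0; lra.
  by apply/eqP; rewrite /t; field.
exists (enorm v *: u + enorm u *: v) => s /andP[s0 s1]; rewrite dot_seg.
have du : 0 < dot (enorm v *: u + enorm u *: v) u.
  rewrite (_ : dot _ _ = enorm u * (enorm u * enorm v + dot u v)) ?mulr_gt0//.
  rewrite mulrDr mulrA -expr2 sqr_enorm; rewrite /dot /= /GRing.scale /=; ring.
have dv : 0 < dot (enorm v *: u + enorm u *: v) v.
  rewrite (_ : dot _ _ = enorm v * (enorm u * enorm v + dot u v)) ?mulr_gt0//.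
  rewrite mulrDr mulrCA -expr2 sqr_enorm; rewrite /dot /= /GRing.scale /=; ring.
have [s1'|s1'] := ltP s 1.
  by rewrite ltr_pwDl// ?mulr_gt0 ?subr_gt0// mulr_ge0// ltW.
by rewrite (_ : s = 1) ?subrr ?mul0r ?add0r ?mul1r//; apply/eqP; rewrite eq_le s1 s1'.
Qed.

Lemma ang_subdivide x y p (M : nat) : (0 < M)%N ->
  (forall s, 0 <= s <= 1 -> x + s *: (y - x) != p) ->
  \sum_(j < M) ang (x + (j%:R / M%:R) *: (y - x) - p)
                   (x + (j.+1%:R / M%:R) *: (y - x) - p) = ang (x - p) (y - p).
Proof.
move=> M0 /seg_halfplane[n nP].
have M0' : 0 < M%:R :> R by rewrite ltr0n.
have fr (j : nat) : (j <= M)%N -> 0 <= (j%:R / M%:R : R) <= 1.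
  by move=> jM; rewrite divr_ge0 ?ler0n//= ler_pdivrMr// mul1r ler_nat.
pose f (j : nat) := polar n (x + (j%:R / M%:R) *: (y - x) - p).
transitivity (\sum_(j < M) (f j.+1 - f j)).
  by apply: eq_bigr => j _; rewrite (@ang_polar n)//; apply: nP; apply: fr => //; exact: ltnW.
have := telescope_sumr f (leq0n M); rewrite big_mkord => ->.
have n0 := nP _ (fr _ (leq0n M)); have n1 := nP _ (fr _ (leqnn M)).
rewrite /f; move: n0 n1.
rewrite divff ?gt_eqF// mul0r scale0r addr0 scale1r (addrC x (y - x)) subrK => n0 n1.
by rewrite -ang_polar.
Qed.

End angle.

Section winding.
Context {R : realType}.
Implicit Types (u v w x y p n : R * R) (X Omega : set (R * R)).

(** In units of |w|^2 the product exceeds 1 - 1/4 - 1/4 - 1/16. *)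
Lemma dot_near w a b : enorm (a - w) < enorm w / 4 -> enorm (b - w) < enorm w / 4 ->
  0 < dot a b.
Proof.
move=> aw bw; have w0 : 0 < enorm w by have := enorm_ge0 (a - w); lra.
have h1 := ler_dot w (a - w); have h2 := ler_dot w (b - w).
have h3 := ler_dot (a - w) (b - w).
have -> : dot a b = dot w w + dot w (a - w) + dot w (b - w) + dot (a - w) (b - w).
  by rewrite /dot /=; ring.
rewrite -sqr_enorm; move: h1 h2 h3; rewrite !ler_norml => /andP[h1 _] /andP[h2 _] /andP[h3 _].
have k1 : enorm w * enorm (a - w) <= enorm w * (enorm w / 4) by rewrite ler_pM2l// ltW.
have k2 : enorm w * enorm (b - w) <= enorm w * (enorm w / 4) by rewrite ler_pM2l// ltW.
have k3 : enorm (a - w) * enorm (b - w) <= (enorm w / 4) * (enorm w / 4).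
  by apply: ler_pM; rewrite ?enorm_ge0// ltW.
have w2 : 0 < enorm w * enorm w by rewrite mulr_gt0.
rewrite expr2; lra.
Qed.

(** Cut the parameter square into K^2 cells so small that on each of them H, seen from p, stays in a
    half-plane. There [ang] is additive, so the total angle of a row of grid points does not depend
    on the row, the two lateral sides being constant; the last row is a point. All large K are
    allowed so that K can be a multiple of the number of edges of a polygon. *)
Lemma null_homotopic_ang (H : R * R -> R * R) p c :
  {within `[0, 1] `*` `[0, 1], continuous H} ->
  (forall s t, 0 <= s <= 1 -> 0 <= t <= 1 -> H (s, t) != p) ->
  (forall t, 0 <= t <= 1 -> H (1, t) = c) ->
  (forall s, 0 <= s <= 1 -> H (s, 0) = c /\ H (s, 1) = c) ->
  exists K0, forall K, (K0 <= K)%N ->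
    \sum_(j < K) ang (H (0, j%:R / K%:R) - p) (H (0, j.+1%:R / K%:R) - p) = 0.
Proof.
move=> cH Hp H1 Hs.
pose Sq : set (R * R) := `[0, 1] `*` `[0, 1].
have cSq : compact Sq by apply: compact_setX; exact: segment_compact.
have : \forall e \near (0 : R)^'+, forall x, Sq x -> forall a b, Sq a -> Sq b ->
    ball x e a -> ball x e b -> 0 < dot (H a - p) (H b - p).
  move/compact_near_coveringP : cSq => cov.
  apply: (cov _ (0 : R)^'+ (fun e x => forall a b, Sq a -> Sq b ->
    ball x e a -> ball x e b -> 0 < dot (H a - p) (H b - p))).
  move=> x Sx; pose w := H x - p.
  have w0 : 0 < enorm w.
    rewrite enorm_gt0 subr_eq0; case: x Sx @w => s t [/= s01 t01].
    by apply: Hp; [move: s01|move: t01]; rewrite in_itv.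
  (* An eighth, since the Euclidean norm is at most twice the sup norm and [dot_near] wants a
     quarter. *)
  move/subspace_continuousP : cH => /(_ x Sx)/cvgrPdist_lt/(_ (enorm w / 8)).
  move=> /(_ (divr_gt0 w0 (ltr0n _ 8))); rewrite near_withinE near_nbhs => /nbhs_ballP.
  move=> [r /= r0 rP].
  have r20 : 0 < r / 2 by rewrite divr_gt0.
  exists (ball x (r / 2), [set e | 0 < e < r / 2]); last first.
    move=> [x' e] /= [xx' /andP[e0 er]] a b Sa Sb x'a x'b.
    have close a' : Sq a' -> ball x' e a' -> enorm (H a' - p - w) < enorm w / 4.
      move=> Sa' xa'; have xa : ball x r a'.
        by rewrite [r]splitr; apply: ball_triangle xx' _; apply: le_ball xa'; exact: ltW.
      have := rP a' xa Sa'; rewrite (_ : H a' - p - w = H a' - H x); last first.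
        by rewrite /w opprB addrA subrK.
      rewrite -normrN opprB => h; apply: le_lt_trans (enorm_le_norm _) _.
      have h1 : `|(H a' - H x).1| <= `|H a' - H x| by rewrite /Num.norm /= le_max lexx.
      have h2 : `|(H a' - H x).2| <= `|H a' - H x| by rewrite /Num.norm /= le_max lexx orbT.
      by move: h h1 h2; lra.
    by apply: (@dot_near w); exact: close.
  split => /=; first exact: nbhsx_ballx.
  near=> e; apply/andP; split; near: e.
    exact: nbhs_right_gt.
  exact: nbhs_right_lt.
case=> e0 /= e00 eP.
pose e := e0 / 2.
have eP' : forall x, Sq x -> forall a b, Sq a -> Sq b ->
    ball x e a -> ball x e b -> 0 < dot (H a - p) (H b - p).
  apply: eP; rewrite /e /= ?divr_gt0// sub0r normrN gtr0_norm ?divr_gt0//.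
  by rewrite ltr_pdivrMr// mulr_natr mulr2n ltrDl.
have e_gt0 : 0 < e by rewrite divr_gt0.
exists (Num.truncn (e^-1)).+1 => K K0K.
have K0 : (0 < K)%N by apply: leq_trans K0K.
have K0' : 0 < K%:R :> R by rewrite ltr0n.
have Ke : K%:R^-1 < e.
  rewrite invf_plt ?posrE//; apply: lt_le_trans (truncnS_gt _) _.
  by rewrite ler_nat.
have fr (j : nat) : (j <= K)%N -> 0 <= (j%:R / K%:R : R) <= 1.
  by move=> jM; rewrite divr_ge0 ?ler0n//= ler_pdivrMr// mul1r ler_nat.
have frS (j : nat) : `|j%:R / K%:R - j.+1%:R / K%:R| < e.
  by rewrite -mulrBl -natr1 opprD addrA subrr sub0r mulN1r normrN gtr0_norm ?invr_gt0.
have fr0 (j : nat) : `|j%:R / K%:R - j%:R / K%:R| < e by rewrite subrr normr0.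
pose W (i j : nat) := H (i%:R / K%:R, j%:R / K%:R) - p.
have SqW i j : (i <= K)%N -> (j <= K)%N -> Sq (i%:R / K%:R, j%:R / K%:R).
  by move=> iK jK; split; rewrite /= in_itv; exact: fr.
pose S i := \sum_(j < K) ang (W i j) (W i j.+1).
have step i : (i < K)%N -> S i = S i.+1.
  move=> iK; apply/eqP; rewrite -subr_eq0 -sumrB.
  have cell j : (j < K)%N -> ang (W i j) (W i j.+1) - ang (W i.+1 j) (W i.+1 j.+1) =
      ang (W i j) (W i.+1 j) - ang (W i j.+1) (W i.+1 j.+1).
    move=> jK; have Sij := SqW _ _ (ltnW iK) (ltnW jK).
    have d i' j' : (i' <= K)%N -> (j' <= K)%N ->
        `|i%:R / K%:R - i'%:R / K%:R| < e -> `|j%:R / K%:R - j'%:R / K%:R| < e ->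
        0 < dot (W i j) (W i' j').
      move=> iK' jK' ii jj; apply: (eP' _ Sij) => //; first exact: SqW.
        exact: ballxx.
    by rewrite !(@ang_polar _ (W i j)); do ?[by apply: d => //; exact: ltnW]; ring.
  apply/eqP; transitivity (\sum_(j < K) (ang (W i j) (W i.+1 j) - ang (W i j.+1) (W i.+1 j.+1))).
    by apply: eq_bigr => j _; exact: cell.
  have := telescope_sumr (fun j => - ang (W i j) (W i.+1 j)) (leq0n K).
  rewrite big_mkord => h; under eq_bigr do rewrite addrC -[X in _ + X]opprK; rewrite h.
  rewrite /W divff ?gt_eqF// mul0r.
  have [-> ->] := Hs _ (fr _ (ltnW iK)); have [-> ->] := Hs _ (fr _ iK).
  by rewrite ang_refl subrr.
have SK : S K = 0.
  rewrite /S big1// => j _; rewrite /W divff ?gt_eqF// !H1 ?fr//; first exact: ang_refl.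
  exact: ltnW.
rewrite (_ : \sum_(j < K) _ = S 0%N); last by rewrite /S /W mul0r.
have SE i : (i <= K)%N -> S i = S 0%N.
  by elim: i => // i IH iK; rewrite -step// IH// ltnW.
by rewrite -(SE K)// SK.
Unshelve. all: by end_near. Qed.

Fixpoint ppath X x (s : seq (R * R)) : Prop :=
  if s is y :: s' then seg_in X x y /\ ppath X y s' else True.

Fixpoint pang p x (s : seq (R * R)) : R :=
  if s is y :: s' then ang (x - p) (y - p) + pang p y s' else 0.

Lemma ppath_cat X x s1 s2 :
  ppath X x (s1 ++ s2) <-> ppath X x s1 /\ ppath X (last x s1) s2.
Proof.
elim: s1 x => [|y s1 IH] x /=; first by split => // -[].
by split => [[? /IH[? ?]]//|[[? ?] ?]]; split => //; apply/IH.
Qed.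

Lemma pang_cat p x s1 s2 : pang p x (s1 ++ s2) = pang p x s1 + pang p (last x s1) s2.
Proof. by elim: s1 x => [|y s1 IH] x /=; rewrite ?add0r// IH addrA. Qed.

Lemma seg_in_sym X x y : seg_in X x y -> seg_in X y x.
Proof.
move=> Xxy s /andP[s0 s1].
have -> : y + s *: (x - y) = x + (1 - s) *: (y - x).
  rewrite scalerBl scale1r -[x - y]opprB scalerN addrA; congr (_ - _).
  by rewrite addrC subrK.
by apply: Xxy; rewrite subr_ge0 s1 lerBlDr lerDl.
Qed.

Lemma ppath_rev X p x s : ppath X x s -> exists s',
  [/\ ppath X (last x s) s', last (last x s) s' = x &
      pang p (last x s) s' = - pang p x s].
Proof.
elim: s x => [|y s IH] x /=; first by exists [::]; rewrite /= oppr0.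
move=> [xy /IH[s' [ps' ls' as']]]; exists (s' ++ [:: x]); split.
- by apply/ppath_cat; split => //=; rewrite ls'; split => //; exact: seg_in_sym.
- by rewrite last_cat.
- by rewrite pang_cat as' ls' /= addr0 ang_sym -opprD addrC.
Qed.

Definition clamp (t : R) := Num.min (Num.max t 0) 1.

Lemma clamp_le0 t : t <= 0 -> clamp t = 0.
Proof. by move=> t0; rewrite /clamp max_r// min_l// ler01. Qed.
Lemma clamp_ge1 t : 1 <= t -> clamp t = 1.
Proof. by move=> t0; rewrite /clamp max_l ?min_r// (le_trans ler01). Qed.
Lemma clamp_id t : 0 <= t <= 1 -> clamp t = t.
Proof. by move=> /andP[t0 t1]; rewrite /clamp max_l// min_l. Qed.

Lemma continuous_clamp : continuous clamp.
Proof.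
move=> t; apply: (@continuous_min R R (fun t => Num.max t 0) (fun=> 1)).
  by apply: (@continuous_max R R id (fun=> 0)); [exact: cvg_id|exact: cvg_cst].
exact: cvg_cst.
Qed.

(** The loop runs through edge k during the time from k / N to (k + 1) / N. With K = N M the grid of
    [null_homotopic_ang] cuts each edge into M equal parts, over which [ang] adds up by
    [ang_subdivide]. *)
Lemma polygon_ang0 Omega p x s : simply_connected Omega -> ~ Omega p ->
  ppath Omega x s -> last x s = x -> pang p x s = 0.
Proof.
move=> [_ sc] Op; have [->//|s0] := eqVneq s [::] => ps ls.
set N := size s; have N0 : (0 < N)%N by rewrite lt0n size_eq0.
have N0' : 0 < N%:R :> R by rewrite ltr0n.
pose v k := nth 0 (x :: s) k.
have vseg k : (k < N)%N -> seg_in Omega (v k) (v k.+1).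
  rewrite /v /N; move: ps; clear; elim: s x k => //= y s IH x [|k] [xy ps] ks //=.
  exact: IH.
have vang : pang p x s = \sum_(k < N) ang (v k - p) (v k.+1 - p).
  rewrite /v /N; clear; elim: s x => [|y s IH] x /=; first by rewrite big_ord0.
  by rewrite big_ord_recl /= IH; congr (_ + _); apply: eq_bigr.
have vN : v N = x by rewrite /v /N -last_nth.
(* A sum of clamped ramps is continuous on the whole line, and nothing has to be glued at the
   vertices. *)
pose gamma (t : R) := v 0%N + \sum_(0 <= k < N) clamp (t * N%:R - k%:R) *: (v k.+1 - v k).
have gammaE k s' : (k < N)%N -> 0 <= s' <= 1 ->
    gamma ((k%:R + s') / N%:R) = v k + s' *: (v k.+1 - v k).
  move=> kN s'01; have /andP[s0' s1'] := s'01; rewrite /gamma mulfVK ?gt_eqF//.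
  rewrite (big_cat_nat (n := k))//=; last exact: ltnW.
  rewrite (eq_big_nat _ _ (F2 := fun i => v i.+1 - v i)); last first.
    move=> i /andP[_ ik]; rewrite clamp_ge1 ?scale1r//.
    have : i.+1%:R <= k%:R :> R by rewrite ler_nat.
    by rewrite -natr1; lra.
  rewrite telescope_sumr// big_ltn// big_nat big1 ?addr0; last first.
    move=> i /andP[ik _]; rewrite clamp_le0 ?scale0r//.
    have : k.+1%:R <= i%:R :> R by rewrite ler_nat.
    by rewrite -natr1; lra.
  by rewrite [k%:R + s']addrC addrK clamp_id// addrA [v 0%N + _]addrC subrK.
have cgamma : continuous gamma.
  have csum r : continuous (fun t : R =>
      \sum_(k <- r) clamp (t * N%:R - k%:R) *: (v k.+1 - v k)).
    elim: r => [|k r IH] t.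
      rewrite (_ : (fun t : R => _) = cst 0); first exact: cst_continuous.
      by apply/funext => u; rewrite big_nil.
    rewrite (_ : (fun t : R => _) = fun t => clamp (t * N%:R - k%:R) *: (v k.+1 - v k)
        + \sum_(k <- r) clamp (t * N%:R - k%:R) *: (v k.+1 - v k)); last first.
      by apply/funext => u; rewrite big_cons.
    apply: cvgD; last exact: IH.
    apply: cvgZr_tmp; apply: (@continuous_comp _ _ _ (fun t : R => t * N%:R - k%:R) clamp).
      by apply: cvgB; [apply: cvgMl; exact: cvg_id|exact: cvg_cst].
    exact: continuous_clamp.
  by move=> t; apply: cvgD; [exact: cst_continuous|exact: csum].
have gammaO t : 0 <= t <= 1 -> Omega (gamma t).
  move=> /andP[t0 t1].
  have [tN|tN] := ltP (t * N%:R) N%:R; last first.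
    have -> : t = (N.-1%:R + 1) / N%:R.
      rewrite natr1 prednK// divff ?gt_eqF//; apply/eqP; rewrite eq_le t1/=.
      by move: tN; rewrite -[leLHS]mul1r ler_pM2r.
    rewrite gammaE ?prednK// ?lexx ?ler01//.
    have := @vseg N.-1; rewrite !prednK// => /(_ (leqnn _))/(_ 1); apply.
    by rewrite lexx ler01.
  have tN0 : 0 <= t * N%:R by rewrite mulr_ge0.
  have /andP[h1 h2] := truncn_itv tN0; set k := Num.truncn _ in h1 h2.
  have kN : (k < N)%N by rewrite -(ltr_nat R); exact: le_lt_trans tN.
  have -> : t = (k%:R + (t * N%:R - k%:R)) / N%:R by rewrite addrC subrK mulfK// gt_eqF.
  have h3 : 0 <= t * N%:R - k%:R <= 1 by move: h1 h2; rewrite -natr1; lra.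
  by rewrite gammaE//; exact: vseg.
have gamma0 : gamma 0 = x.
  have := @gammaE 0%N 0; rewrite addr0 mul0r scale0r addr0; apply => //.
  by rewrite lexx ler01.
have gamma1 : gamma 1 = x.
  have := @gammaE N.-1 1; rewrite natr1 prednK// divff ?gt_eqF// => ->; last 2 first.
  - exact: leqnn.
  - by rewrite lexx ler01.
  by rewrite scale1r addrC subrK.
have [||H [cH HO H0 H1 Hs]] := sc gamma _ gammaO.
- by apply: continuous_subspaceT.
- by rewrite gamma0 gamma1.
rewrite gamma0 in H1 Hs.
have [|K0 K0P] := @null_homotopic_ang H p x cH _ H1 Hs.
  by move=> s' t s'01 t01; apply/eqP => Hp; apply: Op; rewrite -Hp; exact: HO.
pose M := K0.+1.
have M0' : 0 < M%:R :> R by rewrite ltr0n.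
have := K0P (N * M)%N; rewrite (leq_trans (leqnSn _))//; last by rewrite leq_pmull.
move=> /(_ isT); rewrite -(big_mkord xpredT (fun j =>
  ang (H (0, j%:R / (N * M)%:R) - p) (H (0, j.+1%:R / (N * M)%:R) - p))).
rewrite big_nat_mul big_mkord vang => S0; rewrite -[RHS]S0; apply: eq_bigr => k _.
have vp s' : 0 <= s' <= 1 -> v k + s' *: (v k.+1 - v k) != p.
  by move=> s'01; apply/eqP => e; apply: Op; rewrite -e; apply: vseg.
rewrite -(ang_subdivide (M := M))// mulSn -{1}[(k * M)%N]add0n big_addn addnK.
rewrite big_mkord; apply: eq_bigr => j _.
have gH (l : nat) : (l <= M)%N -> H (0, (l + k * M)%:R / (N * M)%:R) =
    v k + (l%:R / M%:R) *: (v k.+1 - v k).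
  move=> lM; have l01 : 0 <= (l%:R / M%:R : R) <= 1.
    by rewrite divr_ge0 ?ler0n//= ler_pdivrMr// mul1r ler_nat.
  rewrite -(@gammaE k)//.
  have -> : (l + k * M)%:R / (N * M)%:R = (k%:R + l%:R / M%:R) / N%:R :> R.
    by rewrite natrD !natrM; field; rewrite !gt_eqF.
  apply: H0; case/andP: l01 => l0 l1; apply/andP; split.
    by apply: divr_ge0 => //; apply: addr_ge0.
  rewrite ler_pdivrMr// mul1r.
  have : k.+1%:R <= N%:R :> R by rewrite ler_nat.
  by rewrite -natr1; lra.
by rewrite -addSn !gH// ltnW.
Qed.


Lemma open_connected_ppath Omega x y : open Omega -> connected Omega ->
  Omega x -> Omega y -> exists s, ppath Omega x s /\ last x s = y.
Proof.
move=> oO cO Ox Oy.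
pose B := [set z | Omega z /\ exists s, ppath Omega x s /\ last x s = z].
suff BE : B = Omega by move: Oy; rewrite -{1}BE => -[_ h].
have near_seg z : Omega z -> \forall z' \near z, seg_in Omega z z' /\ Omega z'.
  move=> Oz; move: oO; rewrite openE => /(_ z Oz); rewrite /interior.
  move=> /nbhs_ballP[r /= r0 rO]; apply/nbhs_ballP; exists r => //= z' zz'; split; last exact: rO.
  move=> t /andP[t0 t1]; apply: rO; case: zz' => z1 z2.
  have h (a b : R) : ball a r b -> ball a r (a + t * (b - a)).
    rewrite /ball /= opprD addrA subrr add0r normrN normrM (ger0_norm t0) => h.
    by apply: le_lt_trans h; rewrite distrC -[leRHS]mul1r ler_wpM2r.
  by split; apply: h.
apply: cO.
- by exists x; split => //; exists [::].
- exists B; last first.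
    by apply/seteqP; split => z => [Bz|[_ Bz]//]; split => //; case: Bz.
  rewrite openE => z [Oz [s [ps ls]]]; rewrite /interior.
  have := near_seg z Oz; apply: filterS => z' [zz' Oz']; split => //.
  exists (s ++ [:: z']); rewrite last_cat; split => //.
  by apply/ppath_cat; rewrite ls.
- exists (closure B); first exact: closed_closure.
  apply/seteqP; split => z; first by move=> Bz; split; [case: Bz|exact: subset_closure].
  move=> [Oz cBz]; split => //.
  have [z' [[Oz' [s [ps ls]]] [zz' _]]] := cBz _ (near_seg z Oz).
  exists (s ++ [:: z]); rewrite last_cat; split => //.
  by apply/ppath_cat; rewrite ls; split => //; split => //; exact: seg_in_sym.
Qed.

(** The branch at x is the angle along a polygonal path from a base point. It does not depend on the
    path, as closed polygons have total angle 0 by [polygon_ang0]. *)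
Lemma simply_connected_hole_free Omega : open Omega -> simply_connected Omega ->
  hole_free Omega.
Proof.
move=> oO sc p Op; have [[x0 Ox0]|/set0P] := pselect (Omega !=set0); last first.
  move=> /negP; rewrite negbK => /eqP O0; exists (fun=> 0) => x y /(_ 0).
  by rewrite O0 lexx ler01 => /(_ isT).
have pathP x : {s | Omega x -> ppath Omega x0 s /\ last x0 s = x}.
  apply: cid; have [Ox|Ox] := pselect (Omega x); last by exists [::].
  by have [s] := open_connected_ppath oO sc.1 Ox0 Ox; exists s.
exists (fun x => pang p x0 (sval (pathP x))) => x y xy.
have Ox : Omega x by have := xy 0; rewrite scale0r addr0 lexx ler01; apply.
have Oy : Omega y by have := xy 1; rewrite scale1r [x + _]addrC subrK lexx ler01; apply.
have [px lx] := svalP (pathP x) Ox; have [py ly] := svalP (pathP y) Oy.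
have [s' [ps' ls' as']] := ppath_rev p py; rewrite ly in ps' ls' as'.
have := @polygon_ang0 Omega p x0 (sval (pathP x) ++ y :: s') sc Op.
rewrite pang_cat lx /= as' => h; apply/eqP; rewrite -subr_eq0; apply/eqP.
rewrite -[RHS]h; first by ring.
- by apply/ppath_cat; rewrite lx.
- by rewrite last_cat.
Qed.

End winding.

(** * Erosion *)

Lemma pair_eq (T1 T2 : Type) (a b : T1 * T2) : a.1 = b.1 -> a.2 = b.2 -> a = b.
Proof. by case: a; case: b => ? ? ? ? /= -> ->. Qed.

Ltac lra_area := repeat match goal with
  | |- context [@area ?R ?X] => generalize (@area R X); intro
  end; lra.

Section erosion.
Context {R : realType}.
Implicit Types (u v w x y p n : R * R) (X Y : set (R * R)).

(** The Minkowski difference of X and the segment from 0 to u, written X - u in the overview. *)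
Definition erode u X := [set x | forall s, 0 <= s <= 1 -> X (x + s *: u)].

Lemma erode_sub u X : erode u X `<=` X.
Proof. by move=> x /(_ 0); rewrite scale0r addr0 lexx ler01; apply. Qed.

Lemma erodeC u v X : erode u (erode v X) = erode v (erode u X).
Proof.
by apply/seteqP; split => x h s s01 t t01; rewrite addrAC; exact: h.
Qed.

Lemma erode_seg u X x : erode u X x <-> seg_in X x (x + u).
Proof. by split => h s /h; rewrite [x + u]addrC addrK. Qed.

Lemma open_erode u X : open X -> open (erode u X).
Proof.
move=> oX; rewrite openE => x ux; rewrite /interior.
have cI : compact (`[0, 1]%classic : set R) by exact: segment_compact.
move/compact_near_coveringP : cI => cov.
have H : forall s : R, `[0, 1]%classic s -> \near s & x, X (x + s *: u).
  move=> s s01; have Xs : X (x + s *: u) by apply: ux; move: s01; rewrite /= in_itv.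
  have c : {for (s, x), continuous (fun z : R * (R * R) => z.2 + z.1 *: u)}.
    apply: cvgD; first exact: cvg_snd.
    by apply: cvgZr_tmp; exact: cvg_fst.
  have : nbhs (x + s *: u) X by apply: open_nbhs_nbhs.
  by move/c.
have := cov _ (nbhs x) (fun y s => X (y + s *: u)) _ H.
move=> /(_ (nbhs_filter x)); apply: filterS => y yP s s01; apply: yP.
by rewrite /= in_itv.
Qed.

(** A point p is missing from the eroded set because some p + s u is missing from X; the branch
    around that point, translated back by s u, serves for p. *)
Lemma erode_hole_free u X : hole_free X -> hole_free (erode u X).
Proof.
move=> hX p /existsNP[s /not_implyP[s01 Xp]].
have [A AP] := hX _ Xp; exists (fun x => A (x + s *: u)) => x y xy.
rewrite -AP; first by congr ang; rewrite opprD addrACA subrr addr0.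
move=> t t01; have := xy t t01 s s01; congr (X _).
by rewrite opprD [y + _ + _]addrACA subrr addr0 addrAC.
Qed.

Lemma bounded_box X : bounded_set X -> exists2 M : R, 0 < M &
  forall x, X x -> `|x.1| <= M /\ `|x.2| <= M.
Proof.
move=> [M [_ MP]]; exists (`|M| + 1); first by rewrite ltr_wpDl.
move=> x Xx; have := MP (`|M| + 1); rewrite (le_lt_trans (ler_norm _)) ?ltrDl//.
move=> /(_ isT x Xx); rewrite /Num.norm /= ge_max => /andP[]; split => //.
Qed.

Lemma plane_measureX (A B : set R) : measurable A -> measurable B ->
  plane_measure (A `*` B) = (lebesgue_measure A * lebesgue_measure B)%E.
Proof. by move=> mA mB; exact: product_measure1E. Qed.

Lemma bounded_plane_measure X : measurable X -> bounded_set X ->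
  (plane_measure X < +oo)%E.
Proof.
move=> mX /bounded_box[M M0 XM].
apply: (@le_lt_trans _ _ (plane_measure (`[-M, M] `*` `[-M, M] : set (R * R)))).
  apply: le_measure; rewrite ?inE//; first by apply: measurableX; exact: measurable_itv.
  by move=> x /XM; rewrite !ler_norml => -[]; split; rewrite /= in_itv.
rewrite plane_measureX; try exact: measurable_itv.
rewrite !lebesgue_measure_itv /= lte_fin; case: ifP => _; last by rewrite mule0 ltry.
by rewrite -EFinB -EFinM ltry.
Qed.

Lemma areaE X : measurable X -> bounded_set X -> plane_measure X = (area X)%:E.
Proof. by move=> mX bX; rewrite fineK// ge0_fin_numE// bounded_plane_measure. Qed.

Lemma sub_bounded X Y : X `<=` Y -> bounded_set Y -> bounded_set X.
Proof.
move=> XY [M [Mr MP]]; exists M; split => // z Mz x /XY; exact: (MP z Mz x).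
Qed.

Lemma le_area X Y : measurable X -> measurable Y -> bounded_set Y ->
  X `<=` Y -> area X <= area Y.
Proof.
move=> mX mY bY XY; have bX := sub_bounded XY bY.
by rewrite -lee_fin -!areaE//; apply: le_measure; rewrite ?inE.
Qed.

Lemma areaU X Y : measurable X -> measurable Y -> bounded_set X -> bounded_set Y ->
  X `&` Y = set0 -> area (X `|` Y) = area X + area Y.
Proof.
move=> mX mY bX bY XY; rewrite {1}/area.
have -> : plane_measure (X `|` Y) = (plane_measure X + plane_measure Y)%E.
  exact: measureU.
by rewrite !areaE.
Qed.

Lemma areaD X Y : measurable X -> measurable Y -> bounded_set X -> Y `<=` X ->
  area (X `\` Y) = area X - area Y.
Proof.
move=> mX mY bX YX; have := @areaU Y (X `\` Y) mY (measurableD mX mY).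
rewrite setDUK// => -> ; first by rewrite [area Y + _]addrC addrK.
- exact: sub_bounded bX.
- by apply: sub_bounded bX; exact: subDsetl.
- by rewrite setDIK.
Qed.

Lemma measurable_shift v X : measurable X ->
  measurable ((fun x => (x.1 + v.1, x.2 + v.2)) @^-1` X).
Proof.
move=> mX; rewrite -[X in measurable X]setTI.
have mf : measurable_fun [set: R * R] (fun x : R * R => (x.1 + v.1, x.2 + v.2)).
  apply: measurable_fun_pair; (apply: measurable_funD; last exact: measurable_cst).
    exact: measurable_fst.
  exact: measurable_snd.
exact: mf.
Qed.

Lemma area_shift v X : measurable X -> area ((fun x => x + v) @^-1` X) = area X.
Proof. by move=> mX; rewrite /area -[in RHS](plane_measure_shift v). Qed.

(* A point of X - v that leaves X - 2v is moved by v to a point of X that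
   leaves X - v. *)
Lemma area_erode2 v X : open X -> bounded_set X ->
  2 * area (erode v X) <= area X + area (erode v (erode v X)).
Proof.
move=> oX bX; set X1 := erode v X; set X2 := erode v X1.
have oX1 : open X1 by exact: open_erode.
have oX2 : open X2 by exact: open_erode.
have [mX mX1 mX2] : [/\ measurable X, measurable X1 & measurable X2].
  by split; exact: open_plane_measurable.
have s1 : X1 `<=` X by exact: erode_sub.
have s2 : X2 `<=` X1 by exact: erode_sub.
have b1 := sub_bounded s1 bX.
have : area (X1 `\` X2) <= area (X `\` X1).
  rewrite -(area_shift v (measurableD mX mX1)); apply: le_area.
  - exact: measurableD.
  - by apply: (@measurable_shift v); exact: measurableD.
  - have [M M0 MP] := bounded_box bX.
    exists (M + `|v|); split; first exact: num_real.
    move=> z Mz x [/MP[x1 x2] _]; apply: le_trans (ltW Mz).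
    rewrite -[x](addrK v); apply: le_trans (ler_normB _ _) _; rewrite lerD2r.
    by rewrite /Num.norm /= ge_max x1 x2.
  - move=> x [x1 x2]; split.
      by have := x1 1; rewrite scale1r; apply; rewrite ler01 lexx.
    move=> xv; apply: x2 => s /andP[s0 s1'] t /andP[t0 t1].
    rewrite -addrA -scalerDl; have [st|st] := leP (s + t) 1.
      by apply: x1; rewrite addr_ge0.
    set r := s + t - 1; have -> : s + t = 1 + r by rewrite /r; ring.
    rewrite scalerDl scale1r addrA; apply: xv.
    by apply/andP; split; rewrite /r; lra.
by rewrite !areaD//; lra_area.
Qed.

End erosion.

Section parallelogram.
Context {R : realType}.
Variables u v : R * R.
Implicit Types (x y p n : R * R) (X Y : set (R * R)).

Definition coord1 x := cross x v / cross u v.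
Definition coord2 x := cross u x / cross u v.

(** Half-open in both coordinates, so that its lattice translates partition the plane. *)
Definition cell (a b : R) := [set x | a <= coord1 x < a + 1 /\ b <= coord2 x < b + 1].

Lemma continuous_coord1 : continuous coord1.
Proof.
move=> x; rewrite /coord1 /cross; apply: cvgMl; apply: cvgB.
- by apply: cvgMl; exact: cvg_fst.
- by apply: cvgMl; exact: cvg_snd.
Qed.

Lemma continuous_coord2 : continuous coord2.
Proof.
move=> x; rewrite /coord2 /cross; apply: cvgMl; apply: cvgB.
- by apply: cvgMr; exact: cvg_snd.
- by apply: cvgMr; exact: cvg_fst.
Qed.

Lemma measurable_cell a b : measurable (cell a b).
Proof.
have -> : cell a b = (coord1 @^-1` `[a, a + 1[) `&` (coord2 @^-1` `[b, b + 1[).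
  by apply/seteqP; split => x /=; rewrite !in_itv.
apply: measurableI; rewrite -[X in measurable X]setTI.
  by apply: (continuous_plane_measurable continuous_coord1) => //; exact: measurable_itv.
by apply: (continuous_plane_measurable continuous_coord2) => //; exact: measurable_itv.
Qed.

Lemma lebesgue_measure_unit (a : R) : a != 0 ->
  lebesgue_measure [set x : R | 0 <= x / a < 1] = `|a|%:E /\
  measurable [set x : R | 0 <= x / a < 1].
Proof.
rewrite neq_lt => /orP[a0|a0].
  have -> : [set x : R | 0 <= x / a < 1] = `]a, 0]%classic.
    apply/seteqP; split => x /=; rewrite in_itv /= ler_ndivlMr// ltr_ndivrMr// mul0r mul1r.
      by rewrite andbC.
    by rewrite andbC.
  split; last exact: measurable_itv.
  by rewrite lebesgue_measure_itv /= lte_fin a0 ltr0_norm// -EFinB sub0r.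
have -> : [set x : R | 0 <= x / a < 1] = `[0, a[%classic.
  by apply/seteqP; split => x /=; rewrite in_itv /= ler_pdivlMr// ltr_pdivrMr// mul0r mul1r.
split; last exact: measurable_itv.
by rewrite lebesgue_measure_itv /= lte_fin a0 gtr0_norm// -EFinB subr0.
Qed.

(** Two shears turn the parallelogram into the rectangle with sides u.1 and (u x v) / u.1. If u.1 =
    0, [plane_measure_cell] exchanges u and v. *)
Lemma plane_measure_cell0 : cross u v != 0 -> u.1 != 0 ->
  plane_measure (cell 0 0) = `|cross u v|%:E.
Proof.
move=> D0 u0.
have c1 (c : R) : continuous (fun x : R => c * x) by move=> x; apply: cvgMr; exact: cvg_id.
rewrite -(plane_measure_shear (c1 (u.2 / u.1)) (measurable_cell 0 0)).
have m1 : measurable ((fun x => (x.1, x.2 + u.2 / u.1 * x.1)) @^-1` cell 0 0).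
  rewrite -[X in measurable X]setTI.
  have mf : measurable_fun [set: R * R] (fun x : R * R => (x.1, x.2 + u.2 / u.1 * x.1)).
    apply: measurable_fun_pair; first exact: measurable_fst.
    apply: measurable_funD; first exact: measurable_snd.
    apply: (measurableT_comp (f := fun x : R => u.2 / u.1 * x)); last exact: measurable_fst.
    exact: continuous_measurable_fun.
  by apply: mf => //; exact: measurable_cell.
rewrite -(plane_measure_shear2 (c1 (u.1 * v.1 / cross u v)) m1).
have [I1 mI1] := lebesgue_measure_unit u0.
have du : cross u v / u.1 != 0 by rewrite mulf_neq0// invr_neq0.
have [I2 mI2] := lebesgue_measure_unit du.
set A := (X in plane_measure X).
have -> : A = [set x : R | 0 <= x / u.1 < 1] `*` [set x : R | 0 <= x / (cross u v / u.1) < 1].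
  have e1 (x : R * R) : coord1 (x.1 + u.1 * v.1 / cross u v * x.2,
      x.2 + u.2 / u.1 * (x.1 + u.1 * v.1 / cross u v * x.2)) = x.1 / u.1.
    by rewrite /coord1; move: D0; rewrite /cross /= => D0; field; rewrite u0 D0.
  have e2 (x : R * R) : coord2 (x.1 + u.1 * v.1 / cross u v * x.2,
      x.2 + u.2 / u.1 * (x.1 + u.1 * v.1 / cross u v * x.2)) = x.2 / (cross u v / u.1).
    by rewrite /coord2; move: D0; rewrite /cross /= => D0; field; rewrite u0 D0.
  by apply/seteqP; split => x; rewrite /A /cell /preimage/= e1 e2 add0r.
rewrite plane_measureX// I1 I2 -EFinM -normrM; congr (`|_|%:E).
by rewrite mulrC mulfVK.
Qed.

End parallelogram.

Lemma plane_measure_cell (R : realType) (u v : R * R) : cross u v != 0 ->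
  plane_measure (cell u v 0 0) = `|cross u v|%:E.
Proof.
move=> D0; have [u0|u0] := eqVneq u.1 0; last exact: plane_measure_cell0.
have D' : cross v u = - cross u v by rewrite /cross; ring.
have v0 : v.1 != 0.
  by apply: contraNneq D0 => v0; rewrite /cross u0 v0 mul0r mulr0 subrr.
have H : cross v u != 0 by rewrite D' oppr_eq0.
transitivity (plane_measure (cell v u 0 0)); last first.
  by rewrite (plane_measure_cell0 H v0) D' normrN.
have e1 x : coord1 v u x = coord2 u v x.
  by rewrite /coord1 /coord2 D' (_ : cross x u = - cross u x) ?invrN ?mulrNN//; rewrite /cross; ring.
have e2 x : coord2 v u x = coord1 u v x.
  by rewrite /coord1 /coord2 D' (_ : cross v x = - cross x v) ?invrN ?mulrNN//; rewrite /cross; ring.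
by congr plane_measure; apply/seteqP; split => x; rewrite /cell /= e1 e2 => -[].
Qed.

Section mixed_erosion.
Context {R : realType}.
Implicit Types (u v x y p n : R * R) (X Y : set (R * R)).

Section lattice.
Variables (u v : R * R) (N : nat).
Hypothesis D0 : 0 < cross u v.

Let D' : cross u v != 0. Proof. by rewrite gt_eqF. Qed.

(** The indices 0, ..., 2 N - 1 are centred at N, so that the grid of [grid_euler], which has
    natural indices, covers a bounded set. *)
Definition lattice_shift (i j : nat) : R * R :=
  (i%:R - N%:R) *: u + (j%:R - N%:R) *: v.

Lemma coord1_shift i j x :
  coord1 u v (x + lattice_shift i j) = coord1 u v x + (i%:R - N%:R).
Proof.
apply: (mulIf D'); rewrite mulrDl /coord1 !mulfVK//.
by rewrite /lattice_shift /cross /= /GRing.scale /=; ring.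
Qed.

Lemma coord2_shift i j x :
  coord2 u v (x + lattice_shift i j) = coord2 u v x + (j%:R - N%:R).
Proof.
apply: (mulIf D'); rewrite mulrDl /coord2 !mulfVK//.
by rewrite /lattice_shift /cross /= /GRing.scale /=; ring.
Qed.

Let n := (N + N)%N.
Let Q := cell u v 0 0.
Let C i j := cell u v (i%:R - N%:R) (j%:R - N%:R).

Definition lattice_count Y x : R :=
  \sum_(i < n) \sum_(j < n) \1_Y (x + lattice_shift i j).

Lemma measurable_lattice_term Y i j : measurable Y ->
  measurable ((fun x => x + lattice_shift i j) @^-1` Y).
Proof. exact: (@measurable_shift R (lattice_shift i j)). Qed.

Lemma measurable_indic_shift Y i j : measurable Y ->
  measurable_fun setT (fun x : R * R => \1_Y (x + lattice_shift i j) : R).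
Proof.
move=> mY; rewrite (_ : (fun x => _) = \1_((fun x => x + lattice_shift i j) @^-1` Y)).
  by apply: measurable_indic; exact: measurable_lattice_term.
by apply/funext => x; rewrite !indicE; congr (nat_of_bool _)%:R; apply/idP/idP; rewrite !in_setE.
Qed.

Lemma measurable_lattice_count Y : measurable Y ->
  measurable_fun setT (lattice_count Y).
Proof.
move=> mY; apply: measurable_sum => i; apply: measurable_sum => j.
exact: measurable_indic_shift.
Qed.

Lemma lattice_count_ge0 Y x : 0 <= lattice_count Y x.
Proof. by apply: sumr_ge0 => i _; apply: sumr_ge0 => j _; rewrite indicE. Qed.

Lemma sum_cells Y x : (forall y, Y y ->
    `|coord1 u v y| < N%:R /\ `|coord2 u v y| < N%:R) ->
  \1_Y x = \sum_(i < n) \sum_(j < n) \1_(C i j `&` Y) x :> R.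
Proof.
move=> YN; have [Yx|nYx] := pselect (Y x); last first.
  rewrite indicE memNset// big1// => i _; rewrite big1// => j _.
  by rewrite indicE memNset// => -[].
have [] := YN x Yx; rewrite !ltr_norml => /andP[a1 a2] /andP[b1 b2].
have tr (a : R) : - N%:R < a -> a < N%:R -> {k : nat | (k < n)%N &
    forall i : nat, (i%:R - N%:R <= a < i%:R - N%:R + 1) = (i == k)}.
  move=> h1 h2; have h0 : 0 <= a + N%:R by lra.
  exists (Num.truncn (a + N%:R)).
    have /andP[t1 _] := truncn_itv h0; rewrite -(ltr_nat R).
    by apply: le_lt_trans t1 _; rewrite /n natrD; lra.
  move=> i; rewrite eq_sym truncn_eq// -natr1.
  by apply/idP/idP => /andP[? ?]; apply/andP; split; lra.
have [k kn kP] := tr _ a1 a2; have [l ln lP] := tr _ b1 b2.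
have CE i j : \1_(C i j `&` Y) x = ((i == k) && (j == l))%:R :> R.
  rewrite indicE; congr (_%:R); congr nat_of_bool; apply/idP/idP.
    by rewrite inE => -[] [c1 c2] _; rewrite -kP -lP c1 c2.
  by rewrite -kP -lP => /andP[c1 c2]; rewrite inE.
rewrite indicE mem_set//=.
under eq_bigr do under eq_bigr do rewrite CE.
rewrite (bigD1 (Ordinal kn))//= (bigD1 (Ordinal ln))//= !eqxx/=.
rewrite !big1 ?addr0//.
- move=> i ik; rewrite big1// => j _; rewrite (_ : (_ == k) = false)//.
  by apply/negbTE; apply: contraNneq ik => ik; apply/eqP/val_inj.
- move=> j jl; rewrite (_ : (_ == l) = false)//.
  by apply/negbTE; apply: contraNneq jl => jl; apply/eqP/val_inj.
Qed.

(** Every cell of the tiling is translated to the fundamental one: integrating over it the number of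
    points of the translated lattice in Y counts each point of Y once. *)
Lemma measure_lattice Y : measurable Y -> (forall y, Y y ->
    `|coord1 u v y| < N%:R /\ `|coord2 u v y| < N%:R) ->
  plane_measure Y = (\int[plane_measure]_(x in Q) (lattice_count Y x)%:E)%E.
Proof.
move=> mY YN; have mQ : measurable Q by exact: measurable_cell.
have mC i j : measurable (C i j `&` Y) by apply: measurableI => //; exact: measurable_cell.
transitivity (\sum_(i < n) \sum_(j < n) plane_measure (C i j `&` Y))%E.
  transitivity (\int[plane_measure]_x (\1_Y x)%:E)%E; first by rewrite integral_indic// setIT.
  transitivity (\int[plane_measure]_x
      (\sum_(i < n) \sum_(j < n) (\1_(C i j `&` Y) x)%:E))%E.
    apply: eq_integral => x _; rewrite (sum_cells x YN) -sumEFin.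
    by apply: eq_bigr => i _; rewrite -sumEFin.
  rewrite ge0_integral_sum//; last 2 first.
  - move=> i; apply: emeasurable_sum => j; apply/measurable_EFinP.
    by apply: measurable_indic; exact: mC.
  - by move=> i x _; apply: sume_ge0 => j _; rewrite lee_fin indicE.
  apply: eq_bigr => i _; rewrite ge0_integral_sum//; last first.
    by move=> j; apply/measurable_EFinP; apply: measurable_indic; exact: mC.
  by apply: eq_bigr => j _; rewrite integral_indic ?setIT//; exact: mC.
rewrite /lattice_count.
transitivity (\int[plane_measure]_(x in Q)
    (\sum_(i < n) \sum_(j < n) (\1_Y (x + lattice_shift i j))%:E))%E; last first.
  apply: eq_integral => x _; rewrite -sumEFin.
  by apply: eq_bigr => i _; rewrite -sumEFin.
have mI i j : measurable_fun Q (fun x : R * R => (\1_Y (x + lattice_shift i j) : R)%:E).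
  apply/measurable_EFinP; apply: measurable_funTS.
  exact: (measurable_indic_shift i j mY).
rewrite ge0_integral_sum//; last 2 first.
- by move=> i; apply: emeasurable_sum => j; exact: mI.
- by move=> i x _; apply: sume_ge0 => j _; rewrite lee_fin indicE.
apply: eq_bigr => i _; rewrite ge0_integral_sum//; last first.
  by move=> j; exact: mI.
apply: eq_bigr => j _.
transitivity (\int[plane_measure]_(x in Q)
    (\1_((fun x => x + lattice_shift i j) @^-1` Y) x)%:E)%E; last first.
  by apply: eq_integral => x _; rewrite !indicE; congr (nat_of_bool _)%:R%:E; apply/idP/idP; rewrite !in_setE.
rewrite integral_indic//; last exact: measurable_lattice_term.
rewrite -(plane_measure_shift (lattice_shift i j) (mC i j)).
have sh x : C i j (x + lattice_shift i j) <-> Q x.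
  rewrite /C /Q /cell /= coord1_shift coord2_shift.
  by split=> -[/andP[? ?] /andP[? ?]]; split; apply/andP; split; lra.
by congr plane_measure; apply/seteqP; split => x => [[/= /(sh x).1 ? ?]|[/= ? /(sh x).2 ?]]; split.
Qed.

End lattice.

Section top.
Variables (u v : R * R) (N : nat) (X : set (R * R)) (x : R * R).
Hypothesis D0 : 0 < cross u v.
Hypothesis hX : hole_free X.
Hypothesis XN : forall y, X y -> `|coord1 u v y| < N%:R /\ `|coord2 u v y| < N%:R.
Hypothesis Qx : cell u v 0 0 x.

Let P i j := x + lattice_shift u v N i j.
Let n := (N + N)%N.

Lemma PS1 i j : P i.+1 j = P i j + u.
Proof. by apply: pair_eq; rewrite /P /lattice_shift -natr1 /= /GRing.scale /=; ring. Qed.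

Lemma PS2 i j : P i j.+1 = P i j + v.
Proof. by apply: pair_eq; rewrite /P /lattice_shift -natr1 /= /GRing.scale /=; ring. Qed.

Lemma P_lt i j : X (P i j) -> (i < n)%N && (j < n)%N.
Proof.
move=> /XN; rewrite /P coord1_shift// coord2_shift//.
rewrite !ltr_norml => -[/andP[_ a] /andP[_ b]].
case: Qx => /andP[a0 _] /andP[b0 _].
by rewrite -!(ltr_nat R) /n natrD; apply/andP; split; lra.
Qed.

(** The parallelogram a, a + u, a + u + v, a + v is seen from the origin, whose coordinates with
    respect to a are (al, be). If the origin lies in the closed parallelogram, no edge is seen
    clockwise and at least one counterclockwise. Otherwise the vertices lie in an open half-plane
    bounded by a line through the origin parallel to u or v, the angles have a common branch there,
    and they cancel. *)
Lemma circ_ang (a : R * R) (al be : R) : a = - al *: u - be *: v ->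
  let c := ang a (a + u) + ang (a + u) (a + u + v) - ang (a + v) (a + v + u)
           - ang a (a + v) in
  0 <= c /\ (0 < c -> (0 <= al <= 1) && (0 <= be <= 1)) /\
  ((0 <= al <= 1) && (0 <= be <= 1) -> 0 < c).
Proof.
move=> aE c.
have Dal : al * cross u v = - cross a v by rewrite aE /cross /= /GRing.scale /=; ring.
have Dbe : be * cross u v = - cross u a by rewrite aE /cross /= /GRing.scale /=; ring.
have cE : c = ang a (a + u) + ang (a + u) (a + u + v) + ang (a + u + v) (a + v) + ang (a + v) a.
  by rewrite /c [ang (a + v) a]ang_sym [ang (a + u + v) _]ang_sym [a + v + u]addrAC.
have k1 : cross a (a + u) = be * cross u v by rewrite Dbe /cross /=; ring.
have k2 : cross (a + u) (a + u + v) = (1 - al) * cross u v.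
  by rewrite mulrBl Dal /cross /=; ring.
have k3 : cross (a + u + v) (a + v) = (1 - be) * cross u v.
  by rewrite mulrBl Dbe /cross /=; ring.
have k4 : cross (a + v) a = al * cross u v by rewrite Dal /cross /=; ring.
have [/andP[/andP[al0 al1] /andP[be0 be1]]|out] := boolP ((0 <= al <= 1) && (0 <= be <= 1)).
  have g1 : 0 <= ang a (a + u) by apply: ang_ge0; rewrite k1 mulr_ge0// ltW.
  have g2 : 0 <= ang (a + u) (a + u + v).
    by apply: ang_ge0; rewrite k2; apply: mulr_ge0; [rewrite subr_ge0|exact: ltW].
  have g3 : 0 <= ang (a + u + v) (a + v).
    by apply: ang_ge0; rewrite k3; apply: mulr_ge0; [rewrite subr_ge0|exact: ltW].
  have g4 : 0 <= ang (a + v) a by apply: ang_ge0; rewrite k4 mulr_ge0// ltW.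
  have cp : 0 < c.
    rewrite cE; have [al_gt0|al_le0] := ltP 0 al.
      have : 0 < ang (a + v) a by apply: ang_gt0; rewrite k4 mulr_gt0.
      lra.
    have : 0 < ang (a + u) (a + u + v) by apply: ang_gt0; rewrite k2 mulr_gt0//; lra.
    lra.
  by split; first exact: ltW.
suff -> : c = 0 by rewrite lexx ltxx.
suff [m [m1 m2 m3 m4]] : exists m, [/\ 0 < dot m a, 0 < dot m (a + u),
    0 < dot m (a + u + v) & 0 < dot m (a + v)].
  by rewrite cE !(@ang_polar _ m)//; ring.
pose m1 : R * R := (v.2, - v.1); pose m2 : R * R := (- u.2, u.1).
have e1 w : dot m1 w = cross w v by rewrite /dot /cross /=; ring.
have e2 w : dot m2 w = cross u w by rewrite /dot /cross /=; ring.
have eN (m w : R * R) : dot (- m) w = - dot m w by rewrite /dot /=; ring.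
have ca : cross a v = - (al * cross u v) by rewrite Dal opprK.
have cb : cross u a = - (be * cross u v) by rewrite Dbe opprK.
have f1 : cross (a + u) v = (1 - al) * cross u v by rewrite mulrBl Dal /cross /=; ring.
have f2 : cross (a + u + v) v = (1 - al) * cross u v by rewrite mulrBl Dal /cross /=; ring.
have f3 : cross (a + v) v = - (al * cross u v) by rewrite Dal /cross /=; ring.
have h1 : cross u (a + u) = - (be * cross u v) by rewrite Dbe /cross /=; ring.
have h2 : cross u (a + u + v) = (1 - be) * cross u v by rewrite mulrBl Dbe /cross /=; ring.
have h3 : cross u (a + v) = (1 - be) * cross u v by rewrite mulrBl Dbe /cross /=; ring.
move: out; rewrite !negb_and -!ltNge => /orP[/orP[al0|al1]|/orP[be0|be1]].
- exists m1; rewrite !e1 ca f1 f2 f3 -!mulNr; split; apply: mulr_gt0 => //; lra.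
- exists (- m1); rewrite !eN !e1 ca f1 f2 f3 -!mulNr; split; apply: mulr_gt0 => //; lra.
- exists m2; rewrite !e2 cb h1 h2 h3 -!mulNr; split; apply: mulr_gt0 => //; lra.
- exists (- m2); rewrite !eN !e2 cb h1 h2 h3 -!mulNr; split; apply: mulr_gt0 => //; lra.
Qed.

(** [grid_euler] for the lattice points in X, with the edges and cells that lie entirely in X, that
    is, whose first vertex lies in the eroded set. A missing cell contains a point outside X, around
    which [hole_free] provides the potential. *)
Lemma lattice_euler : (exists i j, X (P i j)) ->
  lattice_count u v N (erode u X) x + lattice_count u v N (erode v X) x + 1 <=
  lattice_count u v N X x + lattice_count u v N (erode u (erode v X)) x.
Proof.
move=> X0.
pose V i j := P i j \in X; pose Eh i j := P i j \in erode u X.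
pose Ev i j := P i j \in erode v X; pose F i j := P i j \in erode u (erode v X).
have cnt Y : lattice_count u v N Y x = (\sum_(i < n) \sum_(j < n) (P i j \in Y))%:R.
  rewrite natr_sum; apply: eq_bigr => i _; rewrite natr_sum; apply: eq_bigr => j _.
  by rewrite indicE.
have sp (f g : nat -> nat -> nat) : (\sum_(i < n) \sum_(j < n) f i j
    + \sum_(i < n) \sum_(j < n) g i j = \sum_(i < n) \sum_(j < n) (f i j + g i j))%N.
  by rewrite -big_split/=; apply: eq_bigr => i _; rewrite -big_split.
rewrite !cnt -natrD natr1 -natrD ler_nat -addn1.
rewrite (sp (fun i j => nat_of_bool (Eh i j)) (fun i j => nat_of_bool (Ev i j))).
rewrite (sp (fun i j => nat_of_bool (V i j)) (fun i j => nat_of_bool (F i j))).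
apply: (@grid_euler R n V Eh Ev F).
- by move=> i j; rewrite /V in_setE; exact: P_lt.
- move=> i j; rewrite /Eh /V !in_setE => h; apply/andP; split; rewrite in_setE.
    exact: erode_sub h.
  by rewrite PS1; have := h 1; rewrite scale1r; apply; rewrite ler01 lexx.
- move=> i j; rewrite /Ev /V !in_setE => h; apply/andP; split; rewrite in_setE.
    exact: erode_sub h.
  by rewrite PS2; have := h 1; rewrite scale1r; apply; rewrite ler01 lexx.
- move=> i j _ _; rewrite /F notin_setE => /existsNP[s /not_implyP[s01 /existsNP[t /not_implyP[t01 Xp]]]].
  set p := P i j + s *: u + t *: v in Xp.
  have [A AP] := hX Xp.
  exists (i%:R + s), (j%:R + t).
  exists (fun i j => ang (P i j - p) (P i.+1 j - p)).
  exists (fun i j => ang (P i j - p) (P i j.+1 - p)).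
  exists (fun i j => A (P i j)).
  have pE i' j' : p = P i' j' + (i%:R + s - i'%:R) *: u + (j%:R + t - j'%:R) *: v.
    by apply: pair_eq; rewrite /p /P /lattice_shift /= /GRing.scale /=; ring.
  have cP i' j' := circ_ang (a := P i' j' - p) (al := i%:R + s - i'%:R)
     (be := j%:R + t - j'%:R).
  have aE i' j' : P i' j' - p = - (i%:R + s - i'%:R) *: u - (j%:R + t - j'%:R) *: v.
    by rewrite (pE i' j'); apply: pair_eq; rewrite /= /GRing.scale /=; ring.
  have sE i' j' : ang (P i' j' - p) (P i'.+1 j' - p) + ang (P i'.+1 j' - p) (P i'.+1 j'.+1 - p)
      - ang (P i' j'.+1 - p) (P i'.+1 j'.+1 - p) - ang (P i' j' - p) (P i' j'.+1 - p) =
    ang (P i' j' - p) (P i' j' - p + u) + ang (P i' j' - p + u) (P i' j' - p + u + v)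
      - ang (P i' j' - p + v) (P i' j' - p + v + u) - ang (P i' j' - p) (P i' j' - p + v).
    have q1 : P i'.+1 j' - p = P i' j' - p + u by rewrite PS1 addrAC.
    have q2 : P i' j'.+1 - p = P i' j' - p + v by rewrite PS2 addrAC.
    have q3 : P i'.+1 j'.+1 - p = P i' j' - p + u + v by rewrite PS2 PS1 addrAC [_ + u - p]addrAC.
    by rewrite q1 q2 q3 [P i' j' - p + v + u]addrAC.
  split.
  + move=> i' j'; rewrite /Eh in_setE PS1 => h; apply: AP.
    exact: (@erode_seg R _ X _).1 h.
  + move=> i' j'; rewrite /Ev in_setE PS2 => h; apply: AP.
    exact: (@erode_seg R _ X _).1 h.
  + split=> i' j'; rewrite in_setE => h; apply/negP => /andP[/andP[a1 a2] /eqP e].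
      apply: Xp; rewrite -/p (pE i' j') e subrr scale0r addr0; apply: h.
      by move: a1 a2; rewrite -natr1 => a1 a2; apply/andP; split; lra.
    apply: Xp; rewrite -/p (pE i' j') e subrr scale0r addr0; apply: h.
    by move: a1 a2; rewrite -natr1 => a1 a2; apply/andP; split; lra.
  + move=> i' j'; rewrite sE; have [c0 [c1 _]] := cP i' j' (aE i' j'); split => // /c1.
    by move=> /andP[/andP[? ?] /andP[? ?]]; rewrite -!natr1; apply/andP; split; apply/andP; split; lra.
  + rewrite sE; have [_ [_]] := cP i j (aE i j); apply.
    by rewrite !(addrC _%:R) !addrK s01 t01.
- by case: X0 => i [j Xij]; exists i, j; rewrite /V in_setE.
Qed.

End top.

(** [lattice_euler] is integrated over the cell, which has area u x v. A point of the last set is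
    the vertex of a parallelogram spanned by u and v inside X; every translate of the lattice has a
    point in it, so that the constant 1 is gained for all translates. *)
Lemma area_erode_mixed_pos u v X : 0 < cross u v -> open X -> bounded_set X ->
  hole_free X -> erode u (erode v X) !=set0 ->
  area (erode u X) + area (erode v X) + cross u v <=
  area X + area (erode u (erode v X)).
Proof.
move=> D0 oX bX hX [x0 x0P].
have [M M0 MP] := bounded_box bX.
(* By Cramer's rule K bounds both coordinates of the points of X. *)
pose K := (M * `|v.1| + M * `|v.2| + M * `|u.1| + M * `|u.2|) / cross u v.
pose N := (Num.truncn K).+1.
have KN : K < N%:R by exact: truncnS_gt.
have XN y : X y -> `|coord1 u v y| < N%:R /\ `|coord2 u v y| < N%:R.
  move=> /MP[y1 y2]; split; apply: le_lt_trans KN;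
    rewrite /coord1 /coord2 normrM normfV (gtr0_norm D0) ler_pM2r ?invr_gt0//;
    rewrite /cross; apply: le_trans (ler_normB _ _) _; rewrite !normrM.
    have h1 : `|y.1| * `|v.2| <= M * `|v.2| by rewrite ler_wpM2r.
    have h2 : `|y.2| * `|v.1| <= M * `|v.1| by rewrite ler_wpM2r.
    have h3 : 0 <= M * `|u.1| by rewrite mulr_ge0// ltW.
    have h4 : 0 <= M * `|u.2| by rewrite mulr_ge0// ltW.
    lra.
  have h1 : `|u.1| * `|y.2| <= M * `|u.1| by rewrite mulrC ler_wpM2r.
  have h2 : `|u.2| * `|y.1| <= M * `|u.2| by rewrite mulrC ler_wpM2r.
  have h3 : 0 <= M * `|v.1| by rewrite mulr_ge0// ltW.
  have h4 : 0 <= M * `|v.2| by rewrite mulr_ge0// ltW.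
  lra.
have oY w : open (erode w X) by exact: open_erode.
have oZ : open (erode u (erode v X)) by do 2 apply: open_erode.
have mX : measurable X by exact: open_plane_measurable.
have mY w : measurable (erode w X) by exact: open_plane_measurable.
have mZ : measurable (erode u (erode v X)) by exact: open_plane_measurable.
have ZX : erode u (erode v X) `<=` X by move=> y /erode_sub/erode_sub.
have bY w : bounded_set (erode w X) by apply: sub_bounded bX; exact: erode_sub.
have bZ : bounded_set (erode u (erode v X)) by exact: sub_bounded bX.
have meas Y : measurable Y -> Y `<=` X ->
    plane_measure Y = (\int[plane_measure]_(x in cell u v 0 0) (lattice_count u v N Y x)%:E)%E.
  by move=> mY' YX; apply: measure_lattice => // y /YX/XN.
have D' : cross u v != 0 by rewrite gt_eqF.
suff : ((area (erode u X))%:E + (area (erode v X))%:E + (cross u v)%:E <=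
    (area X)%:E + (area (erode u (erode v X)))%:E)%E by rewrite -!EFinD lee_fin.
rewrite -!areaE// (meas (erode u X))//; last exact: erode_sub.
rewrite (meas (erode v X))//; last exact: erode_sub.
rewrite (meas X)// (meas (erode u (erode v X)))//.
have -> : (cross u v)%:E = (\int[plane_measure]_(x in cell u v 0 0) 1)%E.
  rewrite integral_cst ?mul1e; last exact: measurable_cell.
  by rewrite [RHS]plane_measure_cell// gtr0_norm.
have mc Y : measurable Y -> measurable_fun (cell u v 0 0)
    (fun x : R * R => (lattice_count u v N Y x)%:E).
  move=> mY'; apply/measurable_EFinP/measurable_funTS; exact: measurable_lattice_count.
have c0 Y (x : R * R) : (0 <= (lattice_count u v N Y x)%:E)%E.
  by rewrite lee_fin lattice_count_ge0.
have mcell : measurable (cell u v 0 0) by exact: measurable_cell.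
rewrite -!ge0_integralD//; do ?[by apply: mc|by apply: emeasurable_funD; apply: mc|by move=> x _; rewrite adde_ge0].
apply: ge0_le_integral => //; do ?[by move=> x _; rewrite !adde_ge0].
- by apply: emeasurable_funD; [apply: emeasurable_funD; apply: mc|exact: measurable_cst].
- by apply: emeasurable_funD; apply: mc.
move=> x Qx; rewrite -!EFinD lee_fin; apply: lattice_euler => //.
have coordE (y : R * R) : y = coord1 u v y *: u + coord2 u v y *: v.
  by apply: pair_eq; move: D'; rewrite /coord1 /coord2 /cross /= /GRing.scale /= => D'; field.
(* For -1 < y <= 0 the natural number 0 is close enough; hence this lower bound. *)
have ceil (y : R) : -1 < y -> exists i : nat, 0 <= i%:R - y <= 1.
  move=> y1; have [y0|y0] := ltP y 0.
    by exists 0%N; apply/andP; split; lra.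
  exists (Num.truncn y).+1; have /andP[] := truncn_itv y0; rewrite -natr1 => ? ?.
  by apply/andP; split; lra.
have [] := XN _ (ZX _ x0P); rewrite !ltr_norml => /andP[a1 _] /andP[b1 _].
have [/andP[c0' c1] /andP[d0 d1]] := Qx.
have [i iP] : exists i : nat, 0 <= i%:R - (coord1 u v x0 + N%:R - coord1 u v x) <= 1.
  by apply: ceil; lra.
have [j jP] : exists j : nat, 0 <= j%:R - (coord2 u v x0 + N%:R - coord2 u v x) <= 1.
  by apply: ceil; lra.
exists i, j; have := x0P _ iP _ jP; congr X.
rewrite [X in _ = X + _]coordE [X in X + _ + _ = _]coordE.
by apply: pair_eq; rewrite /lattice_shift /= /GRing.scale /=; ring.
Qed.

Lemma area_erode_mixed u v X : open X -> bounded_set X ->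
  hole_free X -> erode u (erode v X) !=set0 ->
  cross u v != 0 ->
  area (erode u X) + area (erode v X) + `|cross u v| <=
  area X + area (erode u (erode v X)).
Proof.
move=> oX bX hX X0; rewrite neq_lt => /orP[D0|D0]; last first.
  by rewrite gtr0_norm//; exact: area_erode_mixed_pos.
have D' : 0 < cross v u by move: D0; rewrite /cross; lra.
rewrite ltr0_norm// erodeC [area (erode u X) + _]addrC.
rewrite (_ : - cross u v = cross v u); last by rewrite /cross; ring.
by apply: area_erode_mixed_pos => //; rewrite erodeC.
Qed.

End mixed_erosion.

(** * Zonotopes and regular polygons *)

Section zonotope.
Context {R : realType}.
Implicit Types (x p : R * R) (X : set (R * R)) (v : nat -> R * R).

Fixpoint erodes v n X := if n is m.+1 then erode (v m) (erodes v m X) else X.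

Definition zonotope v n := [set p | exists s : nat -> R,
  (forall j, 0 <= s j <= 1) /\ p = \sum_(j < n) s j *: v j].

Lemma erodesP v n X x : erodes v n X x <-> forall p, zonotope v n p -> X (x + p).
Proof.
elim: n x => [|n IH] x /=; split.
- by move=> Xx p [s [_ ->]]; rewrite big_ord0 addr0.
- by move/(_ 0); rewrite addr0; apply; exists (fun=> 0); split; [move=> _; rewrite lexx ler01|rewrite big_ord0].
- move=> h p [s [s01 ->]]; rewrite big_ord_recr/= [X in x + X]addrC addrA.
  by apply: (IH _).1; [exact: h|exists s].
- move=> h t t01; apply/IH => p [s [s01 ->]]; rewrite -addrA; apply: h.
  exists (fun j => if (j < n)%N then s j else t); split => [j|].
    by case: ifP.
  rewrite big_ord_recr/= ltnn addrC; congr (_ + _).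
  by apply: eq_bigr => i _; rewrite ltn_ord.
Qed.

Lemma erodes_props v n X : open X -> bounded_set X -> hole_free X ->
  [/\ open (erodes v n X), bounded_set (erodes v n X), hole_free (erodes v n X) &
      erodes v n X `<=` X].
Proof.
move=> oX bX hX; elim: n => [|n [oE bE hE sE]] /=; first by split.
split; [exact: open_erode|apply: sub_bounded bE; exact: erode_sub|exact: erode_hole_free|].
by move=> x /erode_sub/sE.
Qed.

Lemma erodes_erodeC v n u X : erodes v n (erode u X) = erode u (erodes v n X).
Proof. by elim: n => //= n ->; rewrite erodeC. Qed.

Lemma erodesC v n w m X : erodes v n (erodes w m X) = erodes w m (erodes v n X).
Proof. by elim: m => //= m <-; rewrite erodes_erodeC. Qed.

(** Each further erosion by v_j lowers the area lost to u by at least |u x v_j|: this is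
    [area_erode_mixed], or [area_erode2] if v_j = u, where the cross product is 0. *)
Lemma drop_erodes u v n X : open X -> bounded_set X -> hole_free X ->
  (forall j, (j < n)%N -> v j = u \/ cross u (v j) != 0) ->
  erode u (erodes v n X) !=set0 ->
  \sum_(j < n) `|cross u (v j)| <=
  (area X - area (erode u X)) - (area (erodes v n X) - area (erode u (erodes v n X))).
Proof.
move=> oX bX hX; elim: n => [|n IH] /= uv ne; first by rewrite big_ord0 subrr.
rewrite big_ord_recr/=.
have {}IH : \sum_(j < n) `|cross u (v j)| <=
    (area X - area (erode u X)) - (area (erodes v n X) - area (erode u (erodes v n X))).
  apply: IH; first by move=> j jn; apply: uv; rewrite ltnS ltnW.
  by case: ne => x; rewrite erodeC => /erode_sub; exists x.
have [oE bE hE sE] := erodes_props v n oX bX hX.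
have : `|cross u (v n)| <= (area (erodes v n X) - area (erode u (erodes v n X))) -
  (area (erode (v n) (erodes v n X)) - area (erode u (erode (v n) (erodes v n X)))).
  have [<-|c0] := uv n (ltnSn n).
    have := area_erode2 (v n) oE bE.
    rewrite (_ : cross _ _ = 0) ?normr0; last by rewrite /cross; ring.
    by clear; lra_area.
  by move: (area_erode_mixed oE bE hE ne c0); clear; lra_area.
by move: IH; clear; lra_area.
Qed.

(** [drop_erodes] is applied to each v_m in turn. The sum over all ordered pairs is twice the area
    of the zonotope. *)
Lemma area_erodes_convex v n X : open X -> bounded_set X -> hole_free X ->
  (forall i j, (i < n)%N -> (j < n)%N -> v j = v i \/ cross (v i) (v j) != 0) ->
  erodes v n (erodes v n X) !=set0 ->
  \sum_(i < n) \sum_(j < n) `|cross (v i) (v j)| <=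
  area X - 2 * area (erodes v n X) + area (erodes v n (erodes v n X)).
Proof.
move=> oX bX hX vv ne.
suff H m : (m <= n)%N -> \sum_(i < m) \sum_(j < n) `|cross (v i) (v j)| <=
    (area X - area (erodes v m X)) -
    (area (erodes v n X) - area (erodes v m (erodes v n X))).
  by have := H _ (leqnn n); lra_area.
elim: m => [|m IH] mn; first by rewrite big_ord0 /= !subrr.
rewrite big_ord_recr/=.
have [oE bE hE sE] := erodes_props v m oX bX hX.
have := @drop_erodes (v m) v n (erodes v m X) oE bE hE.
rewrite (erodesC v n v m) => D.
have : \sum_(j < n) `|cross (v m) (v j)| <= (area (erodes v m X) - area (erode (v m) (erodes v m X)))
  - (area (erodes v m (erodes v n X)) - area (erode (v m) (erodes v m (erodes v n X)))).
  apply: D; first by move=> j jn; exact: vv.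
  case: ne => x xP; exists x.
  have : erodes v m.+1 (erodes v n X) x; last by [].
  apply/erodesP => p [t [t01 ->]]; move/erodesP: xP; apply.
  exists (fun j => if (j < m.+1)%N then t j else 0); split => [j|].
    by case: ifP => // _; rewrite lexx ler01.
  rewrite (big_ord_widen n (fun j => t j *: v j) mn) big_mkcond/=.
  by apply: eq_bigr => i _; case: ifP => // _; rewrite scale0r.
by move: (IH (ltnW mn)); clear; lra_area.
Qed.

Lemma zonotope_convex v n p q t : 0 <= t <= 1 -> zonotope v n p -> zonotope v n q ->
  zonotope v n ((1 - t) *: p + t *: q).
Proof.
move=> /andP[t0 t1] [s [s01 ->]] [s' [s01' ->]].
exists (fun j => (1 - t) * s j + t * s' j); split => [j|].
  have /andP[a b] := s01 j; have /andP[c d] := s01' j.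
  have e1 : 0 <= (1 - t) * s j by rewrite mulr_ge0// subr_ge0.
  have e2 : 0 <= t * s' j by rewrite mulr_ge0.
  have e3 : (1 - t) * s j <= (1 - t) by rewrite ler_piMr// subr_ge0.
  have e4 : t * s' j <= t by rewrite ler_piMr.
  by apply/andP; split; lra.
rewrite !scaler_sumr -big_split/=; apply: eq_bigr => j _.
by apply: pair_eq; rewrite /= /GRing.scale /=; ring.
Qed.

Lemma zonotope_sym v n p : zonotope v n p -> zonotope v n (\sum_(j < n) v j - p).
Proof.
move=> [s [s01 ->]]; exists (fun j => 1 - s j); split => [j|].
  by have /andP[a b] := s01 j; apply/andP; split; lra.
by rewrite -sumrB; apply: eq_bigr => j _; rewrite scalerBl scale1r.
Qed.

End zonotope.

Section regular_polygon.
Context {R : realType}.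
Variables (n : nat) (h : R).
Hypothesis n3 : (2 < n)%N.
Hypothesis h0 : 0 < h.

Let th : R := pi / n%:R.
(** The vertices cover a half turn. The zonotope of the n sides is a regular 2n-gon of circumradius
    h, placed with its vertex [h *: vertex 0] at the origin; hence the translations by this vector
    in what follows. *)
Definition vertex (k : nat) : R * R := (cos (k%:R * th), sin (k%:R * th)).
Definition side (k : nat) : R * R := h *: (vertex k.+1 - vertex k).

Let n0 : 0 < n%:R :> R. Proof. by rewrite ltr0n; apply: leq_trans n3. Qed.
Let th0 : 0 < th. Proof. by rewrite divr_gt0// pi_gt0. Qed.
Let thn : n%:R * th = pi. Proof. by rewrite /th mulrCA divff ?mulr1// gt_eqF. Qed.
Let th2 : th < pi / 2.
Proof.
rewrite /th ltr_pM2l ?pi_gt0// ltf_pV2 ?posrE//.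
by rewrite (ltr_nat R 2 n).
Qed.

Lemma vertexn : vertex n = - vertex 0.
Proof. by rewrite /vertex thn mul0r cos0 sin0 cospi sinpi; apply: pair_eq; rewrite /= ?oppr0. Qed.

Lemma sum_side k : \sum_(j < k) side j = h *: (vertex k - vertex 0).
Proof.
rewrite -(big_mkord xpredT side) /side -scaler_sumr; congr (_ *: _).
exact: telescope_sumr.
Qed.

Lemma zonotope_vertex k : (k <= n)%N -> zonotope side n (h *: (vertex k - vertex 0)).
Proof.
move=> kn; exists (fun j => (j < k)%N%:R); split => [j|].
  by case: (_ < _)%N; rewrite ?lexx ler01.
rewrite -sum_side (big_ord_widen n side kn) big_mkcond/=.
by apply: eq_bigr => j _; case: (_ < _)%N; rewrite (scale1r, scale0r).
Qed.

Lemma zonotope_center : zonotope side n (- h *: vertex 0).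
Proof.
exists (fun=> 1 / 2); split => [j|]; first by apply/andP; split; lra.
rewrite -scaler_sumr sum_side vertexn.
by apply: pair_eq; rewrite /= /GRing.scale /=; field.
Qed.

Lemma cross_side i j : cross (side i) (side j) =
  h ^+ 2 * (2 * (1 - cos th) * sin (j%:R * th - i%:R * th)).
Proof.
have e (a b : R) : cos a * sin b - sin a * cos b = sin (b - a) by rewrite sinB; ring.
have -> : cross (side i) (side j) = h ^+ 2 *
   (sin (j.+1%:R * th - i.+1%:R * th) - sin (j.+1%:R * th - i%:R * th)
   - sin (j%:R * th - i.+1%:R * th) + sin (j%:R * th - i%:R * th)).
  by rewrite -!e /cross /side /vertex /= /GRing.scale /=; ring.
have -> : j.+1%:R * th - i.+1%:R * th = j%:R * th - i%:R * th by rewrite -!natr1; ring.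
have -> : j.+1%:R * th - i%:R * th = (j%:R * th - i%:R * th) + th by rewrite -!natr1; ring.
have -> : j%:R * th - i.+1%:R * th = (j%:R * th - i%:R * th) - th by rewrite -!natr1; ring.
by move: (j%:R * th - i%:R * th) => d; rewrite sinD sinB; ring.
Qed.

Lemma cos_th_lt1 : cos th < 1.
Proof.
rewrite -cos0 ltr_cos ?in_itv/= ?lexx ?pi_ge0 ?ltW//=.
by apply: (lt_trans th2); have := pi_gt0 R; lra.
Qed.

Lemma cos_th_gt0 : 0 < cos th.
Proof. by rewrite cos_gt0_pihalf// th2 andbT (lt_trans _ th0)// oppr_lt0 divr_gt0// pi_gt0. Qed.

Lemma cross_side_gt0 i j : (i < j < n)%N -> 0 < cross (side i) (side j).
Proof.
move=> /andP[ij jn]; rewrite cross_side mulr_gt0 ?exprn_gt0//.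
rewrite mulr_gt0//; first by have := cos_th_lt1; lra.
rewrite -mulrBl -natrB; last exact: ltnW.
apply: sin_gt0_pi; rewrite mulr_gt0 ?ltr0n ?subn_gt0//= -thn ltr_pM2r// ltr_nat.
by apply: leq_ltn_trans jn; exact: leq_subr.
Qed.

Lemma side_noncollinear i j : (i < n)%N -> (j < n)%N ->
  side j = side i \/ cross (side i) (side j) != 0.
Proof.
move=> iN jN; case: (ltngtP i j) => [ij|ji|->]; last by left.
  by right; rewrite gt_eqF// cross_side_gt0// ij.
right; rewrite (_ : cross _ _ = - cross (side j) (side i)); last by rewrite /cross; ring.
by rewrite oppr_eq0 gt_eqF// cross_side_gt0// ji.
Qed.

(** n h^2 sin (pi / n) is the area of the 2n-gon. The sides i < j add up to the chord from vertex 0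
    to vertex j, whose cross product with side j is twice the area of a triangle; these triangles
    fill half of the polygon. *)
Lemma sum_cross_side : 2 * (h ^+ 2 * (n%:R * sin th)) <=
  \sum_(i < n) \sum_(j < n) `|cross (side i) (side j)|.
Proof.
have H (m : nat) : 2 * (\sum_(j < m) \sum_(i < j) cross (side i) (side j)) <=
    \sum_(i < m) \sum_(j < m) `|cross (side i) (side j)|.
  elim: m => [|m IH]; first by rewrite !big_ord0 mulr0.
  rewrite big_ord_recr/= [leRHS]big_ord_recr/=.
  under [X in _ <= X + _]eq_bigr do rewrite big_ord_recr/=.
  have -> : \sum_(i < m) (\sum_(i0 < m) `|cross (side i) (side i0)| + `|cross (side i) (side m)|) =
      \sum_(i < m) \sum_(i0 < m) `|cross (side i) (side i0)| + \sum_(i < m) `|cross (side i) (side m)|.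
    by rewrite big_split.
  rewrite [X in _ <= _ + X]big_ord_recr/=.
  have e1 : \sum_(i < m) cross (side i) (side m) <= \sum_(i < m) `|cross (side i) (side m)|.
    by apply: ler_sum => i _; exact: ler_norm.
  have e2 : \sum_(i < m) cross (side i) (side m) <= \sum_(i < m) `|cross (side m) (side i)|.
    apply: ler_sum => i _; rewrite (_ : cross (side m) _ = - cross (side i) (side m)).
      by rewrite normrN ler_norm.
    by rewrite /cross; ring.
  have e3 := normr_ge0 (cross (side m) (side m)).
  by rewrite mulrDr; lra.
apply: le_trans (H n).
rewrite ler_pM2l//.
have -> : \sum_(j < n) \sum_(i < j) cross (side i) (side j) =
   \sum_(j < n) (h ^+ 2 * (sin th - cross (vertex 0) (vertex j.+1 - vertex j))).
  apply: eq_bigr => j _.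
  transitivity (cross (\sum_(i < j) side i) (side j)).
    rewrite /cross (raddf_sum fst) (raddf_sum snd) /= !mulr_suml -sumrB.
    by apply: eq_bigr.
  rewrite sum_side.
  have -> : sin th = cross (vertex j) (vertex j.+1).
    rewrite /cross /= (_ : _ - _ = sin (j.+1%:R * th - j%:R * th)) ?sinB; last by ring.
    by rewrite -sinB -natr1; congr sin; ring.
  by rewrite /cross /side /= /GRing.scale /=; ring.
rewrite -mulr_sumr sumrB sumr_const card_ord.
have -> : \sum_(i < n) cross (vertex 0) (vertex i.+1 - vertex i) = 0.
  transitivity (cross (vertex 0) (\sum_(0 <= i < n) (vertex i.+1 - vertex i))).
    rewrite /cross (raddf_sum fst) (raddf_sum snd) /= !mulr_sumr -sumrB big_mkord.
    by apply: eq_bigr.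
  by rewrite telescope_sumr// vertexn /cross /=; ring.
by rewrite subr0 -(mulr_natl (sin th)).
Qed.

(** Variation function on [0, pi] of x -> cos (x - ph), which increases up to ph and decreases
    afterwards. *)
Definition cos_variation_fun (ph x : R) : R :=
  if x <= ph then cos (ph - x) else 2 - cos (x - ph).

Lemma cos_variation (ph a b : R) : 0 <= ph <= pi -> 0 <= a -> a <= b -> b <= pi ->
  `|cos (b - ph) - cos (a - ph)| <= cos_variation_fun ph b - cos_variation_fun ph a.
Proof.
move=> /andP[p0 p1] a0 ab b1.
have cN x y : cos (x - y) = cos (y - x) :> R by rewrite -cosN opprB.
have mono x y : 0 <= x -> x <= y -> y <= pi -> cos y <= cos x :> R.
  move=> x0 xy y1; rewrite leNgt ltr_cos ?in_itv/= ?x0 ?y1 ?(le_trans x0 xy) ?(le_trans xy y1)//.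
  by rewrite -leNgt.
rewrite /cos_variation_fun; case: (leP b ph) => bp.
  rewrite (le_trans ab bp) (cN b) (cN a) ger0_norm// subr_ge0.
  by apply: mono; lra.
case: (leP a ph) => ap.
  have := cos_le1 (b - ph); have := cos_le1 (a - ph); rewrite (cN ph a) => h1 h2.
  by rewrite ler_norml; apply/andP; split; lra.
rewrite ler0_norm ?subr_le0; last by apply: mono; lra.
by lra.
Qed.

Lemma polar_form (e : R * R) : dot e e = 1 -> 0 <= e.2 ->
  exists2 ph, 0 <= ph <= pi & e = (cos ph, sin ph).
Proof.
move=> e1 e2; have e11 : -1 <= e.1 <= 1.
  by rewrite -ler_norml -[leRHS]sqrtr1 -e1; exact: norm1_le_enorm.
exists (acos e.1); first by rewrite acos_ge0// acos_lepi.
apply: pair_eq => /=; first by rewrite acosK.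
rewrite sin_acos// -e1 /dot -expr2 addrAC subrr add0r -expr2 sqrtr_sqr.
by rewrite ger0_norm.
Qed.

(** Measured from the centre, the point is a combination of the sides with coefficients in
    [-1/2, 1/2]. Its component along its own direction is at most half the variation of h cos (x -
    ph) over a half turn, and this variation is 2 h for every ph. *)
Lemma zonotope_enorm p : zonotope side n p -> enorm (h *: vertex 0 + p) <= h.
Proof.
move=> [s [s01 pE]]; set w := _ + p.
have [w0|w0] := eqVneq (enorm w) 0; first by rewrite w0 ltW.
have {}w0 : 0 < enorm w by rewrite lt_neqAle eq_sym w0 enorm_ge0.
have wE : w = \sum_(j < n) (s j - 1 / 2) *: side j.
  rewrite /w pE; have := sum_side n; rewrite vertexn => S.
  under [RHS]eq_bigr do rewrite scalerBl.
  rewrite sumrB -scaler_sumr S addrC; congr (_ + _).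
  by apply: pair_eq; rewrite /= /GRing.scale /=; field.
pose e := (enorm w)^-1 *: w.
have ew : dot e w = enorm w.
  rewrite (_ : dot e w = (enorm w)^-1 * dot w w); last by rewrite /dot /= /GRing.scale /=; ring.
  by rewrite -sqr_enorm expr2 mulKf// gt_eqF.
have ee : dot e e = 1.
  rewrite -sqr_enorm enormZ gtr0_norm ?invr_gt0// mulVf ?expr1n// gt_eqF//.
have [ph ph01 phE] : exists2 ph, 0 <= ph <= pi & (e = (cos ph, sin ph) \/ - e = (cos ph, sin ph)).
  have [e2|e2] := leP 0 e.2.
    by have [ph ? ?] := polar_form ee e2; exists ph => //; left.
  have [||ph ? ?] := @polar_form (- e); last by exists ph => //; right.
    by rewrite /dot /= !mulrNN.
  by rewrite /= oppr_ge0 ltW.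
rewrite -ew wE.
have -> : dot e (\sum_(j < n) (s j - 1 / 2) *: side j) = \sum_(j < n) (s j - 1 / 2) * dot e (side j).
  rewrite /dot (raddf_sum fst) (raddf_sum snd) /= !mulr_sumr -big_split/=.
  by apply: eq_bigr => j _; rewrite /GRing.scale /=; ring.
apply: (@le_trans _ _ (\sum_(j < n) 1 / 2 * (h * `|cos (j.+1%:R * th - ph) - cos (j%:R * th - ph)|))).
  apply: ler_sum => j _.
  have -> : h * `|cos (j.+1%:R * th - ph) - cos (j%:R * th - ph)| = `|dot e (side j)|.
    rewrite -[h in LHS](gtr0_norm h0) -normrM; case: phE => phE.
      congr `|_|; rewrite phE !cosB /dot /side /vertex /= /GRing.scale /=; ring.
    rewrite -[in RHS](opprK e) phE -[RHS]normrN; congr `|_|.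
    by rewrite !cosB /dot /side /vertex /= /GRing.scale /=; ring.
  apply: (le_trans (ler_norm _)); rewrite normrM ler_wpM2r// ler_norml.
  by have /andP[? ?] := s01 j; apply/andP; split; lra.
pose W := cos_variation_fun ph.
apply: (@le_trans _ _ (\sum_(0 <= j < n) 1 / 2 * (h * (W (j.+1%:R * th) - W (j%:R * th))))).
  rewrite big_mkord; apply: ler_sum => j _; rewrite ler_pM2l// ler_pM2l//.
  apply: cos_variation => //.
  - by rewrite mulr_ge0// ltW.
  - by rewrite ler_pM2r// ler_nat.
  - by rewrite -thn ler_pM2r// ler_nat.
rewrite -!mulr_sumr telescope_sumr// thn mul0r.
have -> : W pi - W 0 = 2.
  have /andP[ph0 ph1] := ph01.
  rewrite /W /cos_variation_fun ph0 subr0; case: (leP pi ph) => ppi.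
    rewrite (_ : ph = pi) ?subrr ?cos0 ?cospi; first by lra.
    by apply/eqP; rewrite eq_le ph1 ppi.
  by rewrite cosB cospi sinpi; lra.
by lra.
Qed.

(** A point of the upper half-plane lies in the sector between two successive vertices and is h
    times a combination of them with coefficients al, be >= 0, by the sine rule; al + be <= 1
    because the angles A and B have cosines at least cos th. The radius is slightly smaller than
    that of the inscribed circle, h cos (th / 2). *)
Lemma ball_zonotope q : enorm q <= h * cos th ->
  zonotope side n (q - h *: vertex 0).
Proof.
wlog q2 : q / 0 <= q.2.
  move=> wl qh; have [q2|q2] := leP 0 q.2; first exact: wl.
  have := wl (- q); rewrite enormN /= oppr_ge0 (ltW q2) => /(_ isT qh).
  move/zonotope_sym; rewrite sum_side vertexn; congr (zonotope _ _ _).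
  by apply: pair_eq; rewrite /= /GRing.scale /=; ring.
move=> qh; have [q0|q0] := eqVneq (enorm q) 0.
  move/eqP: q0; rewrite enorm_eq0 => /eqP ->; rewrite sub0r -scaleNr.
  exact: zonotope_center.
have {}q0 : 0 < enorm q by rewrite lt_neqAle eq_sym q0 enorm_ge0.
pose r := enorm q; pose e := r^-1 *: q.
have qe : q = r *: e by rewrite /e scalerA divff ?scale1r// gt_eqF.
have ee : dot e e = 1.
  by rewrite -sqr_enorm enormZ gtr0_norm ?invr_gt0// mulVf ?expr1n// gt_eqF.
have e2 : 0 <= e.2 by rewrite /e /= mulr_ge0// invr_ge0 ltW.
have [ph /andP[p0 p1] eE] := polar_form ee e2.
have [k kn /andP[k1 k2]] : exists2 k, (k < n)%N & k%:R * th <= ph <= k.+1%:R * th.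
  have [->|pn] := eqVneq ph pi.
    exists n.-1; first by rewrite prednK// (leq_trans _ n3).
    rewrite prednK ?(leq_trans _ n3)// thn lexx andbT -[leRHS]thn ler_pM2r// ler_nat.
    exact: leq_pred.
  have pth : 0 <= ph / th by rewrite divr_ge0// ltW.
  have /andP[t1 t2] := truncn_itv pth.
  exists (Num.truncn (ph / th)).
    rewrite -(ltr_nat R); apply: le_lt_trans t1 _.
    by rewrite ltr_pdivrMr// thn lt_neqAle pn.
  by move: t1 t2; rewrite ler_pdivlMr// ltr_pdivrMr// => -> /ltW ->.
pose A := k.+1%:R * th - ph; pose B := ph - k%:R * th.
have AB : A + B = th by rewrite /A /B -natr1; ring.
have A0 : 0 <= A by rewrite subr_ge0.
have B0 : 0 <= B by rewrite subr_ge0.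
have thpi : th <= pi by apply: ltW; apply: (lt_trans th2); have := pi_gt0 R; lra.
have sth : 0 < sin th by rewrite sin_gt0_pi// th0 (lt_trans th2)//; have := pi_gt0 R; lra.
have sA : 0 <= sin A by rewrite sin_ge0_pi// A0/=; lra.
have sB : 0 <= sin B by rewrite sin_ge0_pi// B0/=; lra.
have mono x y : 0 <= x -> x <= y -> y <= pi -> cos y <= cos x :> R.
  move=> x0 xy y1; rewrite leNgt ltr_cos ?in_itv/= ?x0 ?y1 ?(le_trans x0 xy) ?(le_trans xy y1)//.
  by rewrite -leNgt.
have cA : cos th <= cos A by apply: mono => //; lra.
have cB : cos th <= cos B by apply: mono => //; lra.
have sAB : (sin A + sin B) * cos th <= sin th.
  have -> : sin th = sin A * cos B + cos A * sin B by rewrite -sinD AB.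
  rewrite mulrDl [cos A * _]mulrC; apply: lerD; exact: ler_wpM2l.
pose al := r * sin A / (h * sin th); pose be := r * sin B / (h * sin th).
have hs : 0 < h * sin th by rewrite mulr_gt0.
have al0 : 0 <= al by rewrite divr_ge0 ?mulr_ge0// ltW.
have be0 : 0 <= be by rewrite divr_ge0 ?mulr_ge0// ltW.
have albe : al + be <= 1.
  rewrite /al /be -mulrDl -mulrDr ler_pdivrMr// mul1r.
  apply: le_trans (_ : h * cos th * (sin A + sin B) <= _).
    by rewrite ler_wpM2r// addr_ge0.
  by rewrite -mulrA ler_pM2l// mulrC.
have qE : q = h *: (al *: vertex k + be *: vertex k.+1).
  have s1 : cos ph * sin th = sin A * cos (k%:R * th) + sin B * cos (k.+1%:R * th).
    rewrite /A /B !sinB (_ : th = k.+1%:R * th - k%:R * th); last by rewrite -natr1; ring.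
    rewrite (_ : k.+1%:R * (k.+1%:R * th - k%:R * th) = k.+1%:R * th); last by rewrite -natr1; ring.
    rewrite (_ : k%:R * (k.+1%:R * th - k%:R * th) = k%:R * th); last by rewrite -natr1; ring.
    by rewrite sinB; ring.
  have s2 : sin ph * sin th = sin A * sin (k%:R * th) + sin B * sin (k.+1%:R * th).
    rewrite /A /B !sinB (_ : th = k.+1%:R * th - k%:R * th); last by rewrite -natr1; ring.
    rewrite (_ : k.+1%:R * (k.+1%:R * th - k%:R * th) = k.+1%:R * th); last by rewrite -natr1; ring.
    rewrite (_ : k%:R * (k.+1%:R * th - k%:R * th) = k%:R * th); last by rewrite -natr1; ring.
    by rewrite sinB; ring.
  rewrite qe eE; apply: pair_eq; rewrite /= /GRing.scale /= /al /be.
    have -> : r * cos ph = r * (cos ph * sin th) / sin th by field; rewrite gt_eqF.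
    rewrite s1; field.
    by rewrite !gt_eqF.
  have -> : r * sin ph = r * (sin ph * sin th) / sin th by field; rewrite gt_eqF.
    rewrite s2; field.
  by rewrite !gt_eqF.
have [z1 z2] := (zonotope_vertex (ltnW kn), zonotope_vertex kn).
have [g0|g0] := eqVneq (al + be) 0.
  have [a0 b0] : al = 0 /\ be = 0 by split; lra.
  by rewrite qE a0 b0 !scale0r addr0 scaler0 sub0r -scaleNr; exact: zonotope_center.
have {}g0 : 0 < al + be by rewrite lt_neqAle eq_sym g0 addr_ge0.
have t01 : 0 <= be / (al + be) <= 1.
  by rewrite divr_ge0 ?addr_ge0//= ler_pdivrMr// mul1r lerDr.
have ab01 : 0 <= al + be <= 1 by rewrite addr_ge0.
have := zonotope_convex ab01 zonotope_center (zonotope_convex t01 z1 z2).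
congr (zonotope _ _ _); rewrite qE.
by apply: pair_eq; rewrite /= /GRing.scale /=; field; rewrite gt_eqF.
Qed.

End regular_polygon.

(** * Inner parallel sets *)

Section boundary_distance.
Context {R : realType}.
Implicit Types (x y : R * R) (X : set (R * R)).

Lemma edist_sym x y : edist x y = edist y x.
Proof. by rewrite !enorm_dist -enormN opprB. Qed.

Lemma edist_ge0 x y : 0 <= edist x y.
Proof. by rewrite enorm_dist enorm_ge0. Qed.

Lemma edistxx x : edist x x = 0.
Proof. by rewrite enorm_dist subrr; apply/eqP; rewrite enorm_eq0. Qed.

Lemma edist_triangle x y z : edist x z <= edist x y + edist y z.
Proof.
rewrite !enorm_dist (_ : x - z = (x - y) + (y - z)) ?enormD//.
by rewrite addrA subrK.
Qed.

Lemma continuous_lipschitz (f : R * R -> R) (K : R) :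
  (forall x y, `|f x - f y| <= K * edist x y) -> continuous f.
Proof.
move=> fK x; apply/cvgrPdist_lt => e e0.
have K1 : 0 < `|K| + 1 by rewrite ltr_wpDl.
have d0 : 0 < e / (`|K| + 1) / 2 by rewrite !divr_gt0.
apply: filterS (nbhsx_ballx x _ d0) => y [y1 y2]; apply: (le_lt_trans (fK x y)).
apply: (@le_lt_trans _ _ ((`|K| + 1) * edist x y)).
  by rewrite ler_wpM2r ?edist_ge0//; have := ler_norm K; lra.
rewrite mulrC -ltr_pdivlMr// enorm_dist.
apply: (le_lt_trans (enorm_le_norm _)).
by move: y1 y2; rewrite /ball /= => y1 y2; rewrite [ltRHS]splitr; apply: ltrD.
Qed.

(** Distance to the complement rather than to the boundary: for bounded open X they agree inside X,
    and this one is 0 outside and 1-Lipschitz on the whole plane. *)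
Definition bdist X x : R := inf [set edist x y | y in ~` X].

Lemma bdist_le X x y : ~ X y -> bdist X x <= edist x y.
Proof.
move=> Xy; apply: ge_inf; last by exists y.
by exists 0 => _ [z _ <-]; exact: edist_ge0.
Qed.

Lemma bdist_ge X x (t : R) : ~` X !=set0 -> (forall y, ~ X y -> t <= edist x y) ->
  t <= bdist X x.
Proof.
move=> [y Xy] h; apply: lb_le_inf; first by exists (edist x y), y.
by move=> _ [z Xz <-]; exact: h.
Qed.

Lemma setC_bounded X : bounded_set X -> ~` X !=set0.
Proof.
move=> /bounded_box[M M0 MP]; exists (M + 1, 0) => /MP[/= + _].
by rewrite gtr0_norm ?addr_gt0// => ?; lra.
Qed.

Lemma bdist_ge0 X x : bounded_set X -> 0 <= bdist X x.
Proof. by move=> bX; apply: bdist_ge; [exact: setC_bounded|move=> y _; exact: edist_ge0]. Qed.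

Lemma bdist_lip_nonempty X x y : ~` X !=set0 -> `|bdist X x - bdist X y| <= edist x y.
Proof.
move=> X0; suff H a b : bdist X a - edist a b <= bdist X b.
  have h1 := H x y; have h2 := H y x; rewrite [edist y x]edist_sym in h2.
  by rewrite ler_norml; apply/andP; split; lra.
apply: bdist_ge => // z /(@bdist_le X a z) h; have := edist_triangle a b z; lra.
Qed.

Lemma bdist_lip X x y : bounded_set X -> `|bdist X x - bdist X y| <= edist x y.
Proof. by move=> bX; apply: bdist_lip_nonempty; exact: setC_bounded. Qed.

Lemma continuous_bdist X : bounded_set X -> continuous (bdist X).
Proof.
by move=> bX; apply: (@continuous_lipschitz _ 1) => x y; rewrite mul1r; exact: bdist_lip.
Qed.

Lemma bdist_gt X x (t : R) : t < bdist X x -> forall y, edist x y <= t -> X y.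
Proof. by move=> tx y yt; apply: contrapT => /(@bdist_le X x); rewrite leNgt (le_lt_trans yt). Qed.

Lemma bdist_out X x : bounded_set X -> ~ X x -> bdist X x = 0.
Proof.
move=> bX /(@bdist_le X x x); rewrite edistxx => h.
by apply/eqP; rewrite eq_le h bdist_ge0.
Qed.

Lemma bdist_in X x : open X -> bounded_set X -> X x -> 0 < bdist X x.
Proof.
move=> oX bX; move: oX; rewrite openE => /[apply]; rewrite /interior => /nbhs_ballP[r /= r0 rX].
apply: (lt_le_trans r0); apply: bdist_ge; first exact: setC_bounded.
move=> y Xy; rewrite leNgt; apply/negP => h; apply: Xy; apply: rX.
split; rewrite /ball /=; apply: le_lt_trans h; rewrite enorm_dist.
  exact: (norm1_le_enorm (x - y)).
exact: (norm2_le_enorm (x - y)).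
Qed.

Definition inner X (t : R) := [set x | t < bdist X x].

Lemma open_inner X t : bounded_set X -> open (inner X t).
Proof.
move=> bX; rewrite (_ : inner X t = bdist X @^-1` [set r | t < r]).
  by apply: open_comp; [move=> x _; exact: continuous_bdist|exact: open_gt].
by [].
Qed.

Lemma inner_sub X t : bounded_set X -> 0 <= t -> inner X t `<=` X.
Proof. by move=> bX t0 x /(bdist_gt); apply; rewrite edistxx. Qed.

Lemma inner0 X : open X -> bounded_set X -> inner X 0 = X.
Proof.
move=> oX bX; apply/seteqP; split; first exact: inner_sub.
by move=> x; exact: bdist_in.
Qed.

Lemma measurable_inner X t : bounded_set X -> measurable (inner X t).
Proof. by move=> bX; apply: open_plane_measurable; exact: open_inner. Qed.

End boundary_distance.

Section sine.
Context {R : realType}.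

(** Used with x = pi / n: the area of the 2n-gon of circumradius h is at least pi h^2 cos (pi /
    n). *)
Lemma sin_ge_mulcos (x : R) : 0 <= x <= pi -> x * cos x <= sin x.
Proof.
move=> /andP[]; rewrite le_eqVlt => /orP[/eqP <-|x0 xpi].
  by rewrite mul0r sin0.
have df (y : R) : is_derive y 1 (fun y => sin y - y * cos y) (y * sin y).
  have := @is_deriveB _ _ _ _ _ y 1 _ _ (is_derive_sin y)
    (@is_deriveM _ _ _ _ y 1 _ _ (@is_derive_id _ _ y 1) (is_derive_cos y)).
  by move=> h; apply: is_derive_eq; rewrite /GRing.scale /=; ring.
have cf : {within `[0, x], continuous (fun y : R => sin y - y * cos y)}.
  apply: continuous_subspaceT => y; apply: differentiable_continuous.
  by apply/derivable1_diffP; case: (df y).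
have [c] := MVT x0 (fun y _ => df y) cf.
rewrite in_itv /= => /andP[c0 cx]; rewrite sin0 mul0r !subr0 => E.
rewrite -subr_ge0 E !mulr_ge0 ?(ltW c0) ?(ltW x0)// sin_ge0_pi// (ltW c0)/=.
by apply: le_trans xpi; exact: ltW.
Qed.

End sine.

Section inner_parallel.
Context {R : realType}.
Implicit Types (x y : R * R) (X : set (R * R)).

Section step.
Variables (X : set (R * R)) (n : nat) (h : R).
Hypotheses (oX : open X) (bX : bounded_set X) (hX : hole_free X).
Hypotheses (n3 : (2 < n)%N) (h0 : 0 < h).

Let c : R := cos (pi / n%:R).
Let E k := iter k (erodes (side n h) n) X.
Let z0 : R * R := h *: vertex n 0.

Lemma iter_erodes k : [/\ open (E k), bounded_set (E k), hole_free (E k) & E k `<=` X].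
Proof.
rewrite /E; elim: k => [|k [? ? ? s]] /=; first by split.
have [? ? ? s'] : [/\ open (erodes (side n h) n (iter k (erodes (side n h) n) X)),
   bounded_set (erodes (side n h) n (iter k (erodes (side n h) n) X)),
   hole_free (erodes (side n h) n (iter k (erodes (side n h) n) X)) &
   erodes (side n h) n (iter k (erodes (side n h) n) X) `<=` iter k (erodes (side n h) n) X].
  exact: erodes_props.
by split => // x /s'/s.
Qed.

(** The polygon lies in the disk of radius h around its centre ([zonotope_enorm]). As a vertex of
    it, and not its centre, is at the origin, each erosion shifts the set by z0. *)
Lemma inner_iter_erodes k x : k%:R * h < bdist X x -> E k (x + k%:R *: z0).
Proof.
elim: k x => [|k IH] x; first by rewrite mul0r scale0r addr0 => /bdist_gt; apply; rewrite edistxx.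
move=> kx; rewrite /E /=; apply/erodesP => p /(zonotope_enorm n3 h0) ph.
have -> : x + k.+1%:R *: z0 + p = (x + (z0 + p)) + k%:R *: z0.
  by rewrite -natr1; apply: pair_eq; rewrite /= /GRing.scale /=; ring.
apply: IH; have := bdist_lip x (x + (z0 + p)) bX.
have -> : edist x (x + (z0 + p)) = enorm (z0 + p).
  by rewrite enorm_dist -enormN; congr enorm; apply: pair_eq; rewrite /=; ring.
move=> h1.
have h2 : enorm (z0 + p) <= h by [].
move: h1; rewrite ler_norml => /andP[_ h1].
by move: kx; rewrite -natr1; lra.
Qed.

(** The opposite inclusion: the polygon contains the disk of radius h c around its centre
    ([ball_zonotope]). *)
Lemma iter_erodes_ball k x y : 0 < c -> E k x -> enorm (y - (x - k%:R *: z0)) <= k%:R * (h * c) -> X y.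
Proof.
move=> c0; elim: k x y => [|k IH] x y.
  rewrite scale0r subr0 mul0r => Xx; rewrite le_eqVlt ltNge enorm_ge0 orbF enorm_eq0.
  by rewrite subr_eq0 => /eqP ->.
rewrite {1}/E /= => /erodesP Ex yk.
pose q := (k.+1%:R^-1 : R) *: (y - (x - k.+1%:R *: z0)).
have k0 : 0 < k.+1%:R :> R by rewrite ltr0n.
have qh : enorm q <= h * cos (pi / n%:R).
  rewrite /q enormZ gtr0_norm ?invr_gt0// ler_pdivrMl//.
have := ball_zonotope n3 h0 qh => /Ex /IH; apply.
have -> : y - (x + (q - z0) - k%:R *: z0) = k%:R *: q.
  rewrite /q -natr1; apply: pair_eq; rewrite /= /GRing.scale /=; field;
  by rewrite natr1 gt_eqF.
by rewrite enormZ ger0_norm// ler_wpM2l.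
Qed.

Lemma area_inner_le k : area (inner X (k%:R * h)) <= area (E k).
Proof.
have [oE bE _ _] := iter_erodes k.
have mE := open_plane_measurable oE.
rewrite -(area_shift (k%:R *: z0) mE); apply: le_area.
- exact: measurable_inner.
- exact: (@measurable_shift _ (k%:R *: z0)).
- have [M M0 MP] := bounded_box bE; set w := k%:R *: z0.
  exists (M + `|w|); split; first exact: num_real.
  move=> z Mz x /MP[x1 x2]; apply: le_trans (ltW Mz).
  rewrite -[x](addrK w); apply: le_trans (ler_normB _ _) _; rewrite lerD2r.
  by rewrite /Num.norm /= ge_max x1 x2.
- by move=> x; exact: inner_iter_erodes.
Qed.

Lemma area_iter_le k (t : R) : 0 <= t -> 0 < c -> t < k%:R * (h * c) -> area (E k) <= area (inner X t).
Proof.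
move=> t0 c0 tk; have [oE bE _ _] := iter_erodes k.
have mE := open_plane_measurable oE.
rewrite -(area_shift (k%:R *: z0) mE).
have bV : bounded_set (inner X t) by exact: sub_bounded (inner_sub bX t0) bX.
apply: le_area => //.
- exact: (@measurable_shift _ (k%:R *: z0)).
- exact: measurable_inner.
- move=> x /= xE; rewrite /inner /=; apply: lt_le_trans tk _.
  apply: bdist_ge; first exact: setC_bounded.
  move=> y Xy; rewrite leNgt; apply/negP => yk; apply: Xy.
  apply: (iter_erodes_ball c0 xE); rewrite addrK -enormN opprB -enorm_dist.
  exact: ltW.
Qed.

(** The bound is close to 2 pi h^2, the second difference of pi t^2 for the step h. *)
Lemma area_iter_convex k : E k.+2 !=set0 ->
  2 * (h ^+ 2 * (n%:R * sin (pi / n%:R))) <= area (E k) - 2 * area (E k.+1) + area (E k.+2).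
Proof.
move=> ne; have [oE bE hE _] := iter_erodes k.
apply: le_trans; first exact: (sum_cross_side h n3).
apply: area_erodes_convex => // i j iN jN; exact: side_noncollinear.
Qed.

(** With a(k) the area after k erosions, the losses a(k) - a(k + 1) start below K h and decrease by
    at least 2 pi c h^2 at each step; summing them between the indices that correspond to s and t
    gives the claim, up to terms that vanish as c -> 1 and h -> 0. The point x0 keeps all the sets
    involved non-empty. *)
Lemma inner_parallel_step (N : nat) (s t K : R) x0 : 0 <= s -> s < t ->
  h = t / (N%:R * c) -> 0 < c -> (0 < N)%N -> t / c + h < bdist X x0 ->
  0 <= K -> area X - area (inner X h) <= K * h ->
  area (inner X s) - area (inner X t) <=
  (t / c + 2 * h - s) * (K + pi * c * h) - pi * c * ((t / c + h) ^+ 2 - s ^+ 2).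
Proof.
move=> s0 st hE c0 N0 hx0 K0 AK.
have N0' : 0 < N%:R :> R by rewrite ltr0n.
pose P := pi * c; have P0 : 0 < P by rewrite mulr_gt0// pi_gt0.
have PS : P <= n%:R * sin (pi / n%:R).
  have n0' : 0 < n%:R :> R by rewrite ltr0n (leq_trans _ n3).
  have : pi / n%:R * c <= sin (pi / n%:R).
    apply: sin_ge_mulcos; rewrite divr_ge0 ?pi_ge0 ?ler0n//=.
    rewrite ler_pdivrMr// ler_peMr ?pi_ge0// (ler_nat R 1).
    exact: leq_trans n3.
  by rewrite mulrAC ler_pdivrMr// [sin _ * _]mulrC.
pose a k := area (E k).
have Nh : N%:R * h = t / c by rewrite hE; field; rewrite !gt_eqF.
pose D k := a k - a k.+1.
have Dk k : (k <= N)%N -> D k <= K * h - 2 * (P * h ^+ 2) * k%:R.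
  elim: k => [|k IH] kN.
    rewrite mulr0 subr0; apply: le_trans AK.
    have h1 := area_inner_le 1; rewrite mul1r in h1.
    by rewrite /D (_ : a 0%N = area X)// lerD2l lerN2.
  have ne : E k.+2 !=set0.
    exists (x0 + k.+2%:R *: z0); apply: inner_iter_erodes; apply: le_lt_trans hx0.
    rewrite -Nh -[X in _ + X]mul1r -mulrDl ler_pM2r// natr1 ler_nat ltnS.
    exact: kN.
  have := area_iter_convex ne.
  have h2 : 2 * (h ^+ 2 * P) <= 2 * (h ^+ 2 * (n%:R * sin (pi / n%:R))).
    by rewrite ler_pM2l// ler_pM2l// exprn_gt0.
  have := IH (ltnW kN); rewrite /D /a -natr1.
  move: h2; set S := n%:R * _; move: (area (E k)) (area (E k.+1)) (area (E k.+2)) => x y z.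
  clear; lra.
have Dsum i m : (i <= m <= N.+1)%N -> a i - a m <=
    K * h * (m%:R - i%:R) - P * h ^+ 2 * (m%:R * (m%:R - 1) - i%:R * (i%:R - 1)).
  elim: m => [|m IH] /andP[im mN].
    by move: im; rewrite leqn0 => /eqP ->; rewrite !subrr !mulr0 subrr.
  move: im; rewrite leq_eqVlt => /orP[/eqP <-|im].
    by rewrite !subrr !mulr0 subrr.
  have := IH; rewrite -ltnS im ltnW// => /(_ isT).
  have := Dk m; rewrite -ltnS mN => /(_ isT); rewrite /D -natr1.
  by move: (a i) (a m) (a m.+1) => x y z; clear; lra.
(* Rounded down, so that E i contains a translate of [inner X s]; at the other end N + 1 rounds up,
   since (N + 1) h c > t. *)
pose i := Num.truncn (s / h).
have /andP[i1 i2] : i%:R <= s / h < i.+1%:R by apply: truncn_itv; rewrite divr_ge0// ltW.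
have ih : i%:R * h <= s by rewrite -ler_pdivlMr.
have ih2 : s < i%:R * h + h by rewrite -[X in _ + X]mul1r -mulrDl natr1 -ltr_pdivrMr.
have tc : t <= t / c by rewrite ler_pdivlMr// ler_piMr ?cos_le1// (le_trans s0)// ltW.
have iN : (i <= N.+1)%N.
  apply: leqW; rewrite -(ler_nat R) -(ler_pM2r h0) Nh; lra.
have := Dsum i N.+1; rewrite iN leqnn => /(_ isT).
have Vs : area (inner X s) <= a i.
  apply: le_trans (area_inner_le i); apply: le_area.
  - exact: measurable_inner.
  - exact: measurable_inner.
  - by apply: sub_bounded bX; apply: inner_sub => //; rewrite mulr_ge0// ltW.
  - by move=> x; rewrite /inner /=; exact: le_lt_trans.
have Vt : a N.+1 <= area (inner X t).
  apply: area_iter_le => //; first by rewrite (le_trans s0)// ltW.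
  rewrite mulrA -natr1 mulrDl mul1r Nh mulrDl divfK ?gt_eqF// ltrDl.
  by rewrite mulr_gt0.
move=> S; apply: (@le_trans _ _ (a i - a N.+1)); first exact: lerB.
apply: (le_trans S); rewrite -/P.
have JE : N.+1%:R * h = t / c + h by rewrite -natr1 mulrDl mul1r Nh.
have -> : K * h * (N.+1%:R - i%:R) - P * h ^+ 2 * (N.+1%:R * (N.+1%:R - 1) - i%:R * (i%:R - 1)) =
  (N.+1%:R * h - i%:R * h) * (K + P * h) - P * ((N.+1%:R * h) ^+ 2 - (i%:R * h) ^+ 2).
  by ring.
rewrite JE; set J := t / c + h; set I := i%:R * h in ih ih2 *.
have I0 : 0 <= I by rewrite mulr_ge0// ltW.
have KP : 0 <= K + P * h by rewrite addr_ge0// mulr_ge0// ltW.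
have e1 : (J - I) * (K + P * h) <= (t / c + 2 * h - s) * (K + P * h).
  by apply: ler_wpM2r => //; move: ih2; rewrite /J; lra.
have e2 : P * (J ^+ 2 - s ^+ 2) <= P * (J ^+ 2 - I ^+ 2).
  rewrite ler_pM2l// lerD2l lerN2 ler_pXn2r// nnegrE//.
by lra.
Qed.

End step.

Lemma cvg_cos_inv : cos (pi / m.+3%:R) @[m --> \oo] --> (1 : R).
Proof.
rewrite -[X in _ --> X]cos0; apply: continuous_cvg; first exact: continuous_cos.
rewrite -[X in _ --> X](mulr0 pi); apply: cvgMr.
have := @cvg_harmonic R; rewrite -(cvg_shiftn 2) /=; apply: cvg_trans.
by apply: near_eq_cvg; near=> m; rewrite /harmonic addn2.
Unshelve. all: by end_near. Qed.

Theorem inner_parallel X (L s t : R) x0 : open X -> bounded_set X -> hole_free X ->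
  (forall e : R, 0 < e -> exists2 t0 : R, 0 < t0 & forall r, 0 < r -> r < t0 ->
     area X - area (inner X r) <= (L + e) * r) ->
  0 <= s -> s < t -> t < bdist X x0 ->
  area (inner X s) - area (inner X t) <= L * (t - s) - pi * (t ^+ 2 - s ^+ 2).
Proof.
move=> oX bX hX HL s0 st tx.
apply/ler_addgt0Pr => e e0.
have ts : 0 < t - s by rewrite subr_gt0.
have t0 : 0 < t by exact: le_lt_trans st.
pose K := L + e / (t - s).
have [r0 r00 rP] := HL _ (divr_gt0 e0 ts).
have K0 : 0 <= K.
  have r1 : 0 < r0 / 2 by rewrite divr_gt0.
  have r2 : r0 / 2 < r0 by rewrite ltr_pdivrMr// ltr_pMr//; lra.
  have := rP _ r1 r2; rewrite -/K => h.
  rewrite -(pmulr_lge0 _ r1); apply: le_trans h; rewrite subr_ge0.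
  apply: le_area => //; [exact: measurable_inner|exact: open_plane_measurable|].
  by apply: inner_sub => //; exact: ltW.
have -> : L * (t - s) - pi * (t ^+ 2 - s ^+ 2) + e = (t - s) * K - pi * (t ^+ 2 - s ^+ 2).
  by rewrite /K; field; rewrite gt_eqF.
(* m + 3 is both the parameter n > 2 of the 2n-gon and the number N of steps; both errors vanish
   together. *)
pose c (m : nat) : R := cos (pi / m.+3%:R).
pose h m := t / (m.+3%:R * c m).
have cc : c m @[m --> \oo] --> (1 : R) := cvg_cos_inv.
have hc : h m @[m --> \oo] --> (0 : R).
  rewrite (_ : h = fun m => t / m.+3%:R * (c m)^-1); last first.
    by apply/funext => m; rewrite /h invfM mulrA.
  rewrite -(mul0r (1^-1 : R)); apply: cvgM; last by apply: cvgV => //; exact: oner_neq0.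
  rewrite -(mulr0 t); apply: cvgMr.
  have := @cvg_harmonic R; rewrite -(cvg_shiftn 2) /=; apply: cvg_trans.
  by apply: near_eq_cvg; near=> m; rewrite /harmonic addn2.
pose B m := (t / c m + 2 * h m - s) * (K + pi * c m * h m)
   - pi * c m * ((t / c m + h m) * (t / c m + h m) - s ^+ 2).
have tcc : t / c m @[m --> \oo] --> t.
  suff : t * (c m)^-1 @[m --> \oo] --> t * 1^-1 by rewrite invr1 mulr1.
  apply: cvgMr.
  by apply: cvgV => //; exact: oner_neq0.
have Bc : B m @[m --> \oo] --> (t - s) * K - pi * (t ^+ 2 - s ^+ 2).
  have -> : (t - s) * K - pi * (t ^+ 2 - s ^+ 2) =
    (t + 2 * 0 - s) * (K + pi * 1 * 0) - pi * 1 * ((t + 0) * (t + 0) - s ^+ 2) by ring.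
  apply: cvgB; apply: cvgM.
  - by apply: cvgB; [apply: cvgD => //; apply: cvgMr|exact: cvg_cst].
  - by apply: cvgD; [exact: cvg_cst|apply: cvgM => //; apply: cvgMr].
  - exact: cvgMr.
  - by apply: cvgB; [apply: cvgM; exact: cvgD|exact: cvg_cst].
apply: (cvgr_to_ge Bc); near=> m.
have c0 : 0 < c m by exact: cos_th_gt0.
have h0 : 0 < h m by rewrite divr_gt0// mulr_gt0.
rewrite /B -expr2; apply: (@inner_parallel_step X m.+3 (h m) oX bX hX _ h0 m.+3 s t K x0) => //.
  near: m; have th0 : t / c m + h m @[m --> \oo] --> t + 0 by exact: cvgD.
  by apply: (cvgr_lt _ th0); rewrite addr0.
by apply: rP => //; near: m; exact: (cvgr_lt _ hc).
Unshelve. all: by end_near. Qed.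

End inner_parallel.

(** * Hausdorff measure and tubes around the boundary *)

Section hausdorff.
Context {R : realType}.
Implicit Types (x y : R * R) (A B C S X : set (R * R)).
Local Open Scope ereal_scope.

Lemma le_diam A x y : A x -> A y -> (edist x y)%:E <= diam A.
Proof. by move=> Ax Ay; apply: ereal_sup_ubound; right; exists x, y. Qed.

Lemma diam_le A (r : R) : (0 <= r)%R ->
  (forall x y, A x -> A y -> (edist x y <= r)%R) -> diam A <= r%:E.
Proof.
move=> r0 Ar; apply: ge_ereal_sup => e [->|[x [y [Ax Ay ->]]]]; rewrite lee_fin//.
exact: Ar.
Qed.

Lemma gauge_diam d A : diam A <= hausdorff_gauge d A.
Proof. by rewrite /hausdorff_gauge; case: ifP => // _; exact: leey. Qed.

Lemma content_le_sum d S (F : (set (R * R))^nat) : (forall k, measurable (F k)) ->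
  S `<=` \bigcup_k F k ->
  hausdorff_content d S <= \sum_(0 <= k <oo) hausdorff_gauge d (F k).
Proof. by move=> mF SF; apply: ereal_inf_lbound; exists F. Qed.

Lemma hausdorff_content_anti (d1 d2 : R) S : (d1 <= d2)%R ->
  hausdorff_content d2 S <= hausdorff_content d1 S.
Proof.
move=> d12; apply: le_ereal_inf_tmp => _ [F [mF SF] <-].
apply: le_trans (content_le_sum d2 mF SF) _; apply: lee_nneseries => k _.
  by move=> _; exact: hausdorff_gauge_ge0.
rewrite /hausdorff_gauge; case: ifP => d2F; case: ifP => d1F //; first exact: leey.
by move: d2F; rewrite (le_trans d1F)// lee_fin.
Qed.

Lemma hausdorff1_le S (K : R) :
  (forall d : R, (0 < d)%R -> exists n (F : nat -> set (R * R)) (r : nat -> R),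
    [/\ forall k, measurable (F k), S `<=` \bigcup_(k in `I_n) F k,
        forall k x y, F k x -> F k y -> (edist x y <= r k)%R,
        forall k, (0 <= r k <= d)%R & (\sum_(k < n) r k <= K)%R]) ->
  hausdorff1 S <= K%:E.
Proof.
move=> H; apply: ge_ereal_sup => _ [d d0 <-].
have [n [F [r [mF SF Fr rd rK]]]] := H d d0.
pose G k := if (k < n)%N then F k else set0.
have mG k : measurable (G k) by rewrite /G; case: ifP.
have SG : S `<=` \bigcup_k G k.
  by move=> x /SF[k /= kn Fx]; exists k => //; rewrite /G kn.
apply: le_trans (content_le_sum d mG SG) _.
rewrite (nneseries_split 0 n)//; last by move=> k _; exact: hausdorff_gauge_ge0.
rewrite add0n [X in _ + X]eseries0 ?adde0; last first.
  by move=> k nk _; rewrite /G ltnNge nk /= hausdorff_gauge0.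
apply: (@le_trans _ _ (\sum_(k < n) (r k)%:E)); last by rewrite sumEFin lee_fin.
rewrite big_mkord; apply: lee_sum => k _; rewrite /G ltn_ord.
have /andP[r0 rd'] := rd k.
have dr : diam (F k) <= (r k)%:E by apply: diam_le => // x y; exact: Fr.
by rewrite /hausdorff_gauge (le_trans dr) ?lee_fin.
Qed.

(* A cover by sets smaller than the separation r splits into a cover of A and
   one of B. *)
Lemma hausdorff1_separated A B (r : R) : (0 < r)%R ->
  (forall x y, A x -> B y -> (r <= edist x y)%R) ->
  hausdorff1 A + hausdorff1 B <= hausdorff1 (A `|` B).
Proof.
move=> r0 ABr.
have content d : (0 < d)%R -> (d < r)%R ->
    hausdorff_content d A + hausdorff_content d B <= hausdorff_content d (A `|` B).
  move=> d0 dr; apply: le_ereal_inf_tmp => _ [F [mF SF] <-].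
  pose FA k := if `[< F k `&` A !=set0 >] then F k else set0.
  pose FB k := if `[< F k `&` B !=set0 >] then F k else set0.
  have mFA k : measurable (FA k) by rewrite /FA; case: ifP.
  have mFB k : measurable (FB k) by rewrite /FB; case: ifP.
  have AF : A `<=` \bigcup_k FA k.
    move=> x Ax; have [k _ Fx] := SF x (or_introl Ax).
    by exists k => //; rewrite /FA ifT//; apply/asboolP; exists x.
  have BF : B `<=` \bigcup_k FB k.
    move=> x Bx; have [k _ Fx] := SF x (or_intror Bx).
    by exists k => //; rewrite /FB ifT//; apply/asboolP; exists x.
  apply: le_trans (leeD (content_le_sum d mFA AF) (content_le_sum d mFB BF)) _.
  rewrite -nneseriesD; last 2 first.
  - by move=> k _ _; exact: hausdorff_gauge_ge0.
  - by move=> k _ _; exact: hausdorff_gauge_ge0.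
  apply: lee_nneseries => k _.
    by move=> _; apply: adde_ge0; exact: hausdorff_gauge_ge0.
  rewrite /FA /FB; case: ifPn => [/asboolP[x [Fx Ax]]|_]; case: ifPn => [/asboolP[y [Fy By]]|_].
  - rewrite {3}/hausdorff_gauge; case: ifP => [dF|_]; last exact: leey.
    have := le_trans (le_diam Fx Fy) dF; rewrite lee_fin leNgt.
    by rewrite (lt_le_trans dr)// ABr.
  - by rewrite hausdorff_gauge0// adde0.
  - by rewrite hausdorff_gauge0// add0e.
  - by rewrite !hausdorff_gauge0// adde0; exact: hausdorff_gauge_ge0.
have [->|] := eqVneq (hausdorff1 (A `|` B)) +oo; first exact: leey.
rewrite -ltey => fin.
have finH S : S `<=` A `|` B -> hausdorff1 S \is a fin_num.
  by move=> SAB; rewrite ge0_fin_numE ?hausdorff1_ge0// (le_lt_trans (le_hausdorff1 SAB)).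
rewrite -leeBrDr ?finH//.
apply: ge_ereal_sup => _ [d d0 <-].
have finC : hausdorff_content d A \is a fin_num.
  rewrite ge0_fin_numE; last exact: (mu_ext_ge0 (hausdorff_gauge_ge0 d)).
  apply: (le_lt_trans (hausdorff_content_le A d0)).
  by apply: le_lt_trans fin; exact: le_hausdorff1.
rewrite leeBrDr ?finH// addeC -leeBrDr//.
apply: ge_ereal_sup => _ [e e0 <-]; rewrite leeBrDr//.
pose m := Num.min (Num.min d e) (r / 2)%R.
have m0 : (0 < m)%R by rewrite !lt_min d0 e0 divr_gt0.
have mr : (m < r)%R by rewrite gt_min [X in _ || X](_ : _ = true) ?orbT// ltr_pdivrMr// ltr_pMr// ltr1n.
apply: le_trans (hausdorff_content_le _ m0).
apply: le_trans (content m m0 mr).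
rewrite addeC; apply: leeD; apply: hausdorff_content_anti; rewrite !ge_min lexx ?orbT//.
Qed.

Lemma hausdorff1U A B : hausdorff1 (A `|` B) <= hausdorff1 A + hausdorff1 B.
Proof.
pose F (k : nat) : set (R * R) := if k is 0%N then A else if k is 1%N then B else set0.
have AF : A `|` B `<=` \bigcup_k F k.
  by move=> x [Ax|Bx]; [exists 0%N|exists 1%N].
apply: le_trans (le_hausdorff1 AF) _.
apply: le_trans (hausdorff1_sigma_subadditive F) _.
rewrite (nneseries_split 0 2)//; last by move=> k _; exact: hausdorff1_ge0.
rewrite [X in _ + X]eseries0 ?adde0; last by case=> // -[]// k _ _; exact: hausdorff10.
by rewrite big_mkord !big_ord_recr big_ord0 /= add0e.
Qed.

Section closed.
Variables (C X : set (R * R)).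
Hypotheses (cC : closed C) (C0 : C !=set0) (fX : hausdorff1 X < +oo).

Let f x : R := bdist (~` C) x.
Let A k := X `&` [set x | (k.+1%:R^-1 <= f x)%R].
Let D k := X `&` [set x | (k.+2%:R^-1 <= f x <= k.+1%:R^-1)%R].
Let a k := fine (hausdorff1 (A k)).

Let f_lip x y : (`|f x - f y| <= edist x y)%R.
Proof. by apply: bdist_lip_nonempty; rewrite setCK. Qed.

Let finH S : S `<=` X -> hausdorff1 S \is a fin_num.
Proof.
by move=> SX; rewrite ge0_fin_numE ?hausdorff1_ge0// (le_lt_trans (le_hausdorff1 SX)).
Qed.

Let aE k : hausdorff1 (A k) = (a k)%:E.
Proof. by rewrite fineK// finH// => x []. Qed.

Let inv_lt (k l : nat) : (k < l)%N -> (l.+1%:R^-1 < k.+1%:R^-1 :> R)%R.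
Proof. by move=> kl; rewrite ltf_pV2 ?posrE// ltr_nat. Qed.

Let separated S1 S2 (b1 b2 : R) : (b2 < b1)%R -> (forall x, S1 x -> (b1 <= f x)%R) ->
  (forall x, S2 x -> (f x <= b2)%R) ->
  hausdorff1 S1 + hausdorff1 S2 <= hausdorff1 (S1 `|` S2).
Proof.
move=> b12 h1 h2; apply: (@hausdorff1_separated _ _ (b1 - b2)%R).
  by rewrite subr_gt0.
move=> x y /h1 fx /h2 fy; have := f_lip x y; rewrite ler_norml => /andP[_]; lra.
Qed.

Let mono k l : (k <= l)%N -> A k `<=` A l.
Proof.
move=> kl x [Xx fx]; split => //=; apply: le_trans fx.
by rewrite lef_pV2 ?posrE// ler_nat.
Qed.

Let a_mono k l : (k <= l)%N -> (a k <= a l)%R.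
Proof. by move=> kl; rewrite -lee_fin -!aE; apply: le_hausdorff1; exact: mono. Qed.

Let D_le k : hausdorff1 (D k.+1) <= (a k.+2 - a k)%:E.
Proof.
have DX : D k.+1 `<=` X by move=> x [].
rewrite EFinB leeBrDr// addeC -!aE.
have sub : A k `|` D k.+1 `<=` A k.+2.
  move=> x [|[Xx /andP[fx _]]]; last by split.
  by apply: mono; rewrite -addn2 leq_addr.
apply: le_trans (le_hausdorff1 sub).
apply: (@separated _ _ k.+1%:R^-1 k.+2%:R^-1); first exact: inv_lt.
  by move=> x [].
by move=> x [_ /andP[]].
Qed.

(** Caratheodory's argument for metric outer measures. The part A(k) of X at distance at least 1 /
    (k + 1) from C is separated from C, and its length a(k) increases with supremum s. The layer D(k
    + 1) is separated from A(k), and both lie in A(k + 2), so that the layer has length at most a(k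
    + 2) - a(k). These bounds telescope, and the part of X outside C has length at most s. *)
Lemma closed_caratheodory_finite :
  hausdorff1 (X `&` C) + hausdorff1 (X `&` ~` C) <= hausdorff1 X.
Proof.
have fC x : C x -> (f x <= 0)%R.
  by move=> Cx; rewrite -(edistxx x); apply: bdist_le => /=; rewrite -/(~ _) => h; exact: h.
have fnC x : ~ C x -> (0 < f x)%R.
  move: cC; rewrite -openC openE => oC Cx; have := oC x Cx.
  rewrite /interior => /nbhs_ballP[r /= r0 rX].
  apply: (lt_le_trans r0); apply: bdist_ge; first by rewrite setCK.
  move=> y; rewrite -[(~ (~` C) y)]/((~` ~` C) y) setCK => Cy; rewrite leNgt; apply/negP => h.
  have : (~` C) y.
    apply: rX; split; rewrite /ball /=; apply: le_lt_trans h; rewrite enorm_dist.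
      exact: (norm1_le_enorm (x - y)%R).
    exact: (norm2_le_enorm (x - y)%R).
  exact.
have bound k : hausdorff1 (X `&` C) + (a k)%:E <= hausdorff1 X.
  rewrite -aE addeC; apply: (@le_trans _ _ (hausdorff1 (A k `|` (X `&` C)))).
    apply: (@separated _ _ k.+1%:R^-1 0); first by rewrite invr_gt0.
      by move=> x [].
    by move=> x [_ /fC].
  by apply: le_hausdorff1 => x [[]|[]].
pose M := fine (hausdorff1 X).
have aM k : (a k <= M)%R.
  have fin : hausdorff1 X \is a fin_num by exact: finH.
  rewrite -lee_fin -aE /M fineK//; apply: le_hausdorff1.
  by move=> x [].
pose s := sup (range a).
have hs : has_sup (range a) by split; [exists (a 0%N), 0%N|exists M => _ [k _ <-]].
have as_ k : (a k <= s)%R by apply: ub_le_sup; [case: hs|exists k].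
have tail k : hausdorff1 (X `&` ~` C) <= (a k.+1 + 2 * (s - a k))%:E.
  pose G l := if l is l'.+1 then D (k + l)%N else A k.+1.
  have XG : X `&` ~` C `<=` \bigcup_l G l.
    move=> x [Xx /fnC fx].
    have [fk|fk] := leP (k.+2%:R^-1)%R (f x); first by exists 0%N.
    have fi : (0 <= (f x)^-1)%R by rewrite invr_ge0 ltW.
    have /andP[t1 t2] := truncn_itv fi; set l := Num.truncn _ in t1 t2.
    have kl : (k.+2 <= l)%N.
      rewrite -ltnS -(ltr_nat R); apply: lt_trans t2.
      by rewrite -[ltLHS]invrK ltf_pV2 ?posrE ?invr_gt0.
    exists (l - k.+1)%N => //.
    have -> : G (l - k.+1)%N = D l.-1.
      rewrite /G; case E : (l - k.+1)%N => [|l']; first by lia.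
      by congr D; lia.
    have l0 : (0 < l%:R :> R)%R by rewrite ltr0n; lia.
    split => //=; rewrite prednK; last lia.
    rewrite invf_ple ?posrE ?ltr0n// (ltW t2)/=.
    by rewrite -[leLHS]invrK lef_pV2 ?posrE ?invr_gt0.
  apply: le_trans (le_hausdorff1 XG) _.
  apply: le_trans (hausdorff1_sigma_subadditive G) _.
  apply: lime_le; first by apply: is_cvg_nneseries => l _ _; exact: hausdorff1_ge0.
  apply: nearW => n; rewrite /=.
  have partial m : \sum_(0 <= l < m.+1) hausdorff1 (G l) <=
      (a (k + m).+1 + a (k + m)%N - a k)%:E.
    elim: m => [|m IH].
      by rewrite big_nat1 addn0 /G aE lee_fin; lra.
    have GD : G m.+1 = D (k + m).+1 by rewrite /G addnS.
    have DG := D_le (k + m)%N; rewrite -GD in DG.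
    have -> : (\sum_(0 <= l < m.+2) hausdorff1 (G l) = \sum_(0 <= l < m.+1) hausdorff1 (G l) + hausdorff1 (G m.+1))%R.
      exact: big_nat_recr.
    apply: (le_trans (leeD IH DG)).
    rewrite -EFinD lee_fin addnS; lra.
  case: n => [|n]; first by rewrite big_geq// lee_fin addr_ge0// ?mulr_ge0// ?subr_ge0// fine_ge0// hausdorff1_ge0.
  apply: (le_trans (partial n)); rewrite lee_fin.
  have := as_ (k + n).+1; have := as_ (k + n)%N; have := a_mono (leqnSn k); lra.
apply/lee_addgt0Pr => e e0.
have e2 : (0 < e / 2)%R by rewrite divr_gt0.
have [_ [k _ <-] sk] := sup_adherent e2 hs.
apply: (@le_trans _ _ (hausdorff1 (X `&` C) + ((a k.+1)%:E + e%:E))).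
  rewrite leeD2l//; apply: (le_trans (tail k)).
  rewrite -EFinD lee_fin; move: sk; rewrite -/s; lra.
by rewrite addeA leeD2r.
Qed.

End closed.

Lemma closed_caratheodory C : closed C -> caratheodory_measurable (@hausdorff1_outer R) C.
Proof.
move=> cC; apply: le_caratheodory_measurable => X.
have [->|C0] := eqVneq C set0.
  by rewrite setI0 setC0 setIT outer_measure0 add0e.
have [E|] := eqVneq (hausdorff1 X) +oo; first by rewrite [leRHS]E leey.
by rewrite -ltey => fX; apply: closed_caratheodory_finite => //; apply/set0P.
Qed.

Local Notation lengthT := (caratheodory_type (@hausdorff1_outer R)).

Lemma closed_length_measurable C : closed C -> measurable (C : set lengthT).
Proof. exact: closed_caratheodory. Qed.

Lemma open_length_measurable C : open C -> measurable (C : set lengthT).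
Proof.
by move=> oC; rewrite -[C]setCK; apply: measurableC; apply: closed_length_measurable; rewrite closedC.
Qed.

Lemma continuous_length_measurable C (g : R * R -> R) : closed C -> continuous g ->
  measurable_fun (C : set lengthT) (g : lengthT -> R).
Proof.
move=> cC cg; have mC := closed_length_measurable cC.
apply: measurability; first exact: measurable_realfun.RGenOInfty.measurableE.
move=> /= _ [_ [x ->] <-].
apply: measurableI; first exact: closed_length_measurable.
apply: open_length_measurable.
have /continuousP := cg; apply; rewrite set_itvoy; exact: open_gt.
Qed.

(** The projection on e is 1-Lipschitz, so that each set of a cover projects into an interval as
    long as its diameter. The scale 1 of the content is arbitrary. *)
Lemma lebesgue_projection_le (e : R * R) (J : set R) S : dot e e = 1%R -> measurable J ->
  (forall t, J t -> exists2 x, S x & dot e x = t) ->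
  lebesgue_measure J <= hausdorff1 S.
Proof.
move=> e1 mJ JS; apply: le_trans (hausdorff_content_le S ltr01).
apply: le_ereal_inf_tmp => _ [F [mF SF] <-].
(* A set of infinite diameter gets the whole line; its gauge is infinite as well. *)
pose I k : set R := if `[< F k = set0 >] then set0 else
  if `[< diam (F k) = +oo >] then setT
  else [set` `[inf [set dot e x | x in F k], inf [set dot e x | x in F k] + fine (diam (F k))]%R ].
have mI k : measurable (I k) by rewrite /I; case: ifP => // _; case: ifP.
have dotD x y : (`|dot e x - dot e y| <= edist x y)%R.
  have -> : (dot e x - dot e y = dot e (x - y))%R by rewrite /dot /=; ring.
  rewrite enorm_dist; apply: le_trans (ler_dot e (x - y)%R) _.
  by rewrite /enorm e1 sqrtr1 mul1r.
have JI : J `<=` \bigcup_k I k.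
  move=> t /JS[x Sx <-]; have [k _ Fx] := SF x Sx; exists k => //.
  rewrite /I; case: ifPn => [/asboolP F0|_]; first by move: Fx; rewrite F0.
  case: ifPn => [//|/asboolP Fd].
  have fin : diam (F k) \is a fin_num.
    by rewrite ge0_fin_numE ?diam_ge0// ltey; apply/eqP.
  have lb z : F k z -> (dot e x - fine (diam (F k)) <= dot e z)%R.
    move=> Fz; have := le_diam Fx Fz; rewrite -[X in _ <= X](fineK fin) lee_fin.
    by have := dotD x z; rewrite ler_norml => /andP[_]; lra.
  rewrite /= in_itv /=; apply/andP; split.
    by apply: ge_inf; [exists (dot e x - fine (diam (F k)))%R => _ [z Fz <-]; exact: lb|exists x].
  rewrite -lerBlDr; apply: lb_le_inf; first by exists (dot e x), x.
  by move=> _ [z Fz <-]; exact: lb.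
have h := @measure_sigma_subadditive _ _ _ (@lebesgue_measure R) _ _ mI mJ JI; apply: (le_trans h).
apply: lee_nneseries => // k _; apply: le_trans (gauge_diam 1 (F k)).
rewrite /I; case: ifPn => [_|_]; first by rewrite measure0 diam_ge0.
case: ifPn => [/asboolP -> |/asboolP Fd]; first exact: leey.
have fin : diam (F k) \is a fin_num.
  by rewrite ge0_fin_numE ?diam_ge0// ltey; apply/eqP.
rewrite [leLHS](lebesgue_measure_itv _) /= lte_fin ltrDl; case: ifPn => _; last exact: diam_ge0.
by rewrite -EFinD addrAC subrr add0r fineK.
Qed.

End hausdorff.

(** * Compactness in the plane *)

Section compactness.
Context {R : realType}.
Implicit Types (x y p q : R * R) (K X : set (R * R)).

Lemma closed_bounded_compact K : closed K -> bounded_set K -> compact K.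
Proof.
move=> cK bK; have [M M0 KM] := bounded_box bK.
apply: (@subclosed_compact _ _ (`[-M, M] `*` `[-M, M])) => //.
  by apply: compact_setX; exact: segment_compact.
by move=> x /KM[]; rewrite !ler_norml /= !in_itv /=.
Qed.

Lemma edist_ball x y (r : R) : edist x y < r -> ball x r y.
Proof.
rewrite enorm_dist => h; split; rewrite /ball /=; apply: le_lt_trans h.
  exact: (norm1_le_enorm (x - y)).
exact: (norm2_le_enorm (x - y)).
Qed.

Lemma ball_edist x y (r : R) : ball x r y -> edist x y < 2 * r.
Proof.
move=> [h1 h2]; rewrite enorm_dist; apply: le_lt_trans (enorm_le_norm (x - y)) _.
by move: h1 h2; rewrite /ball /=; lra.
Qed.

Lemma nbhs_edist x (A : set (R * R)) : nbhs x A <->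
  exists2 r : R, 0 < r & forall y, edist x y < r -> A y.
Proof.
split=> [|[r r0 rA]].
  by move/nbhs_ballP => [r /= r0 rA]; exists r => // y /edist_ball; exact: rA.
apply/nbhs_ballP; exists (r / 2) => /=; first by rewrite divr_gt0.
by move=> y /ball_edist h; apply: rA; move: h; rewrite mulrC divfK.
Qed.

Lemma continuous_edist x : continuous (edist x).
Proof.
apply: (@continuous_lipschitz _ _ 1) => y z; rewrite mul1r ler_norml.
have := edist_triangle x y z; have := edist_triangle x z y.
rewrite (edist_sym z y) => h1 h2; apply/andP; split; lra.
Qed.

Lemma bdist_attained X x : open X -> ~` X !=set0 ->
  exists2 z, ~ X z & bdist X x = edist x z.
Proof.
move=> oX [c Xc]; pose K := ~` X `&` [set z | edist x z <= edist x c].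
have cK : compact K.
  apply: closed_bounded_compact.
    apply: closedI; first by rewrite closedC.
    apply: (@closed_comp _ _ (edist x) [set t | t <= edist x c]); last exact: closed_le.
    by move=> y _; exact: continuous_edist.
  exists (`|x| + edist x c); split; first exact: num_real.
  move=> M hM z [_ /= xz]; rewrite -[z](subrK x) (le_trans (ler_normD _ _))//.
  apply: (le_trans _ (ltW hM)); rewrite addrC lerD2l; apply: le_trans xz.
  rewrite edist_sym enorm_dist prod_normE ge_max.
  by rewrite norm1_le_enorm norm2_le_enorm.
have K0 : K !=set0 by exists c; split => //=; exact: lexx.
have [z /set_mem[Xz zx] zmin] := compact_EVT_min K0 cK (continuous_subspaceT (@continuous_edist x)).
exists z => //; apply/eqP; rewrite eq_le bdist_le//=.
apply: bdist_ge; first by exists c.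
move=> y Xy; have [yc|yc] := leP (edist x y) (edist x c).
  by apply: zmin; rewrite inE.
exact: (le_trans zx (ltW yc)).
Qed.

(** The disk of radius r around q lies in a disk for which G holds. That larger disk is returned,
    because G need not pass to smaller ones. *)
Lemma lebesgue_number K (G : R * R -> R -> Prop) : compact K ->
  (forall p, K p -> exists2 r, 0 < r & G p r) ->
  exists2 r : R, 0 < r & forall q, K q -> exists p s, G p s /\ edist q p + r < s.
Proof.
move=> /compact_near_coveringP cK KG.
pose P (r : R) q := exists p s, G p s /\ edist q p + r < s.
have FF : Filter (0^'+ : set_system R) by exact: at_right_proper_filter.
have := cK R (0^'+)%R P FF.
case; last first.
  move=> e /= e0 he; exists (e / 2); first by rewrite divr_gt0.
  move=> q Kq; apply: (he (e / 2)) => //=.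
    rewrite /ball /= sub0r normrN gtr0_norm ?divr_gt0//.
    by rewrite ltr_pdivrMr// ltr_pMr// ltr1n.
  by rewrite divr_gt0.
move=> p /KG[s s0 Gs]; have s2 : 0 < s / 2 by rewrite divr_gt0.
exists ([set q : R * R | edist p q < s / 2], [set r : R | 0 < r < s / 2]) => /=.
  split; first by apply/nbhs_edist; exists (s / 2).
  exists (s / 2) => //= r; rewrite /ball /= sub0r normrN => h r0.
  by rewrite r0 (le_lt_trans (ler_norm _) h).
move=> [q r] /= [pq /andP[r0 rs]]; exists p, s; split=> //.
by rewrite edist_sym; lra.
Qed.

End compactness.

(** * Rotations and tubes around pieces of the boundary *)

Section rotation.
Context {R : realType}.
Implicit Types (e x : R * R) (A S : set (R * R)).

Definition rot e x : R * R := (dot e x, cross e x).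

Lemma rotK e x : dot e e = 1 -> rot (e.1, - e.2) (rot e x) = x.
Proof.
rewrite /dot => ab; apply: pair_eq; rewrite /rot /dot /cross /=.
  by rewrite -[RHS]mulr1 -ab; ring.
by rewrite -[RHS]mulr1 -ab; ring.
Qed.

Lemma rotVK e x : dot e e = 1 -> rot e (rot (e.1, - e.2) x) = x.
Proof.
rewrite /dot => ab; apply: pair_eq; rewrite /rot /dot /cross /=.
  by rewrite -[RHS]mulr1 -ab; ring.
by rewrite -[RHS]mulr1 -ab; ring.
Qed.

(** A rotation with cosine c and sine s is the product of three shears of slopes t, - s, t, where t
    = s / (c + 1) is the tangent of half the angle. The half turn, with c = -1, is the square of a
    quarter turn. *)
Lemma plane_measure_rot e A : dot e e = 1 -> measurable A ->
  measurable (rot e @^-1` A) /\ plane_measure (rot e @^-1` A) = plane_measure A.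
Proof.
have mshear (c : R) B : measurable B ->
    measurable ((fun x : R * R => (x.1, x.2 + c * x.1)) @^-1` B) /\
    plane_measure ((fun x => (x.1, x.2 + c * x.1)) @^-1` B) = plane_measure B.
  move=> mB; split; last by apply: (@plane_measure_shear _ (fun t => c * t)) => //; exact: mulrl_continuous.
  have mf : measurable_fun setT (fun x : R * R => (x.1, x.2 + c * x.1)).
    apply/measurable_fun_pairP; split; first exact: measurable_fst.
    by apply: measurable_funD => //; apply: measurable_funM.
  by rewrite -[X in measurable X]setTI; exact: mf.
have mshear2 (c : R) B : measurable B ->
    measurable ((fun x : R * R => (x.1 + c * x.2, x.2)) @^-1` B) /\
    plane_measure ((fun x => (x.1 + c * x.2, x.2)) @^-1` B) = plane_measure B.
  move=> mB; split; last by apply: (@plane_measure_shear2 _ (fun t => c * t)) => //; exact: mulrl_continuous.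
  have mf : measurable_fun setT (fun x : R * R => (x.1 + c * x.2, x.2)).
    apply/measurable_fun_pairP; split; last exact: measurable_snd.
    by apply: measurable_funD => //; apply: measurable_funM.
  by rewrite -[X in measurable X]setTI; exact: mf.
have main e' B : dot e' e' = 1 -> e'.1 + 1 != 0 -> measurable B ->
    measurable (rot e' @^-1` B) /\ plane_measure (rot e' @^-1` B) = plane_measure B.
  case: e' => c s; rewrite /dot /= => cs1 c1 mB; pose t := s / (c + 1).
  have [m1 E1] := mshear2 t _ mB.
  have [m2 E2] := mshear (- s) _ m1.
  have [m3 E3] := mshear2 t _ m2.
  rewrite -E1 -E2 -E3; set X := (X in measurable X) in m3 *.
  suff -> : rot (c, s) @^-1` B = X by [].
  rewrite /X /preimage; apply/funext => x /=; congr B.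
  have ss : s * t = 1 - c.
    by apply: (mulIf c1); rewrite -mulrA divfK//; have : s * s = 1 - c * c by [lra]; move=> ->; ring.
  apply: pair_eq; rewrite /rot /dot /cross /=.
    have tc : t * (c + 1) = s by rewrite /t divfK.
    have -> : x.1 + t * x.2 + t * (x.2 + - s * (x.1 + t * x.2)) =
      x.1 * (1 - s * t) + x.2 * (t * (1 + (1 - s * t))) by ring.
    by rewrite ss -tc; ring.
  ring: ss.
move=> e1 mA; have [e0|e0] := eqVneq (e.1 + 1) 0; last exact: main.
have i1 : dot (0, 1) (0, 1) = 1 :> R by rewrite /dot /=; ring.
have i0 : ((0, 1) : R * R).1 + 1 != 0 by rewrite /= add0r oner_neq0.
have [m1 E1] := main (0, 1) A i1 i0 mA.
have [m2 E2] := main (0, 1) _ i1 i0 m1.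
rewrite -E1 -E2; suff -> : rot e @^-1` A = rot (0, 1) @^-1` (rot (0, 1) @^-1` A) by [].
have e1E : e.1 = -1 by apply/eqP; rewrite -addr_eq0 e0.
have e2E : e.2 = 0.
  by apply/eqP; rewrite -sqrf_eq0; apply/eqP; move: e1; rewrite /dot e1E; lra.
rewrite /preimage; apply/funext => x /=; congr A.
by apply: pair_eq; rewrite /rot /dot /cross /= e1E e2E; ring.
Qed.

Lemma fibre_measure_le S (J : set R) (c : R) : 0 <= c -> measurable S -> measurable J ->
  (forall x, S x -> J x.1) ->
  (forall x y, S x -> S y -> x.1 = y.1 -> x.2 - y.2 <= c) ->
  (plane_measure S <= c%:E * lebesgue_measure J)%E.
Proof.
move=> c0 mS mJ SJ Sc; rewrite /plane_measure /product_measure1.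
apply: (@le_trans _ _ (\int[@lebesgue_measure R]_t (c%:E * (\1_J t)%:E)))%E; last first.
  rewrite ge0_integralZl//; last first.
    by apply/measurable_EFinP; exact: measurable_indic.
  by rewrite integral_indic// setIT.
apply: ge0_le_integral => //.
- exact: measurable_fun_xsection.
- by apply: measurable_funeM; apply/measurable_EFinP; exact: measurable_indic.
move=> t _ /=.
have [->|/set0P[b Sb]] := eqVneq (xsection S t) set0.
  by rewrite measure0 mule_ge0// lee_fin.
have Sb' : S (t, b) by move: Sb; rewrite /xsection /= inE.
rewrite indicE mem_set ?mule1; last exact: (SJ (t, b)).
set F := xsection S t.
have lb y : F y -> b - c <= y.
  by rewrite /F /xsection /= inE => Sy; have := Sc _ _ Sb' Sy erefl; rewrite /=; lra.
have FI : F `<=` `[inf F, inf F + c].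
  move=> y Fy; rewrite /= in_itv /=; apply/andP; split.
    by apply: ge_inf => //; exists (b - c).
  rewrite -lerBlDr; apply: lb_le_inf; first by exists y.
  move=> z Fz; move: Fy Fz; rewrite /F /xsection /= !inE => Sy Sz.
  by have := Sc _ _ Sy Sz erefl; rewrite /=; lra.
apply: (@le_trans _ _ (lebesgue_measure `[inf F, inf F + c]%classic)).
  by apply: le_measure; rewrite ?inE//; exact: measurable_xsection.
rewrite lebesgue_measure_itv /= lte_fin; case: ifP => _; last by rewrite lee_fin.
by rewrite -EFinD lee_fin; lra.
Qed.

End rotation.

Section tube_piece.
Context {R : realType}.
Variables (Omega K : set (R * R)) (e : R * R) (eps rho : R).
Hypotheses (oO : open Omega) (cK : compact K) (K0 : K !=set0) (e1 : dot e e = 1).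
Hypotheses (eps0 : 0 < eps).
Hypothesis (fK : (hausdorff1 K < +oo)%E).
Hypothesis cone : forall y w, K y -> enorm w < rho -> cross e w < - eps * `|dot e w| ->
  ~ Omega (y + w).
Hypothesis K_small : forall x y, K x -> K y -> edist x y < rho / 2.

Definition tube (t : R) := Omega `&` [set x | bdist (~` K) x <= t].

Let oKC : open (~` K).
Proof. by rewrite openC; apply: compact_closed. Qed.

Let CK0 : ~` ~` K !=set0. Proof. by rewrite setCK. Qed.

Lemma measurable_tube t : measurable (tube t).
Proof.
apply: measurableI; first exact: open_plane_measurable.
apply: closed_plane_measurable.
apply: (@closed_comp _ _ (bdist (~` K)) [set s | s <= t]); last exact: closed_le.
move=> x _; apply: (@continuous_lipschitz _ _ 1) => {}x y; rewrite mul1r.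
exact: bdist_lip_nonempty.
Qed.

Let nearest x : exists2 y, K y & bdist (~` K) x = edist x y.
Proof.
by have [y /= ny ->] := bdist_attained x oKC CK0; exists y => //; apply: contrapT.
Qed.

Let cross_le w : cross e w + eps * `|dot e w| <= (1 + eps) * enorm w.
Proof.
have h := ler_dot e w; rewrite {1}/enorm e1 sqrtr1 mul1r in h.
rewrite mulrDl mul1r lerD ?ler_pM2l//.
have -> : cross e w = dot (- e.2, e.1) w by rewrite /cross /dot /=; ring.
have := ler_dot (- e.2, e.1) w; rewrite [enorm (_, _)](_ : _ = 1) ?mul1r.
  by apply: le_trans; exact: ler_norm.
rewrite /enorm (_ : dot _ _ = 1) ?sqrtr1//.
by rewrite -e1 /dot /=; ring.
Qed.

(** Otherwise y would be lower than x by more than t (1 + eps) and, seen from a point p of K nearest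
    to x, would fall into the cone that avoids Omega. *)
Let fibre (t : R) x y : t < rho / 4 -> tube t x -> tube t y -> dot e x = dot e y ->
  cross e x - cross e y <= t * (1 + eps).
Proof.
move=> tr [Ox xt] [Oy yt] exy.
have [p Kp px] := nearest x; have [q Kq qy] := nearest y.
rewrite leNgt; apply/negP => h.
have wx : enorm (x - p) <= t by rewrite -enorm_dist -px.
have wy : enorm (y - p) < rho.
  rewrite -enorm_dist; apply: le_lt_trans (edist_triangle y q p) _.
  by have := K_small Kq Kp; have := K_small Kq Kq; rewrite -qy edistxx; move: yt tr; rewrite /=; lra.
have dE : dot e (y - p) = dot e (x - p).
  by move: exy; rewrite /dot /=; lra.
have cE : cross e (y - p) = cross e (x - p) - (cross e x - cross e y).
  by rewrite /cross /=; ring.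
have := @cone p (y - p) Kp wy.
have -> : p + (y - p) = y by rewrite addrC subrK.
apply => //.
rewrite dE cE; have := cross_le (x - p).
have : (1 + eps) * enorm (x - p) <= (1 + eps) * t by rewrite ler_pM2l// addr_gt0.
by lra.
Qed.

(** The t-neighbourhood of the shadow of K in the direction e. Being compact, it decreases to the
    shadow as t -> 0, and so does its measure. *)
Let J (t : R) : set R := (fun z : (R * R) * R => dot e z.1 + z.2) @` (K `*` `[- t, t]).

Let compactJ t : compact (J t).
Proof.
apply: continuous_compact; last by apply: compact_setX => //; exact: segment_compact.
apply: continuous_subspaceT => z; apply: cvgD; last exact: cvg_snd.
by apply: cvgD; apply: cvgMr; [apply: (cvg_comp _ _ cvg_fst); exact: cvg_fst|
  apply: (cvg_comp _ _ cvg_fst); exact: cvg_snd].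
Qed.

Let compactP : compact (dot e @` K).
Proof.
apply: continuous_compact => //; apply: continuous_subspaceT => z.
by apply: cvgD; apply: cvgMr; [exact: cvg_fst|exact: cvg_snd].
Qed.

Let measurableJ t : measurable (J t).
Proof. by apply: closed_measurable; apply: compact_closed. Qed.

Let JE : \bigcap_n J n.+1%:R^-1 = dot e @` K.
Proof.
apply/seteqP; split => [s Js|_ [y Ky <-] n _]; last first.
  exists (y, 0); rewrite /= ?addr0//; split => //=.
  by rewrite in_itv /= oppr_le0 invr_ge0 ler0n.
have := compact_closed (@norm_hausdorff _ R) compactP; rewrite closedE; apply.
apply/nbhs_ballP => -[r /= r0 rP].
have [n nr] := ltr_add_invr (y := 0) r0; rewrite add0r in nr.
have [[y z] [/= Ky zn] yz] := Js n I.
apply: (rP (dot e y)); last by exists y.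
rewrite /ball /= -yz addrAC subrr add0r.
by apply: le_lt_trans nr; rewrite ler_norml; move: zn; rewrite in_itv /=.
Qed.

Let J_mono s t : s <= t -> J s `<=` J t.
Proof.
move=> st _ [[y z] [/= Ky zs] <-]; exists (y, z) => //; split => //=.
move: zs; rewrite !in_itv /= => /andP[z1 z2].
by rewrite (le_trans z2 st) (le_trans _ z1)// lerN2.
Qed.

(** Cavalieri in coordinates adapted to e: the fibres of the tube have length at most t (1 + eps),
    and its base lies in J(t), whose measure is for small t less than the length of K plus d, since
    the shadow of K measures at most the length of K. *)
Lemma tube_piece (d : R) : 0 < d -> exists2 t0 : R, 0 < t0 & forall t, 0 < t < t0 ->
  (plane_measure (tube t) <= (t * (1 + eps) * (fine (hausdorff1 K) + d))%:E)%E.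
Proof.
move=> d0.
have rho0 : 0 < rho.
  by have [y Ky] := K0; have := K_small Ky Ky; rewrite edistxx; lra.
have Pm : measurable (dot e @` K) by apply: closed_measurable; apply: compact_closed.
have cv : lebesgue_measure \o (fun n => J n.+1%:R^-1) @ \oo --> lebesgue_measure (dot e @` K).
  rewrite -JE; apply: nonincreasing_cvg_mu => //=.
  - have [M [_ hM]] := compact_bounded (@compactJ 1%R^-1%R).
    apply: (@le_lt_trans _ _ (lebesgue_measure `[- (M + 1), M + 1]%classic)).
      apply: le_measure; rewrite ?inE//; first exact: measurableJ.
      have M1 : M < M + 1 by rewrite ltrDl.
      by move=> s /(hM (M + 1) M1); rewrite /= in_itv /= -ler_norml.
    by rewrite lebesgue_measure_itv /=; case: ifP => _; rewrite -?EFinD ltry.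
  - by move=> i; exact: measurableJ.
  - by rewrite JE.
  - by move=> m n mn; apply/subsetPset; apply: J_mono; rewrite lef_pV2 ?posrE// ler_nat.
have H : (lebesgue_measure (dot e @` K) <= hausdorff1 K)%E.
  by apply: (lebesgue_projection_le e1 Pm) => _ [y Ky <-]; exists y.
have fH : hausdorff1 K \is a fin_num by rewrite ge0_fin_numE// hausdorff1_ge0.
have : (lebesgue_measure (dot e @` K) < (fine (hausdorff1 K) + d)%:E)%E.
  by rewrite (le_lt_trans H)// -{1}(fineK fH) lte_fin ltrDl.
move=> Hd; have [n _ hn] := cv _ (open_nbhs_nbhs (conj (@open_ereal_lt_ereal _ _) Hd)).
have {hn} Jn : (lebesgue_measure (J n.+1%:R^-1) < (fine (hausdorff1 K) + d)%:E)%E.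
  by apply: (hn n) => /=; exact: leqnn.
exists (Num.min (rho / 4) n.+1%:R^-1); first by rewrite lt_min divr_gt0//= invr_gt0.
move=> t /andP[t0]; rewrite lt_min => /andP[tr tn].
pose ne : R * R := (e.1, - e.2).
have ne1 : dot ne ne = 1 by rewrite -e1 /ne /dot /=; ring.
have neE x : rot ne (rot e x) = x by exact: rotK.
have [mS ES] := plane_measure_rot ne1 (measurable_tube t).
have ET : rot e @^-1` (rot ne @^-1` tube t) = tube t.
  by rewrite /preimage; apply/funext => x /=; rewrite neE.
have [_ <-] := plane_measure_rot ne1 (measurable_tube t).
have enE x : rot e (rot ne x) = x by exact: rotVK.
have c0 : 0 <= t * (1 + eps) := mulr_ge0 (ltW t0) (addr_ge0 ler01 (ltW eps0)).
apply: le_trans (fibre_measure_le c0 mS (measurableJ t) _ _) _.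
- move=> x /= tx; have [y Ky xy] := nearest (rot ne x).
  clear Hd Jn cv; exists (y, x.1 - dot e y) => /=; last by rewrite addrC subrK.
  split; first exact: Ky.
  have -> : x.1 = dot e (rot ne x) by rewrite -[in LHS](enE x).
  have -> : dot e (rot ne x) - dot e y = dot e (rot ne x - y) by rewrite /dot /=; ring.
  rewrite in_itv /= -ler_norml; apply: le_trans (ler_dot _ _) _.
  by rewrite /enorm e1 sqrtr1 mul1r -/(enorm _) -enorm_dist -xy; case: tx.
- clear Hd Jn cv; move=> x y /= tx ty xy; have := @fibre t _ _ tr tx ty.
  have d1E z : dot e (rot ne z) = z.1 := congr1 fst (enE z).
  have c1E z : cross e (rot ne z) = z.2 := congr1 snd (enE z).
  by rewrite !d1E !c1E; apply.
rewrite [leRHS]EFinM; apply: lee_wpmul2l; first by rewrite lee_fin.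
apply: le_trans (ltW Jn); apply: le_measure; [rewrite inE; exact: measurableJ|rewrite inE; exact: measurableJ|].
exact: (J_mono (ltW tn)).
Qed.

End tube_piece.

Section generic_line.
Import finmap.
Context {R : realType}.
Implicit Types (S : set (R * R)) (f : R * R -> R).

Local Notation lengthT := (caratheodory_type (@hausdorff1_outer R)).

(* Only countably many level sets of f can have positive length. *)
Lemma generic_line S f (a b : R) : closed S -> continuous f ->
  (hausdorff1 S < +oo)%E -> a < b ->
  exists2 t, a < t < b & hausdorff1 (S `&` [set x | f x = t]) = 0%E.
Proof.
move=> cS cf fS ab; apply: contrapT => no.
have pos t : a < t < b -> (0 < hausdorff1 (S `&` [set x | f x = t]))%E.
  move=> tab; rewrite lt0e hausdorff1_ge0 andbT; apply/eqP => h0; apply: no.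
  by exists t.
have fin X : X `<=` S -> hausdorff1 X \is a fin_num.
  by move=> XS; rewrite ge0_fin_numE ?hausdorff1_ge0// (le_lt_trans (le_hausdorff1 XS)).
pose E t := S `&` [set x | f x = t].
have cE t : closed (E t).
  apply: closedI => //; apply: (@closed_comp _ _ f [set t]); last exact: closed_eq.
  by move=> x _; exact: cf.
have finA m : finite_set [set t | a < t < b /\ m.+1%:R^-1 <= fine (hausdorff1 (E t))].
  apply: contrapT => infA.
  pose n := (Num.truncn (fine (hausdorff1 S) * m.+1%:R)).+1.
  have [B BA nB] := infinite_set_fset n infA.
  have tB : trivIset [set` B] (fun t => (E t : set lengthT)).
    by move=> t t' _ _ [x [[_ <-] [_ <-]]].
  have mB t : t \in B -> measurable (E t : set lengthT).
    by move=> _; exact: closed_length_measurable.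
  have := @measure_fbigsetU _ _ _ (@length_measure R) _ _ _ mB tB; move=> mE.
  have H1 : ((n%:R * m.+1%:R^-1)%:E <= hausdorff1 S)%E.
    apply: (@le_trans _ _ (length_measure (\big[setU/set0]_(i <- B) E i))); last first.
      apply: le_hausdorff1 => x; rewrite -bigcup_fset => -[t _] [].
      by [].
    rewrite mE; apply: (@le_trans _ _ (\sum_(t <- B) (m.+1%:R^-1)%:E)%E).
      rewrite sumEFin lee_fin big_const_seq count_predT iter_addr addr0 -[leRHS]mulr_natl.
      by rewrite ler_wpM2r ?invr_ge0// ler_nat.
    rewrite big_seq [leRHS]big_seq; apply: lee_sum => t tB'.
    have [_ h] := BA t tB'; rewrite -[leRHS]fineK; last by apply: fin => x [].
    by rewrite lee_fin.
  move: H1; rewrite -[leRHS]fineK; last by apply: fin.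
  rewrite lee_fin ler_pdivrMr// leNgt => /negP; apply.
  have := truncnS_gt (fine (hausdorff1 S) * m.+1%:R); exact.
have cnt : countable `]a, b[%classic.
  apply: (@sub_countable _ _ _ (\bigcup_m [set t | a < t < b /\ m.+1%:R^-1 <= fine (hausdorff1 (E t))])).
    apply: subset_card_le => t; rewrite /= in_itv /= => tab.
    have := pos t tab; rewrite -[X in (0 < X)%E]fineK; last by apply: fin => x [].
    rewrite lte_fin => /ltr_add_invr[m]; rewrite add0r => /ltW hm.
    by exists m.
  by apply: bigcup_countable => // m _; exact: finite_set_countable.
have := countable_lebesgue_measure0 cnt.
rewrite lebesgue_measure_itv /= lte_fin ab -EFinD => /eqP; rewrite eqe subr_eq0 => /eqP E0.
by move: ab; rewrite E0 ltxx.
Qed.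

End generic_line.

Lemma integral_cover (R : realType) (T : finType) d (X : measurableType d)
    (mu : {measure set X -> \bar R}) (D : set X) (E : T -> set X) (f : X -> \bar R) :
  d.-measurable D -> (forall c, d.-measurable (E c)) -> measurable_fun setT f ->
  (forall x, 0 <= f x)%E -> (forall x, D x -> exists c, E c x) ->
  (\int[mu]_(x in D) f x <= \sum_(c : T) \int[mu]_(x in E c) f x)%E.
Proof.
move=> mD mE mf f0 DE.
have mfS S : measurable_fun S f by apply: (measurable_funS measurableT).
apply: (@le_trans _ _ (\int[mu]_(x in \big[setU/set0]_(c : T) E c) f x)%E).
  apply: ge0_subset_integral => //.
    by apply: bigsetU_measurable => c _; exact: mE.
  by move=> x /DE[c Ecx]; rewrite -bigcup_seq; exists c => //=; exact: mem_index_enum.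
elim: (index_enum T) => [|c s IH]; first by rewrite !big_nil integral_set0.
rewrite !big_cons; set U := \big[setU/set0]_(c <- s) E c in IH *.
have mU : measurable U by apply: bigsetU_measurable => *; exact: mE.
rewrite -(setDUK (@subsetUl _ (E c) U)).
have mUE : d.-measurable ((E c `|` U) `\` E c).
  by apply: measurableD => //; exact: measurableU.
rewrite ge0_integral_setU//; last first.
  by apply/disj_setPS => x [? []].
apply: leeD => //; apply: le_trans IH; apply: ge0_subset_integral => //.
by move=> x [[]].
Qed.

Lemma integral_disjoint_ge (R : realType) (T : finType) d (X : measurableType d)
    (mu : {measure set X -> \bar R}) (S : set X) (E : T -> set X) (f : X -> \bar R)
    (v : T -> R) :
  d.-measurable S -> (forall c, d.-measurable (E c)) -> measurable_fun S f ->
  (forall x, 0 <= f x)%E -> (forall c, E c `<=` S) ->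
  (forall c c' x, E c x -> E c' x -> c = c') ->
  (forall c x, E c x -> (v c)%:E <= f x)%E -> (forall c, 0 <= v c) ->
  (\sum_c ((v c)%:E * mu (E c)) <= \int[mu]_(x in S) f x)%E.
Proof.
move=> mS mE mf f0 ES dE vf v0.
pose U := \big[setU/set0]_(c <- index_enum T) E c.
have mU : measurable U by apply: bigsetU_measurable => c _; exact: mE.
have US : U `<=` S by rewrite /U -bigcup_seq => x [c _ /ES].
apply: (@le_trans _ _ (\int[mu]_(x in U) f x)%E); last exact: ge0_subset_integral.
rewrite /U ge0_integral_bigsetU//; last 3 first.
- exact: index_enum_uniq.
- by move=> c c' _ _ [x [h1 h2]]; exact: dE h1 h2.
- exact: measurable_funS mf.
apply: lee_sum => c _; rewrite -integral_cst//; apply: ge0_le_integral => //.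
- by move=> x _; rewrite lee_fin.
- exact: measurable_funS mf.
- by move=> x Ex; exact: vf.
Qed.

Section tube_integral.
Context {R : realType}.
Implicit Types (Omega : set (R * R)) (f : R * R -> R) (x y p q w : R * R).

Local Notation lengthT := (caratheodory_type (@hausdorff1_outer R)).

(** For small eps the cone is nearly a half-plane, and one direction e serves all boundary points
    near p. Estimates of tubes rely on this property instead of differentiability. *)
Definition outer_cone Omega := forall eps p, 0 < eps -> boundary Omega p ->
  exists e (rho : R), [/\ dot e e = 1, 0 < rho & forall y w, boundary Omega y ->
    edist y p < rho -> enorm w < rho -> cross e w < - eps * `|dot e w| ->
    ~ Omega (y + w)].

Lemma closed_boundary Omega : open Omega -> closed (boundary Omega).
Proof.
move=> oO; rewrite /boundary setDE; apply: closedI; first exact: closed_closure.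
by apply: open_closedC; exact: open_interior.
Qed.

Lemma closure_bounded X : bounded_set X -> bounded_set (closure (X : set (R * R))).
Proof.
move=> bX; have [M M0 XM] := bounded_box bX.
exists M; split; first exact: num_real.
move=> N MN x; have cB : closed (`[-M, M] `*` `[-M, M] : set (R * R)).
  by apply: compact_closed; [exact: norm_hausdorff|apply: compact_setX; exact: segment_compact].
have XB : X `<=` `[-M, M] `*` `[-M, M].
  by move=> y /XM[h1 h2]; split; rewrite /= in_itv /= -ler_norml.
move=> /(closure_subset XB); rewrite -(closure_id _).1// => -[].
rewrite /= !in_itv /= -!ler_norml prod_normE ge_max => h1 h2.
by rewrite !(le_trans _ (ltW MN)).
Qed.

Lemma compact_boundary Omega : open Omega -> bounded_set Omega ->
  compact (boundary Omega).
Proof.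
move=> oO bO; apply: closed_bounded_compact; first exact: closed_boundary.
by apply: (sub_bounded _ (closure_bounded bO)) => x [].
Qed.

Lemma nearest_boundary Omega x : open Omega -> bounded_set Omega -> Omega x ->
  exists2 z, boundary Omega z & bdist Omega x = edist x z.
Proof.
move=> oO bO Ox; have [z Oz xz] := bdist_attained x oO (setC_bounded bO).
exists z => //; split; last first.
  by rewrite ((interior_id Omega).1 oO).
move=> B /nbhs_edist[r r0 rB].
have xz0 : 0 < edist x z by rewrite -xz; exact: bdist_in.
pose s := Num.min (1 / 2) (r / (2 * edist x z)).
have s0 : 0 < s by rewrite lt_min !divr_gt0// mulr_gt0.
have s1 : s < 1 by rewrite gt_min ltr_pdivrMr// mul1r ltr1n.
have sr : s * edist x z < r.
  apply: (@le_lt_trans _ _ (r / 2)); last by rewrite ltr_pdivrMr// ltr_pMr// ltr1n.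
  rewrite -ler_pdivlMr// ge_min; apply/orP; right.
  by rewrite invfM mulrA.
exists (z + s *: (x - z)); split.
  apply: (@bdist_gt _ _ x ((1 - s) * edist x z)).
    by rewrite xz gtr_pMl// gtrBl.
  rewrite !enorm_dist [X in enorm X](_ : _ = (1 - s) *: (x - z)); last first.
    by apply: pair_eq; rewrite /= /GRing.scale /=; ring.
  by rewrite enormZ ger0_norm// subr_ge0 ltW.
apply: rB; rewrite enorm_dist [X in enorm X](_ : _ = - (s *: (x - z))); last first.
  by apply: pair_eq; rewrite /= /GRing.scale /=; ring.
by rewrite enormN enormZ gtr0_norm// -enorm_dist.
Qed.


Lemma generic_grid S f (M h : R) : closed S -> continuous f ->
  (hausdorff1 S < +oo)%E -> (forall x, S x -> `|f x| <= M) -> 0 < h ->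
  exists (N : nat) (t : nat -> R),
  [/\ forall i j, (i < j)%N -> t i < t j, forall i, t i.+1 - t i < 2 * h,
      forall i, hausdorff1 (S `&` [set x | f x = t i]) = 0%E &
      forall x, S x -> exists2 i, (i < N)%N & t i <= f x <= t i.+1].
Proof.
move=> cS cf fS SM h0.
pose c (i : nat) : R := - M - h + i%:R * h.
have cS' i : c i.+1 = c i + h by rewrite /c -natr1 mulrDl mul1r addrA.
have /choice[t ht] : forall i, exists t, c i < t < c i.+1 /\
    hausdorff1 (S `&` [set x | f x = t]) = 0%E.
  move=> i; have ci : c i < c i.+1 by rewrite cS' ltrDl.
  by have [t h1 h2] := generic_line cS cf fS ci; exists t.
have ct i : c i < t i < c i + h by have [] := ht i; rewrite cS'.
have tS i : t i < t i.+1.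
  by have := ct i; have := ct i.+1; rewrite cS' => /andP[h1 _] /andP[_ h2]; exact: lt_trans h1.
exists (Num.truncn ((2 * M + h) / h)).+1, t; split.
- move=> i j; elim: j => // j IH; rewrite ltnS leq_eqVlt => /orP[/eqP ->//|/IH h1].
  exact: lt_trans (tS j).
- move=> i; have := ct i; have := ct i.+1; rewrite cS'; lra.
- by move=> i; have [] := ht i.
move=> x /SM; rewrite ler_norml => /andP[x1 x2].
have y0 : 0 <= (f x + M + h) / h by rewrite divr_ge0 ?(ltW h0)//; lra.
have := truncn_itv y0; set k := Num.truncn _ => /andP[k1 k2].
rewrite ler_pdivlMr// in k1; rewrite -natr1 ltr_pdivrMr// mulrDl mul1r in k2.
have k0 : (0 < k)%N by rewrite lt0n; apply/eqP => E; move: k2; rewrite E mul0r; lra.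
have kN : (k <= Num.truncn ((2 * M + h) / h))%N.
  by apply: le_truncn; rewrite ler_pM2r ?invr_gt0//; lra.
have ck : c k <= f x < c k + h by rewrite /c; lra.
have [tk|tk] := leP (t k) (f x).
  exists k; first by rewrite ltnS.
  by rewrite tk /=; have := ct k.+1; rewrite cS'; lra.
exists k.-1; first by rewrite ltnS (leq_trans (leq_pred _)).
rewrite prednK// (ltW tk) andbT; have := ct k.-1; rewrite -cS' prednK//; lra.
Qed.

Lemma length_rint_ge S (T : finType) (K0 : T -> set (R * R)) f (v : T -> R) :
  closed S -> (hausdorff1 S < +oo)%E -> continuous f -> (forall x, 0 <= f x) ->
  length_measure.-integrable (S : set lengthT) (EFin \o f) ->
  (forall c, measurable (K0 c : set lengthT)) -> (forall c, K0 c `<=` S) ->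
  (forall c c' x, K0 c x -> K0 c' x -> c = c') ->
  (forall c x, K0 c x -> v c <= f x) -> (forall c, 0 <= v c) ->
  \sum_c v c * fine (hausdorff1 (K0 c)) <= \int[length_measure]_(x in S) f x.
Proof.
move=> cS fS cf f0 fi mK KS dK vf v0.
have mfS : measurable_fun (S : set lengthT) (EFin \o f : lengthT -> \bar R).
  by apply/measurable_EFinP; apply: continuous_length_measurable.
have fin c : hausdorff1 (K0 c) \is a fin_num.
  by rewrite ge0_fin_numE ?hausdorff1_ge0// (le_lt_trans (le_hausdorff1 (@KS c))).
have mS : measurable (S : set lengthT) by exact: closed_length_measurable.
rewrite -lee_fin /Rintegral fineK; last exact: integrable_fin_num.
rewrite -sumEFin; under eq_bigr do rewrite EFinM fineK//.
have vf' c x : K0 c x -> ((v c)%:E <= (EFin \o f) x)%E by move=> Kx; rewrite lee_fin vf.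
have f0' x : (0 <= (EFin \o f) x)%E by rewrite lee_fin.
exact: (@integral_disjoint_ge R T _ lengthT (@length_measure R) S K0 (EFin \o f) v mS mK mfS f0' KS dK vf' v0).
Qed.

(* f is nearly constant on the pieces of boundary cut out by a fine grid whose
   lines carry no length, and tube_piece applies to each of them. *)
Lemma tube_integral Omega f (d : R) : open Omega -> bounded_set Omega ->
  outer_cone Omega -> (hausdorff1 (boundary Omega) < +oo)%E ->
  continuous f -> (forall x, 0 <= f x) -> 0 < d ->
  exists2 t0 : R, 0 < t0 & forall t, 0 < t < t0 ->
  (\int[plane_measure]_(x in Omega `&` [set x | (bdist Omega x <= t)%R]) (f x)%:E <=
   (t * (\int[length_measure]_(x in boundary Omega) f x + d))%:E)%E.
Proof.
move=> oO bO coneO fH cf f0 d0; set S := boundary Omega.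
have cS : closed S by exact: closed_boundary.
have kS : compact S by exact: compact_boundary.
have mf A : measurable_fun A f.
  by apply: measurable_funTS; exact: continuous_plane_measurable.
have mS : measurable (S : set lengthT) by exact: closed_length_measurable.
have bS : bounded_set S by exact: compact_bounded.
have [M M0 SM] := bounded_box bS.
set I := \int[length_measure]_(x in S) f x; set H := fine (hausdorff1 S).
have H0 : 0 <= H by rewrite fine_ge0// hausdorff1_ge0.
have fi : length_measure.-integrable (S : set lengthT) (EFin \o f).
  have [B SB] : exists B, forall x, S x -> f x <= B.
    have [->|/set0P S0] := eqVneq S set0; first by exists 0.
    have [c _ hc] := compact_EVT_max S0 kS (continuous_subspaceT cf).
    by exists (f c) => x Sx; apply: hc; exact: mem_set.
  apply: measurable_bounded_integrable => //; first exact: continuous_length_measurable.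
  exists B; split; first exact: num_real.
  by move=> N BN x Sx; rewrite /= ger0_norm//; apply: le_trans (ltW BN); exact: SB.
have I0 : 0 <= I by apply: Rintegral_ge0 => x _; exact: f0.
(* Chosen for (1 + e) (I + 2 e H) <= I + d / 2; the factor 1 + e comes from the cones, the term 2 e
   from the oscillation of f on a cell. *)
pose e := Num.min 1 (d / (2 * (I + 4 * H + 1))).
have D0 : 0 < I + 4 * H + 1 by rewrite ltr_wpDl// addr_ge0// mulr_ge0.
have e0 : 0 < e by rewrite lt_min ltr01 divr_gt0// mulr_gt0.
have e1 : e <= 1 by rewrite ge_min lexx.
have eI : (1 + e) * (I + 2 * e * H) <= I + d / 2.
  have h1 : e * (I + 4 * H + 1) <= d / 2.
    by rewrite -ler_pdivlMr// -[leRHS]mulrA -invfM ge_min lexx orbT.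
  have : e * H * e <= e * H * 1 by rewrite ler_wpM2l// mulr_ge0// ltW.
  nra.
pose G p (r : R) := S p /\ (exists2 u, dot u u = 1 & forall y w, S y ->
    edist y p < r -> enorm w < r -> cross u w < - e * `|dot u w| -> ~ Omega (y + w))
  /\ (forall y, edist y p < r -> `|f y - f p| <= e).
have [p Sp|h h0 hG] := @lebesgue_number _ S G kS.
  have [u [r [u1 r0 hu]]] := coneO e p e0 Sp.
  have /cvgrPdist_le /(_ e e0) /nbhs_edist[r' r'0 hf] := cf p.
  exists (Num.min r r'); first by rewrite lt_min r0.
  split=> //; split.
    exists u => // y w Sy; rewrite !lt_min => /andP[yr _] /andP[wr _].
    exact: hu.
  move=> y; rewrite lt_min => /andP[_ yr]; rewrite distrC; apply: hf.
  by rewrite edist_sym.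
have h16 : 0 < h / 16 by rewrite divr_gt0.
have c1 : continuous (fst : R * R -> R) by move=> x; exact: cvg_fst.
have c2 : continuous (snd : R * R -> R) by move=> x; exact: cvg_snd.
have [N1 [t1 [t1m t1h t10 t1S]]] := generic_grid cS c1 fH (fun x Sx => (SM x Sx).1) h16.
have [N2 [t2 [t2m t2h t20 t2S]]] := generic_grid cS c2 fH (fun x Sx => (SM x Sx).2) h16.
pose T := ('I_N1 * 'I_N2)%type.
(* The closed cells cover S and the open ones are disjoint; both have the same length, since the
   grid lines carry none. *)
pose K (c : T) := S `&` [set x | t1 c.1 <= x.1 <= t1 c.1.+1 /\ t2 c.2 <= x.2 <= t2 c.2.+1].
pose K0 (c : T) := S `&` [set x | t1 c.1 < x.1 < t1 c.1.+1 /\ t2 c.2 < x.2 < t2 c.2.+1].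
have KS c : K c `<=` S by move=> x [].
have K0S c : K0 c `<=` S by move=> x [].
have KE c : (hausdorff1 (K c) <= hausdorff1 (K0 c))%E.
  pose L1 i := S `&` [set x | x.1 = t1 i]; pose L2 i := S `&` [set x | x.2 = t2 i].
  have sub : K c `<=` K0 c `|` (L1 c.1 `|` (L1 c.1.+1 `|` (L2 c.2 `|` L2 c.2.+1))).
    move=> x [Sx [/andP[a1 a2] /andP[b1 b2]]].
    have [E1|n1] := eqVneq x.1 (t1 c.1); first by right; left.
    have [E2|n2] := eqVneq x.1 (t1 c.1.+1); first by right; right; left.
    have [E3|n3] := eqVneq x.2 (t2 c.2); first by right; right; right; left.
    have [E4|n4] := eqVneq x.2 (t2 c.2.+1); first by right; right; right; right.
    left; split => //=; rewrite !lt_neqAle a1 a2 b1 b2 n2 n4.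
    by rewrite eq_sym n1 eq_sym n3.
  apply: le_trans (le_hausdorff1 sub) _.
  have drop (A B : set (R * R)) : hausdorff1 B = 0%E -> (hausdorff1 (A `|` B) <= hausdorff1 A)%E.
    by move=> B0; apply: le_trans (hausdorff1U A B) _; rewrite B0 adde0.
  have negl (A B : set (R * R)) : hausdorff1 A = 0%E -> hausdorff1 B = 0%E -> hausdorff1 (A `|` B) = 0%E.
    move=> A0 B0; apply/eqP; rewrite eq_le hausdorff1_ge0 andbT -A0; exact: drop.
  exact: (drop _ _ (negl _ _ (t10 _) (negl _ _ (t10 _) (negl _ _ (t20 _) (t20 _))))).
have cK c : closed (K c).
  apply: closedI => //; rewrite (_ : [set x | _] = `[t1 c.1, t1 c.1.+1] `*` `[t2 c.2, t2 c.2.+1]).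
    by apply: compact_closed; [exact: norm_hausdorff|apply: compact_setX; exact: segment_compact].
  by apply/seteqP; split => x; rewrite /= !in_itv.
have kK c : compact (K c) by apply: (subclosed_compact _ kS).
have mK0 c : measurable (K0 c : set lengthT).
  apply: measurableI => //; apply: open_length_measurable.
  rewrite (_ : [set x | _] = fst @^-1` `]t1 c.1, t1 c.1.+1[ `&` snd @^-1` `]t2 c.2, t2 c.2.+1[).
    by apply: openI; apply: open_comp; [move=> ? _|exact: itv_open|move=> ? _|exact: itv_open].
  by apply/seteqP; split => x; rewrite /= !in_itv.
have K_small c x y : K c x -> K c y -> edist x y < h / 2.
  move=> [_ [/andP[a1 a2] /andP[b1 b2]]] [_ [/andP[a3 a4] /andP[b3 b4]]].
  rewrite enorm_dist; apply: le_lt_trans (enorm_le_norm _) _.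
  have l1 : `|x.1 - y.1| <= h / 8 by have := t1h c.1; rewrite ler_norml; lra.
  have l2 : `|x.2 - y.2| <= h / 8 by have := t2h c.2; rewrite ler_norml; lra.
  by rewrite /=; lra.
pose n : R := #|{: T}|%:R.
have n0 : 0 <= n by rewrite ler0n.
pose E (c : T) t := [set x | K c !=set0 /\ tube Omega (K c) t x].
have mE c t : measurable (E c t).
  have [K00|/set0P Kn] := eqVneq (K c) set0.
    by rewrite (_ : E c t = set0)// -subset0 => x []; rewrite K00 => -[].
  rewrite (_ : E c t = tube Omega (K c) t); first exact: measurable_tube.
  by apply/seteqP; split => x; [case|].
(* Each cell yields a value close to f and a threshold for t below which [tube_piece] applies; the
   errors of the n cells add up to at most d / 2. *)
have cell c : exists vt : R * R, [/\ 0 <= vt.1, forall x, K0 c x -> vt.1 <= f x + 2 * e, 0 < vt.2 &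
    forall t, 0 < t < vt.2 -> (\int[plane_measure]_(x in E c t) (f x)%:E <=
      (t * ((1 + e) * (vt.1 * fine (hausdorff1 (K0 c))) + d / (2 * (n + 1))))%:E)%E].
  have Hc0 : 0 <= fine (hausdorff1 (K0 c)) by rewrite fine_ge0// hausdorff1_ge0.
  have dn : 0 < d / (2 * (n + 1)) by rewrite divr_gt0// mulr_gt0// ltr_wpDl.
  have [K00|/set0P Kn] := eqVneq (K c) set0.
    exists (0, 1); split => //=; first by move=> x _; rewrite addr_ge0// mulr_ge0// ltW.
    move=> t /andP[t0 _]; rewrite (_ : E c t = set0) ?integral_set0; last first.
      by rewrite -subset0 => x []; rewrite K00 => -[].
    by rewrite lee_fin mul0r mulr0 add0r mulr_ge0// ltW.
  have [q Kq] := Kn; have [p [s [[Sp [[u u1 hu] hf]] ps]]] := hG q (@KS c _ Kq).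
  have near y : edist y q < h -> edist y p < s.
    by move=> yq; have := edist_triangle y q p; lra.
  have hs : h <= s by have := edist_ge0 q p; lra.
  have v0 : 0 < f p + e by rewrite ltr_wpDl.
  have cone y w : K c y -> enorm w < h -> cross u w < - e * `|dot u w| -> ~ Omega (y + w).
    move=> Ky wh; apply: hu; [exact: KS Ky| |exact: lt_le_trans hs].
    by apply: near; have := K_small c y q Ky Kq; lra.
  have Kfin : (hausdorff1 (K c) < +oo)%E by apply: le_lt_trans fH; exact: le_hausdorff1.
  pose d' := d / (2 * (n + 1)) / ((1 + e) * (f p + e)).
  have d'0 : 0 < d' by rewrite divr_gt0// mulr_gt0// addr_gt0.
  have [t0 t00 ht0] := tube_piece oO (@kK c) Kn u1 e0 Kfin cone (K_small c) d'0.
  exists (f p + e, Num.min t0 (h / 2)); split; rewrite /= ?(ltW v0)//.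
  - move=> x [Sx [/andP[a1 a2] /andP[b1 b2]]].
    have /hf : edist x p < s.
      have Kx : K c x by split => //=; rewrite !ltW.
      by apply: near; have := K_small c x q Kx Kq; lra.
    by rewrite ler_norml => /andP[]; lra.
  - by rewrite lt_min t00 divr_gt0.
  move=> t /andP[tt0]; rewrite lt_min => /andP[tt th].
  apply: (@le_trans _ _ (\int[plane_measure]_(x in E c t) (f p + e)%:E)%E).
    apply: ge0_le_integral => //; first exact: mE.
    - by move=> x _; rewrite lee_fin.
    - by apply/measurable_EFinP; exact: mf.
    move=> x [_ [Ox /= xt]]; rewrite lee_fin.
    have [y Ky yE] : exists2 y, K c y & bdist (~` K c) x = edist x y.
      have KCC : ~` ~` K c !=set0 by rewrite setCK.
      have [y ny ->] := bdist_attained x (closed_openC (@cK c)) KCC.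
      by exists y => //; apply: contrapT.
    have /hf : edist x p < s.
      apply: near; have := edist_triangle x y q; have := K_small c y q Ky Kq.
      by rewrite -yE; lra.
    by rewrite ler_norml => /andP[]; lra.
  rewrite integral_cst; last exact: mE.
  apply: (@le_trans _ _ ((f p + e)%:E * plane_measure (tube Omega (K c) t))%E).
    apply: lee_wpmul2l; first by rewrite lee_fin ltW.
    have bT : bounded_set (tube Omega (K c) t) by apply: (sub_bounded _ bO) => x [].
    have mT : measurable (tube Omega (K c) t) by exact: measurable_tube.
    have ET : E c t `<=` tube Omega (K c) t by move=> x [].
    rewrite -[leLHS]/(plane_measure (E c t)) (areaE (mE c t) (sub_bounded ET bT)) (areaE mT bT).
    by rewrite lee_fin; apply: le_area.
  apply: (@le_trans _ _ ((f p + e)%:E * (t * (1 + e) * (fine (hausdorff1 (K c)) + d'))%:E)%E).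
    apply: lee_wpmul2l; first by rewrite lee_fin ltW.
    by apply: ht0; rewrite tt0.
  rewrite -EFinM lee_fin.
  have -> : (f p + e) * (t * (1 + e) * (fine (hausdorff1 (K c)) + d')) =
      t * ((1 + e) * ((f p + e) * fine (hausdorff1 (K c))) + (1 + e) * (f p + e) * d') by ring.
  rewrite ler_pM2l// lerD//; last by rewrite /d' mulrC divfK// gt_eqF// mulr_gt0// addr_gt0.
  rewrite ler_pM2l ?addr_gt0// ler_pM2l//; apply: fine_le; last exact: KE.
    by rewrite ge0_fin_numE// hausdorff1_ge0.
  rewrite ge0_fin_numE ?hausdorff1_ge0//; apply: le_lt_trans fH; exact: le_hausdorff1.
have [vt hvt] := choice cell.
have sumv : \sum_c (vt c).1 * fine (hausdorff1 (K0 c)) <= I + 2 * e * H.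
  have fi2 : length_measure.-integrable (S : set lengthT) (EFin \o cst (2 * e)).
    apply: measurable_bounded_integrable => //.
    exists (2 * e); split; first exact: num_real.
    by move=> N BN x _; rewrite /= ger0_norm ?(ltW BN)// mulr_ge0// ltW.
  have -> : I + 2 * e * H = \int[length_measure]_(x in S) (f x + 2 * e).
    by rewrite RintegralD// Rintegral_cst.
  apply: length_rint_ge => //.
  - by move=> x; apply: cvgD; [exact: cf|exact: cvg_cst].
  - by move=> x; rewrite addr_ge0// mulr_ge0// ltW.
  - have := integrableD mS fi fi2; exact: eq_integrable.
  - move=> c c' x [_ [/andP[a1 a2] /andP[b1 b2]]] [_ [/andP[a3 a4] /andP[b3 b4]]].
    have inc (t : nat -> R) (tm : forall i j, (i < j)%N -> t i < t j) i j (y : R) :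
        t i < y -> y < t i.+1 -> t j < y -> y < t j.+1 -> i = j.
      move=> y1 y2 y3 y4.
      have tle a b : (a <= b)%N -> t a <= t b.
        by rewrite leq_eqVlt => /orP[/eqP->//|/tm/ltW].
      have [ij|ij|//] := ltngtP i j.
        by have := tle _ _ ij; rewrite leNgt (lt_trans y3 y2).
      by have := tle _ _ ij; rewrite leNgt (lt_trans y1 y4).
    case: c c' a1 a2 b1 b2 a3 a4 b3 b4 => i j [i' j'] /= a1 a2 b1 b2 a3 a4 b3 b4.
    congr pair; apply/val_inj; first exact: (inc t1 t1m _ _ x.1).
    exact: (inc t2 t2m _ _ x.2).
  - by move=> c x; have [] := hvt c => _ + _ _; apply.
  - by move=> c; have [] := hvt c.
exists (\big[Num.min/1]_c (vt c).2).
  by apply: lt_bigmin => [|c _]; [exact: ltr01|have [] := hvt c].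
move=> t /andP[t0 tlt].
have tc c : 0 < t < (vt c).2.
  by rewrite t0 (lt_le_trans tlt)// bigmin_le_cond.
have mD : measurable (Omega `&` [set x | bdist Omega x <= t]).
  apply: measurableI; first exact: open_plane_measurable.
  apply: closed_plane_measurable.
  apply: (@closed_comp _ _ (bdist Omega) [set s | s <= t]); last exact: closed_le.
  by move=> x _; exact: continuous_bdist.
apply: (@le_trans _ _ (\sum_c \int[plane_measure]_(x in E c t) (f x)%:E)%E).
  have mfT : measurable_fun setT (EFin \o f) by apply/measurable_EFinP; exact: mf.
  have f0' x : (0 <= (EFin \o f) x)%E by rewrite lee_fin.
  have IC := @integral_cover R T _ _ (@lebesgue_measure R \x @lebesgue_measure R)%E
    (Omega `&` [set x | bdist Omega x <= t]) (fun c => E c t) (EFin \o f).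
  apply: (IC mD (fun c => mE c t) mfT f0').
  move=> x [Ox /= xt]; have [z Sz xz] := nearest_boundary oO bO Ox.
  have [i iN hi] := t1S z Sz; have [j jN hj] := t2S z Sz.
  have Kz : K (Ordinal iN, Ordinal jN) z by split.
  exists (Ordinal iN, Ordinal jN); split; first by exists z.
  split => //=; apply: le_trans xt; rewrite xz; apply: bdist_le.
  by move=> /(_ Kz).
apply: (@le_trans _ _ (\sum_c (t * ((1 + e) * ((vt c).1 * fine (hausdorff1 (K0 c))) + d / (2 * (n + 1))))%:E)%E).
  by apply: lee_sum => c _; have [_ _ _] := hvt c; apply.
rewrite sumEFin lee_fin -mulr_sumr ler_pM2l// big_split /= -mulr_sumr.
rewrite (_ : \sum_(c : T) d / (2 * (n + 1)) = n * (d / (2 * (n + 1)))); last by rewrite sumr_const -[LHS]mulr_natl.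
have h1 : n * (d / (2 * (n + 1))) <= d / 2.
  have n1 : n + 1 != 0 by rewrite gt_eqF// ltr_wpDl.
  have -> : n * (d / (2 * (n + 1))) = d / 2 * (n / (n + 1)) by field.
  by rewrite ger_pMr ?divr_gt0// ler_pdivrMr ?ltr_wpDl// mul1r lerDl.
have h2 : (1 + e) * \sum_c (vt c).1 * fine (hausdorff1 (K0 c)) <= (1 + e) * (I + 2 * e * H).
  by rewrite ler_pM2l// addr_gt0.
by apply: le_trans (lerD h2 h1) _; apply: le_trans (lerD eI (lexx _)) _; lra.
Qed.

End tube_integral.

(** * Finite length and outer cones of graphs *)

Section curves.
Context {R : realType}.
Implicit Types (g : R -> R * R) (A S : set (R * R)).

Lemma hausdorff1_curve g (a b C : R) : continuous g -> a <= b -> 0 <= C ->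
  (forall s t, a <= s <= b -> a <= t <= b -> edist (g s) (g t) <= C * `|s - t|) ->
  (hausdorff1 (g @` `[a, b]) <= (C * (b - a))%:E)%E.
Proof.
move=> cg ab C0 gC; apply: hausdorff1_le => d d0.
pose N := (Num.truncn (C * (b - a) / d)).+1.
pose w := (b - a) / N%:R.
have N0 : 0 < N%:R :> R by rewrite ltr0n.
have w0 : 0 <= w by rewrite divr_ge0// subr_ge0.
have Nw : N%:R * w = b - a by rewrite mulrC divfK// gt_eqF.
have wd : C * w <= d.
  have := truncnS_gt (C * (b - a) / d); rewrite -/N ltr_pdivrMr// => h.
  by rewrite -(ler_pM2l N0) mulrCA Nw ltW.
exists N, (fun k => if (k < N)%N then g @` `[a + k%:R * w, a + k.+1%:R * w] else set0), (fun=> C * w).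
have inab k t : (k < N)%N -> a + k%:R * w <= t <= a + k.+1%:R * w -> a <= t <= b.
  move=> kN /andP[t1 t2].
  have k0 : 0 <= k%:R * w by rewrite mulr_ge0.
  have kb : k.+1%:R * w <= N%:R * w by rewrite ler_wpM2r// ler_nat.
  by move: kb; rewrite Nw; lra.
split.
- move=> k; case: ifP => // _; apply: closed_plane_measurable.
  apply: compact_closed; first exact: norm_hausdorff.
  by apply: continuous_compact; [exact: continuous_subspaceT|exact: segment_compact].
- move=> _ [t /= + <-]; rewrite in_itv /= => /andP[ta tb].
  have [w00|wn0] := eqVneq w 0.
    exists 0%N => //=; exists t => //; rewrite /= in_itv /= !w00 !mulr0 !addr0.
    by move: Nw; rewrite w00 mulr0; lra.
  have wp : 0 < w by rewrite lt_neqAle eq_sym wn0.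
  have [tb'|tb'] := eqVneq t b.
    exists N.-1 => //=; rewrite leqnn; exists t => //; rewrite /= in_itv /= tb'.
    by move: Nw; rewrite /N -!natr1 !mulrDl !mul1r; lra.
  have tlt : t < b by rewrite lt_neqAle tb' tb.
  have y0 : 0 <= (t - a) / w by rewrite divr_ge0// subr_ge0.
  have := truncn_itv y0; set k := Num.truncn _ => /andP[k1 k2].
  rewrite ler_pdivlMr// in k1; rewrite ltr_pdivrMr// in k2.
  have kN : (k < N)%N.
    rewrite -(ltr_nat R) -(ltr_pM2r wp) Nw; lra.
  exists k => //=; rewrite kN; exists t => //; rewrite /= in_itv /=; lra.
- move=> k x y; case: ifP => // kN [s + <-] [t + <-].
  rewrite /= !in_itv /= => hs ht; apply: le_trans (gC s t (inab _ _ kN hs) (inab _ _ kN ht)) _.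
  rewrite ler_wpM2l// ler_norml; move: hs ht; rewrite -natr1 mulrDl mul1r; lra.
- by move=> _; rewrite mulr_ge0.
- by rewrite sumr_const card_ord -mulr_natl mulrCA Nw.
Qed.

Lemma hausdorff1_locally_finite S : compact S ->
  (forall p, S p -> exists2 r : R, 0 < r & (hausdorff1 (S `&` [set x | (edist p x < r)%R]) < +oo)%E) ->
  (hausdorff1 S < +oo)%E.
Proof.
move=> kS locS.
have [r r0 hr] := lebesgue_number kS locS.
have [M M0 SM] := bounded_box (compact_bounded kS).
pose w := r / 4; have w0 : 0 < w by rewrite divr_gt0.
pose N := (Num.truncn (2 * M / w)).+1.
pose idx (t : R) := Num.truncn ((t + M) / w).
have idxP t : `|t| <= M -> (idx t < N)%N /\ `|t + M - (idx t)%:R * w| <= w.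
  rewrite ler_norml => /andP[t1 t2].
  have y0 : 0 <= (t + M) / w by rewrite divr_ge0 ?(ltW w0)//; lra.
  split; first by rewrite ltnS; apply: le_truncn; rewrite ler_pM2r ?invr_gt0//; lra.
  have := truncn_itv y0; rewrite -/(idx t) => /andP[k1 k2].
  rewrite ler_pdivlMr// in k1; rewrite -natr1 ltr_pdivrMr// mulrDl mul1r in k2.
  by rewrite ler_norml; lra.
pose K (c : 'I_N * 'I_N) := S `&` [set x | idx x.1 = c.1 /\ idx x.2 = c.2].
have SK : S `<=` \big[setU/set0]_(c <- index_enum ('I_N * 'I_N)%type) K c.
  move=> x Sx; have [/idxP[i1 _] /idxP[i2 _]] := SM x Sx.
  rewrite -bigcup_seq; exists (Ordinal i1, Ordinal i2) => //=.
  exact: mem_index_enum.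
apply: le_lt_trans (le_hausdorff1 SK) _.
elim: (index_enum _) => [|c s IH]; first by rewrite big_nil hausdorff10 ltry.
rewrite big_cons; apply: le_lt_trans (hausdorff1U _ _) _.
apply: lte_add_pinfty => //.
have [->|/set0P[q [Sq [q1 q2]]]] := eqVneq (K c) set0; first by rewrite hausdorff10 ltry.
have [p [t [Hp pt]]] := hr q Sq.
apply: le_lt_trans Hp; apply: le_hausdorff1 => x [Sx [x1 x2]]; split => //=.
apply: le_lt_trans (edist_triangle p q x) _; rewrite edist_sym.
have [/idxP[_ a1] /idxP[_ a2]] := SM x Sx.
have [/idxP[_ b1] /idxP[_ b2]] := SM q Sq.
have : edist q x <= 4 * w.
  rewrite enorm_dist; apply: le_trans (enorm_le_norm _) _; rewrite /=.
  move: a1 a2 b1 b2; rewrite x1 x2 q1 q2 => a1 a2 b1 b2.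
  have l1 : `|q.1 - x.1| <= 2 * w by move: a1 b1; rewrite !ler_norml; lra.
  have l2 : `|q.2 - x.2| <= 2 * w by move: a2 b2; rewrite !ler_norml; lra.
  lra.
by rewrite /w; lra.
Qed.

End curves.

Section C2.
Context {R : realType}.
Implicit Types (Omega : set (R * R)).

(** Uniform in both points, by the mean value theorem and the continuity of the derivative; this is
    what makes the outer cones uniform. *)
Lemma C2_linear_approx (h : R -> R) (x0 eps : R) : C2_real h -> 0 < eps ->
  exists2 r : R, 0 < r & forall a b, `|a - x0| < r -> `|b - x0| < r ->
    `|h b - h a - (h^`())%classic x0 * (b - a)| <= eps * `|b - a|.
Proof.
move=> [dh dh' _] eps0.
have ch' : {for x0, continuous (h^`())%classic}.
  by apply: differentiable_continuous; apply/derivable1_diffP.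
have /cvgrPdist_le /(_ eps eps0) /nbhs_ballP[r /= r0 hr] := ch'.
exists r => // a b.
wlog ab : a b / a <= b.
  move=> W ha hb; have [ab|/ltW ba] := leP a b; first exact: W.
  have := W b a ba hb ha; set m := (h^`())%classic x0.
  by rewrite -normrN [X in _ <= _ * X]distrC; congr (`|_| <= _); ring.
move=> ha hb; move: ab; rewrite le_eqVlt => /orP[/eqP->|ab].
  by rewrite !subrr mulr0 subrr !normr0 mulr0.
have dh1 x : x \in `]a, b[ -> is_derive x 1 h ((h^`())%classic x).
  by move=> _; rewrite derive1E; apply: derivableP.
have [|c cab ->] := MVT ab dh1.
  by apply: derivable_within_continuous => x _; exact: dh.
rewrite -mulrBl normrM ler_wpM2r// distrC; apply: hr; rewrite /ball /=.
move: cab ha hb; rewrite in_itv /= !ltr_norml; lra.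
Qed.

Section graph.
Variables (Omega : set (R * R)) (p e : R * R) (r : R) (h : R -> R).
Hypotheses (oO : open Omega) (Sp : boundary Omega p) (e1 : dot e e = 1) (r0 : 0 < r).
Hypothesis hC : C2_real h.
Hypothesis hO : forall x, disk p r x -> (Omega x <-> h (dot e x) < cross e x).

Let ch : continuous h.
Proof.
by move=> x; apply: differentiable_continuous; apply/derivable1_diffP; case: hC.
Qed.

Let cdot : continuous (dot e).
Proof. by move=> z; apply: cvgD; apply: cvgMr; [exact: cvg_fst|exact: cvg_snd]. Qed.

Let ccross : continuous (cross e).
Proof. by move=> z; apply: cvgB; apply: cvgMr; [exact: cvg_snd|exact: cvg_fst]. Qed.

Let dot_le w : `|dot e w| <= enorm w.
Proof. by apply: le_trans (ler_dot _ _) _; rewrite {1}/enorm e1 sqrtr1 mul1r. Qed.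

Lemma boundary_graph y : boundary Omega y -> disk p r y -> cross e y = h (dot e y).
Proof.
move=> [cy iy] py; apply/eqP; rewrite eq_le; apply/andP; split.
  rewrite leNgt; apply/negP => hy; apply: iy.
  by rewrite ((interior_id _).1 oO); apply/(hO py).
rewrite leNgt; apply/negP => hy.
have od : open (disk p r).
  apply: (@open_comp _ _ (edist p) [set t | t < r]); last exact: open_lt.
  by move=> x _; exact: continuous_edist.
pose U := disk p r `&` [set x | cross e x - h (dot e x) < 0].
have oU : open U.
  apply: openI => //; apply: (@open_comp _ _ (fun x => cross e x - h (dot e x)) [set t | t < 0]); last exact: open_lt.
  by move=> x _; apply: cvgB; [exact: ccross|apply: continuous_comp; [exact: cdot|exact: ch]].
have Uy : U y by split => //=; rewrite subr_lt0.
have [z [Oz [pz]]] := cy U (open_nbhs_nbhs (conj oU Uy)).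
by move/(hO pz) : Oz; rewrite /=; lra.
Qed.


(** In the frame of e the tangent at p has slope m, and e' is its direction. Near p the graph stays
    in a thin double cone around the tangent, drawn from any of its points. *)
Lemma graph_outer_cone (eps : R) : 0 < eps ->
  exists e' (rho : R), [/\ dot e' e' = 1, 0 < rho & forall y w, boundary Omega y ->
    edist y p < rho -> enorm w < rho -> cross e' w < - eps * `|dot e' w| ->
    ~ Omega (y + w)].
Proof.
move=> eps0; set m := (h^`())%classic (dot e p).
pose D := Num.sqrt (1 + m ^+ 2).
have m1 : 0 < 1 + m ^+ 2 by rewrite ltr_pwDl// sqr_ge0.
have D0 : 0 < D by rewrite sqrtr_gt0.
have D2 : D ^+ 2 = 1 + m ^+ 2 by rewrite sqr_sqrtr// ltW.
have em : 0 < 1 + eps * `|m| by rewrite ltr_pwDl// mulr_ge0// ltW.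
(* Chosen so that a vector in the cone of opening eps below the tangent has, in the frame of e, be <
   m al - eps' |al|. *)
pose eps' := eps * (1 + m ^+ 2) / (1 + eps * `|m|).
have eps'0 : 0 < eps' by rewrite divr_gt0// mulr_gt0.
have [s s0 hs] := C2_linear_approx (dot e p) hC eps'0.
pose e' : R * R := (D^-1 * (e.1 - m * e.2), D^-1 * (e.2 + m * e.1)).
have dE w : dot e' w = (dot e w + m * cross e w) / D.
  by rewrite /e' /dot /cross /=; ring.
have cE w : cross e' w = (cross e w - m * dot e w) / D.
  by rewrite /e' /dot /cross /=; ring.
exists e', (Num.min (r / 2) (s / 2)); split.
- have -> : dot e' e' = (D ^- 2) * (1 + m ^+ 2) * dot e e.
    by rewrite /e' /dot /=; field; rewrite gt_eqF.
  by rewrite e1 mulr1 -D2 mulVf// expf_neq0// gt_eqF.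
- by rewrite lt_min !divr_gt0.
move=> y w Sy; rewrite !lt_min => /andP[yr ys] /andP[wr ws] hw Oyw.
have py : disk p r y.
  by rewrite /disk /= edist_sym (lt_trans yr)// ltr_pdivrMr// ltr_pMr// ltr1n.
have pyw : disk p r (y + w).
  rewrite /disk /=; apply: le_lt_trans (edist_triangle p y (y + w)) _.
  rewrite (edist_sym p) [edist y (y + w)]enorm_dist opprD addNKr enormN; lra.
have hy := boundary_graph Sy py.
move/(hO pyw) : Oyw.
have -> : dot e (y + w) = dot e y + dot e w by rewrite /dot /=; ring.
have -> : cross e (y + w) = cross e y + cross e w by rewrite /cross /=; ring.
rewrite hy => Oyw.
have b1 : `|dot e y - dot e p| < s / 2.
  rewrite (_ : _ - _ = dot e (y - p)); last by rewrite /dot /=; ring.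
  by apply: le_lt_trans (dot_le _) _; rewrite -enorm_dist.
have b2 : `|dot e w| < s / 2 by apply: le_lt_trans (dot_le _) _.
have h1 : `|dot e y - dot e p| < s by lra.
have h2 : `|dot e y + dot e w - dot e p| < s.
  rewrite addrAC; apply: le_lt_trans (ler_normD _ _) _; lra.
have := hs _ _ h1 h2; rewrite -/m (addrC (dot e y)) addrK => hh.
have Di : 0 < D^-1 by rewrite invr_gt0.
move: hw Oyw hh; rewrite dE cE normrM (gtr0_norm Di) mulrA ltr_pM2r//.
set al := dot e w; set be := cross e w => hw Oyw hh.
have k1 : m * al - eps' * `|al| <= h (al + dot e y) - h (dot e y).
  by move: hh; rewrite ler_norml => /andP[]; lra.
have k2 : m * al - be < eps' * `|al| by move: Oyw; rewrite (addrC (dot e y)); lra.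
pose dl : R := m * al - be; rewrite -/dl in k2.
have k3 : eps * `|al + m * be| < dl by rewrite /dl; lra.
have dl0 : 0 < dl by apply: le_lt_trans k3; rewrite mulr_ge0// ltW.
have k4 : (1 + m ^+ 2) * `|al| <= `|al + m * be| + `|m| * dl.
  rewrite -[1 + _]gtr0_norm// -normrM (_ : _ * al = (al + m * be) + m * dl); last by rewrite /dl; ring.
  by apply: le_trans (ler_normD _ _) _; rewrite normrM (gtr0_norm dl0).
have k5 : eps * ((1 + m ^+ 2) * `|al|) < dl * (1 + eps * `|m|).
  apply: le_lt_trans (_ : eps * (`|al + m * be| + `|m| * dl) < _).
    by rewrite ler_pM2l.
  have -> : eps * (`|al + m * be| + `|m| * dl) = eps * `|al + m * be| + dl * (eps * `|m|) by ring.
  by rewrite [dl * (_ + _)]mulrDr mulr1 ltrD2r.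
have k6 : dl * (1 + eps * `|m|) < eps' * `|al| * (1 + eps * `|m|) by rewrite ltr_pM2r.
suff : eps' * `|al| * (1 + eps * `|m|) = eps * ((1 + m ^+ 2) * `|al|) by lra.
by rewrite /eps'; field; rewrite gt_eqF.
Qed.

Lemma graph_length_finite : exists2 r' : R, 0 < r' &
  (hausdorff1 (boundary Omega `&` [set x | (edist p x < r')%R]) < +oo)%E.
Proof.
set m := (h^`())%classic (dot e p).
have [s s0 hs] := C2_linear_approx (dot e p) hC ltr01.
pose rho := Num.min r (s / 2).
have rho0 : 0 < rho by rewrite lt_min r0 divr_gt0.
pose g t := rot (e.1, - e.2) (t, h t).
have cg : continuous g.
  have c1 : continuous (fun t => e.1 * t + - e.2 * h t).
    by move=> t; apply: cvgD; apply: cvgMr; [exact: cvg_id|exact: ch].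
  have c2 : continuous (fun t => e.1 * h t - - e.2 * t).
    by move=> t; apply: cvgB; apply: cvgMr; [exact: ch|exact: cvg_id].
  by move=> t; exact: cvg_pair (c1 t) (c2 t).
exists rho => //.
have sub : boundary Omega `&` [set x | edist p x < rho] `<=`
    g @` `[dot e p - s / 2, dot e p + s / 2].
  move=> y [Sy /=]; rewrite lt_min => /andP[yr ys].
  exists (dot e y); last by rewrite /g -(boundary_graph Sy yr) -/(rot e y) rotK.
  rewrite /= in_itv /= -ler_distlC.
  rewrite (_ : _ - _ = dot e (p - y)); last by rewrite /dot /=; ring.
  by apply: le_trans (dot_le _) _; rewrite -enorm_dist ltW.
apply: le_lt_trans (le_hausdorff1 sub) _.
have ss : dot e p - s / 2 <= dot e p + s / 2 by lra.
have C0 : 0 <= 2 + `|m| by rewrite addr_ge0.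
apply: le_lt_trans (hausdorff1_curve cg ss C0 _) _; last exact: ltry.
move=> a b ha hb.
have ha' : `|a - dot e p| < s by rewrite ltr_norml; lra.
have hb' : `|b - dot e p| < s by rewrite ltr_norml; lra.
have := hs _ _ hb' ha'; rewrite -/m mul1r => hh.
have -> : edist (g a) (g b) = enorm (a - b, h a - h b).
  rewrite enorm_dist /enorm; congr Num.sqrt.
  rewrite -[RHS]mul1r -e1 /g /rot /dot /cross /=; ring.
apply: le_trans (enorm_le_norm _) _; rewrite /=.
have : `|h a - h b| <= `|h a - h b - m * (a - b)| + `|m * (a - b)|.
  by apply: le_trans (ler_normD _ _); rewrite subrK.
rewrite normrM; lra.
Qed.

End graph.

Lemma C2_outer_cone Omega : open Omega -> C2_boundary Omega -> outer_cone Omega.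
Proof.
move=> oO C2O eps p eps0 Sp; have [e [r [h [e1 r0 hC hO]]]] := C2O p Sp.
have e1' : dot e e = 1 by rewrite -e1 /dot; ring.
exact: (graph_outer_cone oO e1' r0 hC hO eps0).
Qed.

Lemma C2_boundary_length Omega : open Omega -> bounded_set Omega ->
  C2_boundary Omega -> (hausdorff1 (boundary Omega) < +oo)%E.
Proof.
move=> oO bO C2O; apply: hausdorff1_locally_finite; first exact: compact_boundary.
move=> p Sp; have [e [r [h [e1 r0 hC hO]]]] := C2O p Sp.
have e1' : dot e e = 1 by rewrite -e1 /dot; ring.
exact: (graph_length_finite oO e1' r0 hC hO).
Qed.

End C2.

(** * Disks *)

Lemma FTC2 (R : realType) (F f : R -> R) (a b : R) : a <= b ->
  (forall x, a <= x <= b -> is_derive x 1 F (f x)) ->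
  {within `[a, b], continuous f} ->
  (\int[@lebesgue_measure R]_(x in `[a, b]) (f x)%:E = (F b - F a)%:E)%E.
Proof.
rewrite le_eqVlt => /orP[/eqP<- dF cf|ab dF cf].
  by rewrite set_itv1 integral_set1 subrr.
have cF x : a <= x <= b -> {for x, continuous F}.
  by move=> /dF h; apply: differentiable_continuous; apply/derivable1_diffP; exact: ex_derive.
have E : {in `]a, b[, (F^`())%classic =1 f}.
  move=> x; rewrite in_itv /= => /andP[/ltW ax /ltW xb].
  have h : is_derive x 1 F (f x) by apply: dF; rewrite ax.
  by rewrite derive1E; apply: derive_val.
have D : derivable_oo_LRcontinuous F a b.
  split.
  - move=> x; rewrite in_itv /= => /andP[/ltW ax /ltW xb].
    by have h : is_derive x 1 F (f x) by [apply: dF; rewrite ax]; exact: ex_derive.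
  - by apply: cvg_at_right_filter; apply: cF; rewrite lexx ltW.
  - by apply: cvg_at_left_filter; apply: cF; rewrite lexx ltW.
by rewrite (continuous_FTC2 ab cf D E) EFinB.
Qed.

Section disks.
Context {R : realType}.
Variables (c : R * R) (r : R).
Hypothesis r0 : 0 < r.
Implicit Types (x y p w : R * R).

Lemma open_disk : open (disk c r).
Proof.
apply: (@open_comp _ _ (edist c) [set t | t < r]); last exact: open_lt.
by move=> x _; exact: continuous_edist.
Qed.

Lemma bounded_disk : bounded_set (disk c r).
Proof.
exists (`|c| + r); split; first exact: num_real.
move=> M hM x cx /=; rewrite -[x](subrK c) (le_trans (ler_normD _ _))//.
apply: (le_trans _ (ltW hM)); rewrite addrC lerD2l; apply: le_trans (ltW cx).
rewrite edist_sym enorm_dist prod_normE ge_max.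
by rewrite norm1_le_enorm norm2_le_enorm.
Qed.

Lemma boundary_disk y : boundary (disk c r) y -> edist c y = r.
Proof.
move=> [cy iy]; apply/eqP; rewrite eq_le; apply/andP; split; last first.
  rewrite leNgt; apply/negP => h; apply: iy.
  by rewrite ((interior_id _).1 open_disk).
rewrite leNgt; apply/negP => h.
have oU : open [set x | r < edist c x].
  apply: (@open_comp _ _ (edist c) [set t | r < t]); last exact: open_gt.
  by move=> x _; exact: continuous_edist.
have [z [cz]] := cy _ (open_nbhs_nbhs (conj oU h)).
by rewrite /= ltNge (ltW cz).
Qed.

Lemma disk_outer_cone : outer_cone (disk c r).
Proof.
move=> eps p eps0 /boundary_disk cp.
pose v := p - c.
have v2 : dot v v = r ^+ 2 by rewrite -cp edist_sym enorm_dist sqr_enorm.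
(* The direction is tangent at p. The radius is small enough for |y - p| |w| <= [dot v w], so that w
   points outwards at y as well. *)
exists (- v.2 / r, v.1 / r), (r * eps / (1 + eps)); split.
- rewrite [LHS](_ : _ = dot v v / r ^+ 2); last by rewrite /dot /=; field; rewrite gt_eqF.
  by rewrite v2 divff// expf_neq0// gt_eqF.
- by rewrite divr_gt0// ?mulr_gt0// addr_gt0.
move=> y w /boundary_disk cy yp wr hw cyw.
have E1 : cross (- v.2 / r, v.1 / r) w = - dot v w / r by rewrite /cross /dot /=; ring.
have E2 : dot (- v.2 / r, v.1 / r) w = cross v w / r by rewrite /cross /dot /=; ring.
have ri : 0 < r^-1 by rewrite invr_gt0.
move: hw; rewrite E1 E2 normrM (gtr0_norm ri) mulrA ltr_pM2r//.
set X := dot v w; set Y := cross v w => hX.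
have XY : eps * `|Y| < X by lra.
have X0 : 0 < X by apply: le_lt_trans XY; rewrite mulr_ge0// ltW.
have dc : X ^+ 2 + Y ^+ 2 = (r * enorm w) ^+ 2.
  by rewrite exprMn sqr_enorm -v2 /X /Y /dot /cross; ring.
have XY0 : 0 <= X + `|Y| by apply: addr_ge0 => //; exact: ltW.
have rw0 : 0 <= r * enorm w by rewrite mulr_ge0 ?sqrtr_ge0// ltW.
have rw : r * enorm w <= X + `|Y|.
  rewrite -(@ler_pXn2r _ 2)//.
  have Y2 : `|Y| ^+ 2 = Y ^+ 2 by rewrite -normrX ger0_norm ?sqr_ge0.
  have -> : (X + `|Y|) ^+ 2 = X ^+ 2 + Y ^+ 2 + 2 * (X * `|Y|) by rewrite -Y2; ring.
  have XY1 : 0 <= X * `|Y| by apply: mulr_ge0 => //; exact: ltW.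
  by rewrite -dc lerDl mulr_ge0.
have yd : enorm (y - p) * enorm w <= X.
  have h1 : enorm (y - p) * enorm w <= r * eps / (1 + eps) * enorm w.
    by rewrite ler_wpM2r ?sqrtr_ge0// -enorm_dist ltW.
  apply: le_trans h1 _.
  have -> : r * eps / (1 + eps) * enorm w = (eps * (r * enorm w)) / (1 + eps) by ring.
  rewrite ler_pdivrMr ?addr_gt0//; apply: le_trans (_ : eps * (X + `|Y|) <= _).
    by rewrite ler_pM2l.
  by rewrite mulrDr [X * _]mulrDr mulr1 [X * eps]mulrC addrC lerD2r ltW.
have : r ^+ 2 <= edist c (y + w) ^+ 2.
  rewrite edist_sym enorm_dist sqr_enorm.
  have -> : dot (y + w - c) (y + w - c) =
      dot (y - c) (y - c) + 2 * (X + dot (y - p) w) + dot w w.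
    by rewrite /X /v /dot /=; ring.
  rewrite -sqr_enorm -enorm_dist edist_sym cy.
  have := ler_dot (y - p) w; rewrite ler_norml => /andP[k _].
  by have := dot_ge0 w; lra.
by rewrite ler_pXn2r ?nnegrE ?(ltW r0) ?edist_ge0// leNgt cyw.
Qed.

Lemma bdist_disk x : edist c x <= r -> bdist (disk c r) x = r - edist c x.
Proof.
move=> cx; apply/eqP; rewrite eq_le; apply/andP; split; last first.
  apply: bdist_ge; first exact: (setC_bounded bounded_disk).
  by move=> y /negP; rewrite -leNgt; have := edist_triangle c x y; lra.
have [xc|xc] := eqVneq (edist c x) 0.
  have -> : x = c.
    by move: xc; rewrite edist_sym enorm_dist => /eqP; rewrite enorm_eq0 subr_eq0 => /eqP.
  rewrite edistxx subr0; apply: le_trans (@bdist_le _ _ c (c.1 + r, c.2) _) _.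
    move=> /=; rewrite /disk /= edist_sym enorm_dist.
    rewrite (_ : enorm _ = r) ?ltxx//.
    by rewrite /enorm /dot /= addrAC !subrr mul0r addr0 add0r -expr2 sqrtr_sqr gtr0_norm.
  rewrite edist_sym enorm_dist.
  by rewrite /enorm /dot /= addrAC !subrr mul0r addr0 add0r -expr2 sqrtr_sqr gtr0_norm.
pose y := c + (r / edist c x) *: (x - c).
have ex0 : 0 < edist c x by rewrite lt_neqAle eq_sym xc edist_ge0.
have cy : edist c y = r.
  rewrite edist_sym enorm_dist /y addrAC subrr add0r enormZ -enorm_dist (edist_sym x).
  by rewrite gtr0_norm ?divr_gt0// divfK.
apply: le_trans (@bdist_le _ _ x y _) _; first by rewrite /disk /= cy ltxx.
rewrite edist_sym enorm_dist (_ : y - x = (r / edist c x - 1) *: (x - c)); last first.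
  by apply: pair_eq; rewrite /y /= /GRing.scale /=; ring.
rewrite enormZ -enorm_dist (edist_sym x) ger0_norm; last first.
  by rewrite subr_ge0 ler_pdivlMr// mul1r.
by rewrite mulrBl mul1r divfK.
Qed.

Lemma disk_length_le : (hausdorff1 (boundary (disk c r)) <= (2 * pi * r)%:E)%E.
Proof.
pose g t := c + r *: (cos t, sin t).
have sub : boundary (disk c r) `<=` g @` `[- pi, pi].
  move=> y /boundary_disk cy; pose e := r^-1 *: (y - c).
  have e1 : dot e e = 1.
    rewrite (_ : dot e e = r ^- 2 * dot (y - c) (y - c)); last first.
      by rewrite /e /dot /= /GRing.scale /=; field; rewrite gt_eqF.
    by rewrite -sqr_enorm -enorm_dist edist_sym cy mulVf// expf_neq0// gt_eqF.
  have yE : y = c + r *: e.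
    by rewrite /e scalerA divff ?gt_eqF// scale1r addrC subrK.
  have [e2|/ltW e2] := leP 0 e.2.
    have [ph hph ee] := polar_form e1 e2; exists ph; last by rewrite yE /g -ee.
    by rewrite /= in_itv /=; have := pi_ge0 R; lra.
  have e1' : dot (e.1, - e.2) (e.1, - e.2) = 1 by rewrite -e1 /dot /=; ring.
  have [|ph hph ee] := polar_form e1'; first by rewrite /= oppr_ge0.
  exists (- ph); first by rewrite /= in_itv /=; have := pi_ge0 R; lra.
  rewrite yE /g cosN sinN; congr (_ + _ *: _); apply: pair_eq => /=.
    by have := congr1 fst ee.
  by have := congr1 snd ee => /= <-; rewrite opprK.
apply: le_trans (le_hausdorff1 sub) _.
have -> : 2 * pi * r = r * (pi - - pi) by ring.
apply: hausdorff1_curve; rewrite ?(ltW r0)//.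
- have c1 : continuous (fun t => c.1 + r * cos t).
    by move=> t; apply: cvgD; [exact: cvg_cst|apply: cvgMr; exact: continuous_cos].
  have c2 : continuous (fun t => c.2 + r * sin t).
    by move=> t; apply: cvgD; [exact: cvg_cst|apply: cvgMr; exact: continuous_sin].
  by move=> t; exact: cvg_pair (c1 t) (c2 t).
- by have := pi_ge0 R; lra.
have sin_lip (x y : R) : `|sin x - sin y| <= `|x - y|.
  wlog xy : x y / x <= y.
    by move=> W; have [/W//|/ltW/W] := leP x y; rewrite distrC [leRHS]distrC.
  move: xy; rewrite le_eqVlt => /orP[/eqP->|xy]; first by rewrite !subrr.
  have [|d _ h] := MVT xy (fun z _ => is_derive_sin z).
    by apply: continuous_subspaceT => z; exact: continuous_sin.
  rewrite distrC h normrM [`|y - x|]distrC ler_piMl// ler_norml cos_geN1.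
  exact: cos_le1.
move=> s t _ _; rewrite enorm_dist.
have -> : g s - g t = r *: ((cos s, sin s) - (cos t, sin t)).
  by apply: pair_eq; rewrite /g /= /GRing.scale /=; ring.
rewrite enormZ gtr0_norm// ler_pM2l//.
pose a := (s - t) / 2.
have h : `|sin a| <= `|a| by have := sin_lip a 0; rewrite sin0 !subr0.
have -> : `|s - t| = 2 * `|a|.
  by rewrite -[X in X * `|a|]gtr0_norm// -normrM /a mulrC divfK.
rewrite -(@ler_pXn2r _ 2)// ?nnegrE ?sqrtr_ge0 ?mulr_ge0// sqr_enorm.
have -> : dot ((cos s, sin s) - (cos t, sin t)) ((cos s, sin s) - (cos t, sin t)) = 4 * sin a ^+ 2.
  have sE : s = t + (a + a) by rewrite /a -splitr addrC subrK.
  have ct : cos t ^+ 2 = 1 - sin t ^+ 2 by exact: cos2sin2.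
  have ca : cos a ^+ 2 = 1 - sin a ^+ 2 by exact: cos2sin2.
  rewrite /dot /= sE !(cosD t) !(sinD t) !(cosD a) !(sinD a).
  transitivity ((cos t ^+ 2 + sin t ^+ 2) *
    ((cos a ^+ 2 - sin a ^+ 2 - 1) ^+ 2 + 4 * cos a ^+ 2 * sin a ^+ 2)); first by ring.
  by rewrite ct ca; ring.
rewrite exprMn (_ : 2 ^+ 2 = 4); last by ring.
have n2 (y : R) : `|y| ^+ 2 = y ^+ 2 by rewrite -normrX ger0_norm ?sqr_ge0.
by rewrite ler_pM2l// -n2 ler_pXn2r ?nnegrE.
Qed.


Definition chord (x : R) : R := 2 * Num.sqrt (r ^+ 2 - (x - c.1) ^+ 2).

Lemma disk_section (x : R) : lebesgue_measure (xsection (disk c r) x) = (chord x)%:E.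
Proof.
set f := chord.
  pose s : R := Num.sqrt (r ^+ 2 - (x - c.1) ^+ 2).
  have -> : xsection (disk c r) x = `]c.2 - s, c.2 + s[%classic.
    apply/seteqP; split => y; rewrite /xsection /= inE /disk /= in_itv /= /edist /= => h.
      have h' : (c.1 - x) ^+ 2 + (c.2 - y) ^+ 2 < r ^+ 2.
        rewrite -(sqr_sqrtr (addr_ge0 (sqr_ge0 _) (sqr_ge0 _))).
        by rewrite ltr_pXn2r// nnegrE ?sqrtr_ge0// ltW.
      rewrite -ltr_distlC /s -(@ltr_pXn2r _ 2)// ?nnegrE ?sqrtr_ge0// sqr_sqrtr.
        by rewrite -normrX ger0_norm ?sqr_ge0//; lra.
      by have := sqr_ge0 (c.2 - y); lra.
    move: h; rewrite -ltr_distlC => h.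
    have s0 : 0 < s by apply: le_lt_trans h.
    have d0 : 0 < r ^+ 2 - (x - c.1) ^+ 2 by rewrite -sqrtr_gt0.
    have s2 : s ^+ 2 = r ^+ 2 - (x - c.1) ^+ 2 by rewrite sqr_sqrtr// ltW.
    have h2 : (c.2 - y) ^+ 2 < s ^+ 2.
      have -> : (c.2 - y) ^+ 2 = `|c.2 - y| ^+ 2 by rewrite -normrX ger0_norm ?sqr_ge0.
      by rewrite ltr_pXn2r// nnegrE ltW.
    rewrite -[ltRHS]gtr0_norm// -sqrtr_sqr ltr_sqrt ?exprn_gt0//.
    by move: h2; rewrite s2; lra.
  rewrite lebesgue_measure_itv /= lte_fin.
  have s0 : 0 <= s by exact: sqrtr_ge0.
  case: ifPn => h; first by rewrite -EFinD /f /chord -/s; congr EFin; ring.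
  rewrite -leNgt in h; rewrite /f /chord -/s; have -> : s = 0 by [lra].
  by rewrite mulr0.
Qed.

Lemma chord_ge0 (x : R) : 0 <= chord x. Proof. by rewrite mulr_ge0// sqrtr_ge0. Qed.

Lemma continuous_chord : continuous chord.
Proof.
move=> x; apply: cvgMr; apply: continuous_comp; last exact: sqrt_continuous.
apply: cvgB; first exact: cvg_cst.
by apply: cvgM; apply: cvgB; [exact: cvg_id|exact: cvg_cst|exact: cvg_id|exact: cvg_cst].
Qed.

Lemma area_disk_chord :
  (area (disk c r))%:E = (\int[@lebesgue_measure R]_x (chord x)%:E)%E.
Proof.
rewrite -areaE; [|exact: open_plane_measurable open_disk|exact: bounded_disk].
by rewrite /plane_measure /product_measure1; apply: eq_integral => x _; exact: disk_section.
Qed.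

(** The strict bound on th keeps away from the ends of the diameter, where the square root and the
    arcsine of the primitive are not differentiable; [area_disk] lets th tend to pi / 2. *)
Lemma integral_chord (th : R) : 0 <= th < pi / 2 ->
  (\int[@lebesgue_measure R]_(x in `[(c.1 - r * sin th)%R, (c.1 + r * sin th)%R]) (chord x)%:E =
   (2 * r ^+ 2 * (sin th * cos th + th))%:E)%E.
Proof.
move=> /andP[th0 th1]; set s := r * sin th.
have rn0 : r != 0 by rewrite gt_eqF.
have sin0 : 0 <= sin th by apply: sin_ge0_pi; have := pi_gt0 R; lra.
have cos0 : 0 < cos th by apply: cos_gt0_pihalf; have := pi_gt0 R; lra.
have s0 : 0 <= s by rewrite mulr_ge0// ltW.
have sr : s < r.
  rewrite gtr_pMr// -(@ltr_pXn2r _ 2)// ?nnegrE// expr1n sin2cos2 gtrBl.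
  by rewrite exprn_gt0.
pose F (x : R) := (x - c.1) * Num.sqrt (r ^+ 2 - (x - c.1) ^+ 2) + r ^+ 2 * asin ((x - c.1) / r).
have ss : c.1 - s <= c.1 + s by lra.
have cch : {within `[c.1 - s, c.1 + s], continuous chord}.
  by apply: continuous_subspaceT; exact: continuous_chord.
suff dF (x : R) : c.1 - s <= x <= c.1 + s -> is_derive x 1 F (chord x).
  rewrite (FTC2 ss dF cch); congr EFin; rewrite /F.
  have -> : c.1 + s - c.1 = s by ring.
  have -> : c.1 - s - c.1 = - s by ring.
  have -> : (- s) ^+ 2 = s ^+ 2 by ring.
  have -> : r ^+ 2 - s ^+ 2 = (r * cos th) ^+ 2 by rewrite /s !exprMn cos2sin2; ring.
  have -> : Num.sqrt ((r * cos th) ^+ 2) = r * cos th by rewrite sqrtr_sqr gtr0_norm// mulr_gt0.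
  have -> : s / r = sin th by rewrite /s mulrAC divff// mul1r.
  have -> : - s / r = sin (- th) by rewrite sinN /s mulNr mulrAC divff// mul1r.
  have K1 : asin (sin th) = th by rewrite sinK// in_itv /=; lra.
  have K2 : asin (sin (- th)) = - th by rewrite sinK// in_itv /=; lra.
  by rewrite K1 K2 /s; ring.
move=> /andP[x1 x2].
  set u := x - c.1; have ur : u ^+ 2 < r ^+ 2.
    have -> : u ^+ 2 = `|u| ^+ 2 by rewrite -normrX ger0_norm ?sqr_ge0.
    by rewrite ltr_pXn2r ?nnegrE// ?(ltW r0)// ltr_norml /u; lra.
  have D0 : 0 < r ^+ 2 - u ^+ 2 by rewrite subr_gt0.
  set q := Num.sqrt (r ^+ 2 - u ^+ 2).
  have q0 : 0 < q by rewrite sqrtr_gt0.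
  have q2 : q ^+ 2 = r ^+ 2 - u ^+ 2 by rewrite sqr_sqrtr// ltW.
  have d1 : is_derive x 1 (fun y : R => r ^+ 2 - (y - c.1) ^+ 2) (- (2 * u)).
    by apply: is_derive_eq; rewrite /GRing.scale /= /u; ring.
  have d2 := @is_derive1_comp _ Num.sqrt (fun y : R => r ^+ 2 - (y - c.1) ^+ 2) x _ _ (is_derive1_sqrt D0) d1.
  have d3 : is_derive x 1 (fun y : R => (y - c.1) / r) r^-1.
    by apply: is_derive_eq; rewrite /GRing.scale /=; ring.
  have u1 : -1 < u / r < 1 by rewrite ltr_pdivlMr// ltr_pdivrMr// /u; lra.
  have d4 := @is_derive1_comp _ (@asin R) (fun y : R => (y - c.1) / r) x _ _ (is_derive1_asin u1) d3.
  apply: is_derive_eq; rewrite /GRing.scale /= -/u -/q /chord -/u -/q.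
  have -> : Num.sqrt (1 - (u / r) ^+ 2) = q / r.
    have -> : 1 - (u / r) ^+ 2 = (q / r) ^+ 2.
      by rewrite [in RHS]expr_div_n q2; field.
    by rewrite sqrtr_sqr gtr0_norm// divr_gt0.
  apply: (mulIf (lt0r_neq0 q0)).
  transitivity (q ^+ 2 - u ^+ 2 + r ^+ 2); first by field; rewrite rn0 gt_eqF.
  by rewrite -mulrA -expr2 q2; ring.
Qed.


End disks.

Lemma continuous_left_le (R : realType) (g : R -> R) (a M : R) : 0 < a ->
  {for a, continuous g} -> (forall t, 0 < t < a -> g t <= M) -> g a <= M.
Proof.
move=> a0 cg gM; apply: (@cvgr_to_le _ (a^'-) _ _ g (g a) M).
  exact: cvg_at_left_filter.
near=> t; apply: gM; apply/andP; split; near: t; [exact: nbhs_left_gt|exact: nbhs_left_lt].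
Unshelve. all: by end_near. Qed.

Lemma area_disk (R : realType) (c : R * R) (r : R) : 0 < r ->
  area (disk c r) = pi * r ^+ 2.
Proof.
move=> r0; have p0 : 0 < pi / 2 :> R by rewrite divr_gt0// pi_gt0.
have sc : {for pi / 2, continuous (fun t : R => sin t * cos t + t)}.
  apply: cvgD; last exact: cvg_id.
  by apply: cvgM; [exact: continuous_sin|exact: continuous_cos].
have mch r' (A : set R) : measurable_fun A (EFin \o chord c r').
  apply/measurable_EFinP; apply: measurable_funTS.
  by apply: continuous_measurable_fun; exact: continuous_chord.
apply/eqP; rewrite eq_le; apply/andP; split.
(* The chords of the larger radius r / sin t dominate those of r, and for the angle t
   [integral_chord] covers exactly the interval from c.1 - r to c.1 + r. *)
- have up t : 0 < t < pi / 2 -> area (disk c r) * sin t ^+ 2 <= 2 * r ^+ 2 * (sin t * cos t + t).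
    move=> /andP[t0 t1].
    have st : 0 < sin t by apply: sin_gt0_pi; have := pi_gt0 R; lra.
    have r'0 : 0 < r / sin t by rewrite divr_gt0.
    rewrite -ler_pdivlMr ?exprn_gt0//.
    have -> : 2 * r ^+ 2 * (sin t * cos t + t) / sin t ^+ 2 =
      2 * (r / sin t) ^+ 2 * (sin t * cos t + t) by field; rewrite gt_eqF.
    have t01 : 0 <= t < pi / 2 by rewrite (ltW t0).
    rewrite -lee_fin -(integral_chord c r'0 t01) (area_disk_chord c r0) divfK ?gt_eqF//.
    rewrite [leRHS]integral_mkcond; apply: ge0_le_integral => //.
    + by move=> x _; rewrite lee_fin chord_ge0.
    + exact: mch.
    + by apply/(measurable_restrictT _ _).1 => //; exact: mch.
    move=> x _; rewrite patchE; case: ifPn => [_|].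
      rewrite lee_fin /chord ler_pM2l//; apply: ler_wsqrtr; rewrite lerD2r.
      rewrite ler_pXn2r ?nnegrE ?(ltW r0) ?(ltW r'0)// ler_pdivlMr// ger_pMr// sin_le1.
    rewrite notin_setE /= in_itv /= => xr.
    rewrite lee_fin /chord ler0_sqrtr ?mulr0// subr_le0.
    have -> : (x - c.1) ^+ 2 = `|x - c.1| ^+ 2 by rewrite -normrX ger0_norm ?sqr_ge0.
    rewrite ler_pXn2r ?nnegrE ?(ltW r0)// leNgt ltr_norml; apply/negP => h; apply: xr; lra.
  have := @continuous_left_le R (fun t => area (disk c r) * sin t ^+ 2 - 2 * r ^+ 2 * (sin t * cos t + t)) _ 0 p0.
  rewrite sin_pihalf cos_pihalf expr1n mulr1 mul1r add0r.
  have -> : 2 * r ^+ 2 * (pi / 2) = pi * r ^+ 2 by field.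
  rewrite subr_le0; apply; last by move=> t /up; rewrite subr_le0.
  apply: cvgB; last by apply: cvgMr; exact: sc.
  by apply: cvgMr; apply: cvgM; exact: continuous_sin.
- have lo t : 0 < t < pi / 2 -> 2 * r ^+ 2 * (sin t * cos t + t) <= area (disk c r).
    move=> /andP[t0 t1]; have t01 : 0 <= t < pi / 2 by rewrite (ltW t0).
    rewrite -lee_fin -(integral_chord c r0 t01) (area_disk_chord c r0).
    apply: ge0_subset_integral => //; first exact: mch.
    by move=> x _; rewrite lee_fin chord_ge0.
  have := @continuous_left_le R (fun t => 2 * r ^+ 2 * (sin t * cos t + t)) _ (area (disk c r)) p0.
  rewrite sin_pihalf cos_pihalf mul1r add0r.
  have -> : 2 * r ^+ 2 * (pi / 2) = pi * r ^+ 2 by field.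
  by apply; [apply: cvgMr; exact: sc|exact: lo].
Qed.

(* The lower bound comes from the area of thin annuli. *)
Lemma disk_length (R : realType) (c : R * R) (r : R) : 0 < r ->
  hausdorff1 (boundary (disk c r)) = (2 * pi * r)%:E.
Proof.
move=> r0; apply/eqP; rewrite eq_le disk_length_le//=.
have fin : (hausdorff1 (boundary (disk c r)) < +oo)%E.
  by apply: le_lt_trans (disk_length_le c r0) _; exact: ltry.
have fH : hausdorff1 (boundary (disk c r)) \is a fin_num by rewrite ge0_fin_numE// hausdorff1_ge0.
have mS : measurable (boundary (disk c r) : set (caratheodory_type (@hausdorff1_outer R))).
  by apply: closed_length_measurable; apply: closed_boundary; exact: open_disk.
rewrite -(fineK fH) lee_fin; apply/ler_addgt0Pr => d d0.
have d2 : 0 < d / 2 by rewrite divr_gt0.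
have [t0 t00 ht] := tube_integral (@open_disk _ c r) (@bounded_disk _ c r) (disk_outer_cone r0)
  fin (fun x => cvg_cst (1 : R)) (fun=> ler01) d2.
pose t := Num.min (t0 / 2) (Num.min (r / 2) (d / (2 * pi))).
have tp : 0 < t by rewrite !lt_min !divr_gt0// mulr_gt0// pi_gt0.
have tt0 : t < t0 by rewrite gt_min ltr_pdivrMr// ltr_pMr// ltr1n.
have tr : t < r by rewrite !gt_min; apply/orP; right; apply/orP; left; rewrite ltr_pdivrMr// ltr_pMr// ltr1n.
have td : 2 * pi * t <= d.
  by rewrite mulrC -ler_pdivlMr ?mulr_gt0 ?pi_gt0// !ge_min lexx !orbT.
have := ht t; rewrite tp tt0 => /(_ isT).
rewrite Rintegral_cst// mul1r.
have dD : disk c r `&` [set x | bdist (disk c r) x <= t] = disk c r `\` disk c (r - t).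
  apply/seteqP; split => x /= [cx h]; split => //=; move: h; rewrite (bdist_disk r0 (ltW cx)) /disk /=.
    by move=> h1 h2; lra.
  by move=> /negP; rewrite -leNgt; lra.
have mD s : measurable (disk c s) by apply: open_plane_measurable; exact: open_disk.
have mDD : measurable (disk c r `\` disk c (r - t)) by apply: measurableD; exact: mD.
rewrite dD integral_cst; last exact: mDD.
rewrite mul1e -[X in (X <= _)%E -> _]/(plane_measure (disk c r `\` disk c (r - t))) areaE; [|exact: mDD|by apply: (sub_bounded _ (@bounded_disk _ c r)) => x []].
rewrite areaD//; last 2 first.
- exact: bounded_disk.
- by move=> x; rewrite /disk /=; lra.
rewrite !area_disk ?subr_gt0// lee_fin -[X in _ <= t * (X + _) -> _]/(fine (hausdorff1 _)) => h.
have : t * (2 * pi * r) <= t * (fine (hausdorff1 (boundary (disk c r))) + d / 2 + pi * t).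
  have E : pi * r ^+ 2 - pi * (r - t) ^+ 2 = t * (2 * pi * r) - t * (pi * t) by ring.
  by move: h; rewrite E (mulrDr t _ (pi * t)) lerBlDr.
by rewrite ler_pM2l//; lra.
Qed.

(** * Bessel functions *)

Section bessel.
Context {R : realType}.
Implicit Types (x z : R) (n m : nat).

Definition jcoeff n m : R := (-1) ^+ m / (m`! * (m + n)`!)%:R.

(* J_n(x) = (x / 2)^n besselj n (x^2 / 4), and besselj is entire with
   derivative - besselj n.+1 *)
Definition besselj n z : R := limn (pseries (jcoeff n) z).

Lemma is_cvg_jcoeff n z : cvgn (pseries (jcoeff n) z).
Proof.
apply: normed_cvg; apply: series_le_cvg (is_cvg_series_exp_coeff `|z|).
- by move=> m; exact: normr_ge0.
- by move=> m; rewrite /exp_coeff /= divr_ge0// exprn_ge0.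
move=> m; rewrite /exp_coeff /= normrM normrX [leRHS]mulrC ler_wpM2r ?exprn_ge0//.
rewrite /jcoeff normrM normrX normrN1 expr1n mul1r ger0_norm ?invr_ge0//.
rewrite lef_pV2 ?posrE ?ltr0n ?muln_gt0 ?fact_gt0// ler_nat.
by rewrite leq_pmulr// fact_gt0.
Qed.

Lemma jcoeff_diffs n : pseries_diffs (jcoeff n) = - jcoeff n.+1.
Proof.
apply/funext => m; rewrite /pseries_diffs /jcoeff /= -[RHS]/(- (_ / _)) factS addSnnS exprS.
have m0 : m.+1%:R != 0 :> R by rewrite pnatr_eq0.
rewrite !natrM; field.
by rewrite !pnatr_eq0 -!lt0n !fact_gt0 /= addrC natr1 m0.
Qed.

Lemma is_derive_besselj n z : is_derive z 1 (besselj n) (- besselj n.+1 z).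
Proof.
have cv (f : R^nat) (K : R) : cvgn (pseries f K) -> cvgn (pseries (- f) K).
  move=> h; rewrite (_ : pseries (- f) K = - pseries f K); first exact: is_cvgN.
  apply/funext => m; rewrite /pseries /series /= -[RHS]/(- \sum_(0 <= i < m) _) -sumrN.
  by apply: eq_bigr => i _; rewrite mulNr.
have := @pseries_snd_diffs R (jcoeff n) (`|z| + 1) z (@is_cvg_jcoeff _ _).
rewrite !jcoeff_diffs pseries_diffsN jcoeff_diffs opprK.
move=> /(_ (cv _ _ (@is_cvg_jcoeff _ _)) (@is_cvg_jcoeff _ _)).
have zlt : `|z| < `|(`|z| + 1)| by rewrite [ltRHS]ger0_norm ?ltrDl// addr_ge0.
move=> /(_ zlt).
suff -> : limn (pseries (- jcoeff n.+1) z) = - besselj n.+1 z by [].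
apply: cvg_lim => //.
rewrite (_ : pseries (- jcoeff n.+1) z = - pseries (jcoeff n.+1) z).
  by apply: cvgN; exact: is_cvg_jcoeff.
apply/funext => m; rewrite /pseries /series /= -[RHS]/(- \sum_(0 <= i < m) _) -sumrN.
by apply: eq_bigr => i _; rewrite mulNr.
Qed.

Lemma continuous_besselj n : continuous (besselj n).
Proof.
move=> z; apply: differentiable_continuous; apply/derivable1_diffP.
by have h := is_derive_besselj n z; exact: ex_derive.
Qed.

Lemma besselj_at0 n : besselj n 0 = (n`!)%:R^-1.
Proof.
have E : (fun m => pseries (jcoeff n) 0 (m + 1)%N) = (fun=> (n`!)%:R^-1).
  apply/funext => m; rewrite /pseries /series /= addn1 big_nat_recl//= big1 ?addr0.
    by rewrite /jcoeff expr0 add0n fact0 mul1n mul1r expr0 mulr1.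
  by move=> i _; rewrite expr0n /= mulr0.
apply: cvg_lim => //; rewrite -(cvg_shiftn 1) [X in X @ _ --> _]E; exact: cvg_cst.
Qed.

(** The recurrence J_0(x) + J_2(x) = (2 / x) J_1(x) at z = x^2 / 4. *)
Lemma besselj_rec z : besselj 0 z = besselj 1 z - z * besselj 2 z.
Proof.
apply: cvg_lim => //; rewrite -(cvg_shiftn 1).
have -> : (fun m => pseries (jcoeff 0) z (m + 1)%N) =
    (fun m => pseries (jcoeff 1) z (m + 1)%N - z * pseries (jcoeff 2) z m).
  apply/funext => m; rewrite !addn1 /pseries /series /=; elim: m => [|m IH].
    rewrite !big_nat1 big_geq// mulr0 subr0; congr (_ * _).
  have -> : \sum_(0 <= k < m.+2) jcoeff 0 k * z ^+ k =
    \sum_(0 <= k < m.+1) jcoeff 0 k * z ^+ k + jcoeff 0 m.+1 * z ^+ m.+1 by exact: big_nat_recr.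
  have -> : \sum_(0 <= k < m.+2) jcoeff 1 k * z ^+ k =
    \sum_(0 <= k < m.+1) jcoeff 1 k * z ^+ k + jcoeff 1 m.+1 * z ^+ m.+1 by exact: big_nat_recr.
  have -> : \sum_(0 <= k < m.+1) jcoeff 2 k * z ^+ k =
    \sum_(0 <= k < m) jcoeff 2 k * z ^+ k + jcoeff 2 m * z ^+ m by exact: big_nat_recr.
  rewrite IH.
  have E : jcoeff 0 m.+1 = jcoeff 1 m.+1 - jcoeff 2 m.
    rewrite /jcoeff exprS addn0 addn1 addn2 !factS !natrM.
    have m0 : m`!%:R != 0 :> R by rewrite pnatr_eq0 -lt0n fact_gt0.
    have m1 : m.+1%:R != 0 :> R by rewrite pnatr_eq0.
    have m2 : m.+2%:R != 0 :> R by rewrite pnatr_eq0.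
    have -> : m.+2%:R = m.+1%:R + 1 :> R by rewrite natr1.
    rewrite -natr1 in m2; move: m0 m1 m2.
    move: (m`!%:R : R) (m.+1%:R : R) => a b a0 b0 b1.
    by field; rewrite ?a0 ?b0 ?b1.
  by rewrite E exprS; ring.
apply: cvgB; first by rewrite (cvg_shiftn 1); exact: is_cvg_jcoeff.
by apply: cvgMr; exact: is_cvg_jcoeff.
Qed.

Lemma bessel_JE n x : bessel_J n x = (x / 2) ^+ n * besselj n (x ^+ 2 / 4).
Proof.
apply: cvg_lim => //.
rewrite (_ : series _ = (fun m => (x / 2) ^+ n * pseries (jcoeff n) (x ^+ 2 / 4) m)).
  by apply: cvgMr; exact: is_cvg_jcoeff.
apply/funext => m; rewrite /pseries /series /= mulr_sumr; apply: eq_bigr => i _.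
rewrite /bessel_coeff /= exprD -mul2n exprM -/(jcoeff n i).
have -> : (x / 2) ^+ 2 = x ^+ 2 / 4 by field.
by rewrite [X in _ * X]mulrC mulrCA.
Qed.

Lemma bessel_J0E x : bessel_J 0 x = besselj 0 (x ^+ 2 / 4).
Proof. by rewrite bessel_JE expr0 mul1r. Qed.

Lemma bessel_J1E x : bessel_J 1 x = x / 2 * besselj 1 (x ^+ 2 / 4).
Proof. by rewrite bessel_JE expr1. Qed.

(** The rule (x J_1)' = x J_0 in the variable z = x^2 / 4. *)
Lemma is_derive_zbesselj1 z : is_derive z 1 (fun y => y * besselj 1 y) (besselj 0 z).
Proof.
have h := is_derive_besselj 1 z.
by apply: is_derive_eq; rewrite besselj_rec /GRing.scale /=; ring.
Qed.

(** J_0(x)^2 + J_1(x)^2 at z = x^2 / 4. *)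
Definition jsum z := besselj 0 z ^+ 2 + z * besselj 1 z ^+ 2.

Lemma is_derive_jsum z : is_derive z 1 jsum (- besselj 1 z ^+ 2).
Proof.
have h0 := is_derive_besselj 0 z; have h1 := is_derive_besselj 1 z.
by rewrite /jsum; apply: is_derive_eq; rewrite besselj_rec /GRing.scale /=; ring.
Qed.

Lemma is_derive_cont (f : R -> R) x (l : R) : is_derive x 1 f l -> {for x, continuous f}.
Proof.
by move=> h; apply: differentiable_continuous; apply/derivable1_diffP; exact: ex_derive.
Qed.

Lemma MVTd (f f' : R -> R) (a b : R) : a < b ->
  (forall x, a <= x <= b -> is_derive x 1 f (f' x)) ->
  exists2 x, a < x < b & f b - f a = f' x * (b - a).
Proof.
move=> ab df; have cf : {within `[a, b], continuous f}.
  apply: derivable_within_continuous => x; rewrite in_itv /= => xab.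
  by have h := df x xab; exact: ex_derive.
have [|x xab ->] := @MVT R f f' a b ab _ cf.
  by move=> x; rewrite in_itv /= => /andP[/ltW ax /ltW xb]; apply: df; rewrite ax.
by exists x => //; move: xab; rewrite in_itv.
Qed.

(** If j_0 stayed positive, z j_1(z) would increase, so that j_1(z) >= c / z for z >= 1 and j_0(z)
    <= j_0(1) - c ln z; at the point y the right-hand side is -1. *)
Lemma besselj0_zero : exists2 z, 0 < z & besselj 0 z <= 0.
Proof.
apply: contrapT => no.
have pos z : 0 <= z -> 0 < besselj 0 z.
  rewrite le_eqVlt => /orP[/eqP<-|z0]; first by rewrite besselj_at0 invr_gt0 ltr0n fact_gt0.
  by rewrite ltNge; apply/negP => h; apply: no; exists z.
have mono (y z : R) : 0 <= y -> y < z -> y * besselj 1 y < z * besselj 1 z.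
  move=> y0 yz; have [|x /andP[yx xz] E] := @MVTd (fun y => y * besselj 1 y) (besselj 0) y z yz.
    by move=> x _; exact: is_derive_zbesselj1.
  by rewrite -subr_gt0 E mulr_gt0 ?subr_gt0// pos// (le_trans y0)// ltW.
pose c := besselj 1 1.
have c0 : 0 < c by have := mono 0 1 (lexx _) ltr01; rewrite mul0r mul1r.
have cz z : 1 <= z -> c <= z * besselj 1 z.
  by rewrite le_eqVlt => /orP[/eqP<-|/(mono 1 z ler01)/ltW]; rewrite mul1r.
pose y := expR ((besselj 0 1 + 1) / c).
have y1 : 1 < y.
  rewrite /y -expR0 ltr_expR divr_gt0// addr_gt0// pos//; exact: ler01.
have [|x /andP[x1 xy] E] := @MVTd (fun z => besselj 0 z + c * ln z)
    (fun z => - besselj 1 z + c / z) 1 y y1.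
  move=> z /andP[z1 _]; have z0 : 0 < z by rewrite (lt_le_trans ltr01).
  have h0 := is_derive_besselj 0 z; have h1 := is_derive1_ln z0.
  by apply: is_derive_eq; rewrite /GRing.scale /=; ring.
have x0 : 0 < x by rewrite (lt_trans ltr01).
have : (- besselj 1 x + c / x) * (y - 1) <= 0.
  rewrite mulr_le0_ge0 ?subr_ge0 ?(ltW y1)// addrC subr_le0 ler_pdivrMr// mulrC.
  by apply: cz; exact: ltW.
have := pos y (ltW (lt_trans ltr01 y1)).
have E2 : c * ((besselj 0 1 + 1) / c) = besselj 0 1 + 1 by rewrite mulrC divfK// gt_eqF.
by move: E; rewrite ln1 mulr0 addr0 expRK E2; lra.
Qed.


Lemma J0_zero : exists2 x : R, 0 < x & bessel_J 0 x = 0.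
Proof.
have [z z0 hz] := besselj0_zero.
have cj : {within `[0, z], continuous (besselj 0)}.
  by apply: continuous_subspaceT; exact: continuous_besselj.
have : Num.min (besselj 0 0) (besselj 0 z) <= 0 <= Num.max (besselj 0 0) (besselj 0 z).
  by rewrite ge_min hz orbT le_max besselj_at0 invr_ge0 ler0n.
move=> /(IVT (ltW z0) cj)[y yz yj].
have y0 : 0 < y.
  move: yz; rewrite in_itv /= le_eqVlt => /andP[/orP[/eqP y0|//] _].
  by move: yj; rewrite -y0 besselj_at0 fact0 invr1 => /eqP; rewrite oner_eq0.
exists (2 * Num.sqrt y); first by rewrite mulr_gt0// sqrtr_gt0.
by rewrite bessel_J0E exprMn sqr_sqrtr ?(ltW y0)// (_ : 2 ^+ 2 * y / 4 = y)//; field.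
Qed.

Lemma continuous_J0 : continuous (bessel_J 0 : R -> R).
Proof.
have -> : bessel_J 0 = (fun x : R => besselj 0 (x ^+ 2 / 4)) by apply/funext => x; exact: bessel_J0E.
move=> x; apply: continuous_comp; last exact: continuous_besselj.
by apply: cvgM; [apply: cvgM; exact: cvg_id|exact: cvg_cst].
Qed.

Lemma J0_pos_zero : [/\ 0 < j01 R, bessel_J 0 (j01 R) = 0 &
  forall x, 0 <= x < j01 R -> 0 < bessel_J 0 x].
Proof.
set E := [set x : R | 0 < x /\ bessel_J 0 x = 0].
have E0 : E !=set0 by have [x x0 hx] := J0_zero; exists x.
have lE : lbound E 0 by move=> x [/ltW].
have hE : has_inf E by split => //; exists 0.
have j0 : 0 <= j01 R by apply: lb_le_inf.
have lt x : 0 < x -> x < j01 R -> bessel_J 0 x <> 0.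
  by move=> x0 xj Jx; move: xj; rewrite ltNge => /negP; apply; apply: ge_inf; [exists 0|].
have Jj : bessel_J 0 (j01 R) = 0.
  apply/eqP; apply/negPn/negP => Jn.
  have Jn' : 0 < `|bessel_J 0 (j01 R)| by rewrite normr_gt0.
  have /cvgrPdist_lt /(_ _ Jn') /nbhs_ballP[d /= d0 hd] := @continuous_J0 (j01 R).
  have [x [x0 Jx] xj] := inf_adherent d0 hE.
  have jx : j01 R <= x by apply: ge_inf; [exists 0|].
  have : ball (j01 R) d x by rewrite /ball /= distrC ger0_norm ?subr_ge0// ltrBlDl.
  by move/hd; rewrite Jx subr0 ltxx.
have jp : 0 < j01 R.
  rewrite lt_neqAle j0 andbT; apply/eqP => j00; move: Jj; rewrite -j00 bessel_J0E expr0n mul0r besselj_at0.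
  by rewrite fact0 invr1 => /eqP; rewrite oner_eq0.
split=> // x /andP[x0 xj]; rewrite ltNge; apply/negP => Jx.
have cJ : {within `[0, x], continuous (bessel_J 0 : R -> R)}.
  by apply: continuous_subspaceT; exact: continuous_J0.
have J00 : bessel_J 0 (0 : R) = 1 by rewrite bessel_J0E expr0n mul0r besselj_at0 fact0 invr1.
have : Num.min (bessel_J 0 0) (bessel_J 0 x) <= 0 <= Num.max (bessel_J 0 0) (bessel_J 0 x).
  by rewrite ge_min Jx orbT le_max J00 ler01.
move=> /(IVT x0 cJ)[y]; rewrite in_itv /= => /andP[y0 yx] Jy.
have y0' : 0 < y.
  rewrite lt_neqAle y0 andbT; apply/eqP => y00; move: Jy; rewrite -y00 J00 => /eqP.
  by rewrite oner_eq0.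
exact: (lt y y0' (le_lt_trans yx xj)).
Qed.

(** z j_1(z) has derivative j_0, hence j_1 is positive up to and including the first zero of j_0;
    and j_0, with derivative - j_1, decreases from 1. *)
Lemma besselj_pos z : 0 <= z <= j01 R ^+ 2 / 4 ->
  [/\ 0 <= besselj 0 z <= 1, z < j01 R ^+ 2 / 4 -> 0 < besselj 0 z & 0 < besselj 1 z].
Proof.
have [j0 Jj Jpos] := J0_pos_zero; set z1 := j01 R ^+ 2 / 4.
have z10 : 0 < z1 by rewrite divr_gt0// exprn_gt0.
have pos y : 0 <= y -> y < z1 -> 0 < besselj 0 y.
  move=> y0 yz; have := Jpos (2 * Num.sqrt y).
  rewrite bessel_J0E exprMn sqr_sqrtr// (_ : 2 ^+ 2 * y / 4 = y); last by field.
  apply; rewrite mulr_ge0 ?sqrtr_ge0//= -(@ltr_pXn2r _ 2)// ?nnegrE ?mulr_ge0 ?sqrtr_ge0 ?(ltW j0)//.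
  by rewrite exprMn sqr_sqrtr//; move: yz; rewrite /z1; lra.
have pos1 y : 0 <= y -> y <= z1 -> 0 < besselj 1 y.
  rewrite le_eqVlt => /orP[/eqP<- _|y0 yz]; first by rewrite besselj_at0 invr_gt0 ltr0n fact_gt0.
  have [|x /andP[x0 xy] E] := @MVTd (fun y => y * besselj 1 y) (besselj 0) 0 y y0.
    by move=> x _; exact: is_derive_zbesselj1.
  have : 0 < y * besselj 1 y.
    rewrite -[ltRHS]subr0 -{2}(mul0r (besselj 1 0)) E subr0 mulr_gt0// pos//.
      exact: ltW.
    exact: lt_le_trans xy yz.
  by rewrite pmulr_rgt0.
have le1 y : 0 <= y -> y <= z1 -> besselj 0 y <= 1.
  have J1 : besselj 0 (0 : R) = 1 by rewrite besselj_at0 fact0 invr1.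
  rewrite le_eqVlt => /orP[/eqP<- _|y0 yz]; first by rewrite J1.
  have [|x /andP[x0 xy] E] := @MVTd (besselj 0) (fun y => - besselj 1 y) 0 y y0.
    by move=> x _; exact: is_derive_besselj.
  rewrite -J1 -subr_le0 E subr0 mulNr oppr_le0 mulr_ge0 ?(ltW y0)// ltW// pos1 ?(ltW x0)//.
  by rewrite (le_trans _ yz)// ltW.
move=> /andP[h0 h1]; split; [|exact: pos|exact: pos1].
rewrite le1// andbT; move: h1; rewrite le_eqVlt => /orP[/eqP->|h1]; last by rewrite ltW// pos.
by rewrite /z1 -bessel_J0E Jj.
Qed.

Lemma jsum_lt (y z : R) : 0 <= y -> y < z -> z <= j01 R ^+ 2 / 4 -> jsum z < jsum y.
Proof.
move=> y0 yz zj; have [|x /andP[yx xz] E] := @MVTd jsum (fun z => - besselj 1 z ^+ 2) y z yz.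
  by move=> x _; exact: is_derive_jsum.
rewrite -subr_lt0 E mulNr oppr_lt0 mulr_gt0 ?subr_gt0// exprn_gt0//.
have [] // := @besselj_pos x.
by rewrite (le_trans y0 (ltW yx)) (le_trans (ltW xz)).
Qed.

Lemma jsum0 : jsum 0 = 1 :> R.
Proof. by rewrite /jsum mul0r addr0 besselj_at0 fact0 invr1 expr1n. Qed.

Lemma jsum_gt0 (z : R) : 0 <= z <= j01 R ^+ 2 / 4 -> 0 < jsum z.
Proof.
move=> hz; have [h0 h1 h2] := besselj_pos hz; have /andP[z0 zj] := hz.
move: z0; rewrite le_eqVlt => /orP[/eqP<-|z0]; first by rewrite jsum0.
by rewrite /jsum ltr_wpDl ?sqr_ge0// mulr_gt0// exprn_gt0.
Qed.

(** The equation is the Robin condition with parameter b for J_0(k |x|) on the unit disk. *)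
Lemma robin_frequency (b : R) : 0 < b -> exists2 k, 0 < k < j01 R &
  k * bessel_J 1 k = b * bessel_J 0 k.
Proof.
move=> b0; have [j0 Jj Jpos] := J0_pos_zero.
pose g x := 2 * (x ^+ 2 / 4 * besselj 1 (x ^+ 2 / 4)) - b * bessel_J 0 x.
have gE x : g x = x * bessel_J 1 x - b * bessel_J 0 x.
  by rewrite /g bessel_J1E; congr (_ - _); field.
have cg : {within `[0, j01 R], continuous g}.
  apply: continuous_subspaceT => x; apply: cvgB; last by apply: cvgMr; exact: continuous_J0.
  have cx : {for x, continuous (fun x : R => x ^+ 2 / 4)}.
    by apply: cvgM; [apply: cvgM; exact: cvg_id|exact: cvg_cst].
  apply: cvgMr; apply: cvgM => //.
  by apply: continuous_comp; [exact: cx|exact: continuous_besselj].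
have zj : 0 <= j01 R ^+ 2 / 4 <= j01 R ^+ 2 / 4 by rewrite lexx divr_ge0 ?sqr_ge0.
have [_ _ j1p] := besselj_pos zj.
have g0 : g 0 = - b.
  by rewrite gE mul0r add0r bessel_J0E expr0n mul0r besselj_at0 fact0 invr1 mulr1.
have gj : 0 < g (j01 R).
  by rewrite gE Jj mulr0 subr0 bessel_J1E mulr_gt0// mulr_gt0// divr_gt0.
have : Num.min (g 0) (g (j01 R)) <= 0 <= Num.max (g 0) (g (j01 R)).
  by rewrite ge_min g0 oppr_le0 (ltW b0) le_max (ltW gj) orbT.
move=> /(IVT (ltW j0) cg)[k]; rewrite in_itv /= => /andP[k0 kj] gk.
exists k; last by apply/eqP; rewrite -subr_eq0 -gE gk.
apply/andP; split; rewrite lt_neqAle ?k0 ?kj andbT; apply/eqP => E.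
  by move: gk; rewrite -E g0 => /eqP; rewrite oppr_eq0 gt_eqF.
by move: gj; rewrite -E gk ltxx.
Qed.

Lemma F_jsum (k : R) : F k = pi * k ^+ 2 * ((jsum (k ^+ 2 / 4))^-1 - 1).
Proof.
rewrite /F /jsum bessel_J0E bessel_J1E div1r; congr (_ * (_^-1 - _)).
by field.
Qed.

Lemma G_jsum (k : R) :
  G k = pi * k ^+ 2 * (besselj 0 (k ^+ 2 / 4) * besselj 1 (k ^+ 2 / 4) / jsum (k ^+ 2 / 4)).
Proof.
rewrite /G /jsum bessel_J0E bessel_J1E.
have -> : besselj 0 (k ^+ 2 / 4) ^+ 2 + (k / 2 * besselj 1 (k ^+ 2 / 4)) ^+ 2 =
  besselj 0 (k ^+ 2 / 4) ^+ 2 + k ^+ 2 / 4 * besselj 1 (k ^+ 2 / 4) ^+ 2 by field.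
by rewrite mulrA [RHS]mulrA; congr (_ / _); field.
Qed.

Lemma C_PW_F : C_PW R = F (j01 R).
Proof. by have [_ Jj _] := J0_pos_zero; rewrite /C_PW /F Jj expr0n add0r. Qed.

(** Both factors in [F_jsum] increase with k, and [C_PW] is the value of [F] at the first zero of
    J_0. *)
Lemma F_lt (k : R) : 0 < k < j01 R -> 0 <= F k < C_PW R.
Proof.
move=> /andP[k0 kj]; rewrite C_PW_F !F_jsum.
have kk : k ^+ 2 / 4 < j01 R ^+ 2 / 4.
  by rewrite ltr_pM2r ?invr_gt0// ltr_pXn2r ?nnegrE// ltW// (lt_trans k0).
have kp : 0 < k ^+ 2 / 4 by rewrite divr_gt0// exprn_gt0.
have s1 : jsum (k ^+ 2 / 4) < 1 by have := jsum_lt (lexx 0) kp (ltW kk); rewrite jsum0.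
have s2 := jsum_lt (ltW kp) kk (lexx _).
have p1 : 0 < jsum (k ^+ 2 / 4) by apply: jsum_gt0; rewrite !ltW.
have p2 : 0 < jsum (j01 R ^+ 2 / 4) by apply: jsum_gt0; rewrite lexx ltW// (lt_trans kp).
have i1 : 1 < (jsum (k ^+ 2 / 4))^-1 by rewrite invf_gt1.
have i2 : (jsum (k ^+ 2 / 4))^-1 < (jsum (j01 R ^+ 2 / 4))^-1 by rewrite ltf_pV2.
apply/andP; split; first by apply: mulr_ge0; [apply: mulr_ge0; [exact: pi_ge0|exact: sqr_ge0]|rewrite subr_ge0 ltW].
have kj2 : pi * k ^+ 2 < pi * j01 R ^+ 2.
  by rewrite ltr_pM2l ?pi_gt0// ltr_pXn2r ?nnegrE// ltW// (lt_trans k0).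
apply: ltr_pM => //; [|by rewrite subr_ge0 ltW|by rewrite ltrD2r].
by apply: mulr_ge0; [exact: pi_ge0|exact: sqr_ge0].
Qed.

(** 2 J_0 J_1 <= J_0^2 + J_1^2 gives G(k) <= pi k. *)
Lemma G_lt (k : R) : 0 < k < j01 R -> 0 <= G k < pi * j01 R.
Proof.
move=> /andP[k0 kj]; have kk : 0 <= k ^+ 2 / 4 <= j01 R ^+ 2 / 4.
  rewrite divr_ge0 ?sqr_ge0//= ler_pM2r ?invr_gt0// ler_pXn2r ?nnegrE ?(ltW k0) ?(ltW kj)//.
  by rewrite ltW// (lt_trans k0).
have [/andP[h0 _] h1 h2] := besselj_pos kk.
have s0 := jsum_gt0 kk.
apply/andP; split.
  rewrite G_jsum; apply: mulr_ge0; first by apply: mulr_ge0; [exact: pi_ge0|exact: sqr_ge0].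
  by apply: divr_ge0; [apply: mulr_ge0 => //; exact: ltW|exact: ltW].
apply: (@le_lt_trans _ _ (pi * k)); last by rewrite ltr_pM2l// pi_gt0.
rewrite /G -[leRHS]mulr1 ler_pM2l ?mulr_gt0 ?pi_gt0//.
set X := bessel_J 0 k; set Y := bessel_J 1 k.
have [->|n0] := eqVneq (X ^+ 2 + Y ^+ 2) 0; first by rewrite invr0 mulr0 ler01.
have p : 0 < X ^+ 2 + Y ^+ 2 by rewrite lt0r n0 addr_ge0 ?sqr_ge0.
by rewrite ler_pdivrMr// mul1r -subr_ge0; have := sqr_ge0 (X - Y); lra.
Qed.

End bessel.

(** * Functions of the distance to the boundary *)

Section level_sets.
Context {R : realType}.
Implicit Types (X : set (R * R)) (x y z : R * R).

Lemma integral_plane_cst X (k : R) : measurable X -> bounded_set X ->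
  (\int[plane_measure]_(x in X) k%:E = (k * area X)%:E)%E.
Proof.
move=> mX bX; rewrite integral_cst//.
rewrite -[X in (_ * X)%E]/(plane_measure X) areaE//.
Qed.

Lemma discrete_countable (B : set R) (r : R) : 0 < r ->
  (forall s t, B s -> B t -> s < t -> r <= t - s) -> countable B.
Proof.
move=> r0 Br; apply/countable_injP.
exists (fun t => pickle (Num.floor (2 * t / r))).
move=> s t; rewrite !inE => Bs Bt /(pcan_inj pickleK) E.
have key (u v : R) : B u -> B v -> Num.floor (2 * u / r) = Num.floor (2 * v / r) -> ~ (u < v).
  move=> Bu Bv Euv uv; have := Br u v Bu Bv uv; rewrite leNgt => /negP; apply.
  have := floor_itv (2 * u / r); have := floor_itv (2 * v / r); rewrite Euv.
  set n := (Num.floor _)%:~R; rewrite intrD /= => /andP[_ a2] /andP[a3 _].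
  have : 2 * v / r - 2 * u / r < 1 by rewrite /n; lra.
  by rewrite -mulrBl ltr_pdivrMr// mul1r; lra.
by case: (ltgtP s t) => // st; [case: (key _ _ Bs Bt E st)|case: (key _ _ Bt Bs (esym E) st)].
Qed.

(* A point x at distance t from its nearest point z outside X can be moved
   towards z along one of the axes, and then gets closer to z: on axis-parallel
   lines the points of the level set with a given axis are separated. *)
Lemma area_level_set X (t : R) : open X -> bounded_set X -> 0 < t ->
  plane_measure [set x | bdist X x = t] = 0%E.
Proof.
move=> oX bX t0; pose L := [set x | bdist X x = t].
have cL : closed L.
  apply: (@closed_comp _ _ (bdist X) [set t]); last exact: closed_eq.
  by move=> x _; exact: continuous_bdist.
have LX : L `<=` X.
  by move=> x Lx; apply: (@bdist_gt _ X x 0); rewrite ?edistxx// Lx.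
have bL : bounded_set L by exact: sub_bounded LX bX.
(* By the law of cosines, a bound for the distance to z after a move by s in a direction that makes
   an angle of at most 60 degrees with z - x; one of the four axis directions always does. *)
pose c (s : R) := Num.sqrt (t ^+ 2 - s * t + s ^+ 2).
pose M (e : R * R) := L `&` \bigcap_(s in [set s : R | 0 < s < t])
  [set x | bdist X (x + s *: e) <= c s].
have cM e : closed (M e).
  apply: closedI => //; apply: closed_bigI => s _.
  apply: (@closed_comp _ _ (fun x => bdist X (x + s *: e)) [set u | u <= c s]); last exact: closed_le.
  move=> x _; apply: (@continuous_lipschitz _ _ 1) => {}x y; rewrite mul1r.
  apply: le_trans (bdist_lip _ _ bX) _.
  by rewrite !enorm_dist (_ : x + s *: e - (y + s *: e) = x - y)//; apply: pair_eq; rewrite /=; ring.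
have c_lt s : 0 < s < t -> c s < t.
  move=> /andP[s0 st]; rewrite -(@ltr_pXn2r _ 2)// ?nnegrE ?sqrtr_ge0 ?(ltW t0)//.
  have st2 : s * s < s * t by rewrite ltr_pM2l.
  rewrite sqr_sqrtr; first by rewrite expr2 [s ^+ 2]expr2; lra.
  have -> : t ^+ 2 - s * t + s ^+ 2 = (t - s) ^+ 2 + s * t by ring.
  by rewrite addr_ge0 ?sqr_ge0// mulr_ge0// ltW.
have sep e x s : M e x -> M e (x + s *: e) -> 0 < s -> t <= s.
  move=> [_ Mx] [Ly _] s0; rewrite leNgt; apply/negP => st.
  have s0t : 0 < s < t by rewrite s0.
  by have := Mx s s0t; rewrite /= Ly leNgt c_lt.
have LM : L `<=` (M (1, 0) `|` M (-1, 0)) `|` (M (0, 1) `|` M (0, -1)).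
  move=> x Lx; have [z Xz xz] := bdist_attained x oX (setC_bounded bX).
  have zt : edist x z = t by rewrite -xz.
  have Mdot e : dot e e = 1 -> t / 2 <= dot e (z - x) -> M e x.
    move=> e1 h; split=> // s /= /andP[s0 st]; apply: le_trans (@bdist_le _ _ _ z Xz) _.
    rewrite /c enorm_dist /enorm; apply: ler_wsqrtr.
    have -> : dot (x + s *: e - z) (x + s *: e - z) =
        dot (x - z) (x - z) - 2 * s * dot e (z - x) + s ^+ 2 * dot e e.
      by rewrite /dot /= /GRing.scale /=; ring.
    rewrite -[dot (x - z) _]sqr_enorm -enorm_dist zt e1 mulr1 lerD2r lerD2l lerN2.
    by have : s * (t / 2) <= s * dot e (z - x) by [rewrite ler_pM2l]; lra.
  have v2 : (z - x).1 ^+ 2 + (z - x).2 ^+ 2 = t ^+ 2.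
    by rewrite -zt edist_sym enorm_dist sqr_enorm /dot !expr2.
  have [h1|h1] := leP (t / 2) (z - x).1.
    by left; left; apply: Mdot; rewrite /dot /=; [ring|rewrite mul1r mul0r addr0].
  have [h2|h2] := leP (t / 2) (- (z - x).1).
    by left; right; apply: Mdot; rewrite /dot /=; [ring|rewrite mulN1r mul0r addr0].
  have [h3|h3] := leP (t / 2) (z - x).2.
    by right; left; apply: Mdot; rewrite /dot /=; [ring|rewrite mul1r mul0r add0r].
  have [h4|h4] := leP (t / 2) (- (z - x).2).
    by right; right; apply: Mdot; rewrite /dot /=; [ring|rewrite mulN1r mul0r add0r].
  have sq (u : R) : u < t / 2 -> - u < t / 2 -> u ^+ 2 < (t / 2) ^+ 2.
    move=> u1 u2; have -> : u ^+ 2 = `|u| ^+ 2 by rewrite -normrX ger0_norm ?sqr_ge0.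
    rewrite ltr_pXn2r// ?nnegrE ?divr_ge0 ?(ltW t0)// ltr_norml; lra.
  have := sq _ h1 h2; have := sq _ h3 h4; have : 0 < t ^+ 2 by rewrite exprn_gt0.
  by move: v2; rewrite expr_div_n; lra.
have mM e : measurable (M e) by exact: closed_plane_measurable.
have null1 (d : R) : d ^+ 2 = 1 -> plane_measure (M (d, 0)) = 0%E.
  move=> d1; rewrite plane_measureE2//; apply: integral0_eq => y _.
  apply: countable_lebesgue_measure0.
  have key (u v : R) : M (d, 0) (u, y) -> M (d, 0) (v, y) -> 0 < d * (v - u) -> t <= d * (v - u).
    move=> Mu Mv; apply: (@sep (d, 0) (u, y)) => //.
    rewrite (_ : _ + _ = (v, y))//; apply: pair_eq; rewrite /= /GRing.scale /=.
      by rewrite mulrAC -expr2 d1; ring.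
    by ring.
  apply: (@discrete_countable _ t) => // u v; rewrite /ysection /= !inE => Mu Mv uv.
  have : (d - 1) * (d + 1) = 0 by rewrite -subr_sqr expr1n d1 subrr.
  move=> /eqP; rewrite mulf_eq0 subr_eq0 addr_eq0 => /orP[/eqP E|/eqP E].
    by have := key _ _ Mu Mv; rewrite E mul1r subr_gt0; apply.
  by have := key _ _ Mv Mu; rewrite E mulN1r opprB subr_gt0; apply.
have null2 (d : R) : d ^+ 2 = 1 -> plane_measure (M (0, d)) = 0%E.
  move=> d1; rewrite /plane_measure /product_measure1; apply: integral0_eq => y _.
  apply: countable_lebesgue_measure0.
  have key (u v : R) : M (0, d) (y, u) -> M (0, d) (y, v) -> 0 < d * (v - u) -> t <= d * (v - u).
    move=> Mu Mv; apply: (@sep (0, d) (y, u)) => //.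
    rewrite (_ : _ + _ = (y, v))//; apply: pair_eq; rewrite /= /GRing.scale /=; first by ring.
    by rewrite mulrAC -expr2 d1; ring.
  apply: (@discrete_countable _ t) => // u v; rewrite /xsection /= !inE => Mu Mv uv.
  have : (d - 1) * (d + 1) = 0 by rewrite -subr_sqr expr1n d1 subrr.
  move=> /eqP; rewrite mulf_eq0 subr_eq0 addr_eq0 => /orP[/eqP E|/eqP E].
    by have := key _ _ Mu Mv; rewrite E mul1r subr_gt0; apply.
  by have := key _ _ Mv Mu; rewrite E mulN1r opprB subr_gt0; apply.
have n1 : (-1) ^+ 2 = 1 :> R by rewrite sqrrN expr1n.
have p1 : 1 ^+ 2 = 1 :> R by rewrite expr1n.
have U0 (A B : set (R * R)) : measurable A -> measurable B -> plane_measure A = 0%E ->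
    plane_measure B = 0%E -> plane_measure (A `|` B) = 0%E.
  move=> mA mB A0 B0; apply/eqP; rewrite eq_le measure_ge0 andbT.
  apply: le_trans (measureU2 (@lebesgue_measure R \x @lebesgue_measure R)%E mA mB) _.
  by rewrite -[X in (X + _)%E]/(plane_measure A) -[X in (_ + X)%E]/(plane_measure B) A0 B0 adde0.
apply/eqP; rewrite eq_le measure_ge0 andbT.
rewrite -(U0 _ _ (measurableU _ _ (mM (1, 0)) (mM (-1, 0))) (measurableU _ _ (mM (0, 1)) (mM (0, -1)))
  (U0 _ _ (mM _) (mM _) (null1 _ p1) (null1 _ n1)) (U0 _ _ (mM _) (mM _) (null2 _ p1) (null2 _ n1))).
apply: le_measure; rewrite ?inE//; first exact: closed_plane_measurable.
by apply: measurableU; apply: measurableU; exact: mM.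
Qed.

End level_sets.

(** Only s is confined to [a, b]; t is any point close to it, which is convenient for approximate
    distances. *)
Lemma uniform_continuous_itv (R : realType) (h : R -> R) (a b e : R) : continuous h -> 0 < e ->
  exists2 r : R, 0 < r & forall s t, a <= s <= b -> `|s - t| < r -> `|h s - h t| <= e.
Proof.
(* The interval is laid on the first axis of the plane, where [lebesgue_number] applies. *)
move=> ch e0; pose K : set (R * R) := `[a, b] `*` `[0, 0].
have kK : compact K by apply: compact_setX; exact: segment_compact.
pose G p (r : R) := forall y : R * R, edist y p < r -> `|h p.1 - h y.1| <= e / 2.
have [p _|r r0 hr] := @lebesgue_number _ K G kK.
  have e2 : 0 < e / 2 by rewrite divr_gt0.
  have /cvgrPdist_le /(_ _ e2) /nbhs_ballP[d /= d0 hd] := ch p.1.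
  exists d => // y yp; apply: hd; rewrite /ball /= distrC.
  by apply: le_lt_trans (norm1_le_enorm (y - p)) _; rewrite -enorm_dist.
exists r => // s t sab st.
have Ks : K (s, 0) by split; rewrite /= in_itv /= ?lexx.
have [p [d [Gp sp]]] := hr _ Ks.
have stE : edist (t, 0) (s, 0) < r.
  rewrite enorm_dist; apply: le_lt_trans (enorm_le_norm _) _.
  by rewrite /= subrr normr0 addr0 distrC.
have h1 := Gp (s, 0) (lt_trans (ltr_pwDr r0 (lexx _)) sp).
have h2 : `|h p.1 - h t| <= e / 2.
  by apply: (Gp (t, 0)); apply: le_lt_trans (edist_triangle _ (s, 0) _) _; lra.
have -> : h s - h t = (h p.1 - h t) - (h p.1 - h s) by ring.
by apply: le_trans (ler_normB _ _) _; move: h1 h2; rewrite /=; lra.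
Qed.

Section profile.
Context {R : realType}.
Variables (X : set (R * R)) (L : R).
Hypotheses (oX : open X) (bX : bounded_set X) (X0 : X !=set0) (L0 : 0 <= L).
Hypothesis parallel : forall (s t : R) (x0 : R * R), 0 <= s -> s < t -> t < bdist X x0 ->
  area (inner X s) - area (inner X t) <= L * (t - s) - pi * (t ^+ 2 - s ^+ 2).

Let V t := area (inner X t).
Let A := area X.

Let mI t : measurable (inner X t). Proof. exact: measurable_inner. Qed.

Let VA : V 0 = A. Proof. by rewrite /V inner0. Qed.

Let bI (t : R) : 0 <= t -> bounded_set (inner X t).
Proof. by move=> t0; apply: sub_bounded bX; exact: inner_sub. Qed.

Lemma inradius : exists2 x0, 0 < bdist X x0 & forall x, bdist X x <= bdist X x0.
Proof.
have [x1 Xx1] := X0; have b1 := bdist_in oX bX Xx1.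
pose K := [set x | bdist X x1 <= bdist X x].
have kK : compact K.
  apply: closed_bounded_compact.
    apply: (@closed_comp _ _ (bdist X) [set u | bdist X x1 <= u]); last exact: closed_ge.
    by move=> x _; exact: continuous_bdist.
  apply: sub_bounded bX => x /= h; apply: (@bdist_gt _ X x 0); rewrite ?edistxx//.
  exact: lt_le_trans h.
have K0 : K !=set0 by exists x1; rewrite /K /=.
have cb : {within K, continuous (bdist X)} by apply: continuous_subspaceT; exact: continuous_bdist.
have [x0 /set_mem Kx0 hx0] := compact_EVT_max K0 kK cb.
exists x0; first exact: lt_le_trans Kx0.
move=> x; have [h|h] := leP (bdist X x1) (bdist X x); first by apply: hx0; exact: mem_set.
exact: (le_trans (ltW h)).
Qed.

(** The left limit of V at t exceeds V(t) by the area of the level set, which is 0. Left continuity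
    carries the parallel inequality to the inradius, where V vanishes. *)
Let Vleft (t : R) : 0 < t -> V (t - t / n.+2%:R) @[n --> \oo] --> V t.
Proof.
move=> t0; pose E n := inner X (t - t / n.+2%:R).
have tn n : 0 <= t - t / n.+2%:R.
  by rewrite subr_ge0 ler_pdivrMr// ler_peMr ?(ltW t0)// ler1n.
have EC : \bigcap_n E n = inner X t `|` [set x | bdist X x = t].
  apply/seteqP; split => x.
    move=> Ex; have : t <= bdist X x.
      apply/ler_addgt0Pr => e e0.
      have [n hn] := ltr_add_invr (y := 0) (divr_gt0 e0 t0); rewrite add0r in hn.
      have := Ex n I; rewrite /E /inner /= => h.
      have h2 : t / n.+2%:R < e.
        apply: le_lt_trans (_ : t / n.+1%:R < e).
          by rewrite ler_pM2l// lef_pV2 ?posrE// ler_nat.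
        by rewrite mulrC -ltr_pdivlMr.
      by rewrite -lerBlDr ltW// (le_lt_trans _ h)// lerD2l lerN2 ltW.
    by rewrite le_eqVlt => /orP[/eqP|]; [right|left].
  have tnt n : t - t / n.+2%:R < t by rewrite gtrBl divr_gt0.
  by move=> [h|h] n _; rewrite /E /inner /=; [exact: lt_trans (tnt n) h|rewrite h].
have mL : measurable [set x | bdist X x = t].
  apply: closed_plane_measurable; apply: (@closed_comp _ _ (bdist X) [set t]); last exact: closed_eq.
  by move=> x _; exact: continuous_bdist.
have cv : plane_measure (E n) @[n --> \oo] --> plane_measure (\bigcap_n E n).
  apply: nonincreasing_cvg_mu => //.
  - by rewrite -[X in (X < _)%E]/(plane_measure (E 0%N)) bounded_plane_measure//; [exact: mI|exact: bI].
  - by move=> i; exact: mI.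
  - by apply: bigcapT_measurable => i; exact: mI.
  - move=> m n mn; apply/subsetPset => x; rewrite /E /inner /=; apply: le_lt_trans.
    by rewrite lerD2l lerN2 ler_pM2l// lef_pV2 ?posrE// ler_nat.
have PE : plane_measure (\bigcap_n E n) = (V t)%:E.
  rewrite EC /V -(areaE (mI t) (bI (ltW t0))).
  have mU : measurable (inner X t `|` [set x | bdist X x = t]) by apply: measurableU; [exact: mI|exact: mL].
  apply/eqP; rewrite eq_le; apply/andP; split; last first.
    rewrite -[X in (X <= _)%E]/(plane_measure (inner X t)).
    apply: le_measure; [exact: mem_set (mI t)|exact: mem_set mU|by move=> x; left].
  apply: le_trans (measureU2 (@lebesgue_measure R \x @lebesgue_measure R)%E (mI t) mL) _.
  by rewrite -[X in (_ + X <= _)%E]/(plane_measure _) area_level_set// adde0.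
move: cv; rewrite PE => /fine_cvgP[_ cv].
exact: cv.
Qed.

Lemma inner_parallel_closed (s t : R) x0 : 0 <= s -> s < t -> t <= bdist X x0 ->
  area (inner X s) - area (inner X t) <= L * (t - s) - pi * (t ^+ 2 - s ^+ 2).
Proof.
move=> s0 st tx; have t0 : 0 < t by exact: le_lt_trans st.
pose u n : R := t - t / n.+2%:R.
have cu : u n @[n --> \oo] --> t.
  rewrite -[X in _ --> X]subr0; apply: cvgB; first exact: cvg_cst.
  rewrite -[X in _ --> X](mulr0 t); apply: cvgMr.
  have := @cvg_harmonic R; rewrite -(cvg_shiftn 1) => h.
  by apply: cvg_trans h; apply: near_eq_cvg; apply: nearW => n; rewrite /= addn1.
have cv : (V s - V (u n) - (L * (u n - s) - pi * (u n * u n - s ^+ 2))) @[n --> \oo] -->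
    V s - V t - (L * (t - s) - pi * (t * t - s ^+ 2)).
  apply: cvgB; first by apply: cvgB; [exact: cvg_cst|exact: Vleft].
  apply: cvgB; apply: cvgMr; apply: cvgB; try exact: cvg_cst; first exact: cu.
  by apply: cvgM; exact: cu.
rewrite -subr_le0 (expr2 t); apply: (cvgr_to_le cv).
have /cvgrPdist_lt /(_ (t - s)) : u n @[n --> \oo] --> t by [].
rewrite subr_gt0 => /(_ st); apply: filterS => n hn.
have un : u n < t by rewrite gtrBl divr_gt0.
rewrite subr_le0 -expr2; apply: (@parallel _ _ x0) => //; last exact: lt_le_trans tx.
by move: hn; rewrite gtr0_norm ?subr_gt0//; lra.
Qed.

Lemma area_inner_ge (t : R) x0 : 0 <= t -> t <= bdist X x0 ->
  A - L * t + pi * t ^+ 2 <= area (inner X t).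
Proof.
rewrite le_eqVlt => /orP[/eqP<- _|t0 tx].
  by rewrite -/(V 0) VA mulr0 subr0 expr0n mulr0 addr0.
by have := inner_parallel_closed (lexx 0) t0 tx; rewrite -/(V 0) VA subr0 expr0n subr0; lra_area.
Qed.

Let D := L ^+ 2 - 4 * pi * A.
(** The smaller root T of A - L t + pi t^2. *)
Definition inner_radius : R := (L - Num.sqrt D) / (2 * pi).
Let T := inner_radius.

Let p0 : 0 < pi :> R. Proof. exact: pi_gt0. Qed.

Lemma area_open_gt0 : 0 < A.
Proof.
have [x1 Xx1] := X0; have b1 := bdist_in oX bX Xx1.
set r := bdist X x1 in b1.
have sub : disk x1 r `<=` X by move=> y /= xy; apply: (bdist_gt xy).
have md : measurable (disk x1 r) by apply: open_plane_measurable; exact: open_disk.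
have mX : measurable X by exact: open_plane_measurable.
apply: lt_le_trans (le_area md mX bX sub).
by rewrite area_disk// mulr_gt0// exprn_gt0.
Qed.

(** Bonnesen's argument: at the inradius r the area V is 0, so that A - L r + pi r^2 <= 0, and the
    discriminant cannot be negative. *)
Lemma isoperimetric : 4 * pi * A <= L ^+ 2.
Proof.
have [x0 r0 hr] := inradius; set r := bdist X x0 in r0 hr.
have Vr : V r = 0.
  have E : inner X r = set0 by rewrite -subset0 => x; rewrite /inner /= ltNge hr.
  by rewrite /V E /area /plane_measure measure0.
have := area_inner_ge (ltW r0) (lexx r); rewrite -/(V r) Vr => h.
have : 0 <= (L - 2 * pi * r) ^+ 2 by exact: sqr_ge0.
have : 4 * pi * (A - L * r + pi * r ^+ 2) <= 4 * pi * 0 by rewrite ler_pM2l// mulr_gt0.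
rewrite mulr0.
have -> : (L - 2 * pi * r) ^+ 2 = L ^+ 2 - 4 * pi * A + 4 * pi * (A - L * r + pi * r ^+ 2) by ring.
by lra_area.
Qed.

(** The inradius lies between the two roots, because the polynomial is at most 0 there; hence T does
    not exceed it. *)
Lemma inner_radiusP : [/\ 0 < T, A - L * T + pi * T ^+ 2 = 0, 2 * pi * T <= L &
  exists x0, T <= bdist X x0].
Proof.
have Dge : 0 <= D by rewrite subr_ge0 isoperimetric.
pose S := Num.sqrt D; have S0 : 0 <= S by exact: sqrtr_ge0.
have S2 : S ^+ 2 = L ^+ 2 - 4 * pi * A by rewrite sqr_sqrtr.
have A4 : 0 < 4 * pi * A by rewrite mulr_gt0 ?area_open_gt0// mulr_gt0.
have SL : S < L.
  by rewrite -(@ltr_pXn2r _ 2)// ?nnegrE// S2 gtrBl.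
have ET : 2 * pi * T = L - S by rewrite /T /inner_radius mulrC divfK// gt_eqF// mulr_gt0.
have pp : 0 < 2 * pi :> R by rewrite mulr_gt0.
split.
- by rewrite divr_gt0 ?subr_gt0.
- apply: (@mulfI _ (4 * pi)); first by rewrite gt_eqF// mulr_gt0.
  rewrite mulr0; transitivity (4 * pi * A - 2 * L * (2 * pi * T) + (2 * pi * T) ^+ 2); first by ring.
  by rewrite ET; transitivity (S ^+ 2 - (L ^+ 2 - 4 * pi * A)); [ring|rewrite S2 subrr].
- by rewrite ET gerBl.
have [x0 r0 hr] := inradius; exists x0; set r := bdist X x0 in r0 hr *.
have Vr : V r = 0.
  have E : inner X r = set0 by rewrite -subset0 => x; rewrite /inner /= ltNge hr.
  by rewrite /V E /area /plane_measure measure0.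
have := area_inner_ge (ltW r0) (lexx r); rewrite -/(V r) Vr => h.
have h2 : (L - 2 * pi * r) ^+ 2 <= S ^+ 2.
  have : 4 * pi * (A - L * r + pi * r ^+ 2) <= 4 * pi * 0 by rewrite ler_pM2l// mulr_gt0.
  rewrite mulr0 S2 => h3; rewrite -subr_le0.
  have -> : (L - 2 * pi * r) ^+ 2 - (L ^+ 2 - 4 * pi * A) = 4 * pi * (A - L * r + pi * r ^+ 2) by ring.
  exact: h3.
rewrite -(ler_pM2l pp) ET lerBlDr -lerBlDl.
rewrite leNgt; apply/negP => h4; move: h2; rewrite leNgt => /negP; apply.
by rewrite ltr_pXn2r// nnegrE// ltW// (le_lt_trans S0).
Qed.

(** Riemann sums over the layers between i w and (i + 1) w. By the parallel inequality the area of a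
    layer is at most w times the value of L - 2 pi t in its middle, and since h >= 0 an upper bound
    for the area is enough. *)
Let integral_bdist_le_pos (h H : R -> R) : continuous h -> (forall t, 0 <= h t) ->
  (forall t : R, 0 <= t <= T -> is_derive t 1 H (h t * (L - 2 * pi * t))) ->
  (\int[plane_measure]_(x in X `&` [set x | (bdist X x <= T)%R]) (h (bdist X x))%:E <=
   (H T - H 0)%:E)%E.
Proof.
move=> ch h0 dH; have [T0 _ TL [x0 Tx0]] := inner_radiusP.
have L0' : 0 <= L by exact: L0.
have [B B0 hB] : exists2 B : R, 0 <= B & forall t, 0 <= t <= T -> h t <= B.
  have [|c _ hc] := @EVT_max _ h 0 T (ltW T0); first exact: continuous_subspaceT.
  by exists (h c) => // t ht; apply: hc; rewrite in_itv.
apply/lee_addgt0Pr => eps eps0.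
pose e := eps / (2 * (T * L + 1)).
have TL1 : 0 < T * L + 1 by rewrite ltr_wpDl// mulr_ge0// ltW.
have TB1 : 0 < T * (B * pi) + 1 by apply: ltr_wpDl => //; exact: mulr_ge0 (ltW T0) (mulr_ge0 B0 (pi_ge0 R)).
have e0 : 0 < e by rewrite divr_gt0// mulr_gt0.
have [rho rho0 hrho] := uniform_continuous_itv 0 T ch e0.
pose rho' := Num.min rho (eps / (2 * (T * (B * pi) + 1))).
have rho'0 : 0 < rho' by rewrite lt_min rho0 divr_gt0// mulr_gt0.
pose N := (Num.truncn (T / rho')).+1; have N0 : 0 < N%:R :> R by rewrite ltr0n.
pose w := T / N%:R; have w0 : 0 < w by rewrite divr_gt0.
have Nw : N%:R * w = T by rewrite mulrC divfK// gt_eqF.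
have wr : w < rho'.
  by rewrite /w ltr_pdivrMr// mulrC -ltr_pdivrMr//; exact: truncnS_gt.
have wrho : w < rho by move: wr; rewrite lt_min => /andP[].
have tle i : (i <= N)%N -> 0 <= i%:R * w <= T.
  by move=> iN; rewrite mulr_ge0 ?(ltW w0)//= -Nw ler_pM2r// ler_nat.
have tS i : i.+1%:R * w = i%:R * w + w by rewrite -natr1 mulrDl mul1r.
pose E (i : 'I_N) := inner X (i%:R * w) `\` inner X (i.+1%:R * w).
have mE i : measurable (E i) by apply: measurableD; exact: mI.
have bE i : bounded_set (E i).
  have /andP[i0 _] := tle i (ltnW (ltn_ord i)).
  by apply: sub_bounded (bI i0) => x [].
have mh (S : set (R * R)) : measurable_fun S (fun x => (h (bdist X x))%:E).
  apply/measurable_EFinP; apply: measurable_funTS; apply: continuous_plane_measurable => x.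
  by apply: continuous_comp; [exact: continuous_bdist|exact: ch].
have piece i : (\int[plane_measure]_(x in E i) (h (bdist X x))%:E <=
    (H (i.+1%:R * w) - H (i%:R * w) + w * (B * pi * w + e * L))%:E)%E.
  have /andP[i0 iT] := tle i (ltnW (ltn_ord i)); have /andP[i1 iT1] := tle i.+1 (ltn_ord i).
  have ii : i%:R * w < i.+1%:R * w by rewrite tS ltrDl.
  have dH' (t : R) : i%:R * w <= t <= i.+1%:R * w -> is_derive t 1 H (h t * (L - 2 * pi * t)) by move=> /andP[ta tb]; apply: dH; rewrite (le_trans i0 ta) (le_trans tb).
  (* With h taken at the mean value point xi, the main terms are the increments of H and
     telescope. *)
  have [xi xii Exi] := MVTd ii dH'; have /andP[x1 x2] := xii.
  have xi0T : 0 <= xi <= T by rewrite (le_trans i0 (ltW x1)) (le_trans (ltW x2)).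
  apply: (@le_trans _ _ (\int[plane_measure]_(x in E i) (h xi + e)%:E)%E).
    apply: ge0_le_integral; [exact: mE|by move=> x _; rewrite lee_fin|exact: mh|exact: measurable_cst|].
    move=> x [/= hx /negP]; rewrite -leNgt => hx'; rewrite lee_fin.
    have : `|h xi - h (bdist X x)| <= e.
      have hx2 : i%:R * w < bdist X x by exact: hx.
      have h3 : `|xi - bdist X x| <= w by rewrite ler_norml; move: x1 x2 hx2 hx'; rewrite !tS; clear; set a := _ * w; lra.
      apply: hrho; [exact: xi0T|exact: le_lt_trans wrho].
    by rewrite ler_norml => /andP[]; lra.
  rewrite integral_plane_cst// lee_fin /E areaD//; last 2 first.
  - exact: bI.
  - by move=> x; apply: lt_trans.
  have V1 := inner_parallel_closed i0 ii (le_trans iT1 Tx0).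
  have V2 : area (inner X (i%:R * w)) - area (inner X (i.+1%:R * w)) <=
      w * (L - pi * (i%:R * w + i.+1%:R * w)).
    by apply: le_trans V1 _; rewrite !tS le_eqVlt; apply/orP; left; apply/eqP; ring.
  have he : 0 <= h xi + e by rewrite addr_ge0// ltW.
  apply: le_trans (ler_wpM2l he V2) _.
  have -> : H (i.+1%:R * w) - H (i%:R * w) = h xi * (L - 2 * pi * xi) * w.
    by rewrite Exi tS addrAC subrr add0r.
  have k1 : h xi * (pi * (2 * xi - (i%:R * w + i.+1%:R * w))) <= B * (pi * w).
    apply: (@le_trans _ _ (h xi * (pi * w))).
      apply: ler_wpM2l => //; rewrite ler_pM2l//; move: x1 x2; rewrite !tS; lra.
    by rewrite ler_wpM2r ?hB// mulr_ge0 ?(ltW w0)// ltW.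
  have k2 : e * (pi * (i%:R * w + i.+1%:R * w)) >= 0.
    by rewrite mulr_ge0 ?(ltW e0)// mulr_ge0 ?(ltW p0)// addr_ge0.
  have -> : (h xi + e) * (w * (L - pi * (i%:R * w + i.+1%:R * w))) =
    w * (h xi * (L - 2 * pi * xi) + h xi * (pi * (2 * xi - (i%:R * w + i.+1%:R * w))) +
         e * L - e * (pi * (i%:R * w + i.+1%:R * w))) by ring.
  have -> : h xi * (L - 2 * pi * xi) * w + w * (B * pi * w + e * L) =
    w * (h xi * (L - 2 * pi * xi) + B * (pi * w) + e * L) by ring.
  by rewrite ler_pM2l//; lra.
have mD : measurable (X `&` [set x | bdist X x <= T]).
  apply: measurableI; first exact: open_plane_measurable.
  apply: closed_plane_measurable; apply: (@closed_comp _ _ (bdist X) [set u | u <= T]); last exact: closed_le.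
  by move=> x _; exact: continuous_bdist.
have IC := @integral_cover R 'I_N _ _ (@lebesgue_measure R \x @lebesgue_measure R)%E
  (X `&` [set x | bdist X x <= T]) E (fun x => (h (bdist X x))%:E).
apply: le_trans (IC mD mE (mh setT) (fun x => _) _) _.
- by move=> x; rewrite lee_fin.
- move=> x [Xx /= xT]; have bx := bdist_in oX bX Xx.
  have exn : exists n, bdist X x <= n%:R * w by exists N; rewrite Nw.
  case: (ex_minnP exn) => -[|n] hn nmin; first by move: bx; rewrite ltNge -(mul0r w) hn.
  have nN : (n < N)%N by apply: nmin; rewrite Nw.
  exists (Ordinal nN); split; rewrite /inner /=; last by apply/negP; rewrite -leNgt.
  by rewrite ltNge; apply/negP => /nmin; rewrite ltnn.
apply: le_trans (lee_sum _ (fun i _ => piece i)) _.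
rewrite sumEFin -EFinD lee_fin big_split /= sumr_const card_ord.
rewrite -(big_mkord xpredT (fun i => H (i.+1%:R * w) - H (i%:R * w))) telescope_sumr// Nw mul0r.
rewrite lerD2l -[leLHS]mulr_natl mulrA Nw.
have a1 : T * (B * pi) * w <= eps / 2.
  apply: (@le_trans _ _ ((T * (B * pi) + 1) * w)); first by rewrite ler_wpM2r ?(ltW w0)// lerDl.
  rewrite mulrC -ler_pdivlMr// -[leRHS]mulrA -invfM; apply: ltW; apply: lt_le_trans wr _.
  by rewrite ge_min lexx orbT.
have a2 : e * (T * L) <= eps / 2.
  apply: (@le_trans _ _ (e * (T * L + 1))); first by rewrite ler_wpM2l ?(ltW e0)// lerDl.
  by rewrite -ler_pdivlMr// /e invfM mulrA.
have -> : T * (B * pi * w + e * L) = T * (B * pi) * w + e * (T * L) by ring.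
by lra.
Qed.

(** The integral sees only the values of h on [0, T]; h is composed with the projection onto this
    interval. *)
Lemma integral_bdist_le (h H : R -> R) : continuous h ->
  (forall t : R, 0 <= t <= T -> 0 <= h t) ->
  (forall t : R, 0 <= t <= T -> is_derive t 1 H (h t * (L - 2 * pi * t))) ->
  (\int[plane_measure]_(x in X `&` [set x | (bdist X x <= T)%R]) (h (bdist X x))%:E <=
   (H T - H 0)%:E)%E.
Proof.
move=> ch h0 dH; have [T0 _ _ _] := inner_radiusP.
pose c (t : R) : R := Num.max 0 (Num.min t T).
have c0T t : 0 <= c t <= T by rewrite /c le_max lexx /= ge_max ltW// ge_min lexx orbT.
have cE t : 0 <= t <= T -> c t = t by move=> /andP[t0 tT]; rewrite /c (min_idPl tT) (max_idPr t0).
have cc : continuous c.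
  move=> t; apply: (@continuous_max R _ (fun=> 0) (fun t => Num.min t T)); first exact: cst_continuous.
  by apply: (@continuous_min R _ id (fun=> T)) => //; exact: cst_continuous.
have := @integral_bdist_le_pos (h \o c) H.
have -> : (\int[plane_measure]_(x in X `&` [set x | (bdist X x <= T)%R]) ((h \o c) (bdist X x))%:E =
  \int[plane_measure]_(x in X `&` [set x | (bdist X x <= T)%R]) (h (bdist X x))%:E)%E.
  apply: eq_integral => x /set_mem[Xx /= xT]; rewrite cE// xT andbT ltW//.
  exact: (bdist_in oX bX Xx).
apply.
- by move=> t; apply: continuous_comp; [exact: cc|exact: ch].
- by move=> t; exact: h0.
- by move=> t t0T; rewrite /= cE//; exact: dH.
Qed.

End profile.

(** * Smooth test functions *)

Section directional.
Context {R : realType}.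
Implicit Types (f g : R * R -> R) (x v : R * R).

(** A directional derivative is a derivative along a line. So the chain rule with a real outer
    function follows from the one-variable rule, without a total differential. *)
Lemma is_derive_line f x v (a : R) :
  is_derive x v f a <-> is_derive (0 : R) 1 (fun h => f (h *: v + x)) a.
Proof.
have E : (fun h : R => h^-1 *: (((fun h => f (h *: v + x)) \o shift 0) (h *: 1) - f (0 *: v + x))) =
    (fun h : R => h^-1 *: ((f \o shift x) (h *: v) - f x)).
  apply/funext => h /=; rewrite addr0 scale0r add0r; congr (_ *: (f (_ *: v + x) - _)).
  by rewrite /GRing.scale /= mulr1.
by split=> -[d e]; split; move: d e; rewrite /derivable /derive E.
Qed.

Lemma is_derive_chain (h : R -> R) f x v (a b : R) :
  is_derive (f x) 1 h a -> is_derive x v f b -> is_derive x v (fun y => h (f y)) (a * b).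
Proof.
move=> dh /is_derive_line df; apply/is_derive_line.
have dh' : is_derive (f (0 *: v + x)) 1 h a by rewrite scale0r add0r.
exact: (is_derive1_comp dh' df).
Qed.

Lemma is_deriveDp f g x v (a b : R) : is_derive x v f a -> is_derive x v g b ->
  is_derive x v (fun y => f y + g y) (a + b).
Proof. by move=> df dg; exact: is_deriveD. Qed.

Lemma is_deriveMp f g x v (a b : R) : is_derive x v f a -> is_derive x v g b ->
  is_derive x v (fun y => f y * g y) (a * g x + f x * b).
Proof.
move=> df dg; apply: is_derive_eq (is_deriveM df dg) _.
by rewrite /GRing.scale /= addrC mulrC.
Qed.

Lemma is_derive_cstp x v (c : R) : is_derive x v (fun=> c) 0.
Proof. exact: is_derive_cst. Qed.

Lemma is_deriveZp (c : R) f x v (a : R) : is_derive x v f a ->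
  is_derive x v (fun y => c * f y) (c * a).
Proof.
move=> df; apply: is_derive_eq (is_deriveMp (is_derive_cstp x v c) df) _.
by rewrite mul0r add0r.
Qed.

Lemma is_derive_fst x v : is_derive x v (fun y => y.1) v.1.
Proof.
apply/is_derive_line; have : is_derive (0 : R) 1 (fun h : R => h * v.1 + x.1) v.1.
  by apply: is_derive_eq; rewrite scaler0 add0r addr0 /GRing.scale /= mulr1.
by [].
Qed.

Lemma is_derive_snd x v : is_derive x v (fun y => y.2) v.2.
Proof.
apply/is_derive_line; have : is_derive (0 : R) 1 (fun h : R => h * v.2 + x.2) v.2.
  by apply: is_derive_eq; rewrite scaler0 add0r addr0 /GRing.scale /= mulr1.
by [].
Qed.

Lemma is_derive_sump (T : Type) (s : seq T) (f : T -> R * R -> R) (a : T -> R) x v :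
  (forall i, is_derive x v (f i) (a i)) ->
  is_derive x v (fun y => \sum_(i <- s) f i y) (\sum_(i <- s) a i).
Proof.
move=> df; elim: s => [|i s IH].
  under eq_fun do rewrite big_nil.
  by rewrite big_nil; exact: is_derive_cstp.
under eq_fun do rewrite big_cons.
by rewrite big_cons; exact: is_deriveDp.
Qed.

Lemma Ck_continuous k f : Ck k f -> continuous f.
Proof. by case: k => [|k] => [|[]]. Qed.

Lemma CkW k f : Ck k.+1 f -> Ck k f.
Proof.
elim: k f => [|k IH] f; first by case.
case=> cf df h1 h2; exact: (And4 cf df (IH _ h1) (IH _ h2)).
Qed.

Lemma CkS k f (a b : R * R -> R) : continuous f ->
  (forall x, is_derive x (1, 0) f (a x)) -> (forall x, is_derive x (0, 1) f (b x)) ->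
  Ck k a -> Ck k b -> Ck k.+1 f.
Proof.
move=> cf da db ka kb; have Ea : d1 f = a by apply/funext => x; have [] := da x.
have Eb : d2 f = b by apply/funext => x; have [] := db x.
have dd x : derivable f x ((1, 0) : R * R) /\ derivable f x ((0, 1) : R * R).
  by split; [have [] := da x|have [] := db x].
rewrite -Ea in ka; rewrite -Eb in kb; exact: (And4 cf dd ka kb).
Qed.

Lemma Ck_d1 k f x : Ck k.+1 f -> is_derive x (1, 0) f (d1 f x).
Proof. by move=> [_ /(_ x)[d _] _ _]; exact: derivableP. Qed.

Lemma Ck_d2 k f x : Ck k.+1 f -> is_derive x (0, 1) f (d2 f x).
Proof. by move=> [_ /(_ x)[_ d] _ _]; exact: derivableP. Qed.

Lemma Ck_cst k (c : R) : Ck k (fun _ : R * R => c).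
Proof.
elim: k c => [|k IH] c; first exact: cst_continuous.
apply: (@CkS _ _ (fun=> 0) (fun=> 0)); [exact: cst_continuous|exact: IH|exact: IH].
Qed.

Lemma Ck_fst k : Ck k (fun y : R * R => y.1).
Proof.
have cf : continuous (fun y : R * R => y.1) by move=> x; exact: cvg_fst.
case: k => // k; apply: (CkS cf (is_derive_fst ^~ _) (is_derive_fst ^~ _)) => /=; exact: Ck_cst.
Qed.

Lemma Ck_snd k : Ck k (fun y : R * R => y.2).
Proof.
have cf : continuous (fun y : R * R => y.2) by move=> x; exact: cvg_snd.
case: k => // k; apply: (CkS cf (is_derive_snd ^~ _) (is_derive_snd ^~ _)) => /=; exact: Ck_cst.
Qed.

Lemma CkD k f g : Ck k f -> Ck k g -> Ck k (fun x => f x + g x).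
Proof.
elim: k f g => [|k IH] f g kf kg; have cf := Ck_continuous kf; have cg := Ck_continuous kg.
  by move=> x; apply: cvgD; [exact: cf|exact: cg].
apply: (@CkS _ _ (fun x => d1 f x + d1 g x) (fun x => d2 f x + d2 g x)).
- by move=> x; apply: cvgD; [exact: cf|exact: cg].
- by move=> x; apply: is_deriveDp; exact: (@Ck_d1 k).
- by move=> x; apply: is_deriveDp; exact: (@Ck_d2 k).
- by apply: IH; [case: kf|case: kg].
- by apply: IH; [case: kf|case: kg].
Qed.

Lemma CkM k f g : Ck k f -> Ck k g -> Ck k (fun x => f x * g x).
Proof.
elim: k f g => [|k IH] f g kf kg; have cf := Ck_continuous kf; have cg := Ck_continuous kg.
  by move=> x; apply: cvgM; [exact: cf|exact: cg].
have [kf' kg'] := (CkW kf, CkW kg).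
apply: (@CkS _ _ (fun x => d1 f x * g x + f x * d1 g x) (fun x => d2 f x * g x + f x * d2 g x)).
- by move=> x; apply: cvgM; [exact: cf|exact: cg].
- by move=> x; apply: is_deriveMp; exact: (@Ck_d1 k).
- by move=> x; apply: is_deriveMp; exact: (@Ck_d2 k).
- by apply: CkD; apply: IH => //; [case: kf|case: kg].
- by apply: CkD; apply: IH => //; [case: kf|case: kg].
Qed.

(** The outer function comes as a family in which [h n.+1] is the derivative of [h n] on D, so that
    the induction on k can move along the family. *)
Lemma Ck_comp (h : nat -> R -> R) (D : set R) k n f :
  (forall n t, D t -> is_derive t 1 (h n) (h n.+1 t)) -> (forall x, D (f x)) ->
  Ck k f -> Ck k (fun x => h n (f x)).
Proof.
move=> dh Df; have ch m g : (forall x, D (g x)) -> continuous g -> continuous (fun x => h m (g x)).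
  move=> Dg cg x; apply: continuous_comp; first exact: cg.
  by apply: is_derive_cont (dh m _ (Dg x)).
elim: k n => [|k IH] n kf; have cf := Ck_continuous kf; first exact: ch.
have kf' := CkW kf.
apply: (@CkS _ _ (fun x => h n.+1 (f x) * d1 f x) (fun x => h n.+1 (f x) * d2 f x)).
- exact: ch.
- by move=> x; apply: is_derive_chain; [exact: dh|exact: (@Ck_d1 k)].
- by move=> x; apply: is_derive_chain; [exact: dh|exact: (@Ck_d2 k)].
- by apply: CkM; [exact: IH|case: kf].
- by apply: CkM; [exact: IH|case: kf].
Qed.

Lemma smooth_cst (c : R) : smooth (fun _ : R * R => c).
Proof. by move=> k; exact: Ck_cst. Qed.

Lemma smoothD f g : smooth f -> smooth g -> smooth (fun x => f x + g x).
Proof. by move=> sf sg k; exact: CkD. Qed.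

Lemma smoothM f g : smooth f -> smooth g -> smooth (fun x => f x * g x).
Proof. by move=> sf sg k; exact: CkM. Qed.

Lemma smoothZ (c : R) f : smooth f -> smooth (fun x => c * f x).
Proof. by move=> sf; apply: smoothM => //; exact: smooth_cst. Qed.

Lemma smooth_sum (T : Type) (s : seq T) (f : T -> R * R -> R) :
  (forall i, smooth (f i)) -> smooth (fun y => \sum_(i <- s) f i y).
Proof.
move=> sf; elim: s => [|i s IH].
  by under eq_fun do rewrite big_nil; exact: smooth_cst.
by under eq_fun do rewrite big_cons; exact: smoothD.
Qed.

Lemma smooth_expR f : smooth f -> smooth (fun x => expR (f x)).
Proof.
by move=> sf k; apply: (@Ck_comp (fun=> expR) setT k 0) => // n t _; exact: is_derive_expR.
Qed.

Lemma smooth_ln f : (forall x, 0 < f x) -> smooth f -> smooth (fun x => ln (f x)).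
Proof.
move=> f0 sf k.
pose h n : R -> R := if n is m.+1 then fun t => (-1) ^+ m * m`!%:R * t^-1 ^+ m.+1 else @ln R.
apply: (@Ck_comp h [set t | 0 < t] k 0) => // -[|n] t /= t0.
  by apply: is_derive_eq (is_derive1_ln t0) _; rewrite fact0 expr0 expr1 !mul1r.
have dV : is_derive t 1 (fun t : R => t^-1) (- (t^-1 ^+ 2)).
  have := @is_deriveV R id t 1 1 (lt0r_neq0 t0) (is_derive_id _ _).
  by move=> dh; apply: is_derive_eq dh _; rewrite /GRing.scale /= mulr1 exprVn.
have dX := is_deriveX n.+1 dV.
have dZ := is_deriveZ ((-1) ^+ n * n`!%:R) dX.
have -> : (fun u : R => (-1) ^+ n * n`!%:R * u^-1 ^+ n.+1) = ((-1) ^+ n * n`!%:R) \*: [eta GRing.inv] ^+ n.+1.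
  by apply/funext => u; rewrite exprfctE.
apply: is_derive_eq dZ _; rewrite /GRing.scale /= factS natrM (exprS _ n) !exprS; ring.
Qed.

Lemma sqrt_expR (t : R) : 0 < t -> Num.sqrt t = expR (2^-1 * ln t).
Proof.
move=> t0; have e0 := expR_ge0 (2^-1 * ln t).
rewrite -[RHS]ger0_norm// -sqrtr_sqr; congr Num.sqrt.
by rewrite -expRM_natl mulrA mulfV// mul1r lnK.
Qed.

Lemma smooth_sqrt f : (forall x, 0 < f x) -> smooth f -> smooth (fun x => Num.sqrt (f x)).
Proof.
move=> f0 sf; rewrite (_ : (fun _ => _) = fun x => expR (2^-1 * ln (f x))); last first.
  by apply/funext => x; exact: sqrt_expR.
by apply: smooth_expR; apply: smoothZ; exact: smooth_ln.
Qed.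

Lemma smooth_besselj n f : smooth f -> smooth (fun x => besselj n (f x)).
Proof.
(* The sign turns the rule j_m' = - j_{m+1} into the form that [Ck_comp] expects. *)
move=> sf; pose h m (t : R) : R := (-1) ^+ m * besselj m t.
have s1 : smooth (fun x => h n (f x)).
  move=> k; apply: (@Ck_comp h setT k n) => // m t _.
  apply: is_derive_eq (is_deriveZ ((-1) ^+ m) (is_derive_besselj m t)) _.
  by rewrite /GRing.scale /h /= exprS mulN1r mulNr mulrN.
rewrite (_ : (fun _ => _) = fun x => (-1) ^+ n * h n (f x)); first exact: smoothZ.
by apply/funext => x; rewrite /h mulrA -expr2 sqrr_sign mul1r.
Qed.

End directional.

Section soft_distance.
Context {R : realType}.
Variables (P : seq (R * R)) (eps N : R).
Hypotheses (eps0 : 0 < eps) (N0 : 0 < N) (P0 : P != [::]).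

Definition soft_edist (p x : R * R) : R :=
  Num.sqrt ((x.1 - p.1) ^+ 2 + (x.2 - p.2) ^+ 2 + eps ^+ 2).

(** The log-sum-exp form of the minimum over P. Its gradient is a weighted mean of those of the
    [soft_edist p], hence at most 1 in norm. A large N brings it close to the minimum, and eps
    removes the kinks at the points of P. *)
Definition soft_dist (x : R * R) : R :=
  - N^-1 * ln (\sum_(p <- P) expR (- N * soft_edist p x)).

Let Q (p x : R * R) : R := (x.1 - p.1) ^+ 2 + (x.2 - p.2) ^+ 2 + eps ^+ 2.

Let Q0 p x : 0 < Q p x.
Proof. by rewrite ltr_wpDl ?exprn_gt0// addr_ge0 ?sqr_ge0. Qed.

Lemma soft_edist_gt0 p x : 0 < soft_edist p x.
Proof. by rewrite sqrtr_gt0; exact: Q0. Qed.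

Lemma soft_edist_ge p x : edist x p <= soft_edist p x.
Proof. by rewrite ler_sqrt ?lerDl ?sqr_ge0//; exact: ltW (Q0 p x). Qed.

Lemma soft_edist_le p x : soft_edist p x <= edist x p + eps.
Proof.
have e0 := edist_ge0 x p.
rewrite -(@ler_pXn2r _ 2) ?nnegrE//; [|exact: ltW (soft_edist_gt0 _ _)|by rewrite addr_ge0// ltW].
rewrite sqr_sqrtr; last exact: ltW (Q0 p x).
have e2 : edist x p ^+ 2 = (x.1 - p.1) ^+ 2 + (x.2 - p.2) ^+ 2 by rewrite sqr_sqrtr// addr_ge0 ?sqr_ge0.
rewrite [leRHS]sqrrD e2 lerD2r lerDl mulrn_wge0//.
by rewrite mulr_ge0// ltW.
Qed.

Let E x := \sum_(p <- P) expR (- N * soft_edist p x).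

Let E_ge p x : p \in P -> expR (- N * soft_edist p x) <= E x.
Proof.
by move=> pP; rewrite /E (big_rem p)//= lerDl sumr_ge0// => q _; exact: expR_ge0.
Qed.

Let E0 x : 0 < E x.
Proof.
have : head (0, 0) P \in P by case: (P) P0 => //= a s _; rewrite inE eqxx.
by move/E_ge => /(_ x); apply: lt_le_trans; exact: expR_gt0.
Qed.

Lemma smooth_soft_dist : smooth soft_dist.
Proof.
have sx (c : R) : smooth (fun x : R * R => x.1 - c).
  by apply: smoothD; [exact: Ck_fst|exact: smooth_cst].
have sy (c : R) : smooth (fun x : R * R => x.2 - c).
  by apply: smoothD; [exact: Ck_snd|exact: smooth_cst].
apply: smoothZ; apply: smooth_ln; first exact: E0.
apply: smooth_sum => p; apply: smooth_expR; apply: smoothZ; apply: (smooth_sqrt (f := Q p)); first exact: Q0.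
apply: smoothD; last exact: smooth_cst.
by apply: smoothD; apply: smoothM.
Qed.

Lemma is_derive_soft_edist p x v : is_derive x v (soft_edist p)
  (((x.1 - p.1) * v.1 + (x.2 - p.2) * v.2) / soft_edist p x).
Proof.
have s0 : soft_edist p x != 0 by rewrite gt_eqF// soft_edist_gt0.
have dx : is_derive x v (fun y => y.1 - p.1) v.1.
  by apply: is_derive_eq (is_deriveDp (is_derive_fst x v) (is_derive_cstp x v _)) _; rewrite addr0.
have dy : is_derive x v (fun y => y.2 - p.2) v.2.
  by apply: is_derive_eq (is_deriveDp (is_derive_snd x v) (is_derive_cstp x v _)) _; rewrite addr0.
have dQ := is_deriveDp (is_deriveDp (is_deriveMp dx dx) (is_deriveMp dy dy)) (is_derive_cstp x v (eps ^+ 2)).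
apply: is_derive_eq (is_derive_chain (is_derive1_sqrt (Q0 p x)) dQ) _.
rewrite -[Num.sqrt _]/(soft_edist p x); field.
exact: s0.
Qed.

Let W p x := expR (- N * soft_edist p x).

Lemma is_derive_soft_dist x v : is_derive x v soft_dist
  ((\sum_(p <- P) W p x * (((x.1 - p.1) * v.1 + (x.2 - p.2) * v.2) / soft_edist p x)) / E x).
Proof.
have dW p := is_derive_chain (is_derive_expR _) (is_deriveZp (- N) (is_derive_soft_edist p x v)).
have dE := is_derive_sump P dW.
apply: is_derive_eq (is_deriveZp (- N^-1) (is_derive_chain (is_derive1_ln (E0 x)) dE)) _.
rewrite mulrC -mulrA mulrC; congr (_ / _).
rewrite mulr_suml; apply: eq_bigr => p _; rewrite /W.
by field; rewrite gt_eqF ?soft_edist_gt0// gt_eqF.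
Qed.

(** The Cauchy-Schwarz inequality with weights. *)
Lemma weighted_sum_sqr (T : Type) (s : seq T) (w a : T -> R) : (forall i, 0 <= w i) ->
  (\sum_(i <- s) w i * a i) ^+ 2 <= (\sum_(i <- s) w i) * (\sum_(i <- s) w i * a i ^+ 2).
Proof.
move=> w0; elim: s => [|i s IH]; first by rewrite !big_nil expr0n mul0r.
rewrite !big_cons; set X := \sum_(_ <- _) _ in IH *; set Y := \sum_(_ <- _) w _ in IH *.
set Z := \sum_(_ <- _) _ in IH *.
have Y0 : 0 <= Y by rewrite sumr_ge0.
have Z0 : 0 <= Z by rewrite sumr_ge0// => j _; rewrite mulr_ge0 ?sqr_ge0.
suff : 2 * a i * X <= Y * a i ^+ 2 + Z.
  move/(ler_wpM2l (w0 i)) => h.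
  have -> : (w i * a i + X) ^+ 2 = w i * (w i * a i ^+ 2) + w i * (2 * a i * X) + X ^+ 2 by ring.
  have -> : (w i + Y) * (w i * a i ^+ 2 + Z) =
    w i * (w i * a i ^+ 2) + w i * (Y * a i ^+ 2 + Z) + Y * Z by ring.
  by rewrite lerD// lerD2l.
have [Y00|Yn0] := eqVneq Y 0.
  have : X ^+ 2 <= 0 by rewrite (le_trans IH)// Y00 mul0r.
  by rewrite le_eqVlt ltNge sqr_ge0 orbF sqrf_eq0 => /eqP->; rewrite mulr0 Y00 mul0r add0r.
have Yp : 0 < Y by rewrite lt_def Yn0.
rewrite -(ler_pM2l Yp) -subr_ge0.
apply: (@le_trans _ _ ((Y * a i - X) ^+ 2)); first exact: sqr_ge0.
by move: IH; nra.
Qed.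

Lemma soft_dist_gradient x : (d1 soft_dist x) ^+ 2 + (d2 soft_dist x) ^+ 2 <= 1.
Proof.
have -> : d1 soft_dist x = (\sum_(p <- P) W p x * ((x.1 - p.1) / soft_edist p x)) / E x.
  have [_] := is_derive_soft_dist x (1, 0); rewrite /d1 => ->; congr (_ / _).
  by apply: eq_bigr => p _; rewrite /= mulr1 mulr0 addr0.
have -> : d2 soft_dist x = (\sum_(p <- P) W p x * ((x.2 - p.2) / soft_edist p x)) / E x.
  have [_] := is_derive_soft_dist x (0, 1); rewrite /d2 => ->; congr (_ / _).
  by apply: eq_bigr => p _; rewrite /= mulr1 mulr0 add0r.
rewrite !expr_div_n -mulrDl ler_pdivrMr ?exprn_gt0// mul1r.
have W0 p : 0 <= W p x by exact: expR_ge0.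
apply: le_trans (lerD (weighted_sum_sqr _ _ W0) (weighted_sum_sqr _ _ W0)) _.
rewrite -/(E x) -mulrDr -big_split /= expr2; apply: ler_wpM2l; first exact: ltW (E0 x).
apply: ler_sum => p _; rewrite -mulrDr; apply: ler_piMr => //.
rewrite !expr_div_n -mulrDl ler_pdivrMr ?exprn_gt0 ?soft_edist_gt0// mul1r sqr_sqrtr ?lerDl ?sqr_ge0//.
exact: ltW (Q0 p x).
Qed.

Lemma soft_dist_ge x (d : R) : (forall p, p \in P -> d <= edist x p) ->
  d - N^-1 * ln (size P)%:R <= soft_dist x.
Proof.
move=> hd; have s0 : 0 < (size P)%:R :> R by rewrite ltr0n lt0n size_eq0.
have h : E x <= (size P)%:R * expR (- N * d).
  apply: (@le_trans _ _ (\sum_(p <- P) expR (- N * d))); last first.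
    by rewrite big_const_seq count_predT iter_addr_0 mulr_natl.
  rewrite /E !big_seq; apply: ler_sum => p pP; rewrite ler_expR !mulNr lerN2 ler_pM2l//.
  by rewrite (le_trans (hd p pP))// soft_edist_ge.
have h2 : ln (E x) <= ln (size P)%:R - N * d.
  apply: (@le_trans _ _ (ln ((size P)%:R * expR (- N * d)))).
    by rewrite ler_ln ?posrE// mulr_gt0 ?expR_gt0.
  by rewrite lnM ?posrE ?expR_gt0// expRK mulNr.
rewrite /soft_dist -/(E x) -(ler_pM2l N0) mulrBr !mulrA mulrN mulfV ?gt_eqF// mul1r mulN1r.
by lra.
Qed.

Lemma soft_dist_le x p : p \in P -> soft_dist x <= edist x p + eps.
Proof.
move=> pP; apply: le_trans (soft_edist_le p x).
have h2 : - N * soft_edist p x <= ln (E x).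
  by rewrite -[leLHS]expRK ler_ln ?posrE ?expR_gt0//; exact: E_ge.
rewrite /soft_dist -/(E x) -(ler_pM2l N0) !mulrA mulrN mulfV ?gt_eqF// mulN1r.
by lra.
Qed.

End soft_distance.

Section smooth_profile.
Context {R : realType}.

Lemma finite_net (K : set (R * R)) (e : R) : compact K -> 0 < e ->
  exists2 P : seq (R * R), forall p, p \in P -> K p &
    forall y, K y -> exists2 p, p \in P & edist y p <= e.
Proof.
move=> /compact_near_coveringP cK e0.
(* The filter of finite sequences, generated by those that contain a given finite part of K; the
   covering property of K along it yields a net. *)
pose FF : set_system (seq (R * R)) := fun A => exists2 s0 : seq (R * R),
  (forall p, p \in s0 -> K p) & forall s, {subset s0 <= s} -> A s.
have FFF : Filter FF.
  split; first by exists [::].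
    move=> A B [sA kA hA] [sB kB hB]; exists (sA ++ sB).
      by move=> p; rewrite mem_cat => /orP[/kA|/kB].
    by move=> s ss; split; [apply: hA|apply: hB] => p ps; apply: ss; rewrite mem_cat ps ?orbT.
  by move=> A B AB [sA kA hA]; exists sA => // s /hA /AB.
have [y Ky|s0 k0 h0] := cK _ FF (fun s y => exists2 p, p \in s & edist y p <= e) FFF.
  exists ([set y' | edist y y' < e], [set s : seq (R * R) | y \in s]).
    split; first by apply/nbhs_edist; exists e.
    exists [:: y]; first by move=> p; rewrite inE => /eqP ->.
    by move=> s ss; apply: ss; rewrite inE eqxx.
  by move=> [y' s] /= [h ys]; exists y => //; rewrite edist_sym ltW.
by exists s0 => // y Ky; exact: (h0 s0).
Qed.

Lemma closure_open_boundary (X : set (R * R)) x : open X -> closure X x -> X x \/ boundary X x.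
Proof.
move=> oX cx; have [Xx|nXx] := pselect (X x); [by left|right; split=> //].
by move=> /interior_subset.
Qed.

Lemma boundary_notin (X : set (R * R)) x : open X -> boundary X x -> ~ X x.
Proof. by move=> /interior_id oX [_ ni] Xx; apply: ni; rewrite oX. Qed.

Lemma smooth_distance X (e : R) : open X -> bounded_set X -> X !=set0 -> 0 < e ->
  exists S : R * R -> R, [/\ smooth S, forall x, d1 S x ^+ 2 + d2 S x ^+ 2 <= 1 &
    forall x, closure X x -> `|S x - bdist X x| <= e].
Proof.
move=> oX bX [x0 Xx0] e0; have e2 : 0 < e / 2 by rewrite divr_gt0.
have [P PK net] := finite_net (compact_boundary oX bX) e2.
have P0 : P != [::].
  have [z zb _] := nearest_boundary oX bX Xx0.
  by have [p pP _] := net z zb; apply/eqP => PE; rewrite PE in pP.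
(* Large enough for ln |P| / N <= e, the loss in [soft_dist_ge]. *)
pose N := (`|ln (size P)%:R| + 1) / e.
have N0 : 0 < N :> R by rewrite divr_gt0// ltr_wpDl.
exists (soft_dist P (e / 2) N); split.
- exact: smooth_soft_dist.
- by move=> x; exact: soft_dist_gradient.
move=> x cx; have lo : bdist X x - N^-1 * ln (size P)%:R <= soft_dist P (e / 2) N x.
  apply: soft_dist_ge => // p /PK bp; apply: bdist_le; exact: (boundary_notin oX bp).
have hN : N^-1 * ln (size P)%:R <= e.
  rewrite -(ler_pM2l N0) mulrA mulfV ?gt_eqF// mul1r /N divfK ?gt_eqF//.
  by rewrite (le_trans (ler_norm _))// lerDl.
have [z zb dz] : exists2 z, boundary X z & bdist X x = edist x z.
  case: (closure_open_boundary oX cx) => [Xx|bx]; first exact: nearest_boundary.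
  by exists x => //; rewrite edistxx; apply: bdist_out => //; exact: (boundary_notin oX bx).
have [p pP zp] := net z zb.
have hi : soft_dist P (e / 2) N x <= bdist X x + e.
  have h1 : soft_dist P (e / 2) N x <= edist x p + e / 2 by exact: soft_dist_le.
  by have := edist_triangle x z p; rewrite dz; lra.
by rewrite ler_norml; apply/andP; split; lra.
Qed.

(** max (0, y) = (y + |y|) / 2 with |y| replaced by the square root of y^2 + eps^2. *)
Definition softplus (eps y : R) : R := (y + Num.sqrt (y ^+ 2 + eps ^+ 2)) / 2.
Definition softplus' (eps y : R) : R := (1 + y / Num.sqrt (y ^+ 2 + eps ^+ 2)) / 2.

Lemma sqrt_add_bounds (eps y : R) : 0 < eps -> let s := Num.sqrt (y ^+ 2 + eps ^+ 2) in
  [/\ 0 < s, s ^+ 2 = y ^+ 2 + eps ^+ 2, `|y| <= s & s <= `|y| + eps].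
Proof.
move=> e0 s; have p0 : 0 < y ^+ 2 + eps ^+ 2 by rewrite ltr_wpDl ?sqr_ge0// exprn_gt0.
have s0 : 0 < s by rewrite sqrtr_gt0.
have s2 : s ^+ 2 = y ^+ 2 + eps ^+ 2 by rewrite sqr_sqrtr// ltW.
split=> //.
  by rewrite -(@ler_pXn2r _ 2) ?nnegrE ?(ltW s0)// s2 -normrX ger0_norm ?sqr_ge0// lerDl sqr_ge0.
rewrite -(@ler_pXn2r _ 2) ?nnegrE ?(ltW s0)//; last by rewrite addr_ge0// ltW.
rewrite s2 sqrrD -normrX (ger0_norm (sqr_ge0 y)) lerD2r lerDl mulrn_wge0//.
by rewrite mulr_ge0// ltW.
Qed.

Lemma softplus_bounds (eps y : R) : 0 < eps ->
  Num.max 0 y <= softplus eps y <= Num.max 0 y + eps.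
Proof.
move=> /(sqrt_add_bounds y)[]; rewrite /softplus; set s := Num.sqrt _ => s0 _.
by have [y0|y0] := leP 0 y; [rewrite ger0_norm// => *|rewrite ltr0_norm// => *]; apply/andP; split; lra.
Qed.

Lemma softplus'_bounds (eps y : R) : 0 < eps -> 0 <= softplus' eps y <= 1.
Proof.
move=> /(sqrt_add_bounds y)[]; rewrite /softplus'; set s := Num.sqrt _ => s0 _ h _.
have : `|y / s| <= 1 by rewrite normrM normfV (gtr0_norm s0) ler_pdivrMr// mul1r.
by rewrite ler_norml => /andP[h1 h2]; apply/andP; split; lra.
Qed.

Lemma softplus'_neg (eps y c : R) : 0 < eps -> 0 < c -> y <= - (c / 2) ->
  softplus' eps y <= eps ^+ 2 / c ^+ 2.
Proof.
move=> e0 c0 yc; have [] := sqrt_add_bounds y e0; rewrite /softplus'; set s := Num.sqrt _ => s0 s2 h _.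
have y0 : y < 0 by apply: le_lt_trans yc _; rewrite oppr_lt0 divr_gt0.
rewrite ltr0_norm// in h.
have sy : 0 < s - y by rewrite subr_gt0 (lt_trans y0).
have -> : (1 + y / s) / 2 = eps ^+ 2 / (2 * s * (s - y)).
  have -> : eps ^+ 2 = s ^+ 2 - y ^+ 2 by rewrite s2; ring.
  by field; rewrite ?gt_eqF.
rewrite ler_pM2l ?exprn_gt0// lef_pV2 ?posrE ?exprn_gt0 ?mulr_gt0//.
apply: (@le_trans _ _ (2 * (c / 2) * c)); first by rewrite le_eqVlt; apply/orP; left; apply/eqP; field.
by apply: ler_pM; rewrite ?mulr_ge0 ?divr_ge0 ?(ltW c0)//; lra.
Qed.

Lemma is_derive_softplus (eps y : R) : 0 < eps -> is_derive y 1 (softplus eps) (softplus' eps y).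
Proof.
move=> e0; have [s0 _ _ _] := sqrt_add_bounds y e0.
have p0 : 0 < y ^+ 2 + eps ^+ 2 by rewrite ltr_wpDl ?sqr_ge0// exprn_gt0.
have dq : is_derive y 1 (fun t : R => t ^+ 2 + eps ^+ 2) (2 * y).
  have h := is_deriveD (is_deriveM (is_derive_id y (1 : R)) (is_derive_id y (1 : R))) (is_derive_cst (eps ^+ 2) y (1 : R)).
  by apply: is_derive_eq h _; rewrite /GRing.scale /= addr0 mulr1 mulr_natl.
have ds : is_derive y 1 (fun t : R => Num.sqrt (t ^+ 2 + eps ^+ 2)) (y / Num.sqrt (y ^+ 2 + eps ^+ 2)).
  have dc := @is_derive1_comp R Num.sqrt (fun t : R => t ^+ 2 + eps ^+ 2) y _ _ (is_derive1_sqrt p0) dq; apply: is_derive_eq dc _.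
  by field; rewrite gt_eqF.
have dd := is_deriveZ 2^-1 (is_deriveD (is_derive_id y (1 : R)) ds).
have -> : softplus eps = 2^-1 \*: (id + (fun t : R => Num.sqrt (t ^+ 2 + eps ^+ 2))).
  by apply/funext => t; rewrite /softplus mulrC.
by apply: is_derive_eq dd _; rewrite /softplus' /GRing.scale /= [RHS]mulrC.
Qed.

Lemma smooth_softplus (eps : R) f : 0 < eps -> smooth f -> smooth (fun x => softplus eps (f x)).
Proof.
move=> e0 sf.
have s1 : smooth (fun x => f x ^+ 2 + eps ^+ 2) by apply: smoothD; [exact: smoothM|exact: smooth_cst].
apply: smoothM; last exact: smooth_cst.
apply: smoothD => //; apply: (smooth_sqrt _ s1) => x.
by rewrite ltr_wpDl ?sqr_ge0// exprn_gt0.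
Qed.

Let softplus_close (u v th c c2 : R) : `|u - v| <= c / 2 -> 0 < c -> c2 <= c ->
  Num.max 0 (v - c) <= th <= Num.max 0 (v - c) + c2 -> `|Num.max 0 u - th| < 3 * c.
Proof.
rewrite ler_norml ltr_norml => /andP[h1 h2] c0 c21.
by have [a1|a1] := leP 0 u; have [a2|a2] := leP 0 (v - c) => /andP[a3 a4]; apply/andP; split; lra.
Qed.

Lemma continuous_bounded_itv (h : R -> R) (a b : R) : a <= b -> continuous h ->
  exists2 B : R, 0 <= B & forall t, a <= t <= b -> `|h t| <= B.
Proof.
move=> ab ch; have cn : continuous (fun t => `|h t|).
  by move=> t; apply: continuous_comp; [exact: ch|exact: norm_continuous].
have [|c _ hc] := @EVT_max _ (fun t => `|h t|) a b ab; first exact: continuous_subspaceT.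
by exists `|h c| => // t ht; apply: hc; rewrite in_itv.
Qed.

Variables (X : set (R * R)) (al be T kap : R).
Hypotheses (oX : open X) (bX : bounded_set X) (X0 : X !=set0).
Let q (t : R) : R := 1 + al * t + be * t ^+ 2.
Let q' (t : R) : R := al + 2 * be * t.
Hypothesis qT : forall x, X x -> T <= bdist X x -> q (bdist X x) <= 0.

(** w is j_0(kap softplus (q(S) - c)) for a smooth approximation S of d. Its values are uniformly
    close to the profile; its gradient is bounded from above only, since that of S is merely known
    to have norm at most 1. Where d >= T, the shift by c brings the argument of [softplus] below - c
    / 2, so that the gradient is small. *)
Lemma smooth_profile (e : R) : 0 < e -> exists2 w : R * R -> R, smooth w &
  forall x, closure X x ->
   `|w x - besselj 0 (kap * Num.max 0 (q (bdist X x)))| <= e /\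
   (X x -> d1 w x ^+ 2 + d2 w x ^+ 2 <=
     (if bdist X x <= T then
       (kap * besselj 1 (kap * Num.max 0 (q (bdist X x)))) ^+ 2 * q' (bdist X x) ^+ 2
      else 0) + e).
Proof.
move=> e0; have [x1 M0 hM] := inradius oX bX X0; set M := bdist X x1 in M0 hM.
have cq : continuous q.
  move=> t; apply: cvgD; first by apply: cvgD; [exact: cvg_cst|apply: cvgMr; exact: cvg_id].
  by apply: cvgMr; apply: (@exprn_continuous R 2).
have cq2 : continuous (fun t => q' t ^+ 2).
  move=> t; apply: (@continuous_comp _ _ _ q' (fun s : R => s ^+ 2)); last exact: (@exprn_continuous R 2).
  by apply: cvgD; [exact: cvg_cst|apply: cvgMr; exact: cvg_id].
have cj n : continuous (fun y : R => besselj n (kap * y)).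
  move=> y; apply: continuous_comp; last exact: continuous_besselj.
  by apply: cvgMr; exact: cvg_id.
pose H1 (y : R) : R := (kap * besselj 1 (kap * y)) ^+ 2.
have cH : continuous H1.
  move=> t; apply: (@continuous_comp _ _ _ (fun y => kap * besselj 1 (kap * y)) (fun s : R => s ^+ 2)); last exact: (@exprn_continuous R 2).
  by apply: cvgMr; exact: cj.
have [Q Q0 hQ] := continuous_bounded_itv (ltW M0) cq.
have [B1 B10 hB1] := continuous_bounded_itv Q0 cH.
have M2 : -1 <= M + 1 by lra.
(* On a larger interval, because S may leave [0, M] by as much as sg <= 1. *)
have [B2 B20 hB2] := continuous_bounded_itv M2 cq2.
pose e1 := Num.min 1 (e / (B1 + B2 + 1)).
have B12 : 0 < B1 + B2 + 1 by lra.
have e10 : 0 < e1 by rewrite lt_min ltr01 divr_gt0.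
have e11 : e1 <= 1 by rewrite ge_min lexx.
have e12 : e1 * (B1 + B2 + 1) <= e by rewrite -ler_pdivlMr// ge_min lexx orbT.
have [r1 r10 hr1] := uniform_continuous_itv 0 Q (cj 0) e0.
have [r2 r20 hr2] := uniform_continuous_itv 0 Q cH e10.
have [r3 r30 hr3] := uniform_continuous_itv 0 M cq2 e10.
have BB : 0 < (B1 + 1) * B2 + 1 by rewrite ltr_wpDl// mulr_ge0// addr_ge0.
pose c := Num.min (Num.min 1 (e / ((B1 + 1) * B2 + 1))) (Num.min r1 r2 / 3).
have c0 : 0 < c by rewrite !lt_min ltr01 !divr_gt0// lt_min r10.
have c1 : c <= 1 by rewrite !ge_min lexx.
have c2 : c * ((B1 + 1) * B2 + 1) <= e by rewrite -ler_pdivlMr// !ge_min lexx orbT.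
have c3 : 3 * c <= Num.min r1 r2 by rewrite mulrC -ler_pdivlMr// !ge_min lexx !orbT.
have [c31 c32] : 3 * c <= r1 /\ 3 * c <= r2.
  by split; apply: (le_trans c3); rewrite ge_min lexx ?orbT.
have c20 : 0 < c / 2 by rewrite divr_gt0.
have [r4 r40 hr4] := uniform_continuous_itv 0 M cq c20.
pose sg := Num.min 1 (Num.min r3 r4 / 2).
have sg0 : 0 < sg by rewrite lt_min ltr01 divr_gt0// lt_min r30.
have sg1 : sg <= 1 by rewrite ge_min lexx.
have [sg3 sg4] : sg < r3 /\ sg < r4.
  have h : sg * 2 <= Num.min r3 r4 by rewrite -ler_pdivlMr// ge_min lexx orbT.
  have h3 : sg * 2 <= r3 by apply: (le_trans h); rewrite ge_min lexx.
  have h4 : sg * 2 <= r4 by apply: (le_trans h); rewrite ge_min lexx orbT.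
  by split; lra.
have [S [sS gS hS]] := smooth_distance oX bX X0 sg0.
have ec0 : 0 < c ^+ 2 by rewrite exprn_gt0.
pose y x := q (S x) - c.
have sy : smooth y.
  apply: smoothD; last exact: smooth_cst.
  apply: smoothD; last by apply: smoothZ; exact: smoothM.
  by apply: smoothD; [exact: smooth_cst|exact: smoothZ].
pose th x := softplus (c ^+ 2) (y x).
have sth : smooth th by exact: smooth_softplus.
exists (fun x => besselj 0 (kap * th x)).
  by apply: smooth_besselj; exact: smoothZ.
move=> x cx; have := hS x cx; set d := bdist X x => hd.
have d0 : 0 <= d by exact: bdist_ge0.
have dM : 0 <= d <= M by rewrite d0 hM.
have hdr : `|d - S x| <= sg by rewrite distrC.
have qd : `|q d - q (S x)| <= c / 2 by apply: hr4 => //; exact: le_lt_trans sg4.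
set b := Num.max 0 (q d).
have bQ : 0 <= b <= Q.
  rewrite le_max lexx /= ge_max Q0 /=.
  exact: le_trans (ler_norm _) (hQ _ dM).
have c21 : c ^+ 2 <= c by rewrite expr2 ler_piMr// ltW.
have thb : `|b - th x| < 3 * c.
  have := softplus_bounds (y x) ec0; rewrite -/(th x) /b /y.
  move: qd; rewrite ler_norml => /andP[qd1 qd2].
  move=> h; apply: (softplus_close _ c0 c21 h); rewrite ler_norml qd1; exact: qd2.
split.
  by rewrite distrC; apply: hr1 => //; exact: lt_le_trans thb c31.
move=> Xx.
pose G := kap * (softplus' (c ^+ 2) (y x) * q' (S x)).
have dv v s : is_derive x v S s -> is_derive x v (fun x => besselj 0 (kap * th x))
    (- besselj 1 (kap * th x) * (G * s)).
  move=> ds.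
  have dq : is_derive x v y (q' (S x) * s).
    have h1 := is_deriveDp (is_derive_cstp x v 1) (is_deriveZp al ds).
    have h2 := is_deriveZp be (is_deriveMp ds ds).
    apply: is_derive_eq (is_deriveDp (is_deriveDp h1 h2) (is_derive_cstp x v (- c))) _.
    by rewrite /q'; ring.
  have h3 := is_deriveZp kap (is_derive_chain (is_derive_softplus (y x) ec0) dq).
  apply: is_derive_eq (is_derive_chain (is_derive_besselj 0 (kap * th x)) h3) _.
  by rewrite /G; ring.
have -> : d1 (fun x => besselj 0 (kap * th x)) x = - besselj 1 (kap * th x) * (G * d1 S x).
  by have [] := dv (1, 0) _ (@Ck_d1 _ 0 _ x (sS 1%N)).
have -> : d2 (fun x => besselj 0 (kap * th x)) x = - besselj 1 (kap * th x) * (G * d2 S x).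
  by have [] := dv (0, 1) _ (@Ck_d2 _ 0 _ x (sS 1%N)).
pose sp := softplus' (c ^+ 2) (y x).
have /andP[sp0 sp1] : 0 <= sp <= 1 := softplus'_bounds (y x) ec0.
have -> : (- besselj 1 (kap * th x) * (G * d1 S x)) ^+ 2 + (- besselj 1 (kap * th x) * (G * d2 S x)) ^+ 2
  = (H1 (th x) * sp ^+ 2 * q' (S x) ^+ 2) * (d1 S x ^+ 2 + d2 S x ^+ 2).
  by rewrite /G /H1 /sp; ring.
have H10 t : 0 <= H1 t by exact: sqr_ge0.
apply: (@le_trans _ _ (H1 (th x) * sp ^+ 2 * q' (S x) ^+ 2)).
  by apply: ler_piMr; [exact: mulr_ge0 (mulr_ge0 (H10 _) (sqr_ge0 _)) (sqr_ge0 _)|exact: gS].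
have Hth : `|H1 b - H1 (th x)| <= e1 by apply: hr2 => //; exact: lt_le_trans thb c32.
have Hq : `|q' d ^+ 2 - q' (S x) ^+ 2| <= e1 by apply: hr3 => //; exact: le_lt_trans sg3.
have HB1 : H1 b <= B1 by exact: le_trans (ler_norm _) (hB1 _ bQ).
have HB2 : q' (S x) ^+ 2 <= B2.
  apply: le_trans (ler_norm _) (hB2 _ _).
  by move: hdr dM; rewrite ler_norml => /andP[] *; lra.
have Hq0 : 0 <= q' (S x) ^+ 2 by exact: sqr_ge0.
case: ifP => dT.
  apply: (@le_trans _ _ (H1 (th x) * q' (S x) ^+ 2)).
    by apply: ler_wpM2r => //; apply: ler_piMr => //; rewrite expr_le1.
  rewrite -/b -/(H1 b) -lerBlDl.
  have -> : H1 (th x) * q' (S x) ^+ 2 - H1 b * q' d ^+ 2 =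
    (H1 (th x) - H1 b) * q' (S x) ^+ 2 + H1 b * (q' (S x) ^+ 2 - q' d ^+ 2) by ring.
  have i1 : (H1 (th x) - H1 b) * q' (S x) ^+ 2 <= e1 * B2.
    apply: le_trans (ler_norm _) _; rewrite normrM (ger0_norm Hq0) distrC.
    exact: ler_pM.
  have i2 : H1 b * (q' (S x) ^+ 2 - q' d ^+ 2) <= B1 * e1.
    apply: le_trans (ler_norm _) _; rewrite normrM (ger0_norm (H10 _)) distrC.
    exact: ler_pM.
  apply: le_trans (lerD i1 i2) _; apply: le_trans e12.
  have -> : e1 * B2 + B1 * e1 = e1 * (B1 + B2) by ring.
  by rewrite ler_wpM2l ?(ltW e10)// lerDl.
rewrite add0r.
have dT' : T <= d by rewrite ltW// ltNge dT.
have qd0 := qT Xx dT'; rewrite -/d in qd0.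
have yc : y x <= - (c / 2).
  by rewrite /y; move: qd; rewrite ler_norml => /andP[]; lra.
have := softplus'_neg ec0 c0 yc; rewrite -/sp expr2 mulfK ?gt_eqF// => spc.
have spc2 : sp ^+ 2 <= c by rewrite expr2 (le_trans _ c21)// (le_trans _ spc)// ler_piMr.
have Hth2 : H1 (th x) <= B1 + 1 by move: Hth; rewrite ler_norml => /andP[]; lra.
apply: (@le_trans _ _ ((B1 + 1) * c * B2)).
  by apply: ler_pM => //; [rewrite mulr_ge0 ?sqr_ge0|apply: ler_pM => //; exact: sqr_ge0].
apply: le_trans c2.
have -> : (B1 + 1) * c * B2 = c * ((B1 + 1) * B2) by ring.
by rewrite ler_wpM2l ?(ltW c0)// lerDl.
Qed.

End smooth_profile.

(** * Integration by parts on slices, weak gradients and traces *)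

Section slices.
Context {R : realType}.
Implicit Types (D X : set (R * R)) (f : R * R -> R).

Let slice_integral0 (h h' : R -> R) (a b : R) (S : set R) (g : R -> \bar R) : a <= b ->
  S = `]a, b[%classic -> g = ((fun s => (h' s)%:E) \_ S)%E ->
  (forall s, a <= s <= b -> is_derive s 1 h (h' s)) ->
  (forall s, a <= s <= b -> {for s, continuous h'}) -> h b = h a ->
  (\int[@lebesgue_measure R]_s g s = 0)%E.
Proof.
move=> ab SE -> dh ch hab; rewrite -integral_mkcond SE.
have ch' : {within `[a, b], continuous h'}.
  by apply: continuous_in_subspaceT => s /set_mem /=; rewrite in_itv => /ch.
have m1 : measurable_fun `]a, b[ (fun s => (h' s)%:E).
  apply/measurable_EFinP; apply: (@measurable_funS _ _ _ _ `[a, b]%classic) => //.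
    by apply: subset_itv; rewrite bnd_simp.
  exact: subspace_continuous_measurable_fun.
by rewrite -(integral_itv_bndoo true false m1) (FTC2 ab dh ch') hab subrr.
Qed.

(** Fubini and the fundamental theorem of calculus on each slice. This takes the place of the
    divergence theorem, both for test functions on a square and for Picone's field on a disk. *)
Lemma integral_slices1 D f (f' : R * R -> R) : measurable D ->
  plane_measure.-integrable D (EFin \o f') ->
  (forall y : R, [set s | D (s, y)] !=set0 -> exists a b : R, [/\ a <= b, [set s | D (s, y)] = `]a, b[%classic,
     forall s, a <= s <= b -> is_derive s 1 (fun s => f (s, y)) (f' (s, y)),
     forall s, a <= s <= b -> {for s, continuous (fun s => f' (s, y))} & f (b, y) = f (a, y)]) ->
  (\int[plane_measure]_(x in D) (f' x)%:E = 0)%E.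
Proof.
move=> mD iD h; rewrite integral_mkcond.
have iT : ((@lebesgue_measure R \x @lebesgue_measure R)%E).-integrable setT ((EFin \o f') \_ D).
  exact: (iffLR (@integrable_mkcond _ _ R (@lebesgue_measure R \x @lebesgue_measure R)%E D (EFin \o f') mD)).
rewrite -[LHS](integral21_prod_meas1 iT).
apply: integral0_eq => y _.
have [[a [b [ab SE df cf fab]]]|S0] : (exists a b : R, [/\ a <= b, [set s | D (s, y)] = `]a, b[%classic,
    forall s, a <= s <= b -> is_derive s 1 (fun s => f (s, y)) (f' (s, y)),
    forall s, a <= s <= b -> {for s, continuous (fun s => f' (s, y))} & f (b, y) = f (a, y)]) \/
    [set s | D (s, y)] = set0.
  by have [/set0P/h|/negPn/eqP] := boolP ([set s | D (s, y)] != set0); [left|right].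
2: {
  apply: integral0_eq => s _; rewrite patchE; case: ifPn => // /set_mem DS.
  by have : [set s | D (s, y)] s by []; rewrite S0.
}
apply: (slice_integral0 ab SE _ df cf fab); apply/funext => s.
by rewrite !patchE /=; congr (if _ then _ else _); apply/idP/idP => /set_mem ?; apply: mem_set.
Qed.

Lemma integral_slices2 D f (f' : R * R -> R) : measurable D ->
  plane_measure.-integrable D (EFin \o f') ->
  (forall x : R, [set s | D (x, s)] !=set0 -> exists a b : R, [/\ a <= b, [set s | D (x, s)] = `]a, b[%classic,
     forall s, a <= s <= b -> is_derive s 1 (fun s => f (x, s)) (f' (x, s)),
     forall s, a <= s <= b -> {for s, continuous (fun s => f' (x, s))} & f (x, b) = f (x, a)]) ->
  (\int[plane_measure]_(x in D) (f' x)%:E = 0)%E.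
Proof.
move=> mD iD h; rewrite integral_mkcond.
have iT : ((@lebesgue_measure R \x @lebesgue_measure R)%E).-integrable setT ((EFin \o f') \_ D).
  exact: (iffLR (@integrable_mkcond _ _ R (@lebesgue_measure R \x @lebesgue_measure R)%E D (EFin \o f') mD)).
rewrite -[LHS](integral12_prod_meas1 iT).
apply: integral0_eq => y _.
have [[a [b [ab SE df cf fab]]]|S0] : (exists a b : R, [/\ a <= b, [set s | D (y, s)] = `]a, b[%classic,
    forall s, a <= s <= b -> is_derive s 1 (fun s => f (y, s)) (f' (y, s)),
    forall s, a <= s <= b -> {for s, continuous (fun s => f' (y, s))} & f (y, b) = f (y, a)]) \/
    [set s | D (y, s)] = set0.
  by have [/set0P/h|/negPn/eqP] := boolP ([set s | D (y, s)] != set0); [left|right].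
2: {
  apply: integral0_eq => s _; rewrite patchE; case: ifPn => // /set_mem DS.
  by have : [set s | D (y, s)] s by []; rewrite S0.
}
apply: (slice_integral0 ab SE _ df cf fab); apply/funext => s.
by rewrite !patchE /=; congr (if _ then _ else _); apply/idP/idP => /set_mem ?; apply: mem_set.
Qed.

Lemma is_derive_slice1 f (s y a : R) : is_derive (s, y) ((1, 0) : R * R) f a <->
  is_derive s 1 (fun s => f (s, y)) a.
Proof.
have E : (fun h : R => h^-1 *: ((f \o shift (s, y)) (h *: ((1, 0) : R * R)) - f (s, y))) =
  (fun h : R => h^-1 *: (((fun s => f (s, y)) \o shift s) (h *: 1) - f (s, y))).
  apply/funext => h /=; congr (_ *: (f _ - _)).
  by apply: pair_eq; rewrite /= ?scaler0 ?add0r.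
by split=> -[d e]; split; move: d e; rewrite /derivable /derive E.
Qed.

Lemma is_derive_slice2 f (x s a : R) : is_derive (x, s) ((0, 1) : R * R) f a <->
  is_derive s 1 (fun s => f (x, s)) a.
Proof.
have E : (fun h : R => h^-1 *: ((f \o shift (x, s)) (h *: ((0, 1) : R * R)) - f (x, s))) =
  (fun h : R => h^-1 *: (((fun s => f (x, s)) \o shift s) (h *: 1) - f (x, s))).
  apply/funext => h /=; congr (_ *: (f _ - _)).
  by apply: pair_eq; rewrite /= ?scaler0 ?add0r.
by split=> -[d e]; split; move: d e; rewrite /derivable /derive E.
Qed.

Lemma continuous_slice1 f (s y : R) : {for (s, y), continuous f} ->
  {for s, continuous (fun s => f (s, y))}.
Proof.
move=> cf; apply: (@continuous_comp _ _ _ (fun s : R => (s, y))) => //.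
by apply: (@cvg_pair _ _ _ (nbhs s) (nbhs s) (nbhs y)); [exact: cvg_id|exact: cvg_cst].
Qed.

Lemma continuous_slice2 f (x s : R) : {for (x, s), continuous f} ->
  {for s, continuous (fun s => f (x, s))}.
Proof.
move=> cf; apply: (@continuous_comp _ _ _ (fun s : R => (x, s))) => //.
by apply: (@cvg_pair _ _ _ (nbhs s) (nbhs x) (nbhs s)); [exact: cvg_cst|exact: cvg_id].
Qed.

Lemma within_bounded X f : bounded_set X -> {within closure X, continuous f} ->
  [bounded f x | x in X].
Proof.
move=> bX cf; have cX : compact (closure X).
  by apply: closed_bounded_compact; [exact: closed_closure|exact: closure_bounded].
have := compact_bounded (continuous_compact cf cX).
move=> [M [Mr hM]]; exists M; split=> // r Mx x Xx; apply: (hM r Mx); exists x => //; exact: subset_closure.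
Qed.

Lemma continuous_integrable X f : measurable X -> bounded_set X -> continuous f ->
  plane_measure.-integrable X (EFin \o f).
Proof.
move=> mX bX cf; apply: measurable_bounded_integrable.
- exact: mX.
- exact: bounded_plane_measure.
- by apply: measurable_funTS; exact: continuous_plane_measurable.
- by apply: within_bounded => //; exact: continuous_subspaceT.
Qed.

Lemma length_integrable X f : open X -> bounded_set X ->
  (hausdorff1 (boundary X) < +oo)%E -> continuous f ->
  length_measure.-integrable (boundary X) (EFin \o f).
Proof.
move=> oX bX hX cf; apply: measurable_bounded_integrable.
- exact: closed_length_measurable (closed_boundary oX).
- exact: hX.
- exact: continuous_length_measurable (closed_boundary oX) cf.
have := compact_bounded (continuous_compact (continuous_subspaceT cf) (compact_boundary oX bX)).
by move=> [M [Mr hM]]; exists M; split=> // r Mx x Xx; apply: (hM r Mx); exists x.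
Qed.

Lemma is_derive_outside f (phi : R * R -> R) x v : ~ closure [set x | phi x != 0] x ->
  phi x = 0 /\ 'D_v phi x = 0.
Proof.
move=> nc; have nx : \near x, phi x = 0.
  have oC : open (~` closure [set x | phi x != 0]) by apply: closed_openC; exact: closed_closure.
  apply: filterS (open_nbhs_nbhs (conj oC (nc : (~` closure [set x | phi x != 0]) x))).
  move=> y ny; apply: contrapT => /eqP py; apply: ny; exact: subset_closure.
split; first exact: nbhs_singleton nx.
by rewrite (near_eq_derive v nx) derive_cst.
Qed.

Lemma integral_support X D (g : R * R -> \bar R) : X `<=` D -> (forall x, ~ X x -> g x = 0%E) ->
  (\int[plane_measure]_(x in X) g x = \int[plane_measure]_(x in D) g x)%E.
Proof.
move=> XD g0; rewrite integral_mkcond [RHS]integral_mkcond; congr integral.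
apply/funext => x; rewrite !patchE; case: ifPn => [/set_mem Xx|/negP nX].
  by rewrite mem_set//; exact: XD.
by case: ifP => // _; rewrite g0// => Xx; apply: nX; exact: mem_set.
Qed.

Let by_parts X (w dw phi dphi : R * R -> R) : measurable X -> bounded_set X ->
  continuous w -> continuous dw -> continuous phi -> continuous dphi ->
  (\int[plane_measure]_(x in X) (dw x * phi x + w x * dphi x)%:E = 0)%E ->
  \int[plane_measure]_(x in X) (w x * dphi x) = - (\int[plane_measure]_(x in X) (dw x * phi x)).
Proof.
move=> mX bX cw cdw cp cdp h.
have c1 : continuous (fun x => dw x * phi x) by move=> x; apply: cvgM; [exact: cdw|exact: cp].
have c2 : continuous (fun x => w x * dphi x) by move=> x; apply: cvgM; [exact: cw|exact: cdp].
apply/eqP; rewrite -subr_eq0 opprK addrC.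
rewrite -(@RintegralD _ _ R (@lebesgue_measure R \x @lebesgue_measure R)%E X _ _ mX (continuous_integrable mX bX c1) (continuous_integrable mX bX c2)).
by rewrite /Rintegral h.
Qed.

(** The slices of X need not be intervals. As phi vanishes outside X, the integrals are extended to
    a square D that contains X and whose sides avoid X. *)
Lemma smooth_weak_gradient X w : open X -> bounded_set X -> smooth w ->
  weak_gradient X w (d1 w) (d2 w).
Proof.
move=> oX bX sw phi [sp cp pX]; have mX := open_plane_measurable oX.
have [M M0 hM] := bounded_box bX.
pose a : R := - M - 1; pose b : R := M + 1.
have ab : a <= b by rewrite /a /b; lra.
pose D : set (R * R) := `]a, b[%classic `*` `]a, b[%classic.
have XD : X `<=` D.
  move=> x /hM[]; rewrite !ler_norml /D /a /b /= !in_itv /= => /andP[? ?] /andP[? ?].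
  by split; apply/andP; split; lra.
have out x v : ~ X x -> phi x = 0 /\ 'D_v phi x = 0.
  by move=> nX; apply: is_derive_outside => // /pX.
have Dout (s t : R) : [\/ s = a, s = b, t = a | t = b] -> ~ X (s, t).
  by move=> h /hM[/=]; rewrite !ler_norml => /andP[? ?] /andP[? ?]; case: h; rewrite /a /b => ?; lra.
have mD : measurable D by apply: measurableX; exact: measurable_itv.
have bD : bounded_set D.
  exists (M + 1); split; first exact: num_real.
  move=> r Mr x; rewrite /D /a /b /= !in_itv /= => -[/andP[? ?] /andP[? ?]].
  by rewrite prod_normE ge_max !ler_norml; apply/andP; split; apply/andP; split; lra.
have cw := Ck_continuous (sw 0%N); have cphi := Ck_continuous (sp 0%N).
have [_ _ cw1 cw2] := sw 1%N; have [_ _ cp1 cp2] := sp 1%N.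
split; apply: by_parts => //.
- have cf : continuous (fun x => d1 w x * phi x + w x * d1 phi x).
    by move=> x; apply: cvgD; apply: cvgM; [exact: cw1|exact: cphi|exact: cw|exact: cp1].
  rewrite (integral_support XD); last first.
    by move=> x /out h; have [p0] := h (1, 0); rewrite /d1 => ->; rewrite p0 !mulr0 addr0.
  apply: (@integral_slices1 D (fun x => w x * phi x)) => //; first exact: continuous_integrable.
  move=> y [s0 []]; rewrite /= !in_itv /= => _ Sy; exists a, b; split=> //.
  + by apply/seteqP; split=> s; rewrite /D /= !in_itv /=; [case|split].
  + move=> s _; apply/(@is_derive_slice1 (fun x => w x * phi x)); apply: is_deriveMp.
      exact: (@Ck_d1 _ 0 _ _ (sw 1%N)).
    exact: (@Ck_d1 _ 0 _ _ (sp 1%N)).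
  + by move=> s _; apply: (@continuous_slice1 (fun x => d1 w x * phi x + w x * d1 phi x)); exact: cf.
  rewrite (proj1 (out (a, y) 0 (Dout _ _ _))); last by constructor 1.
  by rewrite (proj1 (out (b, y) 0 (Dout _ _ _))) ?mulr0//; constructor 2.
have cf : continuous (fun x => d2 w x * phi x + w x * d2 phi x).
  by move=> x; apply: cvgD; apply: cvgM; [exact: cw2|exact: cphi|exact: cw|exact: cp2].
rewrite (integral_support XD); last first.
  by move=> x /out h; have [p0] := h (0, 1); rewrite /d2 => ->; rewrite p0 !mulr0 addr0.
apply: (@integral_slices2 D (fun x => w x * phi x)) => //; first exact: continuous_integrable.
move=> y [s0 []]; rewrite /= !in_itv /= => Sy _; exists a, b; split=> //.
- by apply/seteqP; split=> s; rewrite /D /= !in_itv /=; [case|split].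
- move=> s _; apply/(@is_derive_slice2 (fun x => w x * phi x)); apply: is_deriveMp.
    exact: (@Ck_d2 _ 0 _ _ (sw 1%N)).
  exact: (@Ck_d2 _ 0 _ _ (sp 1%N)).
- by move=> s _; apply: (@continuous_slice2 (fun x => d2 w x * phi x + w x * d2 phi x)); exact: cf.
rewrite (proj1 (out (y, a) 0 (Dout _ _ _))); last by constructor 3.
by rewrite (proj1 (out (y, b) 0 (Dout _ _ _))) ?mulr0//; constructor 4.
Qed.

Lemma continuous_sqr f : continuous f -> continuous (fun x => f x ^+ 2).
Proof. by move=> cf x; exact: cvgM (cf x) (cf x). Qed.

Lemma smooth_H1 X w : open X -> bounded_set X -> smooth w -> H1 X w (d1 w) (d2 w).
Proof.
move=> oX bX sw; have mX := open_plane_measurable oX.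
have L2c f : continuous f -> L2 X f.
  move=> cf; split; first by apply: measurable_funTS; exact: continuous_plane_measurable.
  exact: (continuous_integrable mX bX (continuous_sqr cf)).
have [_ _ cw1 cw2] := sw 1%N.
split; [exact: L2c (Ck_continuous (sw 0%N))|exact: L2c|exact: L2c|exact: smooth_weak_gradient].
Qed.

(** The constant sequence w shows that w is its own trace. *)
Lemma smooth_trace X w : open X -> bounded_set X -> (hausdorff1 (boundary X) < +oo)%E ->
  smooth w -> trace X w (d1 w) (d2 w) w.
Proof.
move=> oX bX hX sw; have cw := Ck_continuous (sw 0%N); split.
  split; first exact: continuous_length_measurable (closed_boundary oX) cw.
  exact: (length_integrable oX bX hX (continuous_sqr cw)).
exists (fun=> w); split=> //.
  under eq_fun do under eq_integral do rewrite !subrr !expr0n !addr0.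
  by under eq_fun do rewrite integral0; exact: cvg_cst.
under eq_fun do under eq_integral do rewrite subrr expr0n.
by under eq_fun do rewrite integral0; exact: cvg_cst.
Qed.

Lemma robin_rayleigh_ge0 X (a : R) u ux uy g : 0 <= a -> 0 <= robin_rayleigh X a u ux uy g.
Proof.
move=> a0; apply: divr_ge0; last by apply: Rintegral_ge0 => x _; exact: sqr_ge0.
apply: addr_ge0; first by apply: Rintegral_ge0 => x _; rewrite addr_ge0 ?sqr_ge0.
by apply: mulr_ge0 => //; apply: Rintegral_ge0 => x _; exact: sqr_ge0.
Qed.

Lemma robin_eigenvalue_le X (a : R) w : open X -> bounded_set X ->
  (hausdorff1 (boundary X) < +oo)%E -> 0 <= a -> smooth w ->
  \int[plane_measure]_(x in X) (w x ^+ 2) != 0 ->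
  robin_eigenvalue X a <= robin_rayleigh X a w (d1 w) (d2 w) w.
Proof.
move=> oX bX hX a0 sw w0; apply: ge_inf.
  by exists 0 => _ [u [ux [uy [g [_ _ _ ->]]]]]; exact: robin_rayleigh_ge0.
exists w, (d1 w), (d2 w), w; split=> //; [exact: smooth_H1|exact: smooth_trace].
Qed.

End slices.

(** * The upper bound *)

Section continuous_integrals.
Context {R : realType}.
Variables (X : set (R * R)).
Hypotheses (mX : measurable X) (bX : bounded_set X).
Implicit Types (f g : R * R -> R).

Lemma continuous_RintegralE f : continuous f ->
  (\int[plane_measure]_(x in X) (f x)%:E = (\int[plane_measure]_(x in X) f x)%:E)%E.
Proof.
move=> cf; rewrite fineK//; apply: (@integrable_fin_num _ _ R (@lebesgue_measure R \x @lebesgue_measure R)%E).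
  exact: mX.
exact: continuous_integrable.
Qed.

Lemma continuous_RintegralB f g : continuous f -> continuous g ->
  \int[plane_measure]_(x in X) (f x - g x) =
  \int[plane_measure]_(x in X) f x - \int[plane_measure]_(x in X) g x.
Proof.
move=> cf cg; exact: (@RintegralB _ _ R (@lebesgue_measure R \x @lebesgue_measure R)%E X _ _ mX
  (continuous_integrable mX bX cf) (continuous_integrable mX bX cg)).
Qed.

Lemma continuous_RintegralD f g : continuous f -> continuous g ->
  \int[plane_measure]_(x in X) (f x + g x) =
  \int[plane_measure]_(x in X) f x + \int[plane_measure]_(x in X) g x.
Proof.
move=> cf cg; exact: (@RintegralD _ _ R (@lebesgue_measure R \x @lebesgue_measure R)%E X _ _ mX
  (continuous_integrable mX bX cf) (continuous_integrable mX bX cg)).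
Qed.

Lemma continuous_le_Rintegral f g : continuous f -> continuous g ->
  (forall x, X x -> f x <= g x) ->
  \int[plane_measure]_(x in X) f x <= \int[plane_measure]_(x in X) g x.
Proof.
move=> cf cg; exact: (@le_Rintegral _ _ R (@lebesgue_measure R \x @lebesgue_measure R)%E X _ _ mX
  (continuous_integrable mX bX cf) (continuous_integrable mX bX cg)).
Qed.

Lemma continuous_RintegralZ (z : R) f : continuous f ->
  \int[plane_measure]_(x in X) (z * f x) = z * \int[plane_measure]_(x in X) f x.
Proof.
move=> cf; exact: (@RintegralZl _ _ R (@lebesgue_measure R \x @lebesgue_measure R)%E X _ z mX
  (continuous_integrable mX bX cf)).
Qed.

Lemma Rintegral_plane_cst (k : R) : \int[plane_measure]_(x in X) k = k * area X.
Proof. by rewrite /Rintegral integral_plane_cst. Qed.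

Lemma le_Rintegral_part (P : set (R * R)) (f g h : R * R -> R) (I : R) : measurable P ->
  continuous f -> continuous g -> continuous h ->
  (forall x, X x -> 0 <= f x) -> (forall x, X x -> 0 <= g x) -> (forall x, 0 <= h x) ->
  (forall x, X x -> f x <= g x + (if x \in P then h x else 0)) ->
  (\int[plane_measure]_(x in X `&` P) (h x)%:E <= I%:E)%E ->
  \int[plane_measure]_(x in X) f x <= \int[plane_measure]_(x in X) g x + I.
Proof.
move=> mP cf cg ch f0 g0 h0 fgh hI.
have mE (u : R * R -> R) (S : set (R * R)) : continuous u -> measurable_fun S (fun x => (u x)%:E).
  by move=> cu; apply/measurable_EFinP; apply: measurable_funTS; exact: continuous_plane_measurable.
rewrite -lee_fin EFinD -!continuous_RintegralE//; apply: le_trans (leeD2l _ hI).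
rewrite integral_mkcondr.
have p0 x : X x -> (0%R <= ((fun x => (h x)%:E) \_ P) x)%E.
  by move=> _; rewrite patchE; case: ifP => _; rewrite lee_fin.
have mp : measurable_fun X ((fun x => (h x)%:E) \_ P).
  by apply/(measurable_restrict _ mP mX); exact: mE.
have p1 (x : R * R) : X x -> (0%R <= (g x)%:E)%E by move=> /g0; rewrite lee_fin.
rewrite -(@ge0_integralD _ _ R (@lebesgue_measure R \x @lebesgue_measure R)%E X mX _ _ p1 (mE _ X cg) p0 mp).
apply: ge0_le_integral.
- exact: mX.
- by move=> x /f0; rewrite lee_fin.
- exact: mE.
- by apply: emeasurable_funD => //; exact: mE.
by move=> x Xx; rewrite patchE; have := fgh x Xx; case: ifP => _; rewrite ?adde0 ?addr0 -?EFinD lee_fin.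
Qed.

End continuous_integrals.

Section upper_bound.
Context {R : realType}.
Variables (X : set (R * R)).
Hypotheses (oX : open X) (bX : bounded_set X) (X0 : X !=set0).
Hypothesis hX : (hausdorff1 (boundary X) < +oo)%E.
Let L := perimeter X.
Hypothesis parallel : forall (s t : R) (x0 : R * R), 0 <= s -> s < t -> t < bdist X x0 ->
  area (inner X s) - area (inner X t) <= L * (t - s) - pi * (t ^+ 2 - s ^+ 2).
Variables (b k : R).
Hypotheses (b0 : 0 < b) (k0 : 0 < k < j01 R) (kb : k * bessel_J 1 k = b * bessel_J 0 k).

Let A := area X.
Let T := inner_radius X L.
Let kap := k ^+ 2 / 4.
Let q (t : R) : R := 1 + (- (L / A)) * t + (pi / A) * t ^+ 2.
Let q' (t : R) : R := - (L / A) + 2 * (pi / A) * t.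
Let D0 := L ^+ 2 - 4 * pi * A.

Lemma perimeter_ge0 : 0 <= L.
Proof. by rewrite fine_ge0// hausdorff1_ge0. Qed.

Let L0 := perimeter_ge0.
Let mX := open_plane_measurable oX.
Let A0 : 0 < A. Proof. exact: area_open_gt0 oX bX X0. Qed.
Let A00 : A != 0. Proof. by rewrite gt_eqF. Qed.
Let IRP := inner_radiusP oX bX X0 L0 parallel.

Let kap0 : 0 < kap.
Proof. by case/andP: k0 => k1 _; rewrite divr_gt0// exprn_gt0. Qed.

Let kapj : kap < j01 R ^+ 2 / 4.
Proof.
case/andP: k0 => k1 k2; rewrite ltr_pM2r ?invr_gt0//.
by rewrite ltr_pXn2r ?nnegrE ?ltW// (lt_trans k1).
Qed.

Let jz (y : R) : 0 <= y <= 1 -> 0 <= kap * y <= j01 R ^+ 2 / 4.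
Proof.
move=> /andP[y0 y1]; rewrite mulr_ge0 ?(ltW kap0)//=.
by rewrite (le_trans _ (ltW kapj))// ler_piMr// ltW.
Qed.

Let q0 : q 0 = 1. Proof. by rewrite /q expr0n !mulr0 !addr0. Qed.
Let qT0 : q T = 0.
Proof.
have [_ h _ _] := IRP; rewrite -/T -/A in h.
by rewrite /q; transitivity ((A - L * T + pi * T ^+ 2) / A); [field|rewrite h mul0r].
Qed.

Let q01 (t : R) : 0 <= t <= T -> 0 <= q t <= 1.
Proof.
move=> /andP[t0 tT]; have [_ h TL _] := IRP; rewrite -/T -/A in h TL.
apply/andP; split.
  have -> : q t = (T - t) * (L - pi * (T + t)) / A.
    have -> : q t = q t - q T by rewrite qT0 subr0.
    by rewrite /q; field.
  rewrite divr_ge0 ?(ltW A0)// mulr_ge0 ?subr_ge0//.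
  apply: le_trans TL; by rewrite [2 * pi]mulrC -mulrA ler_pM2l ?pi_gt0//; lra.
rewrite -subr_ge0; have -> : 1 - q t = t * (L - pi * t) / A by rewrite /q; field.
rewrite divr_ge0 ?(ltW A0)// mulr_ge0// subr_ge0.
apply: le_trans TL; have p0 := pi_gt0 R.
by rewrite mulrAC mulrC ler_pM2r//; lra.
Qed.

(** At the inradius r, which is at least d(x), the area V is 0, so that q(r) <= 0; and q is convex
    with q(T) = 0, hence q <= 0 on [T, r]. *)
Let qneg x : X x -> T <= bdist X x -> q (bdist X x) <= 0.
Proof.
move=> Xx Td; have [x1 r0 hr] := inradius oX bX X0.
set d := bdist X x in Td *; set r := bdist X x1 in r0 hr.
have fr : A - L * r + pi * r ^+ 2 <= 0.
  apply: le_trans (area_inner_ge oX bX parallel (ltW r0) (lexx r)) _.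
  have -> : inner X r = set0 by rewrite -subset0 => y; rewrite /inner /= ltNge hr.
  by rewrite /area /plane_measure measure0.
have [_ fT _ _] := IRP; rewrite -/T -/A in fT.
have dr : d <= r by exact: hr.
have -> : q d = (A - L * d + pi * d ^+ 2) / A by rewrite /q; field.
rewrite pmulr_lle0 ?invr_gt0//.
have [->|dT] := eqVneq d T; first by rewrite fT.
have Tr : 0 < r - T by rewrite subr_gt0 (lt_le_trans _ dr)// lt_neqAle eq_sym dT.
rewrite -(pmulr_rle0 _ Tr).
have -> : (r - T) * (A - L * d + pi * d ^+ 2) =
  (r - d) * (A - L * T + pi * T ^+ 2) + (d - T) * (A - L * r + pi * r ^+ 2)
  - pi * ((r - T) * ((r - d) * (d - T))) by ring.
rewrite fT mulr0 add0r subr_le0 (@le_trans _ _ 0)//.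
  by rewrite mulr_ge0_le0// subr_ge0.
by rewrite mulr_ge0 ?pi_ge0// mulr_ge0 ?(ltW Tr)// mulr_ge0 ?subr_ge0.
Qed.

Let dq (t : R) : is_derive t 1 q (q' t).
Proof.
have h := is_deriveD (is_deriveD (is_derive_cst (1 : R) t (1 : R)) (is_deriveZ (- (L / A)) (is_derive_id t (1 : R))))
  (is_deriveZ (pi / A) (is_deriveM (is_derive_id t (1 : R)) (is_derive_id t (1 : R)))).
apply: is_derive_eq h _; rewrite /GRing.scale /= /q'; field; exact: A00.
Qed.

Let cq : continuous q. Proof. by move=> t; exact: is_derive_cont (dq t). Qed.

Let dkq (t : R) : is_derive t 1 (fun t => kap * q t) (kap * q' t).
Proof. exact: is_deriveZ (dq t). Qed.

Let djsum (t : R) : is_derive t 1 (fun t => jsum (kap * q t)) (- besselj 1 (kap * q t) ^+ 2 * (kap * q' t)).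
Proof. exact: (@is_derive1_comp R jsum (fun t => kap * q t)) (is_derive_jsum _) (dkq t). Qed.

Let djj (t : R) n : is_derive t 1 (fun t => besselj n (kap * q t)) (- besselj n.+1 (kap * q t) * (kap * q' t)).
Proof. exact: (@is_derive1_comp R (besselj n) (fun t => kap * q t)) (is_derive_besselj _ _) (dkq t). Qed.

Let dzj1 (t : R) : is_derive t 1 (fun t => kap * q t * besselj 1 (kap * q t)) (besselj 0 (kap * q t) * (kap * q' t)).
Proof. exact: (@is_derive1_comp R (fun z => z * besselj 1 z) (fun t => kap * q t)) (is_derive_zbesselj1 _) (dkq t). Qed.

Let q'E (t : R) : q' t = - (L - 2 * pi * t) / A.
Proof. by rewrite /q'; field. Qed.

(* [I] and [H] are primitives because z (j0^2 + z j1^2) has derivative j0^2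
   and j0^2 + z j1^2 has derivative - j1^2. *)
Let I (t : R) := - A * (q t - q t * jsum (kap * q t)).

Let dI (t : R) : is_derive t 1 I ((1 - besselj 0 (kap * q t) ^+ 2) * (L - 2 * pi * t)).
Proof.
have h := is_deriveZ (- A) (is_deriveB (dq t) (is_deriveM (dq t) (djsum t))).
apply: is_derive_eq h _; rewrite /GRing.scale /= /jsum q'E; field; exact: A00.
Qed.

Let h (t : R) : R := (kap * besselj 1 (kap * q t)) ^+ 2 * q' t ^+ 2.
Let H (t : R) : R := - A^-1 * (D0 * (- kap * jsum (kap * q t)) +
  4 * pi * A * (kap * q t * jsum (kap * q t) - besselj 0 (kap * q t) * (kap * q t * besselj 1 (kap * q t)))).

Let dH (t : R) : is_derive t 1 H (h t * (L - 2 * pi * t)).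
Proof.
have d1 := is_deriveZ D0 (is_deriveZ (- kap) (djsum t)).
have d2 := is_deriveZ (4 * pi * A) (is_deriveB (is_deriveM (dkq t) (djsum t)) (is_deriveM (djj t 0) (dzj1 t))).
have h1 := is_deriveZ (- A^-1) (is_deriveD d1 d2).
apply: is_derive_eq h1 _; rewrite /GRing.scale /= /h /D0 /jsum !q'E /q.
set j := besselj 0 _; set j1 := besselj 1 _.
by field; exact: A00.
Qed.

Let HT : H T - H 0 = (D0 * kap * (1 - jsum kap) + 4 * pi * A * (kap * (jsum kap - besselj 0 kap * besselj 1 kap))) / A.
Proof. by rewrite /H qT0 q0 !mulr0 !mulr1 jsum0 !mul0r !mulr0; field. Qed.

Let IT : I T - I 0 = A * (1 - jsum kap).
Proof. by rewrite /I qT0 q0 !mulr1 !mul0r; ring. Qed.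

Let cj n : continuous (fun t => besselj n (kap * q t)).
Proof. by move=> t; exact: is_derive_cont (djj t n). Qed.

Let P := [set x | bdist X x <= T].
Let mP : measurable P.
Proof.
apply: closed_plane_measurable; apply: (@closed_comp _ _ (bdist X) [set u | u <= T]); last exact: closed_le.
by move=> x _; exact: continuous_bdist.
Qed.

Let psi x := besselj 0 (kap * Num.max 0 (q (bdist X x))).

Let cpsi : continuous psi.
Proof.
move=> x; apply: (@continuous_comp _ _ _ (fun x => kap * Num.max 0 (q (bdist X x))) (besselj 0)); last exact: continuous_besselj.
apply: cvgMr; apply: (@continuous_max R _ (fun=> 0) (fun x => q (bdist X x))); first exact: cst_continuous.
by apply: continuous_comp; [exact: continuous_bdist|exact: cq].
Qed.

Let max_q (t : R) : 0 <= t <= T -> Num.max 0 (q t) = q t.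
Proof. by move=> /q01 /andP[? _]; rewrite (max_idPr _). Qed.

Let psi_out x : X x -> ~ P x -> psi x = 1.
Proof.
move=> Xx /negP; rewrite -ltNge => /ltW /(qneg Xx) h1.
by rewrite /psi (max_idPl h1) mulr0 besselj_at0 fact0 invr1.
Qed.

Let psi01 x : X x -> 0 <= psi x <= 1.
Proof.
move=> Xx; have [Px|nP] := pselect (P x); last by rewrite psi_out// ler01 lexx.
have d01 : 0 <= bdist X x <= T by rewrite bdist_ge0.
by rewrite /psi max_q//; have [] := besselj_pos (jz (q01 d01)).
Qed.

(** Equivalent to an upper bound for the integral of 1 - psi^2. This function vanishes where d > T,
    so that [integral_bdist_le] applies, with the primitive I. *)
Let psi_integral : A * jsum kap <= \int[plane_measure]_(x in X) (psi x ^+ 2).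
Proof.
have cp2 := continuous_sqr cpsi.
have c1 : continuous (fun _ : R * R => 1 : R) by exact: cst_continuous.
suff : \int[plane_measure]_(x in X) (1 - psi x ^+ 2) <= A * (1 - jsum kap).
  by rewrite continuous_RintegralB// Rintegral_plane_cst// -/A; lra.
have cc : continuous (fun x => 1 - psi x ^+ 2) by move=> x; apply: cvgB; [exact: c1|exact: cp2].
rewrite -lee_fin -continuous_RintegralE// -IT.
have ch : continuous (fun t : R => 1 - besselj 0 (kap * q t) ^+ 2).
  by move=> t; apply: cvgB; [exact: cvg_cst|have c0 := @cj 0%N; exact: cvgM (c0 t) (c0 t)].
have h1 (t : R) : 0 <= t <= T -> 0 <= 1 - besselj 0 (kap * q t) ^+ 2.
  move=> /q01 /jz /besselj_pos[/andP[j0 j1] _ _].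
  by rewrite subr_ge0 expr_le1.
apply: le_trans (integral_bdist_le oX bX X0 L0 parallel ch h1 (fun t _ => dI t)).
rewrite integral_mkcondr le_eqVlt; apply/orP; left; apply/eqP.
apply: eq_integral => x /set_mem Xx; rewrite patchE; case: ifPn => [/set_mem Px|/negP nP].
  have d01 : 0 <= bdist X x <= T by rewrite bdist_ge0.
  by rewrite /psi max_q.
by rewrite psi_out// ?expr1n ?subrr// => Px; apply: nP; exact: mem_set.
Qed.

Let grad_integral (w : R * R -> R) (e : R) : smooth w -> 0 < e ->
  (forall x, X x -> d1 w x ^+ 2 + d2 w x ^+ 2 <=
     (if bdist X x <= T then
       (kap * besselj 1 (kap * Num.max 0 (q (bdist X x)))) ^+ 2 * q' (bdist X x) ^+ 2 else 0) + e) ->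
  \int[plane_measure]_(x in X) (d1 w x ^+ 2 + d2 w x ^+ 2) <= H T - H 0 + e * A.
Proof.
move=> sw e0 hw; have [_ _ cw1 cw2] := sw 1%N.
have cg : continuous (fun x => d1 w x ^+ 2 + d2 w x ^+ 2).
  by move=> x; apply: cvgD; exact: continuous_sqr.
have ch : continuous h.
  have cq1 : continuous q'.
    by move=> t; apply: cvgD; [exact: cvg_cst|apply: cvgMr; exact: cvg_id].
  have c1 : continuous (fun t => kap * besselj 1 (kap * q t)) by move=> t; apply: cvgMr; exact: cj.
  by move=> t; apply: cvgM; [exact: cvgM (c1 t) (c1 t)|exact: cvgM (cq1 t) (cq1 t)].
have h0 (t : R) : 0 <= h t by rewrite mulr_ge0 ?sqr_ge0.
rewrite addrC -(Rintegral_plane_cst mX bX e).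
apply: (le_Rintegral_part mX bX mP cg _ _ _ _ _ _
  (integral_bdist_le oX bX X0 L0 parallel ch (fun t _ => h0 t) (fun t _ => dH t))).
- exact: cst_continuous.
- by move=> x; apply: continuous_comp; [exact: continuous_bdist|exact: ch].
- by move=> x _; rewrite addr_ge0 ?sqr_ge0.
- by move=> x _; exact: ltW.
- by move=> x; exact: h0.
move=> x Xx; have hx := hw x Xx; rewrite [e + _]addrC.
have -> : (x \in P) = (bdist X x <= T) by apply/idP/idP => [/set_mem|?]//; exact: mem_set.
move: hx; case: ifP => dT hx; last exact: hx.
by rewrite max_q ?bdist_ge0 in hx.
Qed.

(** For b = a / sqrt pi this is a / sqrt |X|, the Robin parameter of the theorem. *)
Let beta := b * Num.sqrt pi / Num.sqrt A.

(** Since |w - psi| <= e and 0 <= psi <= 1, w^2 >= psi^2 - 2 e; on the boundary d = 0 and q = 1, so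
    that psi is the constant j_0(kap). *)
Let bound_eps (e : R) : 0 < e -> e < 1 -> 2 * e < jsum kap ->
  robin_eigenvalue X beta * (A * (jsum kap - 2 * e)) <=
  H T - H 0 + e * A + beta * (L * (besselj 0 kap + e) ^+ 2).
Proof.
move=> e0 e1 ej; have [w sw hw] := smooth_profile kap oX bX X0 qneg e0.
have cw := Ck_continuous (sw 0%N); have cw2 := continuous_sqr cw.
have beta0 : 0 <= beta by rewrite divr_ge0 ?sqrtr_ge0// mulr_ge0 ?sqrtr_ge0// ltW.
have subX : forall x, X x -> closure X x by exact: subset_closure.
have den : A * (jsum kap - 2 * e) <= \int[plane_measure]_(x in X) (w x ^+ 2).
  have cp2 := continuous_sqr cpsi.
  have c1 : continuous (fun _ : R * R => 2 * e) by exact: cst_continuous.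
  apply: (@le_trans _ _ (\int[plane_measure]_(x in X) (psi x ^+ 2 - 2 * e))).
    by rewrite continuous_RintegralB// Rintegral_plane_cst// -/A; have := psi_integral; lra.
  apply: continuous_le_Rintegral => //.
    by move=> x; apply: cvgB; [exact: cp2|exact: c1].
  move=> x Xx; have [hwx _] := hw x (subX x Xx); have /andP[p0 p1] := psi01 Xx.
  move: hwx; rewrite -/(psi x) ler_norml => /andP[h1 h2].
  have [pe|pe] := leP (psi x) e.
    have : psi x ^+ 2 <= e * 1 by rewrite expr2 ler_pM.
    by have := sqr_ge0 (w x); lra.
  have : (psi x - e) ^+ 2 <= w x ^+ 2 by rewrite ler_pXn2r// ?nnegrE; lra.
  have -> : (psi x - e) ^+ 2 = psi x ^+ 2 - 2 * e * psi x + e ^+ 2 by ring.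
  have : 2 * e * psi x <= 2 * e by rewrite ler_piMr// mulr_ge0// ltW.
  by have := sqr_ge0 e; lra.
have den0 : 0 < A * (jsum kap - 2 * e) by rewrite mulr_gt0// subr_gt0.
have dw0 : 0 < \int[plane_measure]_(x in X) (w x ^+ 2) by exact: lt_le_trans den.
have bd : \int[length_measure]_(x in boundary X) (w x ^+ 2) <= L * (besselj 0 kap + e) ^+ 2.
  apply: (@le_trans _ _ (\int[length_measure]_(x in boundary X) ((besselj 0 kap + e) ^+ 2))); last first.
    rewrite Rintegral_cst; last exact: closed_length_measurable (closed_boundary oX).
    by rewrite mulrC; exact: lexx.
  apply: le_Rintegral.
  - exact: closed_length_measurable (closed_boundary oX).
  - exact: length_integrable.
  - by apply: (@length_integrable _ X (fun=> (besselj 0 kap + e) ^+ 2)) => //; exact: cst_continuous.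
  move=> x bx; have cx : closure X x by case: bx.
  have [hwx _] := hw x cx; move: hwx.
  rewrite (bdist_out bX (boundary_notin oX bx)) -/(q 0) q0 (max_idPr ler01) mulr1 => hwx.
  have [/andP[j0 _] _ _] := besselj_pos (jz (introT andP (conj ler01 (lexx 1)))).
  rewrite mulr1 in j0.
  rewrite -[leLHS]ger0_norm ?sqr_ge0// normrX ler_pXn2r ?nnegrE ?addr_ge0 ?(ltW e0)//.
  by rewrite -[w x](subrK (besselj 0 kap)) (le_trans (ler_normD _ _))// (ger0_norm j0) addrC lerD2l.
apply: (@le_trans _ _ (robin_rayleigh X beta w (d1 w) (d2 w) w * (A * (jsum kap - 2 * e)))).
  rewrite ler_pM2r//; apply: robin_eigenvalue_le => //; exact: lt0r_neq0.
rewrite /robin_rayleigh mulrAC ler_pdivrMr//.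
set N := _ + _ * _; have N0 : 0 <= N.
  rewrite addr_ge0//; first by apply: Rintegral_ge0 => x _; rewrite addr_ge0 ?sqr_ge0.
  by rewrite mulr_ge0//; apply: Rintegral_ge0 => x _; exact: sqr_ge0.
apply: (@le_trans _ _ (N * \int[plane_measure]_(x in X) (w x ^+ 2))); first by rewrite ler_wpM2l.
rewrite ler_pM2r//; apply: lerD; last by rewrite ler_wpM2l.
by apply: grad_integral => // x Xx; have [_] := hw x (subX x Xx); exact.
Qed.

Lemma robin_upper_bound :
  A * robin_eigenvalue X beta <= pi * k ^+ 2 +
    F k * (isoperimetric_deficit X * (isoperimetric_deficit X + 2)) + G k * isoperimetric_deficit X.
Proof.
set delta := isoperimetric_deficit X; set mu := robin_eigenvalue X beta.
have beta0 : 0 <= beta by rewrite divr_ge0 ?sqrtr_ge0// mulr_ge0 ?sqrtr_ge0// ltW.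
have D0' : 0 < jsum kap by apply: jsum_gt0; rewrite (ltW kap0) ltW.
have jz1 := jz (introT andP (conj ler01 (lexx 1))); rewrite mulr1 in jz1.
have [/andP[j0 j1] _ _] := besselj_pos jz1.
have lim : mu * (A * jsum kap) <= H T - H 0 + beta * (L * besselj 0 kap ^+ 2).
  apply/ler_addgt0Pr => e e0.
  (* C collects the coefficients of the errors, all of which are at most linear in e1. *)
  pose C := A + 3 * beta * L + 2 * A * `|mu| + 1.
  have C0 : 0 < C.
    by rewrite ltr_wpDl// !addr_ge0 ?(ltW A0)// !mulr_ge0// ltW.
  pose e1 := Num.min (1 / 2) (Num.min (jsum kap / 4) (e / C)).
  have e10 : 0 < e1 by rewrite !lt_min !divr_gt0.
  have e11 : e1 < 1 by rewrite (le_lt_trans (_ : _ <= 1 / 2))//; [rewrite ge_min lexx|lra].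
  have e12 : 2 * e1 < jsum kap.
    have : e1 <= jsum kap / 4 by rewrite !ge_min lexx orbT.
    by lra.
  have e13 : e1 * C <= e by rewrite -ler_pdivlMr// !ge_min lexx !orbT.
  have := bound_eps e10 e11 e12; rewrite -/mu.
  have -> : (besselj 0 kap + e1) ^+ 2 = besselj 0 kap ^+ 2 + e1 * (2 * besselj 0 kap + e1) by ring.
  have a1 : beta * (L * (e1 * (2 * besselj 0 kap + e1))) <= e1 * (3 * beta * L).
    have -> : e1 * (3 * beta * L) = beta * (L * (e1 * 3)) by ring.
    by apply: ler_wpM2l => //; apply: ler_wpM2l => //; rewrite ler_pM2l//; lra.
  have a2 : mu * (A * (2 * e1)) <= e1 * (2 * A * `|mu|).
    have -> : e1 * (2 * A * `|mu|) = `|mu| * (A * (2 * e1)) by ring.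
    by rewrite ler_wpM2r ?ler_norm// !mulr_ge0// ltW.
  rewrite mulrBr [X in X <= _]mulrBr 2!mulrDr.
  have : e1 * C = e1 * A + e1 * (3 * beta * L) + e1 * (2 * A * `|mu|) + e1 by rewrite /C; ring.
  by lra.
have p0 := pi_gt0 R; have sA : 0 < Num.sqrt A by rewrite sqrtr_gt0.
have sp : 0 < Num.sqrt pi :> R by rewrite sqrtr_gt0.
have sA2 : Num.sqrt A ^+ 2 = A by rewrite sqr_sqrtr// ltW.
have sp2 : Num.sqrt pi ^+ 2 = pi :> R by rewrite sqr_sqrtr// ltW.
have LE : L = 2 * (Num.sqrt pi * Num.sqrt A) * (1 + delta).
  rewrite /delta /isoperimetric_deficit -/L -/A addrCA subrr addr0.
  rewrite !sqrtrM ?mulr_ge0 ?(ltW p0)//.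
  have -> : Num.sqrt 4 = 2 :> R.
    by rewrite (_ : 4 = 2 ^+ 2) ?sqrtr_sqr ?ger0_norm//; ring.
  by field; rewrite !gt_eqF.
have D0E : D0 = 4 * pi * A * (delta * (delta + 2)).
  have L2 : L ^+ 2 = 4 * (Num.sqrt pi ^+ 2 * Num.sqrt A ^+ 2) * (1 + delta) ^+ 2 by rewrite LE; ring.
  by rewrite /D0 L2 sp2 sA2; ring.
have kb' : 2 * kap * besselj 1 kap = b * besselj 0 kap.
  by move: kb; rewrite bessel_J0E bessel_J1E -/kap => <-; rewrite /kap; field.
(* The Robin condition trades b j_0 for 2 kap j_1. The part without delta then cancels the last term
   of [HT], and the part with delta gives G. *)
have bL : beta * (L * besselj 0 kap ^+ 2) = 4 * pi * kap * (1 + delta) * (besselj 0 kap * besselj 1 kap).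
  have -> : beta * (L * besselj 0 kap ^+ 2) = (b * besselj 0 kap) * (2 * pi * (1 + delta)) * besselj 0 kap.
    by rewrite {1}LE /beta -{3}sp2; field; rewrite gt_eqF.
  by rewrite -kb'; ring.
move: lim; rewrite HT D0E bL => lim.
rewrite F_jsum G_jsum -/kap -(ler_pM2r D0').
apply: le_trans (_ : _ <= mu * (A * jsum kap)) _; first by rewrite mulrA [A * mu]mulrC.
apply: le_trans lim _; rewrite le_eqVlt; apply/orP; left; apply/eqP.
have -> : k ^+ 2 = 4 * kap by rewrite /kap; field.
by field; rewrite A00 gt_eqF.
Qed.

End upper_bound.

(** * Picone's inequality on disks *)

Section picone.
Context {R : realType}.
Variables (c : R * R) (r b k : R).
Hypotheses (r0 : 0 < r) (b0 : 0 < b) (k0 : 0 < k < j01 R) (kb : k * bessel_J 1 k = b * bessel_J 0 k).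

Let kap := k ^+ 2 / 4.
Let D := disk c r.
(** The eigenfunction J_0(k |x - c| / r) is j_0(kap s). *)
Let s (x : R * R) : R := ((x.1 - c.1) ^+ 2 + (x.2 - c.2) ^+ 2) / r ^+ 2.

Let kap0 : 0 < kap.
Proof. by case/andP: k0 => k1 _; rewrite divr_gt0// exprn_gt0. Qed.

Let kapj : kap < j01 R ^+ 2 / 4.
Proof.
case/andP: k0 => k1 k2; rewrite ltr_pM2r ?invr_gt0//.
by rewrite ltr_pXn2r ?nnegrE ?ltW// (lt_trans k1).
Qed.

Let jz (y : R) : 0 <= y <= 1 -> 0 <= kap * y <= j01 R ^+ 2 / 4.
Proof.
move=> /andP[y0 y1]; rewrite mulr_ge0 ?(ltW kap0)//=.
by rewrite (le_trans _ (ltW kapj))// ler_piMr// ltW.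
Qed.

Let jpos (y : R) : 0 <= y <= 1 -> 0 < besselj 0 (kap * y) /\ 0 < besselj 1 (kap * y).
Proof.
move=> y01; have [_ h1 h2] := besselj_pos (jz y01); split=> //; apply: h1.
by case/andP: y01 => y1 y2; rewrite (le_lt_trans _ kapj)// ler_piMr// ltW.
Qed.

Let one01 : 0 <= (1 : R) <= 1. Proof. by rewrite ler01 lexx. Qed.

Let j0pos : 0 < besselj 0 kap.
Proof. by have [] := jpos one01; rewrite mulr1. Qed.

Let kb' : 2 * kap * besselj 1 kap = b * besselj 0 kap.
Proof. by move: kb; rewrite bessel_J0E bessel_J1E -/kap => <-; rewrite /kap; field. Qed.

Let j0_mono (y : R) : 0 <= y <= 1 -> besselj 0 kap <= besselj 0 (kap * y).
Proof.
move=> /andP[y0]; rewrite le_eqVlt => /orP[/eqP->|y1]; first by rewrite mulr1.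
have lt1 : kap * y < kap by rewrite gtr_pMr.
have [z /andP[z1 z2] E] := MVTd lt1 (fun x _ => is_derive_besselj 0 x).
rewrite -subr_le0 E mulNr oppr_le0; apply: mulr_ge0; last by rewrite subr_ge0 ltW.
have zz : 0 <= z / kap <= 1.
  rewrite (divr_ge0 (le_trans (mulr_ge0 (ltW kap0) y0) (ltW z1)) (ltW kap0)) /=.
  by rewrite ler_pdivrMr// mul1r ltW.
by have [_] := jpos zz; rewrite mulrC divfK ?gt_eqF// => /ltW.
Qed.

Let j1_mono (y : R) : 0 <= y <= 1 -> y * besselj 1 (kap * y) <= besselj 1 kap.
Proof.
move=> /andP[y0]; rewrite le_eqVlt => /orP[/eqP->|y1]; first by rewrite mulr1 mul1r.
have lt1 : kap * y < kap by rewrite gtr_pMr.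
have [z /andP[z1 z2] E] := MVTd lt1 (fun x _ => is_derive_zbesselj1 x).
have zz : 0 <= z / kap <= 1.
  rewrite (divr_ge0 (le_trans (mulr_ge0 (ltW kap0) y0) (ltW z1)) (ltW kap0)) /=.
  by rewrite ler_pdivrMr// mul1r ltW.
have jz0 : 0 <= besselj 0 z by have [+ _] := jpos zz; rewrite mulrC divfK ?gt_eqF// => /ltW.
have : 0 <= besselj 0 z * (kap - kap * y) by apply: mulr_ge0 => //; rewrite subr_ge0 ltW.
by rewrite -E subr_ge0 -mulrA ler_pM2l.
Qed.

Let r2 : 0 < r ^+ 2. Proof. by rewrite exprn_gt0. Qed.
Let rn : r != 0. Proof. by rewrite gt_eqF. Qed.

Let s_ge0 x : 0 <= s x.
Proof. by rewrite divr_ge0 ?addr_ge0 ?sqr_ge0// ltW. Qed.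

Let diskE x : D x <-> s x < 1.
Proof.
rewrite /D /disk /= /s ltr_pdivrMr// mul1r.
rewrite -[X in _ <-> X < _]sqr_sqrtr ?addr_ge0 ?sqr_ge0//.
rewrite ltr_pXn2r ?nnegrE ?sqrtr_ge0 ?(ltW r0)// -/(edist x c) edist_sym.
by [].
Qed.

Let s_edist x : s x = (edist c x / r) ^+ 2.
Proof. by rewrite expr_div_n edist_sym /edist sqr_sqrtr// addr_ge0 ?sqr_ge0. Qed.

Let oD : open D. Proof. exact: open_disk. Qed.
Let bD : bounded_set D. Proof. exact: bounded_disk. Qed.
Let mD : measurable D. Proof. exact: open_plane_measurable. Qed.

Section smooth_case.
Variables (w : R * R -> R) (e : R).
Hypotheses (sw : smooth w) (e0 : 0 < e) (e2 : e <= 1 / 2).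

(* The cutoff [chi] vanishes on the circle, has slope at most 1 / e in s, and
   is almost constant where 1 - s > e. *)
Let eps0 : 0 < e ^+ 2. Proof. by rewrite exprn_gt0. Qed.
Let arg x : R := 1 - (1 - s x) / e.
Let chi x : R := softplus (e ^+ 2) 1 - softplus (e ^+ 2) (arg x).
Let chi' x : R := softplus' (e ^+ 2) (arg x).
Let J n x := besselj n (kap * s x).
(** 1 / J_0 on the closed disk, where J_0 >= j_0(kap); the maximum makes N continuous on the whole
    plane, as the integrability lemmas require. *)
Let N x := (Num.max (J 0 x) (besselj 0 kap / 2))^-1.

Let NE x : s x <= 1 -> N x = (J 0 x)^-1 /\ 0 < J 0 x.
Proof.
move=> s1; have s01 : 0 <= s x <= 1 by rewrite s_ge0.
have [h _] := jpos s01; split=> //; rewrite /N (max_idPl _)//.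
apply: le_trans (j0_mono s01); have := j0pos; lra.
Qed.

Let ds x v : is_derive x v s (2 * ((x.1 - c.1) * v.1 + (x.2 - c.2) * v.2) / r ^+ 2).
Proof.
have dx : is_derive x v (fun y => y.1 - c.1) v.1.
  by apply: is_derive_eq (is_deriveDp (is_derive_fst x v) (is_derive_cstp x v _)) _; rewrite addr0.
have dy : is_derive x v (fun y => y.2 - c.2) v.2.
  by apply: is_derive_eq (is_deriveDp (is_derive_snd x v) (is_derive_cstp x v _)) _; rewrite addr0.
have h := is_deriveMp (is_deriveDp (is_deriveMp dx dx) (is_deriveMp dy dy)) (is_derive_cstp x v (r ^+ 2)^-1).
by apply: is_derive_eq h _; field; exact: rn.
Qed.

Let dchi x v (a : R) : is_derive x v s a -> is_derive x v chi (- chi' x * (a / e)).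
Proof.
move=> da; have en : e != 0 by rewrite gt_eqF.
have dar : is_derive x v arg (a / e).
  have h1 := is_deriveMp (is_deriveDp (is_derive_cstp x v 1) (is_deriveZp (-1) da)) (is_derive_cstp x v e^-1).
  have h2 := is_deriveDp (is_derive_cstp x v 1) (is_deriveZp (-1) h1).
  have -> : arg = fun y => 1 + -1 * ((1 + -1 * s y) / e) by apply/funext => y; rewrite /arg !mulN1r.
  by apply: is_derive_eq h2 _; field.
have h := is_deriveDp (is_derive_cstp x v (softplus (e ^+ 2) 1))
  (is_deriveZp (-1) (is_derive_chain (is_derive_softplus (arg x) eps0) dar)).
have -> : chi = fun y => softplus (e ^+ 2) 1 + -1 * softplus (e ^+ 2) (arg y).
  by apply/funext => y; rewrite /chi mulN1r.
by apply: is_derive_eq h _; rewrite /chi'; ring.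
Qed.

(** [phi x] times x - c is - r^2 / (2 kap) chi w^2 grad v / v for v = j_0(kap s). [phin] is the same
    with [N] and so continuous on the plane; [dphi] is the derivative, on the disk, in a direction
    along which s and w have derivatives a and dw. *)
Let phi x := chi x * (w x * w x) * (J 1 x * (J 0 x)^-1).
Let phin x := chi x * (w x * w x) * (J 1 x * N x).
Let dphi x (a dw : R) := chi' x * (- e^-1) * a * (w x * w x) * (J 1 x * N x)
  + chi x * (2 * (w x * dw)) * (J 1 x * N x)
  + chi x * (w x * w x) * (kap * a * (J 1 x * J 1 x * (N x * N x) + -1 * (J 2 x * N x))).

Let derive_phi x v (dw : R) : s x <= 1 -> is_derive x v w dw ->
  is_derive x v phi (dphi x (2 * ((x.1 - c.1) * v.1 + (x.2 - c.2) * v.2) / r ^+ 2) dw).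
Proof.
move=> s1 hw; have [NE1 J0] := NE s1.
set a := _ / _; have da : is_derive x v s a by exact: ds.
have dJ n : is_derive x v (J n) (- J n.+1 x * (kap * a)).
  exact: (is_derive_chain (is_derive_besselj n (kap * s x)) (is_deriveZp kap da)).
have dV : is_derive (J 0 x) 1 (fun t : R => t^-1) (- ((J 0 x)^-1 ^+ 2)).
  have h := @is_deriveV R id (J 0 x) 1 1 (lt0r_neq0 J0) (is_derive_id _ _).
  by apply: is_derive_eq h _; rewrite /GRing.scale /= mulr1 exprVn.
have h := is_deriveMp (is_deriveMp (dchi da) (is_deriveMp hw hw)) (is_deriveMp (dJ 1%N) (is_derive_chain dV (dJ 0%N))).
apply: is_derive_eq h _; rewrite /dphi NE1; ring.
Qed.

Let F1 x := dphi x (2 * (x.1 - c.1) / r ^+ 2) (d1 w x) * (x.1 - c.1) + phin x.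
Let F2 x := dphi x (2 * (x.2 - c.2) / r ^+ 2) (d2 w x) * (x.2 - c.2) + phin x.

Let dF1 x : s x <= 1 -> is_derive x (1, 0) (fun x => phi x * (x.1 - c.1)) (F1 x).
Proof.
move=> s1; have [NE1 _] := NE s1.
have dx : is_derive x (1, 0) (fun y : R * R => y.1 - c.1) 1.
  by apply: is_derive_eq (is_deriveDp (is_derive_fst x _) (is_derive_cstp x _ _)) _; rewrite addr0.
have h := is_deriveMp (derive_phi s1 (@Ck_d1 _ 0 _ x (sw 1%N))) dx.
by apply: is_derive_eq h _; rewrite /F1 /phin NE1 /= !mulr1 mulr0 addr0.
Qed.

Let dF2 x : s x <= 1 -> is_derive x (0, 1) (fun x => phi x * (x.2 - c.2)) (F2 x).
Proof.
move=> s1; have [NE1 _] := NE s1.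
have dx : is_derive x (0, 1) (fun y : R * R => y.2 - c.2) 1.
  by apply: is_derive_eq (is_deriveDp (is_derive_snd x _) (is_derive_cstp x _ _)) _; rewrite addr0.
have h := is_deriveMp (derive_phi s1 (@Ck_d2 _ 0 _ x (sw 1%N))) dx.
by apply: is_derive_eq h _; rewrite /F2 /phin NE1 /= !mulr1 mulr0 add0r.
Qed.

Let cw : continuous w. Proof. exact: Ck_continuous (sw 0%N). Qed.
Let cw1 : continuous (d1 w). Proof. by have [] := sw 1%N. Qed.
Let cw2 : continuous (d2 w). Proof. by have [] := sw 1%N. Qed.
Let ss : smooth s.
Proof.
have h i : smooth (fun x : R * R => x.1 - i) by apply: smoothD; [exact: Ck_fst|exact: smooth_cst].
have h' i : smooth (fun x : R * R => x.2 - i) by apply: smoothD; [exact: Ck_snd|exact: smooth_cst].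
by apply: smoothM; [apply: smoothD; apply: smoothM|exact: smooth_cst].
Qed.
Let sarg : smooth arg.
Proof.
have -> : arg = fun y => 1 + -1 * ((1 + -1 * s y) * e^-1) by apply/funext => y; rewrite /arg !mulN1r.
apply: smoothD; first exact: smooth_cst.
apply: smoothZ; apply: smoothM; last exact: smooth_cst.
by apply: smoothD; [exact: smooth_cst|exact: smoothZ].
Qed.
Let cchi : continuous chi.
Proof.
apply: (@CkD _ 0); first exact: cst_continuous.
move=> x; apply: cvgN; exact: (Ck_continuous (smooth_softplus eps0 sarg 0%N)).
Qed.
Let cchi' : continuous chi'.
Proof.
have ca := Ck_continuous (sarg 0%N).
have cq : continuous (fun x => Num.sqrt (arg x ^+ 2 + (e ^+ 2) ^+ 2)).
  move=> x; apply: (@continuous_comp _ _ _ (fun x => arg x ^+ 2 + (e ^+ 2) ^+ 2) Num.sqrt); last exact: sqrt_continuous.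
  by apply: cvgD; [exact: continuous_sqr|exact: cvg_cst].
apply: (@CkM _ 0); last exact: cst_continuous.
apply: (@CkD _ 0); first exact: cst_continuous.
apply: (@CkM _ 0); first exact: ca.
move=> x; apply: cvgV; last exact: cq.
by have [h _ _ _] := sqrt_add_bounds (arg x) eps0; exact: lt0r_neq0.
Qed.
Let cJ n : continuous (J n).
Proof. exact: (Ck_continuous (smooth_besselj n (smoothZ kap ss) 0%N)). Qed.
Let cN : continuous N.
Proof.
move=> x; apply: cvgV.
  by apply: lt0r_neq0; rewrite lt_max orbC divr_gt0.
apply: (@continuous_max R _ (J 0) (fun=> besselj 0 kap / 2)); [exact: cJ|exact: cst_continuous].
Qed.
Let c1 : continuous (fun x : R * R => x.1 - c.1).
Proof. by apply: (@CkD _ 0); [exact: (@Ck_fst _ 0)|exact: cst_continuous]. Qed.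
Let c2 : continuous (fun x : R * R => x.2 - c.2).
Proof. by apply: (@CkD _ 0); [exact: (@Ck_snd _ 0)|exact: cst_continuous]. Qed.

Let cphin : continuous phin.
Proof. exact: (@CkM R 0 _ _ (@CkM R 0 _ _ cchi (@CkM R 0 _ _ cw cw)) (@CkM R 0 _ _ (@cJ 1%N) cN)). Qed.

Let cdphi a dw : continuous a -> continuous dw -> continuous (fun x => dphi x (a x) (dw x)).
Proof.
move=> ca cdw.
have cm (f g : R * R -> R) : continuous f -> continuous g -> continuous (fun x : R * R => f x * g x : R) := @CkM R 0 f g.
have cd (f g : R * R -> R) : continuous f -> continuous g -> continuous (fun x : R * R => f x + g x : R) := @CkD R 0 f g.
have ck z : continuous (fun _ : R * R => z : R) := @Ck_cst R 0 z.
have cW := cm _ _ cw cw; have cM := cm _ _ (@cJ 1%N) cN.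
have p1 := cm _ _ (cm _ _ (cm _ _ (cm _ _ cchi' (ck (- e^-1))) ca) cW) cM.
have p2 := cm _ _ (cm _ _ cchi (cm _ _ (ck 2) (cm _ _ cw cdw))) cM.
have p3 := cd _ _ (cm _ _ (cm _ _ (@cJ 1%N) (@cJ 1%N)) (cm _ _ cN cN)) (cm _ _ (ck (-1)) (cm _ _ (@cJ 2%N) cN)).
exact: (cd _ _ (cd _ _ p1 p2) (cm _ _ (cm _ _ cchi cW) (cm _ _ (cm _ _ (ck kap) ca) p3))).
Qed.

Let cF1 : continuous F1.
Proof.
apply: (@CkD _ 0); last exact: cphin.
apply: (@CkM _ 0); last exact: c1.
apply: cdphi => //; apply: (@CkM _ 0); last exact: cst_continuous.
by apply: (@CkM _ 0); [exact: cst_continuous|exact: c1].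
Qed.

Let cF2 : continuous F2.
Proof.
apply: (@CkD _ 0); last exact: cphin.
apply: (@CkM _ 0); last exact: c2.
apply: cdphi => //; apply: (@CkM _ 0); last exact: cst_continuous.
by apply: (@CkM _ 0); [exact: cst_continuous|exact: c2].
Qed.

Let phi_edge x : s x = 1 -> phi x = 0.
Proof. by move=> s1; rewrite /phi /chi /arg s1 subrr mul0r subr0 subrr !mul0r. Qed.

Let half_chord (y p : R) : (y - p) ^+ 2 < r ^+ 2 ->
  exists h : R, [/\ 0 < h, h ^+ 2 = r ^+ 2 - (y - p) ^+ 2 &
    forall t q : R, (t - q) ^+ 2 < h ^+ 2 <-> q - h < t < q + h].
Proof.
move=> hy; have h0 : 0 < r ^+ 2 - (y - p) ^+ 2 by rewrite subr_gt0.
exists (Num.sqrt (r ^+ 2 - (y - p) ^+ 2)); split; [by rewrite sqrtr_gt0|by rewrite sqr_sqrtr// ltW|].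
move=> t q; set h := Num.sqrt _; have hp : 0 < h by rewrite sqrtr_gt0.
have -> : ((t - q) ^+ 2 < h ^+ 2) = (`|t - q| < h).
  by rewrite -[(t - q) ^+ 2]ger0_norm ?sqr_ge0// normrX ltr_pXn2r ?nnegrE// ltW.
by rewrite ltr_distl.
Qed.

(** The slices of the disk are intervals, and chi vanishes at their ends, which lie on the
    circle. *)
Let F1_integral : (\int[plane_measure]_(x in D) (F1 x)%:E = 0)%E.
Proof.
apply: (@integral_slices1 _ D (fun x => phi x * (x.1 - c.1))) => //; first exact: continuous_integrable.
move=> y [t0 /= /diskE]; rewrite /s /= ltr_pdivrMr// mul1r => h0.
have hy : (y - c.2) ^+ 2 < r ^+ 2 by apply: le_lt_trans h0; rewrite lerDr sqr_ge0.
have [h [hp h2 hE]] := half_chord hy.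
have sE t : s (t, y) = 1 - (h ^+ 2 - (t - c.1) ^+ 2) / r ^+ 2 by rewrite /s /= h2; field; exact: rn.
exists (c.1 - h), (c.1 + h); split.
- by lra.
- apply/seteqP; split=> t /=; rewrite in_itv /=.
    by move/diskE; rewrite sE gtrBl pmulr_lgt0 ?invr_gt0// subr_gt0 => /hE.
  by move=> /hE ht; apply/diskE; rewrite sE gtrBl pmulr_lgt0 ?invr_gt0// subr_gt0.
- move=> t /andP[ta tb].
  suff s1 : s (t, y) <= 1 by exact: (iffLR (@is_derive_slice1 R (fun x => phi x * (x.1 - c.1)) _ _ _) (dF1 s1)).
  rewrite sE gerBl divr_ge0 ?(ltW r2)// subr_ge0.
  by rewrite -[leLHS]ger0_norm ?sqr_ge0// normrX ler_pXn2r ?nnegrE ?(ltW hp)// ler_distl ta.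
- by move=> t _; apply: continuous_slice1; exact: cF1.
by rewrite !phi_edge ?mul0r// sE; field.
Qed.

Let F2_integral : (\int[plane_measure]_(x in D) (F2 x)%:E = 0)%E.
Proof.
apply: (@integral_slices2 _ D (fun x => phi x * (x.2 - c.2))) => //; first exact: continuous_integrable.
move=> y [t0 /= /diskE]; rewrite /s /= ltr_pdivrMr// mul1r => h0.
have hy : (y - c.1) ^+ 2 < r ^+ 2 by apply: le_lt_trans h0; rewrite lerDl sqr_ge0.
have [h [hp h2 hE]] := half_chord hy.
have sE t : s (y, t) = 1 - (h ^+ 2 - (t - c.2) ^+ 2) / r ^+ 2 by rewrite /s /= h2; field; exact: rn.
exists (c.2 - h), (c.2 + h); split.
- by lra.
- apply/seteqP; split=> t /=; rewrite in_itv /=.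
    by move/diskE; rewrite sE gtrBl pmulr_lgt0 ?invr_gt0// subr_gt0 => /hE.
  by move=> /hE ht; apply/diskE; rewrite sE gtrBl pmulr_lgt0 ?invr_gt0// subr_gt0.
- move=> t /andP[ta tb].
  suff s1 : s (y, t) <= 1 by exact: (iffLR (@is_derive_slice2 R (fun x => phi x * (x.2 - c.2)) _ _ _) (dF2 s1)).
  rewrite sE gerBl divr_ge0 ?(ltW r2)// subr_ge0.
  by rewrite -[leLHS]ger0_norm ?sqr_ge0// normrX ler_pXn2r ?nnegrE ?(ltW hp)// ler_distl ta.
- by move=> t _; apply: continuous_slice2; exact: cF2.
by rewrite !phi_edge ?mul0r// sE; field.
Qed.

Let chi'_bounds x : 0 <= chi' x <= 1. Proof. exact: softplus'_bounds. Qed.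

Let chi_bounds x : s x <= 1 -> 0 <= chi x <= 1 + e ^+ 2.
Proof.
move=> s1; have a1 : arg x <= 1 by rewrite /arg gerBl divr_ge0 ?subr_ge0// ltW.
have /andP[_] := softplus_bounds (1 : R) eps0; rewrite (max_idPr ler01) => u1.
have /andP[l2 _] := softplus_bounds (arg x) eps0.
have l3 : 0 <= softplus (e ^+ 2) (arg x) by apply: le_trans l2; rewrite le_max lexx.
apply/andP; split; last by rewrite /chi; lra.
move: a1; rewrite /chi le_eqVlt => /orP[/eqP->|a1]; first by rewrite subrr.
have [z _ ->] := MVTd a1 (fun t _ => is_derive_softplus t eps0).
by rewrite mulr_ge0 ?subr_ge0 ?(ltW a1)//; have /andP[] := softplus'_bounds z eps0.
Qed.

(** This is (k / r)^2, the eigenvalue of the disk. *)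
Let K := 4 * kap / r ^+ 2.

(* With V = grad v / v for the radial eigenfunction v, the defect is
   [chi |grad w - w V|^2]; [F1 + F2] is a multiple of div (chi w^2 V). *)
Let picone_pointwise x : D x ->
  K * (chi x * (w x * w x)) <= chi x * (d1 w x ^+ 2 + d2 w x ^+ 2)
   + 2 * b / (r ^+ 2 * e) * (chi' x * (w x * w x)) + 2 * kap / r ^+ 2 * (F1 x + F2 x).
Proof.
move=> /diskE sx; have [NE1 J0] := NE (ltW sx).
have s01 : 0 <= s x <= 1 by rewrite s_ge0 ltW.
have [_ J1] := jpos s01; rewrite -/(J 1 x) in J1.
have /andP[x0 _] := chi_bounds (ltW sx); have /andP[x0' _] := chi'_bounds x.
set W := w x * w x; have W0 : 0 <= W by rewrite /W -expr2 sqr_ge0.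
have n0 : J 0 x != 0 by rewrite gt_eqF.
have en : e != 0 by rewrite gt_eqF.
(* On the circle this is an equality, by the Robin condition. It turns the term with the derivative
   of chi into the boundary term with coefficient b. *)
have sm : s x * (J 1 x * N x) <= b / (2 * kap).
  have -> : b / (2 * kap) = besselj 1 kap / besselj 0 kap.
    have jn : besselj 0 kap != 0 by rewrite gt_eqF.
    by rewrite -[b in LHS](mulfK jn) -kb'; field; rewrite jn gt_eqF.
  rewrite NE1 mulrA; apply: ler_pM.
  - by rewrite mulr_ge0// ltW.
  - by rewrite invr_ge0 ltW.
  - exact: j1_mono.
  - by rewrite lef_pV2 ?posrE//; exact: j0_mono.
have yy : ((x.1 - c.1) ^+ 2 + (x.2 - c.2) ^+ 2) / r ^+ 2 = s x by [].
have rec : kap * s x * J 2 x = J 1 x - J 0 x.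
  by rewrite /J (besselj_rec (kap * s x)); ring.
set y1 := x.1 - c.1 in yy *; set y2 := x.2 - c.2 in yy *.
set m := J 1 x * N x.
have FE : F1 x + F2 x = - (2 * s x / e) * (chi' x * W) * m
   + chi x * (2 * w x * m * (d1 w x * y1 + d2 w x * y2)) + 2 * chi x * W * (kap * s x * m ^+ 2 + 1).
  transitivity (- (2 * ((y1 ^+ 2 + y2 ^+ 2) / r ^+ 2) / e) * (chi' x * W) * m
   + chi x * (2 * w x * m * (d1 w x * y1 + d2 w x * y2))
   + chi x * W * (2 * kap * ((y1 ^+ 2 + y2 ^+ 2) / r ^+ 2) * (m ^+ 2 - J 2 x * N x) + 2 * m)).
    by rewrite /F1 /F2 /dphi /phin -/y1 -/y2 -/W /m; field; rewrite rn en.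
  rewrite yy.
  have E2 : kap * s x * (J 2 x * N x) = m - 1.
    by rewrite mulrA rec NE1 mulrBl mulfV// /m NE1.
  have -> : 2 * kap * s x * (m ^+ 2 - J 2 x * N x) + 2 * m =
    2 * (kap * s x * m ^+ 2) - 2 * (kap * s x * (J 2 x * N x)) + 2 * m by ring.
  by rewrite E2; ring.
have sq : 0 <= (d1 w x + (2 * kap / r ^+ 2) * (m * w x * y1)) ^+ 2 + (d2 w x + (2 * kap / r ^+ 2) * (m * w x * y2)) ^+ 2.
  by rewrite addr_ge0 ?sqr_ge0.
have sqE : (d1 w x + (2 * kap / r ^+ 2) * (m * w x * y1)) ^+ 2 + (d2 w x + (2 * kap / r ^+ 2) * (m * w x * y2)) ^+ 2 =
  d1 w x ^+ 2 + d2 w x ^+ 2 + K * (m * w x * (d1 w x * y1 + d2 w x * y2)) + K * W * (kap * s x * m ^+ 2).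
  transitivity (d1 w x ^+ 2 + d2 w x ^+ 2 + K * (m * w x * (d1 w x * y1 + d2 w x * y2)) + K * W * (kap * ((y1 ^+ 2 + y2 ^+ 2) / r ^+ 2) * m ^+ 2)).
    by rewrite /K /W; field; exact: rn.
  by rewrite yy.
rewrite sqE in sq.
have t1 := mulr_ge0 x0 sq.
have t2 : 0 <= chi' x * W * (K / e) * (b / (2 * kap) - s x * m).
  have K0 : 0 <= K := divr_ge0 (mulr_ge0 (ler0n _ 4) (ltW kap0)) (ltW r2).
  apply: mulr_ge0; last by rewrite subr_ge0.
  exact: mulr_ge0 (mulr_ge0 x0' W0) (divr_ge0 K0 (ltW e0)).
rewrite -subr_ge0 FE.
have -> : chi x * (d1 w x ^+ 2 + d2 w x ^+ 2) + 2 * b / (r ^+ 2 * e) * (chi' x * W) +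
   2 * kap / r ^+ 2 * (- (2 * s x / e) * (chi' x * W) * m + chi x * (2 * w x * m * (d1 w x * y1 + d2 w x * y2)) + 2 * chi x * W * (kap * s x * m ^+ 2 + 1)) - K * (chi x * W) =
  chi x * (d1 w x ^+ 2 + d2 w x ^+ 2 + K * (m * w x * (d1 w x * y1 + d2 w x * y2)) + K * W * (kap * s x * m ^+ 2))
  + chi' x * W * (K / e) * (b / (2 * kap) - s x * m).
  by rewrite /K; field; rewrite rn en gt_eqF.
exact: addr_ge0.
Qed.

(** [arg x <= - (e / 2)] amounts to 1 - s >= th, and u, about e / 2, is an elementary upper bound
    for 1 - sqrt (1 - th). So at depth more than r u below the circle [arg] is at most - e / 2, and
    chi' is at most e^2. *)
Let th := e * (1 + e / 2).
Let u := th * (1 + th) / 2.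

Let th_bounds : 0 < th <= 5 / 4 * e.
Proof.
have h : e / 2 <= 1 / 4 by have := e2; lra.
by rewrite /th mulr_gt0 ?addr_gt0 ?divr_gt0//= [5 / 4 * e]mulrC ler_pM2l//; lra.
Qed.

Let near_edge x : D x -> 1 - s x < th -> bdist D x <= r * u.
Proof.
move=> Dx hs; rewrite bdist_disk//; last exact: ltW.
have /andP[th0 th1] := th_bounds.
have u0 : 0 <= u by apply: divr_ge0 => //; apply: mulr_ge0; [exact: ltW|apply: addr_ge0 => //; exact: ltW].
have uth : u <= th.
  by rewrite /u -mulrA ger_pMr//; have := e2; lra.
have tt : th * 1 <= th * th + th by rewrite mulr1 lerDr mulr_ge0// ltW.
rewrite leNgt; apply/negP => h.
have h1 : edist c x / r < 1 - u by rewrite ltr_pdivrMr// mulrBl mul1r mulrC; lra.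
have h2 : 0 <= edist c x / r by rewrite divr_ge0 ?edist_ge0// ltW.
have h3 : s x < (1 - u) ^+ 2 by rewrite s_edist ltr_pXn2r// nnegrE// (le_trans h2 (ltW h1)).
have h4 : u ^+ 2 <= th ^+ 2 by rewrite ler_pXn2r// nnegrE// ltW.
have : (1 - u) ^+ 2 = 1 - th - th ^+ 2 + u ^+ 2 by rewrite /u; field.
by lra.
Qed.

Let far x : D x -> ~ [set x | bdist D x <= r * u] x -> arg x <= - (e / 2).
Proof.
move=> Dx nP; have h : th <= 1 - s x.
  by rewrite leNgt; apply/negP => /(near_edge Dx).
rewrite /arg; have : th / e <= (1 - s x) / e by rewrite ler_pM2r ?invr_gt0.
have -> : th / e = 1 + e / 2 by rewrite /th [e * _]mulrC mulfK// gt_eqF.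
by lra.
Qed.

(** [picone_pointwise] integrated over the disk, where F1 + F2 has integral 0. Outside the layer of
    depth r u, chi is at least 1 - e^2, which the factor 1 + 2 e^2 compensates, and chi' is at most
    e^2; inside the layer the bound I is used. *)
Lemma picone_cutoff (I : R) :
  (\int[plane_measure]_(x in D `&` [set x | (bdist D x <= r * u)%R]) (w x ^+ 2)%:E <= I%:E)%E ->
  K * \int[plane_measure]_(x in D) (w x ^+ 2) <=
  (1 + 2 * e ^+ 2) * ((1 + e ^+ 2) * \int[plane_measure]_(x in D) (d1 w x ^+ 2 + d2 w x ^+ 2)
    + 2 * b / (r ^+ 2 * e) * (e ^+ 2 * \int[plane_measure]_(x in D) (w x ^+ 2) + I)) + K * I.
Proof.
move=> hI; set P := [set x | _] in hI.
have mP : measurable P.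
  apply: closed_plane_measurable; apply: (@closed_comp _ _ (bdist D) [set z | z <= r * u]); last exact: closed_le.
  by move=> x _; exact: continuous_bdist.
have K0 : 0 <= K := divr_ge0 (mulr_ge0 (ler0n _ 4) (ltW kap0)) (ltW r2).
have ee : e ^+ 2 <= 1 / 4.
  by have : e ^+ 2 <= (1 / 2) ^+ 2 by [rewrite ler_pXn2r ?nnegrE ?(ltW e0)//; lra]; lra.
have cwq := continuous_sqr cw.
have cW : continuous (fun x => w x * w x) := @CkM R 0 _ _ cw cw.
have cchiW : continuous (fun x => chi x * (w x * w x)) := @CkM R 0 _ _ cchi cW.
have cchi'W : continuous (fun x => chi' x * (w x * w x)) := @CkM R 0 _ _ cchi' cW.
have cZ (z : R) f : continuous f -> continuous (fun x : R * R => z * f x) := @CkM R 0 _ f (@Ck_cst R 0 z).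
have cg : continuous (fun x => d1 w x ^+ 2 + d2 w x ^+ 2) := @CkD R 0 _ _ (continuous_sqr cw1) (continuous_sqr cw2).
have in_P x : (x \in P) = false -> ~ P x by move=> h Px; move: h; rewrite mem_set.
have WE x : w x ^+ 2 = w x * w x by rewrite expr2.
have e4 : 0 <= 1 + 2 * e ^+ 2 by have := sqr_ge0 e; lra.
have a1 : \int[plane_measure]_(x in D) (w x ^+ 2) <=
    (1 + 2 * e ^+ 2) * \int[plane_measure]_(x in D) (chi x * (w x * w x)) + I.
  rewrite -continuous_RintegralZ//; apply: (le_Rintegral_part mD bD mP cwq _ cwq _ _ _ _ hI).
  - exact: cZ.
  - by move=> x _; exact: sqr_ge0.
  - move=> x /diskE /ltW /chi_bounds /andP[h _].
    by rewrite mulr_ge0// mulr_ge0// -WE sqr_ge0.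
  - by move=> x; exact: sqr_ge0.
  move=> x Dx; case: ifPn => [_|/negbTE /in_P nP].
    rewrite lerDr; move: Dx => /diskE /ltW /chi_bounds /andP[h _].
    by rewrite mulr_ge0// mulr_ge0// -WE sqr_ge0.
  have hf := far Dx nP; rewrite addr0 WE mulrA; apply: ler_peMl; first by rewrite -WE sqr_ge0.
  have /andP[u1 _] := softplus_bounds (1 : R) eps0; rewrite (max_idPr ler01) in u1.
  have a0 : arg x <= 0 by have := e0; lra.
  have /andP[_ u2] := softplus_bounds (arg x) eps0; rewrite (max_idPl a0) add0r in u2.
  have h : 1 - e ^+ 2 <= chi x by rewrite /chi; lra.
  apply: le_trans (ler_wpM2l e4 h).
  have -> : (1 + 2 * e ^+ 2) * (1 - e ^+ 2) = 1 + e ^+ 2 * (1 - 2 * e ^+ 2) by ring.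
  by rewrite lerDl mulr_ge0 ?sqr_ge0//; lra.
have a3 : \int[plane_measure]_(x in D) (chi' x * (w x * w x)) <=
    e ^+ 2 * \int[plane_measure]_(x in D) (w x ^+ 2) + I.
  rewrite -continuous_RintegralZ//; apply: (le_Rintegral_part mD bD mP cchi'W _ cwq _ _ _ _ hI).
  - exact: cZ.
  - by move=> x _; have /andP[h _] := chi'_bounds x; rewrite mulr_ge0// -WE sqr_ge0.
  - by move=> x _; rewrite mulr_ge0 ?sqr_ge0.
  - by move=> x; exact: sqr_ge0.
  move=> x Dx; have /andP[h h'] := chi'_bounds x; have W0 : 0 <= w x ^+ 2 by exact: sqr_ge0.
  case: ifPn => [_|/negbTE /in_P nP].
    by rewrite -WE (le_trans (ler_piMl W0 h'))// lerDr mulr_ge0// sqr_ge0.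
  rewrite addr0 -WE; apply: ler_wpM2r => //; apply: le_trans (softplus'_neg eps0 e0 (far Dx nP)) _.
  by rewrite expr2 mulfK// gt_eqF// exprn_gt0.
have a2 : K * \int[plane_measure]_(x in D) (chi x * (w x * w x)) <=
    (1 + e ^+ 2) * \int[plane_measure]_(x in D) (d1 w x ^+ 2 + d2 w x ^+ 2)
    + 2 * b / (r ^+ 2 * e) * \int[plane_measure]_(x in D) (chi' x * (w x * w x)).
  have cF : continuous (fun x => F1 x + F2 x) := @CkD R 0 _ _ cF1 cF2.
  have FI : \int[plane_measure]_(x in D) (F1 x + F2 x) = 0.
    by rewrite continuous_RintegralD// /Rintegral F1_integral F2_integral addr0.
  have -> : (1 + e ^+ 2) * \int[plane_measure]_(x in D) (d1 w x ^+ 2 + d2 w x ^+ 2)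
    + 2 * b / (r ^+ 2 * e) * \int[plane_measure]_(x in D) (chi' x * (w x * w x)) =
    \int[plane_measure]_(x in D) ((1 + e ^+ 2) * (d1 w x ^+ 2 + d2 w x ^+ 2)
    + 2 * b / (r ^+ 2 * e) * (chi' x * (w x * w x)) + 2 * kap / r ^+ 2 * (F1 x + F2 x)).
    have cs := @CkD R 0 _ _ (cZ (1 + e ^+ 2) _ cg) (cZ (2 * b / (r ^+ 2 * e)) _ cchi'W).
    rewrite (continuous_RintegralD mD bD cs (cZ _ _ cF)).
    rewrite (continuous_RintegralD mD bD (cZ _ _ cg) (cZ _ _ cchi'W)).
    by rewrite !continuous_RintegralZ// FI mulr0 addr0.
  rewrite -continuous_RintegralZ//; apply: continuous_le_Rintegral => //.
  - exact: cZ.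
  - exact: (@CkD R 0 _ _ (@CkD R 0 _ _ (cZ _ _ cg) (cZ _ _ cchi'W)) (cZ _ _ cF)).
  move=> x Dx; apply: le_trans (picone_pointwise Dx) _; rewrite !lerD2r.
  have := Dx; move=> /diskE /ltW /chi_bounds /andP[_ h].
  by rewrite ler_wpM2r// addr_ge0 ?sqr_ge0.
have b1 := ler_wpM2l K0 a1.
apply: (le_trans b1); rewrite mulrDr lerD2r mulrCA; apply: ler_wpM2l => //.
apply: (le_trans a2); rewrite lerD2l ler_wpM2l//.
apply: divr_ge0; first by apply: mulr_ge0 => //; exact: ltW.
exact: mulr_ge0 (ltW r2) (ltW e0).
Qed.

End smooth_case.

Let K := 4 * kap / r ^+ 2.
Let K0 : 0 <= K := divr_ge0 (mulr_ge0 (ler0n _ 4) (ltW kap0)) (ltW r2).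

Let hD : (hausdorff1 (boundary D) < +oo)%E.
Proof. by rewrite disk_length// ltry. Qed.

Let br0 : 0 <= b / r. Proof. by rewrite divr_ge0 ?ltW. Qed.

(** [tube_integral] provides I = r u (B + d) for [picone_cutoff]. As u / e tends to 1/2, the term 2
    b / (r^2 e) I tends to (b / r) B when e and d tend to 0. *)
Lemma picone_smooth w : smooth w ->
  K * \int[plane_measure]_(x in D) (w x ^+ 2) <=
  \int[plane_measure]_(x in D) (d1 w x ^+ 2 + d2 w x ^+ 2)
   + b / r * \int[length_measure]_(x in boundary D) (w x ^+ 2).
Proof.
move=> sw; have cw := Ck_continuous (sw 0%N).
set W := \int[plane_measure]_(x in D) (w x ^+ 2).
set G := \int[plane_measure]_(x in D) (d1 w x ^+ 2 + d2 w x ^+ 2).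
set B := \int[length_measure]_(x in boundary D) (w x ^+ 2).
have W0 : 0 <= W by apply: Rintegral_ge0 => x _; exact: sqr_ge0.
have G0 : 0 <= G by apply: Rintegral_ge0 => x _; rewrite addr_ge0 ?sqr_ge0.
have B0 : 0 <= B by apply: Rintegral_ge0 => x _; exact: sqr_ge0.
apply/ler_addgt0Pr => z z0.
pose d := z * r / (2 * b); have d0 : 0 < d by rewrite divr_gt0 ?mulr_gt0.
have brd : b / r * d = z / 2 by rewrite /d; field; rewrite rn gt_eqF.
have [t0 t00 ht0] := tube_integral oD bD (disk_outer_cone r0) hD (continuous_sqr cw) (fun x => sqr_ge0 (w x)) d0.
rewrite -/B in ht0.
pose Bd := B + d; have Bd0 : 0 <= Bd by rewrite addr_ge0// ltW.
pose C := 2 * G + 5 * (b / r * Bd) + 4 * b / r ^+ 2 * W + 2 * r * (K * Bd) + 1.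
have C0 : 0 < C.
  have i1 : 0 <= 4 * b / r ^+ 2 * W by apply: mulr_ge0 => //; apply: divr_ge0; [rewrite mulr_ge0// ltW|exact: ltW].
  have i2 : 0 <= b / r * Bd by exact: mulr_ge0.
  have i3 : 0 <= 2 * r * (K * Bd) by apply: mulr_ge0; [rewrite mulr_ge0// ltW|exact: mulr_ge0].
  by rewrite /C; lra.
pose e := Num.min (1 / 2) (Num.min (z / (2 * C)) (t0 / (4 * r))).
have e0 : 0 < e by rewrite !lt_min !divr_gt0// mulr_gt0.
have e1 : e <= 1 / 2 by rewrite ge_min lexx.
have e2 : e * C <= z / 2.
  have : e <= z / (2 * C) by rewrite !ge_min lexx orbT.
  by rewrite ler_pdivlMr ?mulr_gt0// => h; lra.
have e3 : 2 * r * e < t0.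
  have : e <= t0 / (4 * r) by rewrite !ge_min lexx !orbT.
  by rewrite ler_pdivlMr ?mulr_gt0// => h; lra.
pose th := e * (1 + e / 2); pose u := th * (1 + th) / 2.
have ee : e ^+ 2 <= e / 2.
  by rewrite expr2 -ler_pdivlMl// mulrA mulVf ?gt_eqF// mul1r; lra.
have eep := sqr_ge0 e.
have th0 : 0 < th by rewrite mulr_gt0// addr_gt0// divr_gt0.
have th1 : th <= 5 / 4 * e by rewrite /th mulrDr mulr1 mulrA -expr2; lra.
have u0 : 0 < u by rewrite divr_gt0// mulr_gt0// addr_gt0.
have u1 : u <= 2 * e.
  have : th * (1 + th) <= 5 / 4 * e * 2 by apply: ler_pM => //; [exact: ltW|rewrite addr_ge0// ltW|lra].
  by rewrite /u; lra.
have tpos : 0 < r * u < t0.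
  by rewrite mulr_gt0//= (le_lt_trans _ e3)// [2 * r]mulrC -mulrA ler_pM2l.
have := picone_cutoff sw e0 e1 (ht0 _ tpos); rewrite -/W -/G -/Bd -/K => h.
apply: (le_trans h).
have -> : 2 * b / (r ^+ 2 * e) * (e ^+ 2 * W + r * u * Bd) =
  2 * b / r ^+ 2 * (e * W) + (1 + e / 2) * (1 + th) * (b / r * Bd).
  by rewrite /u /th; field; rewrite rn gt_eqF.
have c1 : (1 + 2 * e ^+ 2) * ((1 + e ^+ 2) * G) <= (1 + 2 * e) * G.
  rewrite mulrA ler_wpM2r//.
  have -> : (1 + 2 * e ^+ 2) * (1 + e ^+ 2) = 1 + 3 * e ^+ 2 + 2 * (e ^+ 2 * e ^+ 2) by ring.
  have : e ^+ 2 * e ^+ 2 <= e ^+ 2 * (1 / 4) by rewrite ler_wpM2l//; lra.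
  by lra.
have bW : 0 <= 2 * b / r ^+ 2 * (e * W) by rewrite !mulr_ge0 ?invr_ge0// ltW.
have c2 : (1 + 2 * e ^+ 2) * (2 * b / r ^+ 2 * (e * W)) <= 2 * (2 * b / r ^+ 2 * (e * W)).
  by rewrite ler_wpM2r//; lra.
have c3 : (1 + 2 * e ^+ 2) * ((1 + e / 2) * (1 + th) * (b / r * Bd)) <= (1 + 5 * e) * (b / r * Bd).
  rewrite mulrA; apply: ler_wpM2r; first exact: mulr_ge0.
  have f1 : (1 + e / 2) * (1 + th) <= (1 + e / 2) * (1 + 5 / 4 * e) by rewrite ler_pM2l; lra.
  have f2 : (1 + e / 2) * (1 + 5 / 4 * e) = 1 + 7 / 4 * e + 5 / 8 * e ^+ 2 by field.
  have f3 : (1 + e / 2) * (1 + th) <= 1 + 5 / 2 * e by lra.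
  have f4 : (1 + 2 * e ^+ 2) * ((1 + e / 2) * (1 + th)) <= (1 + e) * (1 + 5 / 2 * e).
    apply: ler_pM => //; first by lra.
      by rewrite mulr_ge0//; lra.
    by lra.
  apply: (le_trans f4).
  have -> : (1 + e) * (1 + 5 / 2 * e) = 1 + 7 / 2 * e + 5 / 2 * e ^+ 2 by field.
  by lra.
have c4 : K * (r * u * Bd) <= 2 * r * (K * Bd) * e.
  have -> : K * (r * u * Bd) = r * (K * Bd) * u by ring.
  have -> : 2 * r * (K * Bd) * e = r * (K * Bd) * (2 * e) by ring.
  by apply: ler_wpM2l => //; apply: mulr_ge0; [exact: ltW|exact: mulr_ge0].
have CE : e * C = 2 * e * G + 5 * e * (b / r * Bd) + 2 * (2 * b / r ^+ 2 * (e * W)) + 2 * r * (K * Bd) * e + e.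
  by rewrite /C; ring.
have BE : b / r * Bd = b / r * B + z / 2 by rewrite /Bd mulrDr brd.
rewrite [(1 + 2 * e ^+ 2) * _]mulrDr [(1 + 2 * e ^+ 2) * (_ + _ * (_ * Bd))]mulrDr.
apply: le_trans (lerD (lerD c1 (lerD c2 c3)) c4) _.
move: CE BE e2 e0; rewrite [(1 + 2 * e) * G]mulrDl [(1 + 5 * e) * _]mulrDl !mul1r.
by lra.
Qed.

Let le_integral_two d (T : measurableType d) (mu : {measure set T -> \bar R}) (S : set T) (f g h : T -> R) (al ga : R) :
  measurable S -> 0 <= al -> 0 <= ga ->
  measurable_fun S f -> measurable_fun S g -> measurable_fun S h ->
  (forall x, 0 <= f x) -> (forall x, 0 <= g x) -> (forall x, 0 <= h x) ->
  (forall x, f x <= al * g x + ga * h x) ->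
  (\int[mu]_(x in S) (f x)%:E <= al%:E * \int[mu]_(x in S) (g x)%:E + ga%:E * \int[mu]_(x in S) (h x)%:E)%E.
Proof.
move=> mS a0 ga0 mf mg mh f0 g0 h0 fgh.
have ef (u : T -> R) : measurable_fun S u -> measurable_fun S (fun x => (u x)%:E) by move=> mu'; exact/measurable_EFinP.
have mz (z : R) (u : T -> R) : measurable_fun S u -> measurable_fun S (fun x => (z * u x)%:E).
  by move=> mu'; apply: ef; apply: measurable_funM => //; exact: measurable_cst.
rewrite -(ge0_integralZl_EFin _ mS) //; [|by move=> x _; rewrite lee_fin|exact: ef].
rewrite -(ge0_integralZl_EFin _ mS) //; [|by move=> x _; rewrite lee_fin|exact: ef].
rewrite -(ge0_integralD _ mS) //; last 4 first.
- by move=> x _; rewrite -EFinM lee_fin mulr_ge0.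
- by under eq_fun do rewrite -EFinM; exact: mz.
- by move=> x _; rewrite -EFinM lee_fin mulr_ge0.
- by under eq_fun do rewrite -EFinM; exact: mz.
apply: ge0_le_integral => //.
- by move=> x _; rewrite lee_fin.
- exact: ef.
- by under eq_fun do rewrite -!EFinM; apply: emeasurable_funD; exact: mz.
by move=> x _; rewrite -!EFinM -EFinD lee_fin.
Qed.

Let near0 (a : nat -> \bar R) (z : R) : a n @[n --> \oo] --> 0%E -> 0 < z ->
  \forall n \near \oo, (a n <= z%:E)%E.
Proof.
move=> /fine_cvgP[fa /cvgrPdist_le ca] z0; near=> n.
have fn : a n \is a fin_num by near: n.
rewrite -(fineK fn) lee_fin.
have : `|0 - fine (a n)| <= z by near: n; exact: ca.
by rewrite sub0r normrN; apply: le_trans; exact: ler_norm.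
Unshelve. all: by end_near. Qed.

Let fin_step (p q h ga y : R) (I : \bar R) : 0 < ga -> ga * y = h -> (I <= y%:E)%E ->
  (p%:E * q%:E + ga%:E * I <= (p * q + h)%:E)%E.
Proof.
move=> ga0 <- Iy; rewrite -EFinM [leRHS]EFinD leeD2l// EFinM.
by apply: lee_wpmul2l => //; rewrite lee_fin ltW.
Qed.

Let young (h x y : R) : 0 < h -> x ^+ 2 <= (1 + h) * y ^+ 2 + (1 + h^-1) * (x - y) ^+ 2.
Proof.
move=> h0; rewrite -subr_ge0.
have -> : (1 + h) * y ^+ 2 + (1 + h^-1) * (x - y) ^+ 2 - x ^+ 2 = h^-1 * (h * y + y - x) ^+ 2.
  by field; rewrite gt_eqF.
by rewrite mulr_ge0 ?sqr_ge0// invr_ge0 ltW.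
Qed.

(** By the definition of the trace, smooth functions approximate u, its weak gradient and g at once.
    [young] transfers each integral with a factor 1 + h and an error h, and h is arbitrary. *)
Lemma picone_disk u ux uy g : H1 D u ux uy -> trace D u ux uy g ->
  K * \int[plane_measure]_(x in D) (u x ^+ 2) <=
  \int[plane_measure]_(x in D) (ux x ^+ 2 + uy x ^+ 2)
   + b / r * \int[length_measure]_(x in boundary D) (g x ^+ 2).
Proof.
move=> [[mu iu] [mux iux] [muy iuy] _] [[mg ig] [w [sw cw cwg]]].
have mB := closed_length_measurable (closed_boundary oD).
set U := \int[plane_measure]_(x in D) (u x ^+ 2).
set G := \int[plane_measure]_(x in D) (ux x ^+ 2 + uy x ^+ 2).
set B := \int[length_measure]_(x in boundary D) (g x ^+ 2).
have G0 : 0 <= G by apply: Rintegral_ge0 => x _; rewrite addr_ge0 ?sqr_ge0.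
have B0 : 0 <= B by apply: Rintegral_ge0 => x _; exact: sqr_ge0.
have UE : (\int[plane_measure]_(x in D) (u x ^+ 2)%:E = U%:E)%E.
  by rewrite fineK//; apply: (@integrable_fin_num _ _ R (@lebesgue_measure R \x @lebesgue_measure R)%E); [exact: mD|exact: iu].
have GE : (\int[plane_measure]_(x in D) (ux x ^+ 2 + uy x ^+ 2)%:E = G%:E)%E.
  rewrite fineK//; apply: (@integrable_fin_num _ _ R (@lebesgue_measure R \x @lebesgue_measure R)%E); first exact: mD.
  exact: (@integrableD _ _ R (@lebesgue_measure R \x @lebesgue_measure R)%E D mD _ _ iux iuy).
have BE : (\int[length_measure]_(x in boundary D) (g x ^+ 2)%:E = B%:E)%E.
  by rewrite fineK//; apply: (@integrable_fin_num _ _ R length_measure); [exact: mB|exact: ig].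
apply/ler_addgt0Pr => z z0.
pose C := 3 * (G + b / r * B) + 2 * (1 + b / r) + K.
have C0 : 0 < C by have h1 := mulr_ge0 br0 B0; have h2 := K0; have h3 := br0; rewrite /C; lra.
pose h := Num.min 1 (z / C).
have h0 : 0 < h by rewrite lt_min ltr01 divr_gt0.
have h1 : h <= 1 by rewrite ge_min lexx.
have hC : h * C <= z by rewrite -ler_pdivlMr// ge_min lexx orbT.
pose ga := 1 + h^-1; have ga0 : 0 < ga by rewrite addr_gt0// invr_gt0.
(* An approximation within y costs ga y = h in [young]. *)
pose y := h / ga; have y0 : 0 < y by rewrite divr_gt0.
have yE : ga * y = h by rewrite mulrC divfK// gt_eqF.
have [n [an bn]] := filter_ex (filterI (near0 cw y0) (near0 cwg y0)).
have csw := Ck_continuous (sw n 0%N); have [_ _ csw1 csw2] := sw n 1%N.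
have mc (f : R * R -> R) : continuous f -> measurable_fun D f.
  by move=> cf; apply: measurable_funTS; exact: continuous_plane_measurable.
have sq_m (f : R * R -> R) : measurable_fun D f -> measurable_fun D (fun x => f x ^+ 2).
  by move=> mf; exact: measurable_funX.
pose dl x := (w n x - u x) ^+ 2 + (d1 (w n) x - ux x) ^+ 2 + (d2 (w n) x - uy x) ^+ 2.
have mdl : measurable_fun D dl.
  by apply: measurable_funD; [apply: measurable_funD|]; apply: sq_m; apply: measurable_funB => //; exact: mc.
have dl0 x : 0 <= dl x by rewrite !addr_ge0 ?sqr_ge0.
have cw2 := continuous_sqr csw.
have cg2 : continuous (fun x => d1 (w n) x ^+ 2 + d2 (w n) x ^+ 2) := @CkD R 0 _ _ (continuous_sqr csw1) (continuous_sqr csw2).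
set W := \int[plane_measure]_(x in D) (w n x ^+ 2).
set N := \int[plane_measure]_(x in D) (d1 (w n) x ^+ 2 + d2 (w n) x ^+ 2).
set Bw := \int[length_measure]_(x in boundary D) (w n x ^+ 2).
have h10 : 0 <= 1 + h by lra.
have i1 : U <= (1 + h) * W + h.
  have := @le_integral_two _ _ (@lebesgue_measure R \x @lebesgue_measure R)%E D
    (fun x => u x ^+ 2) (fun x => w n x ^+ 2) dl (1 + h) ga mD h10 (ltW ga0) (sq_m _ mu) (mc _ cw2) mdl
    (fun x => sqr_ge0 _) (fun x => sqr_ge0 _) dl0.
  rewrite -[X in (X <= _)%E]/(\int[plane_measure]_(x in D) (u x ^+ 2)%:E)%E UE.
  rewrite -[X in (_ <= _ * X + _)%E]/(\int[plane_measure]_(x in D) (w n x ^+ 2)%:E)%E (continuous_RintegralE mD bD cw2) -/W.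
  move=> H; rewrite -lee_fin; apply: le_trans (H _) _.
    move=> x; have := young (u x) (w n x) h0; rewrite -[(u x - _) ^+ 2]sqrrN opprB => hy; apply: (le_trans hy).
    by rewrite lerD2l ler_pM2l// /dl -addrA lerDl addr_ge0 ?sqr_ge0.
  exact: (fin_step _ _ ga0 yE).
have i2 : N <= (1 + h) * G + h.
  have := @le_integral_two _ _ (@lebesgue_measure R \x @lebesgue_measure R)%E D
    (fun x => d1 (w n) x ^+ 2 + d2 (w n) x ^+ 2) (fun x => ux x ^+ 2 + uy x ^+ 2) dl (1 + h) ga mD h10 (ltW ga0)
    (mc _ cg2) (measurable_funD (sq_m _ mux) (sq_m _ muy)) mdl
    (fun x => addr_ge0 (sqr_ge0 _) (sqr_ge0 _)) (fun x => addr_ge0 (sqr_ge0 _) (sqr_ge0 _)) dl0.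
  rewrite -[X in (X <= _)%E]/(\int[plane_measure]_(x in D) (d1 (w n) x ^+ 2 + d2 (w n) x ^+ 2)%:E)%E (continuous_RintegralE mD bD cg2) -/N.
  rewrite -[X in (_ <= _ * X + _)%E]/(\int[plane_measure]_(x in D) (ux x ^+ 2 + uy x ^+ 2)%:E)%E GE.
  move=> H; rewrite -lee_fin; apply: le_trans (H _) _.
    move=> x; have hy1 := young (d1 (w n) x) (ux x) h0; have hy2 := young (d2 (w n) x) (uy x) h0.
    apply: (le_trans (lerD hy1 hy2)); rewrite -/ga /dl.
    have h3 : 0 <= ga * (w n x - u x) ^+ 2 by apply: mulr_ge0; [exact: ltW|exact: sqr_ge0].
    by rewrite !mulrDr; lra.
  exact: (fin_step _ _ ga0 yE).
have i3 : Bw <= (1 + h) * B + h.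
  have := @le_integral_two _ _ length_measure (boundary D)
    (fun x => w n x ^+ 2) (fun x => g x ^+ 2) (fun x => (w n x - g x) ^+ 2) (1 + h) ga mB h10 (ltW ga0)
    (continuous_length_measurable (closed_boundary oD) cw2) (measurable_funX 2 mg)
    (measurable_funX 2 (measurable_funB (continuous_length_measurable (closed_boundary oD) csw) mg))
    (fun x => sqr_ge0 _) (fun x => sqr_ge0 _) (fun x => sqr_ge0 _) (fun x => young (w n x) (g x) h0).
  have BwE : (\int[length_measure]_(x in boundary D) (w n x ^+ 2)%:E = Bw%:E)%E.
    by rewrite fineK//; apply: (@integrable_fin_num _ _ R length_measure); [exact: mB|exact: length_integrable].
  rewrite -[X in (X <= _)%E]/(\int[length_measure]_(x in boundary D) (w n x ^+ 2)%:E)%E BwE.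
  rewrite -[X in (_ <= _ * X + _)%E]/(\int[length_measure]_(x in boundary D) (g x ^+ 2)%:E)%E BE.
  move=> H; rewrite -lee_fin; apply: (le_trans H).
  exact: (fin_step _ _ ga0 yE).
have := picone_smooth (sw n); rewrite -/W -/N -/Bw => i4.
have j1 : K * U <= (1 + h) * (K * W) + K * h.
  by apply: le_trans (ler_wpM2l K0 i1) _; rewrite mulrDr mulrCA.
have j2 : (1 + h) * (K * W) <= (1 + h) * (N + b / r * Bw) by rewrite ler_wpM2l.
have j3 : b / r * Bw <= b / r * ((1 + h) * B + h) by rewrite ler_wpM2l.
have j4 : (1 + h) * (N + b / r * Bw) <= (1 + h) * ((1 + h) * (G + b / r * B) + h * (1 + b / r)).
  apply: ler_wpM2l => //; apply: le_trans (lerD i2 j3) _.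
  by rewrite le_eqVlt; apply/orP; left; apply/eqP; ring.
have S0 : 0 <= G + b / r * B by rewrite addr_ge0// mulr_ge0.
have j5 : (1 + h) * ((1 + h) * (G + b / r * B) + h * (1 + b / r)) <=
    (1 + 3 * h) * (G + b / r * B) + 2 * h * (1 + b / r).
  rewrite mulrDr; apply: lerD.
    by rewrite mulrA ler_wpM2r//; nra.
  rewrite mulrA ler_wpM2r//; first by rewrite addr_ge0.
  by rewrite ler_wpM2r//; lra.
have CE : h * C = 3 * h * (G + b / r * B) + 2 * h * (1 + b / r) + K * h by rewrite /C; ring.
by move: j1 j2 j4 j5 CE hC; rewrite [(1 + 3 * h) * _]mulrDl mul1r; lra.
Qed.

End picone.

(** * Disks and the equality case *)

Section disks.
Context {R : realType}.
Variables (c : R * R) (r : R).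
Hypothesis r0 : 0 < r.
Let oD : open (disk c r) := @open_disk _ c r.
Let bD := bounded_disk c r.
Let mD : measurable (disk c r). Proof. exact: open_plane_measurable oD. Qed.
Let p0 : 0 < pi :> R. Proof. exact: pi_gt0. Qed.
Let D0 : disk c r !=set0.
Proof. by exists c; rewrite /disk /= edistxx. Qed.

Lemma perimeter_disk : perimeter (disk c r) = 2 * pi * r.
Proof. by rewrite /perimeter disk_length. Qed.

Lemma isoperimetric_deficit_disk : isoperimetric_deficit (disk c r) = 0.
Proof.
rewrite /isoperimetric_deficit perimeter_disk area_disk//.
have -> : 4 * pi * (pi * r ^+ 2) = (2 * pi * r) ^+ 2 by ring.
have h : 0 < 2 * pi * r by rewrite !mulr_gt0.
by rewrite sqrtr_sqr gtr0_norm// divff ?subrr// gt_eqF.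
Qed.

Lemma inner_disk (t : R) : 0 <= t -> inner (disk c r) t = disk c (r - t).
Proof.
move=> t0; apply/seteqP; split=> x; rewrite /inner /=.
  have [h|h] := leP (edist c x) r; first by rewrite bdist_disk// ltrBrDl -ltrBrDr.
  have nx : ~ disk c r x by rewrite /disk /= ltNge (ltW h).
  by rewrite (bdist_out bD nx) ltNge t0.
rewrite /disk /= => h; have hr : edist c x <= r by rewrite (le_trans (ltW h))// gerBl.
by rewrite bdist_disk// ltrBrDl -ltrBrDr.
Qed.

(** A direct computation, with equality; the upper bound thus applies to disks without a passage
    through [parallel_domain]. *)
Lemma disk_parallel (s t : R) x0 : 0 <= s -> s < t -> t < bdist (disk c r) x0 ->
  area (inner (disk c r) s) - area (inner (disk c r) t) <=
  perimeter (disk c r) * (t - s) - pi * (t ^+ 2 - s ^+ 2).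
Proof.
move=> s0 st tx; have t0 : 0 <= t by rewrite (le_trans s0)// ltW.
have tr : t < r.
  have : inner (disk c r) t x0 by [].
  rewrite inner_disk// /disk /= => h.
  by have := edist_ge0 c x0; lra.
have sr : s < r by exact: lt_trans tr.
rewrite !inner_disk// !area_disk ?subr_gt0// perimeter_disk.
by rewrite le_eqVlt; apply/orP; left; apply/eqP; ring.
Qed.

Let hD : (hausdorff1 (boundary (disk c r)) < +oo)%E.
Proof. by rewrite disk_length// ltry. Qed.

(** The upper bound is [robin_upper_bound] with deficit 0, the lower bound is Picone's
    inequality. *)
Lemma robin_eigenvalue_disk (b k : R) : 0 < b -> 0 < k < j01 R ->
  k * bessel_J 1 k = b * bessel_J 0 k -> robin_eigenvalue (disk c r) (b / r) = (k / r) ^+ 2.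
Proof.
move=> b0 k0 kb; have r2 : 0 < r ^+ 2 by rewrite exprn_gt0.
have A0 : 0 < area (disk c r) by rewrite area_disk// mulr_gt0.
apply/eqP; rewrite eq_le; apply/andP; split.
  have := robin_upper_bound oD bD D0 hD disk_parallel b0 k0 kb.
  rewrite isoperimetric_deficit_disk !mul0r !mulr0 !addr0.
  have -> : b * Num.sqrt pi / Num.sqrt (area (disk c r)) = b / r.
    rewrite area_disk// sqrtrM ?(ltW p0)// sqrtr_sqr gtr0_norm//.
    by field; rewrite !gt_eqF ?sqrtr_gt0.
  rewrite area_disk// -mulrA ler_pM2l// => h.
  by rewrite expr_div_n ler_pdivlMr// mulrC.
apply: lb_le_inf.
  (* Constants compete, so that the infimum is taken over a non-empty set. *)
  have s1 : smooth (fun _ : R * R => 1 : R) by exact: smooth_cst.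
  eexists; exists (fun=> 1), (d1 (fun=> 1)), (d2 (fun=> 1)), (fun=> 1); split; last by reflexivity.
  - exact: smooth_H1.
  - exact: smooth_trace.
  - by rewrite (Rintegral_plane_cst mD bD) expr1n mul1r gt_eqF.
move=> _ [u [ux [uy [g [hu ht u0 ->]]]]].
have up : 0 < \int[plane_measure]_(x in disk c r) (u x ^+ 2).
  by rewrite lt_def u0; apply: Rintegral_ge0 => x _; exact: sqr_ge0.
rewrite /robin_rayleigh ler_pdivlMr//; apply: le_trans (picone_disk r0 b0 k0 kb hu ht).
by rewrite le_eqVlt; apply/orP; left; apply/eqP; congr (_ * _); field; rewrite gt_eqF.
Qed.

End disks.

Section equality.
Context {R : realType}.
Implicit Types (X : set (R * R)).

(** X contains a disk of some radius e around a point y of X off the given disk. Since y may lie on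
    the circle, it is first moved outwards by e / 2; the disk of radius e / 4 there is disjoint from
    the given one and adds area. *)
Lemma open_disk_full X x0 (r : R) : open X -> bounded_set X -> 0 < r ->
  disk x0 r `<=` X -> area X <= area (disk x0 r) -> X = disk x0 r.
Proof.
move=> oX bX r0 sub ale; apply/seteqP; split=> // y Xy; apply: contrapT.
rewrite /disk /= => /negP; rewrite -leNgt => hy.
have [e e0 he] := iffLR (nbhs_edist _ _) (oX y Xy : nbhs y X).
have l0 : 0 < edist x0 y by exact: lt_le_trans hy.
set l := edist x0 y in hy l0.
pose y' : R * R := (y.1 + e / 2 / l * (y.1 - x0.1), y.2 + e / 2 / l * (y.2 - x0.2)).
have l2 : l ^+ 2 = (y.1 - x0.1) ^+ 2 + (y.2 - x0.2) ^+ 2.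
  by rewrite /l edist_sym sqr_sqrtr// addr_ge0 ?sqr_ge0.
have ln : l != 0 by rewrite gt_eqF.
have el : 0 <= e / 2 / l by apply: divr_ge0; [apply: divr_ge0 => //; exact: ltW|exact: ltW].
have dyy : edist y' y = e / 2.
  rewrite /edist /y' /=.
  have -> : (y.1 + e / 2 / l * (y.1 - x0.1) - y.1) ^+ 2 + (y.2 + e / 2 / l * (y.2 - x0.2) - y.2) ^+ 2 =
    (e / 2 / l) ^+ 2 * l ^+ 2 by rewrite l2; ring.
  rewrite -exprMn sqrtr_sqr (ger0_norm (mulr_ge0 el (ltW l0))).
  by field.
have dxy : edist y' x0 = l + e / 2.
  rewrite /edist /y' /=.
  have -> : (y.1 + e / 2 / l * (y.1 - x0.1) - x0.1) ^+ 2 + (y.2 + e / 2 / l * (y.2 - x0.2) - x0.2) ^+ 2 =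
    (1 + e / 2 / l) ^+ 2 * l ^+ 2 by rewrite l2; ring.
  rewrite -exprMn sqrtr_sqr (ger0_norm (mulr_ge0 (addr_ge0 ler01 el) (ltW l0))).
  by field.
have e4 : 0 < e / 4 by rewrite divr_gt0.
have subB : disk y' (e / 4) `<=` X.
  move=> z; rewrite /disk /= => hz; apply: he => /=.
  by have := edist_triangle y y' z; rewrite (edist_sym y y') dyy; lra.
have dis : disk x0 r `&` disk y' (e / 4) = set0.
  rewrite -subset0 => z []; rewrite /disk /= => h1 h2.
  by have := edist_triangle y' z x0; rewrite dxy (edist_sym z x0); lra.
have mU (c : R * R) (t : R) : measurable (disk c t) by apply: open_plane_measurable; exact: open_disk.
have mX := open_plane_measurable oX.
have : area (disk x0 r) + area (disk y' (e / 4)) <= area X.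
  rewrite -(areaU (mU x0 r) (mU y' (e / 4)) (bounded_disk x0 r) (bounded_disk y' (e / 4)) dis).
  apply: le_area => //; first exact: measurableU (mU x0 r) (mU y' (e / 4)).
  by move=> z [/sub|/subB].
have : 0 < area (disk y' (e / 4)) by rewrite area_disk// mulr_gt0 ?pi_gt0 ?exprn_gt0.
by lra.
Qed.

(** The bound on the slope at 0 that [inner_parallel] needs is [tube_integral] for f = 1. *)
Lemma parallel_domain X : open X -> bounded_set X -> simply_connected X -> C2_boundary X ->
  forall (s t : R) (x0 : R * R), 0 <= s -> s < t -> t < bdist X x0 ->
  area (inner X s) - area (inner X t) <= perimeter X * (t - s) - pi * (t ^+ 2 - s ^+ 2).
Proof.
move=> oX bX scX cX s t x0; apply: inner_parallel => //; first exact: simply_connected_hole_free.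
move=> e e0; have hX := C2_boundary_length oX bX cX.
have [t0 t00 ht] := @tube_integral R X (fun=> 1) e oX bX (C2_outer_cone oX cX) hX
  (@cst_continuous _ _ (1 : R)) (fun=> ler01) e0.
exists t0 => // p p0 pt; have mX := open_plane_measurable oX.
have mI : measurable (inner X p) by exact: measurable_inner.
have subI : inner X p `<=` X by apply: inner_sub => //; exact: ltW.
rewrite -areaD//.
have E : X `&` [set x | bdist X x <= p] = X `\` inner X p.
  by apply/seteqP; split=> x [Xx] /=; rewrite /inner /= => h; split=> //; move: h; [move=> h /=; apply/negP; rewrite -leNgt|move/negP; rewrite -leNgt].
have := ht p; rewrite p0 pt => /(_ isT); rewrite E.
rewrite integral_plane_cst; [|exact: measurableD|by apply: sub_bounded bX => x []].
rewrite mul1r lee_fin Rintegral_cst; last exact: closed_length_measurable (closed_boundary oX).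
by rewrite mul1r mulrC.
Qed.

End equality.

Theorem theorem2p1 (R : realType) (Omega : set (R * R))
    (Omega_bounded : bounded_set Omega)
    (Omega_domain : domain Omega)
    (Omega_sc : simply_connected Omega)
    (Omega_C2 : C2_boundary Omega) :
  let delta := isoperimetric_deficit Omega in
  let muD (a : R) := robin_eigenvalue (unit_disk R) (a / Num.sqrt pi) in
  let gap (a : R) :=
    area Omega * robin_eigenvalue Omega (a / Num.sqrt (area Omega))
    - pi * muD a in
  (forall a : R, 0 < a ->
     gap a <= F (Num.sqrt (muD a)) * (delta * (delta + 2))
              + G (Num.sqrt (muD a)) * delta)
  /\
  (forall a : R, 0 < a ->
     gap a <= C_PW R * (delta * (delta + 2)) + pi * j01 R * delta
     /\
     (gap a = C_PW R * (delta * (delta + 2)) + pi * j01 R * delta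
        <-> is_disk Omega)).
Proof.
move=> delta muD gap; have [oO _ O0] := Omega_domain.
have hO := C2_boundary_length oO Omega_bounded Omega_C2.
have parO := parallel_domain oO Omega_bounded Omega_sc Omega_C2.
have p0 : 0 < pi :> R := pi_gt0 R.
have sp : 0 < Num.sqrt pi :> R by rewrite sqrtr_gt0.
have A0 := area_open_gt0 oO Omega_bounded O0.
have sA : 0 < Num.sqrt (area Omega) by rewrite sqrtr_gt0.
(* The square root of the eigenvalue of the unit disk is the frequency k, so that [F] and [G] are
   evaluated at k. *)
have key (a : R) : 0 < a -> exists k : R, [/\ 0 < k < j01 R, muD a = k ^+ 2, Num.sqrt (muD a) = k,
    k * bessel_J 1 k = a / Num.sqrt pi * bessel_J 0 k &
    gap a <= F k * (delta * (delta + 2)) + G k * delta].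
  move=> a0; have b0 : 0 < a / Num.sqrt pi by rewrite divr_gt0.
  have [k k0 kb] := robin_frequency b0; exists k.
  have mE : muD a = k ^+ 2.
    by have := robin_eigenvalue_disk (0, 0) ltr01 b0 k0 kb; rewrite !divr1.
  split=> //.
    by case/andP: k0 => k0 _; rewrite mE sqrtr_sqr gtr0_norm.
  have := robin_upper_bound oO Omega_bounded O0 hO parO b0 k0 kb.
  rewrite divfK ?gt_eqF// -/delta /gap mE.
  by lra.
have LE : perimeter Omega = Num.sqrt (4 * pi * area Omega) * (1 + delta).
  rewrite /delta /isoperimetric_deficit addrCA subrr addr0 mulrCA divff ?mulr1//.
  by rewrite gt_eqF// sqrtr_gt0 !mulr_gt0.
have s0 : 0 < Num.sqrt (4 * pi * area Omega) by rewrite sqrtr_gt0 !mulr_gt0.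
(* The isoperimetric inequality; it makes the right-hand side monotone in the values of [F] and
   [G]. *)
have delta0 : 0 <= delta.
  have := isoperimetric oO Omega_bounded O0 parO.
  rewrite -[leLHS]sqr_sqrtr ?mulr_ge0 ?(ltW p0) ?(ltW A0)// ler_pXn2r ?nnegrE ?(ltW s0) ?perimeter_ge0//.
  by rewrite {1}LE -ler_pdivrMl// mulVf ?gt_eqF// lerDl.
have mono (k : R) : 0 < k < j01 R ->
    F k * (delta * (delta + 2)) + G k * delta <= C_PW R * (delta * (delta + 2)) + pi * j01 R * delta /\
    (0 < delta -> F k * (delta * (delta + 2)) + G k * delta < C_PW R * (delta * (delta + 2)) + pi * j01 R * delta).
  move=> k0; have /andP[_ f] := F_lt k0; have /andP[_ g] := G_lt k0.
  have d2 : 0 <= delta * (delta + 2) by rewrite mulr_ge0// addr_ge0.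
  split=> [|dp]; first by rewrite lerD// ler_wpM2r// ltW.
  by rewrite ltrD// ltr_pM2r// mulr_gt0// addr_gt0.
split=> a a0; have [k [k0 mE sE kb gk]] := key a a0; first by rewrite sE.
have [m1 m2] := mono k k0; split; first exact: le_trans m1.
split=> [ge|[c [r [r0 OE]]]].
  (* For delta > 0 the strict bounds [F_lt] and [G_lt] exclude equality. *)
  have d0 : delta = 0.
    apply/eqP; rewrite eq_le delta0 andbT leNgt; apply/negP => dp.
    by have := le_lt_trans gk (m2 dp); rewrite ge ltxx.
  have LE2 : perimeter Omega ^+ 2 = 4 * pi * area Omega.
    by rewrite LE d0 addr0 mulr1 sqr_sqrtr// !mulr_ge0 ?(ltW p0)// ltW.
  have [T0 TE _ [x0 Tx]] := inner_radiusP oO Omega_bounded O0 (perimeter_ge0 Omega) parO.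
  set T := inner_radius Omega (perimeter Omega) in T0 TE Tx.
  exists x0, T; split=> //; apply: open_disk_full => //.
    move=> y; rewrite /disk /= => h; exact: (bdist_gt (lt_le_trans h Tx) (lexx _)).
  rewrite area_disk//.
  (* For delta = 0 the discriminant vanishes and T is the double root L / (2 pi). *)
  have TL : 2 * pi * T = perimeter Omega.
    apply/eqP; rewrite -subr_eq0 -sqrf_eq0; apply/eqP.
    transitivity (4 * pi * (area Omega - perimeter Omega * T + pi * T ^+ 2) + (perimeter Omega ^+ 2 - 4 * pi * area Omega)); first by ring.
    by rewrite TE LE2 subrr mulr0 addr0.
  rewrite -(ler_pM2l (_ : 0 < 4 * pi)) ?mulr_gt0// -LE2 -TL.
  by rewrite le_eqVlt; apply/orP; left; apply/eqP; ring.
(* Conversely, on a disk of radius r both sides are 0: the eigenvalue is (k / r)^2 and the area pi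
   r^2. *)
have d0 : delta = 0 by rewrite /delta OE isoperimetric_deficit_disk.
rewrite d0 !mul0r !mulr0 addr0 /gap mE OE area_disk//.
have -> : a / Num.sqrt (pi * r ^+ 2) = a / Num.sqrt pi / r.
  rewrite sqrtrM ?(ltW p0)// sqrtr_sqr gtr0_norm//.
  by field; rewrite !gt_eqF.
have b0 : 0 < a / Num.sqrt pi by rewrite divr_gt0.
by rewrite (robin_eigenvalue_disk c r0 b0 k0 kb); field; rewrite gt_eqF.
Qed.
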